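(* Let $\rho>0$, let the standing assumptions (A1)–(A5) listed in the context hold, and suppose in addition that at least one of the following holds: (i) $\sum_{i\in\mathbb{Z}}w(t-i)=1$ for a.e. $t\in\mathbb{R}$; (ii) $\mathcal K^*:L^2\to C$ is compact. Let $\tau_N>0$ be a sequence with $\tau_N\to\infty$. For $N\ge N_1$ let $\mu_N^d$ be the probability measure on $\mathbb{R}^N$ with density in $\vec\eta$ proportional to $\exp\{-\tau_N\Psi_N^{\mathrm{full}}(\vec u_{*,N}+\vec\eta)\}$, and let $\check\mu_N^d$ be the law of $\sqrt{\tau_N}\,\vec\eta$, $\vec\eta\sim\mu_N^d$. If $N^2/\tau_N\to0$ and $(\log\tau_N)/N\to0$, then $(\mathcal I_N)_\#\check\mu_N^d\Rightarrow\mathcal N(\vec 0,Q^{-1})$ weakly as probability measures on $L^2$ as $N\to\infty$, where $$Q=\mathcal K^*\big[b\,\mathcal K\,\cdot\,\big]+\rho(-\partial_t^2+\mathrm{Id}):H^2(S^1)\to L^2,\qquad b(t)=\partial_1^2\Phi\big((\mathcal K u_* )(t),g(t),t\big).$$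
   Context: $S^1$ is the interval $[0,1]$ with endpoints glued; functions on $S^1$ are identified with $1$-periodic functions on $\mathbb{R}$. All functions are real valued, $C=C(S^1)$, $L^2=L^2(S^1)$. $N$ is a positive integer, $t_i=i/N$, vectors in $\mathbb{R}^N$ are written $\vec f=(f_0,\dots,f_{N-1})$ with the periodic convention $f_N=f_0$. $\mathcal N(\vec 0,Q^{-1})$ is the centered Gaussian measure on $L^2$ with covariance operator $Q^{-1}$ (which is trace class). Data of the problem: a linear operator $\mathcal K$, a function $g$ on $S^1$, a function $w:\mathbb{R}\to\mathbb{R}$, a function $\Phi:\mathbb{R}\times\mathbb{R}\times S^1\to\mathbb{R}$; $\partial_1$ denotes differentiation in the first argument of $\Phi$. Put $$g_i=N\int_{\mathbb{R}}w(N(t-t_i))g(t)\,dt,\qquad 0\le i\le N-1,$$ $$\mathcal I_N:\mathbb{R}^N\to L^2,\quad (\mathcal I_N\vec f)(t)=f_m\ \text{ for } t\in[m/N,(m+1)/N),$$ $$(\mathcal K_N\vec f)_i=N\int_{\mathbb{R}}w(N(t-t_i))(\mathcal K\mathcal I_N\vec f)(t)\,dt,\qquad (D_N\vec f)_i=N(f_{i+1}-f_i),$$ $$\Psi_N^{\mathrm{full}}(\vec f)=\frac{1}{N}\sum_{i=0}^{N-1}\Phi\big((\mathcal K_N\vec f)_i,g_i,t_i\big)+\frac{\rho}{2N}\sum_{i=0}^{N-1}\big[f_i^2+(D_N\vec f)_i^2\big],\quad \vec f\in\mathbb{R}^N,$$ $$\Psi^{\mathrm{full}}(f)=\int_{S^1}\Phi\big((\mathcal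 K f)(t),g(t),t\big)\,dt+\frac{\rho}{2}\int_{S^1}\big(f(t)^2+|f'(t)|^2\big)\,dt,\quad f\in H^1(S^1).$$ $\vec u_{*,N}$ is the unique minimizer of $\Psi_N^{\mathrm{full}}$ over $\mathbb{R}^N$ (for $N\ge N_1$) and $u_*$ is the unique minimizer of $\Psi^{\mathrm{full}}$ over $H^1(S^1)$; both exist under the assumptions below. Standing assumptions: (A1) $w\in L^\infty(\mathbb{R})$ has compact support and $\int_{\mathbb{R}}w=1$. (A2) $\mathcal K$ and its $L^2$-adjoint $\mathcal K^*$ are bounded from $L^2$ to $C$; $g\in C$. (A3) There are $h_0>0$ and $c\ge0$ such that $\Phi(p,g(t)+h,t)\ge -c$ and $\partial_1^2\Phi(p,g(t)+h,t)\ge0$ for all $p\in\mathbb{R}$, $t\in S^1$, $|h|\le h_0$. (A4) $\Phi$ is locally Lipschitz in $(p,v,t)$, and $\partial_1\Phi$, $\partial_1^2\Phi$ exist and are continuous in $(p,v,t)$. (A5) For some $p_0>0$, $\partial_1^3\Phi(r_i+p,g_i,t_i)$ exists for $|p|\le p_0$ and $\sup_{N\ge N_1}\sup_{0\le i\le N-1}\sup_{|p|\le p_0}|\partial_1^3\Phi(r_i+p,g_i,t_i)|<\infty$, where $r_i=(\mathcal K_N\vec u_{*,N})_i$. Here $N_1$ is an integer such that $|g_i-g(t_i)|\le h_0$ for all $0\le i\le N-1$ and all $N\ge N_1$ (it exists by (A1) and continuity of $g$). *)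

(* Defs.v *)
From HB Require Import structures.
From mathcomp Require Import all_boot all_order all_algebra.
From mathcomp Require Import all_classical all_reals all_analysis.
From mathcomp Require Import measurable_realfun.

Set Implicit Arguments.
Unset Strict Implicit.
Unset Printing Implicit Defensive.

Import Order.TTheory GRing.Theory Num.Theory.
Import numFieldNormedType.Exports.

Local Open Scope classical_set_scope.
Local Open Scope ring_scope.

Definition circle (R : realType) : {measure set (measurableTypeR R) -> \bar R} :=
  mrestr (@lebesgue_measure R) (measurable_itv `[0, 1]%R).

Lemma circle_setT (R : realType) : circle R [set: _] = 1%E.
Proof.
rewrite /circle/= /mrestr/= setTI lebesgue_measure_itv/= lte_fin ltr01.
by rewrite oppr0 adde0.
Qed.

Section L2.
Context {R : realType}.
Local Notation T := (measurableTypeR R).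
Local Notation mu := (circle R).

Definition isL2 (f : R -> R) : Prop := f \in Lfun mu 2%:E.

Definition L2norm (f : R -> R) : R := fine 'N[mu]_2%:E[EFin \o f]%E.

Definition L2inner (f h : R -> R) : R :=
  \int[lebesgue_measure]_(t in `[0, 1]) (f t * h t).

Let measurable_pow2 (f : R -> R) : measurable_fun [set: T] f ->
  measurable_fun [set: T] (fun x : T => (`|(f x)%:E| `^ 2)%E : \bar R).
Proof.
move=> mf; apply: (measurableT_comp (measurable_poweR _)).
by apply: measurableT_comp => //; exact/measurable_EFinP.
Qed.

Lemma Lnorm_bounded (f : R -> R) (M : R) : measurable_fun [set: T] f ->
  0 <= M -> (forall t, `|f t| <= M) -> ('N[mu]_2%:E[EFin \o f] <= M%:E)%E.
Proof.
move=> mf M0 fM; rewrite unlock /=.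
have le1 : (\int[mu]_x (`|(f x)%:E| `^ 2) <= (M ^+ 2)%:E)%E.
  rewrite (@le_trans _ _ (\int[mu]_x (M ^+ 2)%:E)%E)//.
    apply: ge0_le_integral => //.
    - by move=> x _; exact: poweR_ge0.
    - exact: measurable_pow2.
    - move=> x _; rewrite abse_EFin poweR_EFin lee_fin powR_mulrn//.
      by rewrite lerXn2r ?nnegrE.
  by rewrite integral_cst// -/(circle R) circle_setT mule1.
apply: (@le_trans _ _ ((M ^+ 2)%:E `^ 2^-1)%E).
  apply: gt0_ler_poweR => //; rewrite ?in_itv/= ?andbT ?leey ?invr_ge0//.
    by rewrite integral_ge0// => x _; exact: poweR_ge0.
  by rewrite lee_fin exprn_ge0.
by rewrite poweR_EFin -powR_mulrn// -powRrM mulfV// powRr1.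
Qed.

Lemma isL2_bounded (f : R -> R) (M : R) : measurable_fun [set: T] f ->
  0 <= M -> (forall t, `|f t| <= M) -> isL2 f.
Proof.
move=> mf M0 fM; rewrite /isL2 inE; apply/andP; split; rewrite inE//=.
by rewrite /finite_norm (le_lt_trans (Lnorm_bounded mf M0 fM))// ltry.
Qed.

Lemma ae_eq_Lnorm2 (f h : R -> R) : measurable_fun [set: T] f ->
  measurable_fun [set: T] h -> f = h %[ae mu] ->
  'N[mu]_2%:E[EFin \o f]%E = 'N[mu]_2%:E[EFin \o h]%E.
Proof.
move=> mf mh fh; rewrite unlock /=; congr (_ `^ _)%E.
apply: ge0_ae_eq_integral => //.
- exact: measurable_pow2.
- exact: measurable_pow2.
- have [A [mA A0 subA]] := fh; exists A; split=> // x/= nfh; apply: subA => /= e.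
  by apply: nfh => _; rewrite e.
Qed.

End L2.

Definition L2 (R : realType) : Type := LspaceType2 (circle R).

Definition L2fun (R : realType) (x : L2 R) : R -> R :=
  (x : LspaceType2 (circle R)).
Coercion L2fun : L2 >-> Funclass.

Section L2_metric.
Context {R : realType}.
Local Notation T := (measurableTypeR R).
Local Notation mu := (circle R).

Lemma measurable_L2 (x : L2 R) : measurable_fun [set: T] (x : R -> R).
Proof. exact: (@measurable_funPT _ _ T T (repr (LebesgueSpace.sort x))). Qed.

Lemma L2P (x : L2 R) : isL2 x.
Proof.
rewrite /isL2 inE; apply/andP; split; rewrite inE/=; first exact: measurable_L2.
exact: (@Lebesgue_finite _ _ _ mu _ _ x).
Qed.

Lemma L2_eq (x y : L2 R) : (x : R -> R) = y %[ae mu] -> x = y.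
Proof.
move=> xy; have e : LebesgueSpace.sort x = LebesgueSpace.sort y.
  have := introT (ae_eqP (LebesgueSpace.sort x) (LebesgueSpace.sort y)) xy.
  by rewrite !reprK => /eqP.
case: x y e {xy} => [f [[Pf]]] [h [[Ph]]] /= e.
by case: _ / e Ph => Ph; rewrite (Prop_irrelevance Pf Ph).
Qed.

Lemma L2_of_subproof (f : R -> R) (fL2 : isL2 f) :
  exists x : L2 R, (x : R -> R) = f %[ae mu].
Proof.
move: (fL2); rewrite /isL2 inE => /andP[]; rewrite !inE/= => mf nf.
pose mf' := isMeasurableFun.Build _ _ T T f mf.
pose F : {mfun T >-> T} := HB.pack f mf'.
pose cF : {mfun_ mu, T >-> T} := (\pi F)%qT.
have cFF : (cF : T -> T) = f %[ae mu].
  suff /asboolP : @ae_eq_op _ _ R T T mu (repr cF) F by [].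
  have <- := eqmodE (@ae_eq_op_canonical _ _ R T T mu) (repr cF) F.
  exact/eqP/(reprK cF).
have fin : finite_norm mu 2%:E (cF : T -> R).
  rewrite /finite_norm (ae_eq_Lnorm2 _ _ cFF)//.
  exact: (@measurable_funPT _ _ T T (repr cF)).
pose fm := isFinLebesgue.Build _ T R mu 2%:E (lee1n 2) cF fin.
by exists (LebesgueSpace.Pack (LebesgueSpace.Class fm)).
Qed.

Definition L2_of (f : R -> R) (fL2 : isL2 f) : L2 R :=
  sval (cid (L2_of_subproof fL2)).

Lemma L2_ofE (f : R -> R) (fL2 : isL2 f) : (L2_of fL2 : R -> R) = f %[ae mu].
Proof. by rewrite /L2_of; case: cid. Qed.

Lemma isL2_0 : isL2 (fun _ : R => 0 : R).
Proof. by apply: (@isL2_bounded _ _ 0) => // t; rewrite normr0. Qed.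

Lemma isL2B (f h : R -> R) : isL2 f -> isL2 h -> isL2 (f \- h).
Proof.
move=> fL2 hL2.
have := LfunP (@Lfun_Sub _ T R mu _ (lee1n 2) f fL2 -
               @Lfun_Sub _ T R mu _ (lee1n 2) h hL2).
by [].
Qed.

Lemma L2normE (f : R -> R) : isL2 f ->
  (L2norm f)%:E = 'N[mu]_2%:E[EFin \o f]%E.
Proof.
rewrite /isL2 inE => /andP[_]; rewrite inE/= => nf.
by rewrite /L2norm fineK// ge0_fin_numE ?Lnorm_ge0.
Qed.

Definition L2dist (x y : L2 R) : R := L2norm ((x : R -> R) \- y).

Lemma L2distxx x : L2dist x x = 0.
Proof.
rewrite /L2dist /L2norm (_ : EFin \o _ = cst 0%E); last first.
  by apply/funext => t /=; rewrite subrr.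
by rewrite Lnorm0.
Qed.

Lemma L2dist_sym x y : L2dist x y = L2dist y x.
Proof.
rewrite /L2dist /L2norm unlock; congr (fine (_ `^ _)%E).
by apply: eq_integral => t _ /=; rewrite distrC.
Qed.

Lemma L2dist_triangle y x z : L2dist x z <= L2dist x y + L2dist y z.
Proof.
rewrite -lee_fin EFinD /L2dist !L2normE; try by apply: isL2B; exact: L2P.
have -> : (x : R -> R) \- z =
    ((x : R -> R) \- y) \+ ((y : R -> R) \- z).
  by apply/funext => t /=; rewrite addrA subrK.
apply: minkowski => //; last by rewrite ler1n.
- exact: measurable_funB (measurable_L2 x) (measurable_L2 y).
- exact: measurable_funB (measurable_L2 y) (measurable_L2 z).
Qed.

Lemma L2dist_eq0 x y : L2dist x y = 0 -> x = y.
Proof.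
move=> xy0; apply: L2_eq.
have mB := measurable_funB (measurable_L2 x) (measurable_L2 y).
have /= := @Lnorm_eq0_eq0 _ _ _ mu (EFin \o ((x : R -> R) \- y)) 2%:E.
move=> /(_ ((measurable_EFinP _ _).2 mB)); rewrite -L2normE; last first.
  by apply: isL2B; exact: L2P.
rewrite -/(L2dist x y) xy0 lte_fin ltr0n => /(_ isT erefl).
by apply: filterS => t /= /[apply] -[] /eqP; rewrite subr_eq0 => /eqP.
Qed.

HB.instance Definition _ := gen_eqMixin (L2 R).
HB.instance Definition _ := gen_choiceMixin (L2 R).
HB.instance Definition _ := isPointed.Build (L2 R) (L2_of isL2_0).
HB.instance Definition _ := @isMetric.Build R (L2 R)
  L2dist L2distxx L2dist_eq0 L2dist_sym L2dist_triangle.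

End L2_metric.

Notation L2borel R := (g_sigma_algebraType (@open (L2 R))).


Notation rvec R N := (N.-tuple (measurableTypeR R)).

Lemma sigma_finite_prod d1 d2 (T1 : measurableType d1) (T2 : measurableType d2)
    (R : realType) (m1 : {sigma_finite_measure set T1 -> \bar R})
    (m2 : {sigma_finite_measure set T2 -> \bar R}) :
  sigma_finite [set: T1 * T2] (m1 \x m2)%E.
Proof.
have /sigma_finiteP[F [TF ndF Foo]] := sigma_finiteT m1.
have /sigma_finiteP[G [TG ndG Goo]] := sigma_finiteT m2.
exists (fun n => F n `*` G n).
  rewrite -setXTT TF TG predeqE => -[x y]; split.
    move=> [/= [n _ Fnx] [k _ Gky]]; exists (maxn n k) => //; split.
    - by move: x Fnx; exact/subsetPset/ndF/leq_maxl.
    - by move: y Gky; exact/subsetPset/ndG/leq_maxr.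
  by move=> [n _ []/= ? ?]; split; exists n.
move=> k; have [? ?] := Foo k; have [? ?] := Goo k.
split; first exact: measurableX.
by rewrite product_measure1E// lte_mul_pinfty// ge0_fin_numE.
Qed.

Section lebesgue_rvec.
Context {R : realType}.
Local Notation T := (measurableTypeR R).

Definition consv n (z : T * rvec R n) : rvec R n.+1 :=
  [the n.+1.-tuple T of z.1 :: z.2].

Lemma measurable_consv n : measurable_fun [set: T * rvec R n] (@consv n).
Proof. exact: measurable_cons. Qed.

HB.instance Definition _ n := isMeasurableFun.Build _ _
  (T * rvec R n)%type (rvec R n.+1) (@consv n) (@measurable_consv n).

Definition push_consv n (m : {sigma_finite_measure set (rvec R n) -> \bar R}) :
    set (rvec R n.+1) -> \bar R :=
  pushforward (@lebesgue_measure R \x m)%E (@consv n).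

HB.instance Definition _ n m := Measure.copy (@push_consv n m)
  (measure_function_pushforward__canonical__measure_function_Measure
     (@lebesgue_measure R \x m)%E (@measurable_consv n)).

Lemma sigma_finite_push_consv n m :
  sigma_finite [set: rvec R n.+1] (@push_consv n m).
Proof.
have [F TF mF] := sigma_finite_prod (@lebesgue_measure R) m.
pose u (y : rvec R n.+1) : T * rvec R n := (thead y, [tuple of behead y]).
have consvK : cancel (@consv n) u.
  move=> [a b]; rewrite /u /consv theadE; congr pair.
  exact: val_inj.
have mu' : measurable_fun [set: rvec R n.+1] u.
  apply: measurable_fun_pair; first exact: measurable_tnth.
  exact: measurable_behead.
exists (fun k => u @^-1` (F k)).
  by rewrite -preimage_bigcup -TF preimage_setT.
move=> k; have [mFk Fk] := mF k; split.
  by rewrite -[X in measurable X]setTI; exact: mu'.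
rewrite /push_consv /pushforward -comp_preimage.
by rewrite (_ : u \o _ = id)//; apply/funext => z /=; exact: consvK.
Qed.

HB.instance Definition _ n m := Measure_isSigmaFinite.Build _ _ _
  (@push_consv n m) (@sigma_finite_push_consv n m).

Fixpoint lebesgue_rvec n : {sigma_finite_measure set (rvec R n) -> \bar R} :=
  if n is n'.+1 then push_consv (lebesgue_rvec n') else \d_[tuple].

End lebesgue_rvec.

(* Vanishes off [0, 1), which is harmless: only the class for circle matters. *)
Definition stepfun (R : realType) N (x : rvec R N) (t : R) : R :=
  \sum_(m < N) tnth x m * \1_(`[m%:R / N%:R, m.+1%:R / N%:R[%classic) t.

Definition scale_rvec (R : realType) N (c : R) (x : rvec R N) : rvec R N :=
  [tuple c * tnth x i | i < N].

Section step.
Context {R : realType}.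
Local Notation T := (measurableTypeR R).

Lemma measurable_scale_rvec N (c : R) :
  measurable_fun [set: rvec R N] (@scale_rvec R N c).
Proof.
apply/measurable_fun_tnthP => i.
rewrite (_ : _ \o _ = (fun r : T => c * r : T) \o (fun x : rvec R N => tnth x i)); last first.
  by apply/funext => x /=; rewrite tnth_mktuple.
apply: measurableT_comp; last exact: measurable_tnth.
exact: (@mulrl_measurable R setT c).
Qed.

HB.instance Definition _ N c := isMeasurableFun.Build _ _
  (rvec R N) (rvec R N) (@scale_rvec R N c) (@measurable_scale_rvec N c).

Lemma measurable_stepfun N (x : rvec R N) : measurable_fun [set: T] (stepfun x).
Proof.
apply: measurable_sum => m; apply: measurable_funM => //.
Qed.

Lemma stepfunB N (x y : rvec R N) (d : R) : 0 <= d ->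
  (forall i, `|tnth x i - tnth y i| <= d) ->
  forall t, `|stepfun x t - stepfun y t| <= d.
Proof.
move=> d0 xyd t; rewrite -sumrB.
under eq_bigr do rewrite -mulrBl.
have [[m tm]|no] := pselect (exists m : 'I_N,
    t \in (`[m%:R / N%:R, m.+1%:R / N%:R[%classic : set R)).
  rewrite (bigD1 m)//= big1 ?addr0.
    by rewrite indicE tm mulr1.
  move=> k km; rewrite indicE; case: (boolP (t \in _)) => [tk|_]; last first.
    by rewrite mulr0.
  exfalso; move/negP: km; apply; apply/eqP/val_inj/eqP => /=.
  have N0 : 0 < N%:R :> R by rewrite ltr0n (leq_trans _ (ltn_ord k)).
  move: tm tk; rewrite !inE/= !in_itv/= => /andP[m1 m2] /andP[k1 k2].
  rewrite eqn_leq; apply/andP; split; rewrite -ltnS.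
    by rewrite -(ltr_nat R) -(ltr_pM2r (_ : 0 < N%:R^-1)) ?invr_gt0// (le_lt_trans k1).
  by rewrite -(ltr_nat R) -(ltr_pM2r (_ : 0 < N%:R^-1)) ?invr_gt0// (le_lt_trans m1).
rewrite big1 ?normr0// => k _; rewrite indicE.
case: (boolP (t \in _)) => [tk|_]; last by rewrite mulr0.
by exfalso; apply: no; exists k.
Qed.

Lemma isL2_stepfun N (x : rvec R N) : isL2 (stepfun x).
Proof.
pose z : rvec R N := [tuple 0 | i < N].
pose M := \sum_(i < N) `|tnth x i|.
have z0 t : stepfun z t = 0.
  by rewrite /stepfun big1// => i _; rewrite tnth_mktuple mul0r.
apply: (@isL2_bounded _ _ M); first exact: measurable_stepfun.
  by apply: sumr_ge0.
move=> t; rewrite -[stepfun x t]subr0 -(z0 t).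
apply: stepfunB; first exact: sumr_ge0.
move=> i; rewrite tnth_mktuple subr0 /M (bigD1 i)//= lerDl.
exact: sumr_ge0.
Qed.

Definition interp N (x : rvec R N) : L2borel R := L2_of (isL2_stepfun x).

Lemma interp_dist N (x y : rvec R N) (d : R) : 0 <= d ->
  (forall i, `|tnth x i - tnth y i| <= d) ->
  L2dist (interp x) (interp y) <= d.
Proof.
move=> d0 xyd; rewrite -lee_fin /L2dist L2normE; last first.
  by apply: isL2B; exact: L2P.
rewrite (@ae_eq_Lnorm2 _ _ (stepfun x \- stepfun y)).
- apply: Lnorm_bounded => //.
    by apply: measurable_funB; exact: measurable_stepfun.
  exact: stepfunB.
- exact: measurable_funB (measurable_L2 _) (measurable_L2 _).
- by apply: measurable_funB; exact: measurable_stepfun.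
- have [A [mA A0 sA]] := L2_ofE (isL2_stepfun x).
  have [B [mB B0 sB]] := L2_ofE (isL2_stepfun y).
  exists (A `|` B); split; first exact: measurableU.
    by apply/eqP; rewrite -measure_le0 -[leRHS]adde0 -{1}A0 -B0 measureU2.
  move=> t /= nt; apply: contrapT => /not_orP[nA nB]; apply: nt => _.
  have ex : ([set: T] t -> interp x t = stepfun x t) by apply: contrapT => /sA.
  have ey : ([set: T] t -> interp y t = stepfun y t) by apply: contrapT => /sB.
  by congr (_ - _); [exact: ex|exact: ey].
Qed.

Lemma measurable_interp N : measurable_fun [set: rvec R N] (@interp N).
Proof.
apply: (@measurability _ _ _ _ setT (@interp N) (@open (L2 R))) => //.
move=> _ [U oU <-]; rewrite setTI.
pose box (q : N.-tuple rat * nat) : set (rvec R N) :=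
  [set y | forall i, `|tnth y i - ratr (tnth q.1 i)| < q.2.+1%:R^-1].
pose B (q : N.-tuple rat * nat) :=
  if `[< box q `<=` @interp N @^-1` U >] then box q else set0.
pose F n := if unpickle n is Some q then B q else set0.
rewrite [X in measurable X](_ : _ = \bigcup_n F n).
  apply: bigcup_measurable => n _; rewrite /F.
  case: unpickle => // q; rewrite /B; case: asboolP => // _.
  rewrite (_ : box q = \bigcap_(i in [set: 'I_N])
     [set y | `|tnth y i - ratr (tnth q.1 i)| < q.2.+1%:R^-1]); last first.
    apply/seteqP; split=> y /= h; first by move=> i _; exact: h.
    by move=> i; exact: h.
  apply: fin_bigcap_measurable => // i _.
  have mt : measurable_fun [set: rvec R N]
      (fun y : rvec R N => `|tnth y i - ratr (tnth q.1 i)|).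
    apply: measurableT_comp => //; apply: measurable_funB => //.
    exact: measurable_tnth.
  have := mt measurableT [set r : R | r < q.2.+1%:R^-1].
  rewrite setTI; apply.
  by rewrite -set_itvNyo; exact: measurable_itv.
apply/seteqP; split; last first.
  move=> y [n _]; rewrite /F; case: unpickle => // q; rewrite /B.
  by case: asboolP => [sub|_] // /sub.
move=> y Uy.
have /nbhs_ballP[e /= e0 eU] : nbhs (interp y : L2 R) U by exact: open_nbhs_nbhs.
have [k ke] : exists k : nat, 2 * k.+1%:R^-1 < e.
  have [k _ /(_ k (leqnn k))] := near_infty_natSinv_lt (PosNum (divr_gt0 e0 (ltr0n R 2))).
  rewrite /= => k2; exists k; by rewrite mulrC -ltr_pdivlMr.
have k0 : 0 < k.+1%:R^-1 :> R by rewrite invr_gt0.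
have /choice[q qy] : forall i : 'I_N, exists q : rat,
    `|tnth y i - ratr q| < k.+1%:R^-1.
  move=> i; have /rat_in_itvoo[q] : (tnth y i - k.+1%:R^-1 : R) < tnth y i + k.+1%:R^-1.
    by rewrite ltrBlDr -addrA ltrDl addr_gt0.
  rewrite in_itv/= => /andP[q1 q2]; exists q; rewrite distrC ltr_distl.
  by rewrite q1 q2.
pose Q : N.-tuple rat * nat := ([tuple q i | i < N], k).
exists (pickle Q) => //; rewrite /F pickleK /B.
case: asboolP => [_ i|].
  by rewrite tnth_mktuple.
case=> z zb; apply: eU; rewrite ballEmdist/=.
apply: le_lt_trans ke; apply: interp_dist; first by rewrite mulr_ge0.
move=> i; rewrite (le_trans (ler_distD (ratr (q i)) _ _))//.
rewrite mulr_natl mulr2n lerD//; first exact/ltW/qy.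
by rewrite distrC; have := zb i; rewrite tnth_mktuple => /ltW.
Qed.

HB.instance Definition _ N := isMeasurableFun.Build _ _
  (rvec R N) (L2borel R) (@interp N) (@measurable_interp N).

End step.

Section problem.
Context {R : realType}.
Implicit Types (f h w g b : R -> R) (K : (R -> R) -> (R -> R))
  (Phi : R -> R -> R -> R).
Local Notation leb := (@lebesgue_measure R).

Definition periodic1 f : Prop := forall t, f (t + 1) = f t.

Definition CS1 f : Prop := continuous f /\ periodic1 f.

(* Operators act on representatives. The bound and linearity force K f = K h
   as soon as f and h agree almost everywhere on [0, 1]. *)
Definition bounded_L2_C K : Prop :=
  [/\ forall f, isL2 f -> CS1 (K f),
      forall (a : R) f h, isL2 f -> isL2 h ->
        K (fun t => a * f t + h t) = (fun t => a * K f t + K h t) &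
      exists M : R, forall f, isL2 f -> forall t, `|K f t| <= M * L2norm f].

Definition L2_adjoint K Kst : Prop :=
  forall f h, isL2 f -> isL2 h -> L2inner (K f) h = L2inner f (Kst h).

(* The 1-periodic continuous functions are closed in {uniform R -> R}, so this
   is relative compactness in C(S^1) of the image of the unit ball. *)
Definition compact_L2_C K : Prop :=
  precompact (K @` [set h | isL2 h /\ L2norm h <= 1] : set {uniform R -> R}).

Definition weak_deriv f df : Prop :=
  forall phi : R -> R, periodic1 phi -> (forall t, derivable phi t 1) ->
    continuous (derive1 phi) ->
    L2inner f (derive1 phi) = - L2inner df phi.

Definition isH1 f df : Prop := [/\ isL2 f, isL2 df & weak_deriv f df].

Definition isH2 f df ddf : Prop := isH1 f df /\ isH1 df ddf.

Definition partial1 k Phi (p v t : R) : R := derive1n k (fun q => Phi q v t) p.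

Definition grid N (i : 'I_N) : R := i%:R / N%:R.

Definition wsample w N h (i : 'I_N) : R :=
  N%:R * \int[leb]_t (w (N%:R * (t - grid i)) * h t).

Definition KN K w N (x : rvec R N) (i : 'I_N) : R := wsample w (K (stepfun x)) i.

(* ordS is the cyclic successor, which encodes x_N = x_0. *)
Definition DN N (x : rvec R N) (i : 'I_N) : R :=
  N%:R * (tnth x (ordS i) - tnth x i).

Definition PsiN Phi K w g (rho : R) N (x : rvec R N) : R :=
  N%:R^-1 * \sum_(i < N) Phi (KN K w x i) (wsample w g i) (grid i)
  + rho / (2 * N%:R) * \sum_(i < N) (tnth x i ^+ 2 + DN x i ^+ 2).

(* df is the weak derivative of f. *)
Definition Psi Phi K g (rho : R) f df : R :=
  \int[leb]_(t in `[0, 1]) Phi (K f t) (g t) t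
  + rho / 2 * \int[leb]_(t in `[0, 1]) (f t ^+ 2 + df t ^+ 2).

Definition PsiN_minimizer Phi K w g rho N (x : rvec R N) : Prop :=
  forall y : rvec R N, PsiN Phi K w g rho x <= PsiN Phi K w g rho y.

Definition Psi_minimizer Phi K g rho f df : Prop :=
  isH1 f df /\
  forall h dh, isH1 h dh -> Psi Phi K g rho f df <= Psi Phi K g rho h dh.

Definition A1 w : Prop :=
  [/\ w \in Lfun leb +oo%E,
      exists a : R, {ae leb, forall t, a < `|t| -> w t = 0} &
      \int[leb]_t w t = 1].

Definition A2 K Kst g : Prop :=
  [/\ bounded_L2_C K, bounded_L2_C Kst, L2_adjoint K Kst & CS1 g].

Definition A3 Phi g (h0 c : R) : Prop :=
  [/\ 0 < h0, 0 <= c &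
      forall p t e : R, `|e| <= h0 ->
        - c <= Phi p (g t + e) t /\ 0 <= partial1 2 Phi p (g t + e) t].

Definition A4 Phi : Prop :=
  [/\ forall x : R * R * R, exists2 U : set (R * R * R), nbhs x U &
        [lipschitz (Phi y.1.1 y.1.2 y.2 : R^o) | y in U],
      forall p v t, derivable (fun q => Phi q v t) p 1 /\
                    derivable (derive1 (fun q => Phi q v t)) p 1,
      continuous (fun x : R * R * R => partial1 1 Phi x.1.1 x.1.2 x.2) &
      continuous (fun x : R * R * R => partial1 2 Phi x.1.1 x.1.2 x.2)].

Definition A5 Phi K w g N1 (u : forall N, rvec R N) : Prop :=
  exists2 p0 : R, 0 < p0 & exists M : R,
    forall N, (N1 <= N)%N -> forall (i : 'I_N) (p : R), `|p| <= p0 ->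
      derivable (derive1n 2 (fun q => Phi q (wsample w g i) (grid i)))
        (KN K w (u N) i + p) 1 /\
      `|partial1 3 Phi (KN K w (u N) i + p) (wsample w g i) (grid i)| <= M.

(* Under compact support of w the sum has finite support for almost every t. *)
Definition partition_of_unity w : Prop :=
  {ae leb, forall t, \sum_(k \in [set: int]) w (t - k%:~R) = 1}.

Definition add_rvec N (x y : rvec R N) : rvec R N :=
  [tuple (tnth x i + tnth y i : R) | i < N].

Definition density_propto N (P : probability (rvec R N) R)
    (dens : rvec R N -> R) : Prop :=
  exists z : R, forall A : set (rvec R N), measurable A ->
    P A = (z%:E * \int[lebesgue_rvec N]_(x in A) (dens x)%:E)%E.

(* f lies in H^2(S^1) and Q f = h. *)
Definition Qrel K Kst b (rho : R) f h : Prop :=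
  exists df ddf, isH2 f df ddf /\
    h = (fun t => Kst (fun s => b s * K f s) t + rho * (- ddf t + f t))
      %[ae circle R].

Definition inverse_op (Q : (R -> R) -> (R -> R) -> Prop)
    (G : (R -> R) -> (R -> R)) : Prop :=
  (forall h, isL2 h -> Q (G h) h) /\
  (forall f h, isL2 h -> Q f h -> G h = f %[ae circle R]).

(* normal_prob 0 0 is not the Dirac mass at 0. *)
Definition centered_normal (s : R) (A : set (measurableTypeR R)) : \bar R :=
  if s == 0 then \d_(0 : measurableTypeR R) A else normal_prob 0 s A.

Definition centered_gaussian (P : probability (L2borel R) R)
    (C : (R -> R) -> (R -> R)) : Prop :=
  (forall h, isL2 h -> exists2 s : R, 0 <= s &
     forall A : set (measurableTypeR R), measurable A ->
       P [set x | A (L2inner h (x : L2 R))] = centered_normal s A) /\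
  (forall h k, isL2 h -> isL2 k ->
     L2inner (C h) k = \int[P]_x (L2inner h (x : L2 R) * L2inner k (x : L2 R))).

Definition weak_cvg (P : nat -> probability (L2borel R) R)
    (P0 : probability (L2borel R) R) : Prop :=
  forall F : L2 R -> R, continuous F ->
    (exists M : R, forall x, `|F x| <= M) ->
    (fun N => \int[P N]_x F x) @ \oo --> \int[P0]_x F x.

End problem.

(* Main.v *)
Require Import Defs.
From HB Require Import structures.
From mathcomp Require Import all_boot all_order all_algebra.
From mathcomp Require Import all_classical all_reals all_analysis.
From mathcomp Require Import measurable_realfun.
From mathcomp Require Import ring lra.

Set Implicit Arguments.
Unset Strict Implicit.
Unset Printing Implicit Defensive.

Import Order.TTheory GRing.Theory Num.Theory.
Import numFieldNormedType.Exports.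

Local Open Scope classical_set_scope.
Local Open Scope ring_scope.

(* The data term is convex near the data, so in the rescaled coordinates
   [x = sqrt tau (f - u_N)] the posterior density is [exp (- V_N x)] times the
   Gaussian density [exp (- rho A_N(x, x) / 2)] of the discrete H1 energy, with
   [V_N >= 0].  Under that Gaussian the step functions [I_N x] have second moment
   at most [2 / rho] and their distance to their averages over [m] cells has
   second moment at most [2 / (m rho)]; both bounds pass to the posterior because
   the normalizing constants stay bounded below.  Where [I_N x] is bounded and
   close to its averages, [V_N] is close to [W x = (1/2) int b (K I_N x)^2]: a
   Taylor expansion at the discrete minimizer [u_N], which tends to [u_*] by
   monotonicity of the Euler-Lagrange equation tested against a sampled [u_*].
   Replacing [V_N] by [W] turns the posterior into a Gaussian whose variance in
   direction [h] is [<h, I_N y_N>], where [y_N] is a Galerkin solution of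
   [Q y = h]; this tends to [<Q^-1 h, h>].  Finally, convergence of the integrals
   of [cos (<h, x> + th)] together with the uniform smallness of the distance to
   the averages yields weak convergence on L2. *)

(** * Square integrable functions on the circle *)

(** Boundedness of [K] into C does not make window sampling of [K f] uniformly accurate over bounded
    [f]. It is accurate on the finite-dimensional space of averages over [m] cells, so distances to
    averages are tracked throughout and [m] is fixed before [N] grows. The same averages stand in
    for tightness, since bounded sets of L2 are not relatively compact. No estimate sees the
    dimension: the value of a step function at a point is a linear functional whose square is at
    most twice the energy, so its variance under the energy Gaussian is at most $2/\rho$, and
    integrating over the circle gives the second moment. Normalizing constants are never computed:
    unnormalized integrals are compared relative to the mass of the energy Gaussian, and the lower
    bound they need follows from the second moment by Chebyshev. Derivatives are weak and given only
    through test functions, so elements of H1 are first identified with primitives, by completeness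
    of the trigonometric system; only then can they be sampled at grid points. *)

Section density.
Context d (T : measurableType d) (R : realType).
Variables (la nu : {measure set T -> \bar R}) (p : T -> R).
Hypothesis mp : measurable_fun setT p.
Hypothesis p0 : forall x, 0 <= p x.
Hypothesis nuE : forall A, measurable A ->
  nu A = (\int[la]_(x in A) (p x)%:E)%E.

Import HBNNSimple.
Local Open Scope ereal_scope.

(** The density formula is assumed on measurable sets only, which is how the circle measure, the
    posterior and the Gaussian marginals are given; simple functions and monotone convergence do the
    rest. *)
Lemma ge0_integral_density (f : T -> \bar R) : measurable_fun setT f ->
  (forall x, 0 <= f x) ->
  \int[nu]_x f x = \int[la]_x (f x * (p x)%:E).
Proof.
move=> mf f0.
have mpE : measurable_fun setT (EFin \o p) by exact/measurable_EFinP.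
pose f_ := nnsfun_approx measurableT mf.
transitivity (limn (fun n => \int[nu]_x (f_ n x)%:E)).
  rewrite -monotone_convergence//.
  - apply: eq_integral => y _; apply/esym/cvg_lim => //.
    by apply: cvg_nnsfun_approx => // *; exact: f0.
  - by move=> n; exact/measurable_EFinP/measurable_funP.
  - by move=> n y _; rewrite lee_fin.
  - by move=> y _ m n mn; rewrite lee_fin; exact/lefP/nd_nnsfun_approx.
rewrite [X in limn X](_ : _ =
    (fun n => \int[la]_x ((f_ n x)%:E * (p x)%:E))).
  rewrite -monotone_convergence//; last 3 first.
    - move=> n /=; apply: emeasurable_funM => //.
      exact/measurable_EFinP/measurable_funP.
    - by move=> n x _ /=; rewrite mule_ge0// lee_fin.
    - move=> x _ m n mn; apply: lee_pmul; rewrite ?lee_fin//.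
      exact/lefP/nd_nnsfun_approx.
  apply: eq_integral => x _ /=; apply/cvg_lim => //.
  apply: cvgeZr => //.
  by apply: cvg_nnsfun_approx => // y Dy; exact: f0.
apply/funext => n.
transitivity (\sum_(k \in range (f_ n))
    \int[nu]_x (k * \1_(f_ n @^-1` [set k]) x)%:E).
  under eq_integral do rewrite fimfunE -fsumEFin//.
  rewrite ge0_integral_fsum//.
  - by move=> y; exact/measurable_EFinP/measurable_funM.
  - by move=> y x _; rewrite nnfun_muleindic_ge0.
transitivity (\sum_(k \in range (f_ n))
    \int[la]_x ((k * \1_(f_ n @^-1` [set k]) x)%:E * (p x)%:E)); last first.
  rewrite -ge0_integral_fsum//.
  - apply: eq_integral => x _; rewrite [in RHS]fimfunE -fsumEFin//.
    by rewrite ge0_mule_fsuml// => r; rewrite nnfun_muleindic_ge0.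
  - move=> y; apply: emeasurable_funM => //.
    exact/measurable_EFinP/measurable_funM.
  - by move=> y x _; rewrite mule_ge0 ?nnfun_muleindic_ge0// lee_fin.
apply: eq_fsbigr => r; rewrite inE => -[x0 _ rE].
have r0 : (0 <= r)%R by rewrite -rE.
under eq_integral do rewrite EFinM.
rewrite ge0_integralZl//; last by apply/measurable_EFinP.
rewrite integral_indic// setIT.
under [RHS]eq_integral do rewrite EFinM -muleA.
rewrite ge0_integralZl//; last 2 first.
- by apply: emeasurable_funM => //; exact/measurable_EFinP.
- by move=> *; rewrite mule_ge0// lee_fin.
congr (_ * _); rewrite nuE//.
rewrite integral_mkcond; apply: eq_integral => x _.
rewrite patchE indicE; case: ifPn => _; by rewrite ?mul1e ?mul0e.
Qed.

End density.

Section integrable_real.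
Context d (T : measurableType d) (R : realType) (mu : {measure set T -> \bar R}).
Implicit Types (f h : T -> R) (D : set T).

Lemma integrable_realD D f h : measurable D -> mu.-integrable D (EFin \o f) ->
  mu.-integrable D (EFin \o h) ->
  mu.-integrable D (EFin \o (fun t => f t + h t)).
Proof.
by move=> mD fi hi; have := integrableD mD fi hi; apply: eq_integrable.
Qed.

Lemma integrable_realZ D (a : R) f : measurable D -> mu.-integrable D (EFin \o f) ->
  mu.-integrable D (EFin \o (fun t => a * f t)).
Proof.
by move=> mD fi; have := integrableZl mD a fi; apply: eq_integrable.
Qed.

End integrable_real.

Lemma ge0_integral_circle (R : realType) (f : R -> \bar R) :
  measurable_fun [set: measurableTypeR R] f -> (forall x, 0 <= f x)%E ->
  (\int[circle R]_x f x = \int[lebesgue_measure]_(x in `[0%R, 1%R]) f x)%E.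
Proof.
move=> mf f0.
rewrite (@ge0_integral_density _ (measurableTypeR R) R lebesgue_measure (circle R)
   (\1_(`[0, 1]%classic)))//.
- rewrite [RHS]integral_mkcond; apply: eq_integral => x _.
  by rewrite patchE indicE; case: ifPn => _; rewrite ?mule1 ?mule0.
- move=> A mA; rewrite integral_indic//; congr (lebesgue_measure _).
  by rewrite setIC.
Qed.

Section L2tools.
Context {R : realType}.
Implicit Types (f h k : R -> R) (a : R).
Local Notation leb := (@lebesgue_measure R).
Local Notation I01 := (`[0, 1]%classic : set R).
Local Notation T := (measurableTypeR R).

Lemma isL2_measurable f : isL2 f -> measurable_fun [set: T] f.
Proof. by rewrite /isL2 inE => /andP[]; rewrite inE. Qed.

Lemma integrable_circle f :
  (circle R).-integrable setT (EFin \o f) -> leb.-integrable I01 (EFin \o f).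
Proof.
move=> /integrableP[mf foo]; apply/integrableP; split.
  exact: measurable_funS mf.
by rewrite -ge0_integral_circle//; exact: measurableT_comp.
Qed.

Lemma integrable_L2sqr f : isL2 f ->
  leb.-integrable I01 (EFin \o (fun t => f t ^+ 2)).
Proof. by move=> f2; apply: integrable_circle; exact: Lfun2_integrable_sqr. Qed.

Lemma integrable_L2M f h : isL2 f -> isL2 h ->
  leb.-integrable I01 (EFin \o (fun t => f t * h t)).
Proof.
move=> f2 h2; apply: integrable_circle.
by apply/Lfun1_integrable; exact: Lfun2_mul_Lfun1.
Qed.

Lemma isL2P f : measurable_fun [set: T] f ->
  leb.-integrable I01 (EFin \o (fun t => f t ^+ 2)) -> isL2 f.
Proof.
move=> mf /integrableP[_ foo]; rewrite /isL2 inE; apply/andP; split; rewrite inE//=.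
rewrite /finite_norm unlock poweR_lty//.
apply: le_lt_trans foo; rewrite ge0_integral_circle//.
- rewrite le_eqVlt; apply/orP; left; apply/eqP/eq_integral => x _.
  by rewrite /= powR_mulrn// normrX.
- apply: (measurableT_comp (measurable_poweR _)).
  by apply: measurableT_comp => //; exact/measurable_EFinP.
- by move=> x; exact: poweR_ge0.
Qed.

Lemma isL2_lin a f h : isL2 f -> isL2 h -> isL2 (fun t => a * f t + h t).
Proof.
move=> f2 h2; apply: isL2P.
  apply: measurable_funD; last exact: isL2_measurable.
  by apply: measurable_funM => //; exact: isL2_measurable.
have := integrable_realD _ (integrable_realZ (a ^+ 2) _ (integrable_L2sqr f2))
  (integrable_realD _ (integrable_realZ (2 * a) _ (integrable_L2M f2 h2))
  (integrable_L2sqr h2)).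
move=> /(_ (measurable_itv _) (measurable_itv _) (measurable_itv _) (measurable_itv _)).
by apply: eq_integrable => // t _ /=; congr EFin; ring.
Qed.

Lemma isL2_bounded01 f M : measurable_fun [set: T] f ->
  (forall t, 0 <= t <= 1 -> `|f t| <= M) -> isL2 f.
Proof.
move=> mf fM; apply: isL2P => //; apply: measurable_bounded_integrable => //=.
- by rewrite lebesgue_measure_itv/= lte_fin ltr01 -EFinB ltry.
- by apply: measurable_funX; exact: measurable_funTS.
- exists (M ^+ 2); split; rewrite ?num_real// => x Mx y /=.
  rewrite in_itv/= => /fM fy; apply/ltW/(le_lt_trans _ Mx).
  by rewrite normrX lerXn2r ?nnegrE ?(le_trans _ fy).
Qed.

Lemma isL2_continuous f : continuous f -> isL2 f.
Proof.
move=> cf; apply: isL2P.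
  by apply: continuous_measurable_fun.
apply: continuous_compact_integrable; first exact: segment_compact.
apply: continuous_subspaceT => x.
by apply: (@continuous_comp _ _ _ f (fun y => y ^+ 2)); [exact: cf|exact: exprn_continuous].
Qed.

Lemma isL2_cst a : isL2 (fun=> a).
Proof. by apply: isL2_continuous => x; exact: cvg_cst. Qed.

Lemma isL2D f h : isL2 f -> isL2 h -> isL2 (fun t => f t + h t).
Proof.
move=> f2 h2; have := isL2_lin 1 f2 h2.
by under eq_fun do rewrite mul1r.
Qed.

Lemma isL2Z a f : isL2 f -> isL2 (fun t => a * f t).
Proof.
move=> f2; have := isL2_lin a f2 (isL2_cst 0).
by under eq_fun do rewrite addr0.
Qed.

Lemma isL2_sum n (F : 'I_n -> R -> R) : (forall i, isL2 (F i)) ->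
  isL2 (fun t => \sum_(i < n) F i t).
Proof.
elim: n F => [|n IH] F F2.
  by under eq_fun do rewrite big_ord0; exact: isL2_cst.
under eq_fun do rewrite big_ord_recr/=.
by apply: isL2D => //; exact: IH.
Qed.

Lemma L2innerC f h : L2inner f h = L2inner h f.
Proof. by rewrite /L2inner; under eq_Rintegral do rewrite mulrC. Qed.

Lemma L2inner_linl a f h k : isL2 f -> isL2 h -> isL2 k ->
  L2inner (fun t => a * f t + h t) k = a * L2inner f k + L2inner h k.
Proof.
move=> f2 h2 k2; rewrite /L2inner.
under eq_Rintegral do rewrite mulrDl -mulrA.
rewrite RintegralD//; last exact: integrable_L2M.
- by rewrite RintegralZl//; exact: integrable_L2M.
- exact: integrable_realZ (integrable_L2M f2 k2).
Qed.

Lemma L2inner_linr a f h k : isL2 f -> isL2 h -> isL2 k ->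
  L2inner k (fun t => a * f t + h t) = a * L2inner k f + L2inner k h.
Proof. by move=> *; rewrite L2innerC L2inner_linl// !(L2innerC _ k). Qed.

Lemma L2innerDl f h k : isL2 f -> isL2 h -> isL2 k ->
  L2inner (fun t => f t + h t) k = L2inner f k + L2inner h k.
Proof.
move=> f2 h2 k2; rewrite -[in RHS](mul1r (L2inner f k)) -L2inner_linl//.
by congr L2inner; apply/funext => t; rewrite mul1r.
Qed.

Lemma L2innerZl a f k : isL2 f -> isL2 k ->
  L2inner (fun t => a * f t) k = a * L2inner f k.
Proof.
move=> f2 k2; rewrite /L2inner.
under eq_Rintegral do rewrite -mulrA.
by rewrite RintegralZl//; exact: integrable_L2M.
Qed.

Lemma L2innerBl f h k : isL2 f -> isL2 h -> isL2 k ->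
  L2inner (fun t => f t - h t) k = L2inner f k - L2inner h k.
Proof.
move=> f2 h2 k2; rewrite -[RHS]addrC -mulN1r -L2inner_linl//.
by congr L2inner; apply/funext => t; rewrite mulN1r addrC.
Qed.

Lemma L2innerDr f h k : isL2 f -> isL2 h -> isL2 k ->
  L2inner k (fun t => f t + h t) = L2inner k f + L2inner k h.
Proof. by move=> *; rewrite L2innerC L2innerDl// !(L2innerC _ k). Qed.

Lemma L2innerZr a f k : isL2 f -> isL2 k ->
  L2inner k (fun t => a * f t) = a * L2inner k f.
Proof. by move=> *; rewrite L2innerC L2innerZl// (L2innerC k). Qed.

Lemma L2innerBr f h k : isL2 f -> isL2 h -> isL2 k ->
  L2inner k (fun t => f t - h t) = L2inner k f - L2inner k h.
Proof. by move=> *; rewrite L2innerC L2innerBl// !(L2innerC _ k). Qed.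

Lemma L2inner_sumr n (F : 'I_n -> R -> R) k : (forall i, isL2 (F i)) -> isL2 k ->
  L2inner k (fun t => \sum_(i < n) F i t) = \sum_(i < n) L2inner k (F i).
Proof.
move=> + k2; elim: n F => [|n IH] F F2.
  rewrite big_ord0 /L2inner; under eq_Rintegral do rewrite big_ord0 mulr0.
  by rewrite Rintegral_cst// mul0r.
rewrite big_ord_recr/= -IH// -L2innerDr//; last exact: isL2_sum.
by congr L2inner; apply/funext => t; rewrite big_ord_recr.
Qed.

Lemma L2norm_ge0 f : 0 <= L2norm f.
Proof. by rewrite /L2norm fine_ge0// Lnorm_ge0. Qed.

Lemma L2norm_sqr f : isL2 f -> L2norm f ^+ 2 = L2inner f f.
Proof.
move=> f2; apply: EFin_inj; rewrite -powR_mulrn ?L2norm_ge0// -poweR_EFin L2normE//.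
rewrite poweR_Lnorm// ge0_integral_circle//; last 2 first.
- apply: (measurableT_comp (measurable_poweR _)).
  by apply: measurableT_comp => //; apply/measurable_EFinP; exact: isL2_measurable.
- by move=> x; exact: poweR_ge0.
rewrite /L2inner /Rintegral fineK.
  apply: eq_integral => x _; rewrite abse_EFin poweR_EFin powR_mulrn//.
  by rewrite real_normK ?num_real// expr2.
by apply: integrable_fin_num => //; exact: (integrable_L2M f2 f2).
Qed.

Lemma L2inner_ge0 f : 0 <= L2inner f f.
Proof. by apply: Rintegral_ge0 => t _; rewrite -expr2 sqr_ge0. Qed.

Lemma L2_CauchySchwarz f h : isL2 f -> isL2 h ->
  `|L2inner f h| <= L2norm f * L2norm h.
Proof.
move=> f2 h2.
have P s : 0 <= s ^+ 2 * L2norm f ^+ 2 + 2 * s * L2inner f h + L2norm h ^+ 2.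
  have s2 := isL2_lin s f2 h2.
  have := L2inner_ge0 (fun t => s * f t + h t).
  rewrite L2inner_linl// !L2inner_linr// !L2norm_sqr// (L2innerC h f).
  by move=> /le_trans; apply; rewrite le_eqVlt; apply/orP; left; apply/eqP; ring.
have nf := L2norm_ge0 f; have nh := L2norm_ge0 h.
have [f0|f0] := eqVneq (L2norm f) 0.
  suff -> : L2inner f h = 0 by rewrite normr0 mulr_ge0.
  apply/eqP; apply: contraT => i0.
  (* With [L2norm f = 0] the polynomial [P] is affine in [s], and this [s] would give it the value
     -1. *)
  have := P (- (L2norm h ^+ 2 + 1) / (2 * L2inner f h)).
  rewrite f0 expr0n/= mulr0 add0r.
  rewrite (_ : 2 * _ * _ = - (L2norm h ^+ 2 + 1)); last by field.
  by move=> H; exfalso; lra.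
have f1 : 0 < L2norm f by rewrite lt_def f0.
rewrite -ler_sqr ?nnegrE ?mulr_ge0// real_normK ?num_real//.
(* The minimizer of the quadratic polynomial in [s]. *)
have := P (- L2inner f h / L2norm f ^+ 2).
rewrite (_ : _ + _ + _ = L2norm h ^+ 2 - L2inner f h ^+ 2 / L2norm f ^+ 2); last by field.
by rewrite subr_ge0 ler_pdivrMr ?exprn_gt0// exprMn mulrC.
Qed.

Lemma L2normZ a f : isL2 f -> L2norm (fun t => a * f t) = `|a| * L2norm f.
Proof.
move=> f2; apply/eqP; rewrite -(@eqrXn2 _ 2)// ?L2norm_ge0 ?mulr_ge0 ?L2norm_ge0//.
rewrite exprMn !L2norm_sqr//; last exact: isL2Z.
rewrite L2innerZl//; last exact: isL2Z.
by rewrite L2innerZr// real_normK ?num_real// expr2 mulrA.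
Qed.

Lemma ler_L2normD f h : isL2 f -> isL2 h ->
  L2norm (fun t => f t + h t) <= L2norm f + L2norm h.
Proof.
move=> f2 h2; have fh2 := isL2D f2 h2.
rewrite -ler_sqr ?nnegrE ?addr_ge0 ?L2norm_ge0// L2norm_sqr//.
rewrite L2innerDl// !L2innerDr// (L2innerC h f) sqrrD !L2norm_sqr//.
have := L2_CauchySchwarz f2 h2; rewrite ler_norml => /andP[_]; lra.
Qed.

Lemma L2normBC f h : isL2 f -> isL2 h -> L2norm (fun t => f t - h t) = L2norm (fun t => h t - f t).
Proof.
move=> f2 h2; rewrite -[RHS]mul1r -(normrN1 R) -L2normZ; last exact: isL2B.
by congr L2norm; apply/funext => t; rewrite mulN1r opprB.
Qed.

Lemma ler_L2normB k f h : isL2 f -> isL2 h -> isL2 k ->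
  L2norm (fun t => f t - h t) <=
  L2norm (fun t => f t - k t) + L2norm (fun t => k t - h t).
Proof.
move=> f2 h2 k2; rewrite [X in L2norm X <= _](_ : _ =
  (fun t => (f t - k t) + (k t - h t))); last first.
  by apply/funext => t; rewrite addrA subrK.
by apply: ler_L2normD; exact: isL2B.
Qed.

Lemma L2norm_le_add f h : isL2 f -> isL2 h ->
  L2norm f <= L2norm (fun t => f t - h t) + L2norm h.
Proof.
move=> f2 h2; rewrite [X in L2norm X <= _](_ : _ = (fun t => (f t - h t) + h t)).
  by apply: ler_L2normD => //; exact: isL2B.
by apply/funext => t; rewrite subrK.
Qed.

Lemma L2norm_ae0 f h : isL2 f -> isL2 h -> f = h %[ae circle R] ->
  L2norm (fun t => f t - h t) = 0.
Proof.
move=> f2 h2 fh; rewrite /L2norm.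
rewrite (@ae_eq_Lnorm2 _ _ (cst 0)).
- by rewrite (_ : EFin \o _ = cst 0%E)// Lnorm0.
- by apply: measurable_funB; exact: isL2_measurable.
- exact: measurable_cst.
- have [A [mA A0 sA]] := fh; exists A; split=> // t /= ne; apply: sA => /= e.
  by apply: ne => _; rewrite (e I) subrr.
Qed.

Lemma L2norm_eq0 f h : isL2 f -> isL2 h ->
  L2norm (fun t => f t - h t) = 0 -> f = h %[ae circle R].
Proof.
move=> f2 h2 fh0.
have mB := measurable_funB (isL2_measurable f2) (isL2_measurable h2).
have /= := @Lnorm_eq0_eq0 _ _ _ (circle R) (EFin \o (f \- h)) 2%:E.
move=> /(_ ((measurable_EFinP _ _).2 mB)); rewrite -L2normE; last exact: isL2B.
rewrite fh0 lte_fin ltr0n => /(_ isT erefl).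
by apply: filterS => t /= /[apply] -[] /eqP; rewrite subr_eq0 => /eqP.
Qed.

Lemma L2inner_aer f h k : isL2 f -> isL2 h -> isL2 k -> f = h %[ae circle R] ->
  L2inner k f = L2inner k h.
Proof.
move=> f2 h2 k2 fh; apply/eqP; rewrite -subr_eq0 -L2innerBr// -normr_le0.
rewrite (le_trans (L2_CauchySchwarz k2 (isL2B f2 h2)))//.
by rewrite (L2norm_ae0 f2 h2 fh) mulr0.
Qed.

(** The bound is asked on the half-open interval because the cells cover only [0, 1) and step
    functions vanish at 1. *)
Lemma le_Rintegral01 f M : measurable_fun [set: T] f ->
  (forall t, 0 <= t < 1 -> `|f t| <= M) -> `|\int[leb]_(t in `[0, 1]) f t| <= M.
Proof.
move=> mf fM.
have intf : leb.-integrable `[0, 1[%classic (EFin \o f).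
  apply: measurable_bounded_integrable => //=.
  - by rewrite lebesgue_measure_itv/= lte_fin ltr01 -EFinB ltry.
  - exact: measurable_funTS.
  - exists M; split; rewrite ?num_real// => x Mx y /=.
    by rewrite in_itv/= => /fM fy; apply/ltW/(le_lt_trans _ Mx).
rewrite -Rintegral_itv_bndo_bndc//.
apply: (le_trans (le_normr_Rintegral _ _)) => //.
have -> : M = \int[leb]_(t in `[0, 1[) M.
  rewrite Rintegral_cst//= lebesgue_measure_itv/= lte_fin ltr01.
  by rewrite oppr0 adde0 mulr1.
apply: le_Rintegral => //.
- by apply: integrable_norm.
- apply: measurable_bounded_integrable => //=.
    by rewrite lebesgue_measure_itv/= lte_fin ltr01 -EFinB ltry.
  exists `|M|; split; rewrite ?num_real// => x Mx y _ /=; exact: ltW.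
Qed.

Lemma L2norm_bounded f M : measurable_fun [set: T] f -> 0 <= M ->
  (forall t, 0 <= t < 1 -> `|f t| <= M) -> L2norm f <= M.
Proof.
move=> mf M0 fM.
have f2 : isL2 f.
  apply: (@isL2_bounded01 _ (M + `|f 1|)) => // t /andP[t0].
  rewrite le_eqVlt => /predU1P[->|t1]; first by rewrite lerDr.
  by rewrite (le_trans (fM t _)) ?t0// lerDl.
rewrite -ler_sqr ?nnegrE ?L2norm_ge0// L2norm_sqr//.
apply: (le_trans (ler_norm _)); rewrite /L2inner.
apply: le_Rintegral01 => [|t t01]; first exact: measurable_funM.
by rewrite -expr2 normrX lerXn2r ?nnegrE// fM.
Qed.

End L2tools.

(** * Uniform closure of a span of bounded functions *)

Section uniform_closure.
Context {R : realType} {X : Type}.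
Implicit Types (f g : X -> R) (a M : R).

Inductive lspan (atom : set (X -> R)) : (X -> R) -> Prop :=
| lspan_atom f : atom f -> lspan atom f
| lspan0 : lspan atom (fun=> 0)
| lspan_lin a f g : lspan atom f -> lspan atom g ->
    lspan atom (fun x => a * f x + g x).

(** Replaces Stone-Weierstrass on domains that need not be compact: bounded atoms that contain 1 and
    have products in their span already give a uniform closure stable under products, absolute
    values, maxima and minima. *)
Definition uclos (atom : set (X -> R)) f : Prop :=
  forall e : R, 0 < e -> exists2 g, lspan atom g & forall x, `|f x - g x| <= e.

Variable atom : set (X -> R).
Hypothesis atom_le1 : forall f, atom f -> forall x, `|f x| <= 1.
Hypothesis atom1 : atom (fun=> 1).
Hypothesis atomM : forall f g, atom f -> atom g ->
  lspan atom (fun x => f x * g x).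

Lemma lspanZ a f : lspan atom f -> lspan atom (fun x => a * f x).
Proof.
move=> lf; have := lspan_lin a lf (lspan0 atom).
by under eq_fun do rewrite addr0.
Qed.

Lemma lspan_bounded f : lspan atom f -> exists2 M : R, 0 < M & forall x, `|f x| <= M.
Proof.
elim=> {f} [f /atom_le1 f1| |a f g _ [M M0 fM] _ [M' M'0 gM]].
- by exists 1.
- by exists 1 => // x; rewrite normr0.
- exists (`|a| * M + M'); first by rewrite ltr_wpDl// mulr_ge0// ltW.
  move=> x; rewrite (le_trans (ler_normD _ _))// lerD// normrM.
  by rewrite ler_wpM2l.
Qed.

Lemma lspanM f g : lspan atom f -> lspan atom g -> lspan atom (fun x => f x * g x).
Proof.
move=> lf lg; elim: lf => {f} [f af| |a f1 f2 _ IH1 _ IH2].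
- elim: lg => {g} [g ag| |a g1 g2 _ IH1 _ IH2].
  + exact: atomM.
  + by under eq_fun do rewrite mulr0; exact: lspan0.
  + have := lspan_lin a IH1 IH2; congr (lspan atom _).
    by apply/funext => x; ring.
- by under eq_fun do rewrite mul0r; exact: lspan0.
- have := lspan_lin a IH1 IH2; congr (lspan atom _).
  by apply/funext => x; ring.
Qed.

Lemma uclos_lspan f : lspan atom f -> uclos atom f.
Proof. by move=> lf e e0; exists f => // x; rewrite subrr normr0 ltW. Qed.

Lemma uclos_cst a : uclos atom (fun=> a).
Proof.
apply: uclos_lspan; have := lspanZ a (lspan_atom atom1).
by under eq_fun do rewrite mulr1.
Qed.

Lemma uclos_bounded f : uclos atom f -> exists2 M : R, 0 < M & forall x, `|f x| <= M.
Proof.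
move=> /(_ 1 ltr01)[g /lspan_bounded[M M0 gM] fg].
exists (M + 1); first exact: addr_gt0.
move=> x; rewrite -[f x](subrK (g x)) (le_trans (ler_normD _ _))// addrC.
exact: lerD.
Qed.

Lemma uclos_lim f :
  (forall e : R, 0 < e -> exists2 g, uclos atom g & forall x, `|f x - g x| <= e) ->
  uclos atom f.
Proof.
move=> H e e0; have e2 : 0 < e / 2 by exact: divr_gt0.
have [g ug fg] := H _ e2; have [h lh gh] := ug _ e2.
exists h => // x; rewrite (le_trans (ler_distD (g x) _ _))// [leRHS]splitr.
exact: lerD.
Qed.

Lemma uclos_lin a f g : uclos atom f -> uclos atom g ->
  uclos atom (fun x => a * f x + g x).
Proof.
move=> uf ug e e0; have e2 : 0 < e / 2 by exact: divr_gt0.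
have a1 : 0 < `|a| + 1 by rewrite ltr_wpDl.
have [f' lf ff'] := uf _ (divr_gt0 e2 a1); have [g' lg gg'] := ug _ e2.
exists (fun x => a * f' x + g' x); first exact: lspan_lin.
move=> x; rewrite (_ : _ - _ = a * (f x - f' x) + (g x - g' x)); last by ring.
rewrite (le_trans (ler_normD _ _))// [leRHS]splitr lerD// normrM.
apply: (@le_trans _ _ ((`|a| + 1) * (e / 2 / (`|a| + 1)))).
  by rewrite ler_pM// lerDl.
by rewrite mulrC divfK// gt_eqF.
Qed.

Lemma uclosD f g : uclos atom f -> uclos atom g -> uclos atom (fun x => f x + g x).
Proof.
move=> uf ug; have := uclos_lin 1 uf ug.
by under eq_fun do rewrite mul1r.
Qed.

Lemma uclosZ a f : uclos atom f -> uclos atom (fun x => a * f x).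
Proof.
move=> uf; have := uclos_lin a uf (uclos_cst 0).
by under eq_fun do rewrite addr0.
Qed.

Lemma uclosB f g : uclos atom f -> uclos atom g -> uclos atom (fun x => f x - g x).
Proof.
move=> uf ug; have := uclos_lin (-1) ug uf; congr (uclos atom _).
by apply/funext => x; rewrite mulN1r addrC.
Qed.

Lemma uclosM f g : uclos atom f -> uclos atom g -> uclos atom (fun x => f x * g x).
Proof.
move=> uf ug e e0.
have [Mf Mf0 fM] := uclos_bounded uf; have [Mg Mg0 gM] := uclos_bounded ug.
(* The cap 1 keeps [f'] below [Mf + 1]; the total error is then [d * (Mf + Mg + 1)]. *)
pose d := Num.min 1 (e / (Mf + Mg + 1)).
have S0 : 0 < Mf + Mg + 1 by rewrite !addr_gt0.
have d0 : 0 < d by rewrite lt_min ltr01 divr_gt0.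
have [f' lf ff'] := uf _ d0; have [g' lg gg'] := ug _ d0.
exists (fun x => f' x * g' x); first exact: lspanM.
move=> x; rewrite (_ : _ - _ = (f x - f' x) * g x + f' x * (g x - g' x)); last by ring.
have f'M : `|f' x| <= Mf + 1.
  rewrite -[f' x](subKr (f x)) (le_trans (ler_normB _ _))// lerD//.
  by rewrite (le_trans (ff' x))// ge_min lexx.
apply: (@le_trans _ _ (d * Mg + (Mf + 1) * d)).
  by rewrite (le_trans (ler_normD _ _))// !normrM lerD// ler_pM.
rewrite (_ : _ + _ = d * (Mf + Mg + 1)); last by ring.
by rewrite -ler_pdivlMr// ge_min lexx orbT.
Qed.

(* [absq n t] is the classical polynomial iteration increasing to [|t|] on
   [[-1, 1]], with error at most [2 / n]. *)
Fixpoint absq n (t : R) : R :=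
  if n is n'.+1 then absq n' t + (t ^+ 2 - absq n' t ^+ 2) / 2 else 0.

(** With $a=|t|$ and $p$ the current iterate, one step multiplies the error $a-p$ by $1-(a+p)/2\le
    1-a/2$. Since $(1-a/2)(2+(n+1)a)\le 2+na$, the product of the error with $2+na$ never exceeds
    its initial value $2a$. *)
Lemma absq_bound n t : `|t| <= 1 ->
  0 <= absq n t <= `|t| /\ (`|t| - absq n t) * (2 + n%:R * `|t|) <= 2 * `|t|.
Proof.
move=> t1; have t0 : 0 <= `|t| by []; elim: n => [|n [/andP[p0 pt] IH]] /=.
  by rewrite lexx t0 mul0r; split=> //; lra.
rewrite -(real_normK (num_real t)).
set a := `|t| in t1 t0 p0 pt IH *; set p := absq n t in p0 pt IH *.
have n0 : 0 <= n%:R :> R by [].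
have -> : n.+1%:R = n%:R + 1 :> R by rewrite natr1.
set k : R := n%:R in n0 IH *.
have E : a - (p + (a ^+ 2 - p ^+ 2) / 2) = (a - p) * (1 - (a + p) / 2) by field.
have e1 : 0 <= 1 - (a + p) / 2 by lra.
have e2 : 0 <= a - p by lra.
split.
  apply/andP; split; last by rewrite -subr_ge0 E mulr_ge0.
  by rewrite addr_ge0// divr_ge0// subr_ge0 lerXn2r ?nnegrE.
rewrite E; apply: le_trans IH; rewrite -mulrA ler_wpM2l//.
have : 0 <= k * a ^+ 2 by rewrite mulr_ge0// sqr_ge0.
have : 0 <= p * a by rewrite mulr_ge0.
have : 0 <= k * (p * a) by rewrite !mulr_ge0.
have : 0 <= a ^+ 2 by rewrite sqr_ge0.
nra.
Qed.

Lemma absq_cvg n t : `|t| <= 1 -> `| `|t| - absq n.+1 t| <= 2 / n.+1%:R.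
Proof.
move=> /(absq_bound n.+1)[/andP[p0 pt] H].
rewrite ger0_norm ?subr_ge0//.
have [t0|t0] := eqVneq `|t| 0.
  by rewrite t0 in pt *; rewrite sub0r (le_trans (_ : _ <= 0))// ?oppr_le0// divr_ge0.
have t1 : 0 < `|t| by rewrite lt_def t0 normr_ge0.
rewrite ler_pdivlMr// -(ler_pM2r t1) -mulrA (le_trans _ H)//.
by rewrite ler_wpM2l ?subr_ge0// lerDr.
Qed.

Lemma uclos_abs f : uclos atom f -> uclos atom (fun x => `|f x|).
Proof.
move=> uf; have [M M0 fM] := uclos_bounded uf.
have M1 : M != 0 by rewrite gt_eqF.
have uq n : uclos atom (fun x => absq n (M^-1 * f x)).
  elim: n => [|n IH] /=; first exact: uclos_cst.
  have ut := uclosZ M^-1 uf.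
  have := uclosD IH (uclosZ 2^-1 (uclosB (uclosM ut ut) (uclosM IH IH))).
  by congr (uclos atom _); apply/funext => x; ring.
apply: uclos_lim => e e0.
have [n ne] : exists n, M * (2 / n.+1%:R) <= e.
  have [n _ /(_ n (leqnn n))] := near_infty_natSinv_lt (PosNum (divr_gt0 e0 (mulr_gt0 M0 (ltr0n R 2)))).
  rewrite /= ltr_pdivlMr ?mulr_gt0// => /ltW ne; exists n.
  by rewrite (le_trans _ ne)// le_eqVlt; apply/orP; left; apply/eqP; ring.
exists (fun x => M * absq n.+1 (M^-1 * f x)); first exact: uclosZ.
move=> x; apply: le_trans ne.
have -> : `|f x| = M * `|M^-1 * f x|.
  by rewrite normrM gtr0_norm ?invr_gt0// mulrA divff// mul1r.
rewrite -mulrBr normrM gtr0_norm// ler_pM2l//.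
apply: absq_cvg; rewrite normrM gtr0_norm ?invr_gt0// mulrC ler_pdivrMr// mul1r.
exact: fM.
Qed.

Lemma uclos_max f g : uclos atom f -> uclos atom g ->
  uclos atom (fun x => Num.max (f x) (g x)).
Proof.
move=> uf ug.
have := uclosZ 2^-1 (uclosD (uclosD uf ug) (uclos_abs (uclosB uf ug))).
by congr (uclos atom _); apply/funext => x; rewrite maxr_absE mulrC.
Qed.

Lemma uclos_min f g : uclos atom f -> uclos atom g ->
  uclos atom (fun x => Num.min (f x) (g x)).
Proof.
move=> uf ug.
have := uclosZ 2^-1 (uclosB (uclosD uf ug) (uclos_abs (uclosB uf ug))).
by congr (uclos atom _); apply/funext => x; rewrite minr_absE mulrC.
Qed.

Lemma uclos_sum n (F : 'I_n -> X -> R) : (forall i, uclos atom (F i)) ->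
  uclos atom (fun x => \sum_(i < n) F i x).
Proof.
elim: n F => [|n IH] F uF.
  by under eq_fun do rewrite big_ord0; exact: uclos_cst.
under eq_fun do rewrite big_ord_recr/=.
by apply: uclosD => //; exact: IH.
Qed.

Lemma uclos_bigmax (I : Type) (s : seq I) (F : I -> X -> R) (a : R) :
  (forall i, uclos atom (F i)) ->
  uclos atom (fun x => \big[Num.max/a]_(i <- s) F i x).
Proof.
move=> uF; elim: s => [|i s IH].
  by under eq_fun do rewrite big_nil; exact: uclos_cst.
by under eq_fun do rewrite big_cons; exact: uclos_max.
Qed.

End uniform_closure.

(** * Cell averages *)

(** Only one of the two points has to lie in [A]: the sampling windows reach outside [0, 1], and the
    sampled data are compared with points of a box without lying in it. *)
Lemma compact_uniform_continuity (R : realType) (X : pseudoMetricType R)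
    (A : set X) (f : X -> R) : compact A -> continuous f ->
  forall e : R, 0 < e -> exists2 d : R, 0 < d &
    forall x y, A x -> ball x d y -> `|f x - f y| <= e.
Proof.
move=> cA cf e e0.
have := (compact_near_coveringP A).1 cA R 0^'+
  (fun d x => forall y, ball x d y -> `|f x - f y| <= e) _.
case.
  move=> x Ax.
  have e2 : 0 < e / 2 by exact: divr_gt0.
  have := cf x => /cvgrPdist_le/(_ _ e2)/nbhs_ballP[r /= r0 xr].
  have r2 : 0 < r / 2 by exact: divr_gt0.
  exists (ball x (r / 2), [set d | d < r / 2]); first split => /=.
  - exact: nbhsx_ballx.
  - exact: nbhs_right_lt.
  - move=> [x' d] /= [xx' dr] y x'y.
    rewrite (le_trans (ler_distD (f x) _ _))// [leRHS]splitr lerD//.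
      rewrite distrC; apply: xr; apply: le_ball xx'.
      by rewrite ler_pdivrMr// ler_peMr ?ler1n// ltW.
    apply: xr; rewrite [r]splitr; apply: ball_triangle xx' _.
    by apply: le_ball x'y; exact: ltW.
move=> d0 /= d00 Hd.
exists (d0 / 2); first exact: divr_gt0.
move=> x y Ax; apply: (Hd (d0 / 2)) => //=; last exact: divr_gt0.
by rewrite sub0r normrN gtr0_norm ?divr_gt0// ltr_pdivrMr// ltr_pMr// ltr1n.
Qed.

Section averages.
Context {R : realType}.
Implicit Types (f h : R -> R) (s t a e d M : R) (m N : nat).
Local Notation leb := (@lebesgue_measure R).
Local Notation T := (measurableTypeR R).

Definition cell N (i : nat) : set R := `[i%:R / N%:R, i.+1%:R / N%:R[%classic.

(** Normalized to integral 1, so that pairing with it averages over the cell. *)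
Definition hcell N (i : nat) (t : R) : R := N%:R * \1_(cell N i) t.

Definition avg N f : rvec R N := [tuple L2inner (hcell N i) f | i < N].

(** The orthogonal projection of L2 onto the step functions with [N] cells. *)
Definition Pavg N f : R -> R := stepfun (avg N f).

Definition lin_rvec N (a : R) (x y : rvec R N) : rvec R N :=
  [tuple a * tnth x i + tnth y i | i < N].

Lemma cellP N t : (0 < N)%N -> 0 <= t < 1 -> exists i : 'I_N, cell N i t.
Proof.
move=> N0 /andP[t0 t1]; have N1 : 0 < N%:R :> R by rewrite ltr0n.
have tN : (Num.truncn (t * N%:R) < N)%N.
  rewrite -(ltr_nat R) (@le_lt_trans _ _ (t * N%:R))// ?truncn_le ?mulr_ge0//.
  by rewrite -ltr_pdivlMr// divff ?gt_eqF.
exists (Ordinal tN); rewrite /cell/= in_itv/= ler_pdivrMr// ltr_pdivlMr//.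
by rewrite truncn_le ?mulr_ge0//= truncnS_gt.
Qed.

Lemma cell_inj N (i j : 'I_N) t : cell N i t -> cell N j t -> i = j.
Proof.
rewrite /cell/= !in_itv/= => /andP[i1 i2] /andP[j1 j2]; apply/val_inj/eqP => /=.
have N0 : 0 < N%:R :> R by rewrite ltr0n (leq_trans _ (ltn_ord i)).
rewrite eqn_leq; apply/andP; split; rewrite -ltnS.
  by rewrite -(ltr_nat R) -(ltr_pM2r (_ : 0 < N%:R^-1)) ?invr_gt0// (le_lt_trans i1).
by rewrite -(ltr_nat R) -(ltr_pM2r (_ : 0 < N%:R^-1)) ?invr_gt0// (le_lt_trans j1).
Qed.

Lemma cell01 N (i : 'I_N) t : cell N i t -> 0 <= t < 1.
Proof.
have N0 : 0 < N%:R :> R by rewrite ltr0n (leq_trans _ (ltn_ord i)).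
rewrite /cell/= in_itv/= => /andP[i1 i2]; rewrite (le_trans _ i1) ?divr_ge0//=.
by rewrite (lt_le_trans i2)// ler_pdivrMr// mul1r ler_nat.
Qed.

Lemma indic_cell N (i j : 'I_N) t : cell N i t -> \1_(cell N j) t = (i == j)%:R :> R.
Proof.
move=> it; rewrite indicE; congr (_%:R); congr nat_of_bool.
apply/idP/eqP => [|<-]; last by rewrite inE.
by rewrite inE; exact: cell_inj.
Qed.

Lemma stepfunE N (x : rvec R N) (i : 'I_N) t : cell N i t -> stepfun x t = tnth x i.
Proof.
move=> it; rewrite /stepfun (bigD1 i)//= big1 ?addr0; last first.
  by move=> j ji; rewrite (indic_cell j it) eq_sym (negbTE ji) mulr0.
by rewrite (indic_cell i it) eqxx mulr1.
Qed.

Lemma stepfun_lin N a (x y : rvec R N) :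
  stepfun (lin_rvec a x y) = (fun t => a * stepfun x t + stepfun y t).
Proof.
apply/funext => t; rewrite /stepfun mulr_sumr -big_split/=.
by apply: eq_bigr => i _; rewrite tnth_mktuple; ring.
Qed.

Lemma measurable_cell N i : measurable (cell N i : set T).
Proof. exact: measurable_itv. Qed.

Lemma isL2_indic_cell N i : isL2 (\1_(cell N i) : R -> R).
Proof.
apply: (@isL2_bounded01 _ _ 1); first by apply: measurable_indic; exact: measurable_cell.
by move=> t _; rewrite indicE; case: (_ \in _); rewrite ?normr0 ?normr1.
Qed.

Lemma isL2_hcell N i : isL2 (hcell N i).
Proof. by apply: isL2Z; exact: isL2_indic_cell. Qed.

Lemma isL2_Pavg N f : isL2 (Pavg N f).
Proof. exact: isL2_stepfun. Qed.

Lemma Rintegral_hcell N (i : 'I_N) : \int[leb]_(t in `[0, 1]) hcell N i t = 1.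
Proof.
have N0 : (0 < N)%N by rewrite (leq_trans _ (ltn_ord i)).
rewrite RintegralZl//; last first.
  have := integrable_L2M (isL2_cst 1) (isL2_indic_cell N i).
  by apply: eq_integrable => // t _ /=; rewrite mul1r.
rewrite /Rintegral integral_indic//; last exact: measurable_cell.
rewrite setIidl; last first.
  move=> t /cell01/andP[t0 t1]; rewrite /= in_itv/= t0/=; exact: ltW.
rewrite [X in fine X]lebesgue_measure_itv/= lte_fin ltr_pM2r ?invr_gt0 ?ltr0n// ltr_nat ltnSn/=.
rewrite -mulrBl -natrB// subSnn mul1r divff// pnatr_eq0; by case: N N0 i.
Qed.

Lemma L2inner_hcell_stepfun N (x : rvec R N) (i : 'I_N) :
  L2inner (hcell N i) (stepfun x) = tnth x i.
Proof.
transitivity (\int[leb]_(t in `[0, 1]) (tnth x i * hcell N i t)); last first.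
  rewrite RintegralZl// ?Rintegral_hcell ?mulr1//.
  have := integrable_L2M (isL2_cst 1) (isL2_hcell N i).
  by apply: eq_integrable => // t _ /=; rewrite mul1r.
apply: eq_Rintegral => t _; rewrite /hcell indicE.
have [it|] := boolP (t \in cell N i).
  by rewrite (@stepfunE _ _ i) 1?mulrC//; move: it; rewrite inE.
by rewrite !mulr0 mul0r.
Qed.

Lemma avg_stepfun N (x : rvec R N) : avg N (stepfun x) = x.
Proof.
by apply: eq_from_tnth => i; rewrite tnth_mktuple L2inner_hcell_stepfun.
Qed.

Lemma L2inner_stepfun N (x : rvec R N) f : isL2 f ->
  L2inner f (stepfun x) = N%:R^-1 * \sum_(i < N) tnth x i * tnth (avg N f) i.
Proof.
move=> f2; rewrite /stepfun L2inner_sumr//; last first.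
  by move=> i; apply: isL2Z; exact: isL2_indic_cell.
rewrite mulr_sumr; apply: eq_bigr => i _.
have N0 : N%:R != 0 :> R by rewrite pnatr_eq0; case: N x i => // x [].
rewrite L2innerZr//; last exact: isL2_indic_cell.
rewrite tnth_mktuple L2innerZl//; last exact: isL2_indic_cell.
by rewrite L2innerC -/(cell N i); field.
Qed.

Lemma L2inner_stepfun2 N (x y : rvec R N) :
  L2inner (stepfun x) (stepfun y) = N%:R^-1 * \sum_(i < N) tnth x i * tnth y i.
Proof.
rewrite L2inner_stepfun; last exact: isL2_stepfun.
by rewrite avg_stepfun; under eq_bigr do rewrite mulrC.
Qed.

Lemma L2norm_stepfun N (x : rvec R N) :
  L2norm (stepfun x) ^+ 2 = N%:R^-1 * \sum_(i < N) tnth x i ^+ 2.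
Proof.
rewrite L2norm_sqr; last exact: isL2_stepfun.
by rewrite L2inner_stepfun2; under eq_bigr do rewrite -expr2.
Qed.

Lemma Rintegral_stepfun N (x : rvec R N) : (0 < N)%N ->
  \int[leb]_(t in `[0, 1]) stepfun x t = N%:R^-1 * \sum_(i < N) tnth x i.
Proof.
move=> N0; pose e : rvec R N := [tuple 1 | _ < N].
rewrite (_ : N%:R^-1 * _ = L2inner (stepfun x) (stepfun e)); last first.
  rewrite L2inner_stepfun2; congr (_ * _).
  by apply: eq_bigr => i _; rewrite tnth_mktuple mulr1.
have ix : leb.-integrable (`[0, 1]%classic : set R) (EFin \o stepfun x).
  have := integrable_L2M (isL2_cst 1) (isL2_stepfun x).
  by apply: eq_integrable => // t _ /=; rewrite mul1r.
have i01 : (`[0, 1[%classic : set R) `<=` `[0, 1]%classic.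
  by apply: subset_itvl; rewrite bnd_simp.
rewrite /L2inner -Rintegral_itv_bndo_bndc; last exact: integrableS ix.
rewrite -[RHS]Rintegral_itv_bndo_bndc; last first.
  by apply: integrableS (integrable_L2M (isL2_stepfun x) (isL2_stepfun e)).
apply: eq_Rintegral => t; rewrite inE/= in_itv/= => t01.
by have [i it] := cellP N0 t01; rewrite (stepfunE e it) tnth_mktuple mulr1.
Qed.

Lemma L2inner_Pavg N (x : rvec R N) f : isL2 f ->
  L2inner (Pavg N f) (stepfun x) = L2inner f (stepfun x).
Proof.
move=> f2; rewrite L2inner_stepfun2 L2inner_stepfun//.
by under eq_bigr do rewrite mulrC.
Qed.

(** The square of the left side is the pairing of [f] with its own projection, so Cauchy-Schwarz
    gives the contraction. *)
Lemma L2norm_Pavg N f : isL2 f -> L2norm (Pavg N f) <= L2norm f.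
Proof.
move=> f2; have P2 := isL2_Pavg N f.
have := L2_CauchySchwarz f2 P2.
rewrite -L2inner_Pavg// -/(Pavg N f) -L2norm_sqr// ger0_norm ?sqr_ge0// expr2.
have [->|P0] := eqVneq (L2norm (Pavg N f)) 0; first by rewrite L2norm_ge0.
by rewrite ler_pM2r// lt_def P0 L2norm_ge0.
Qed.

Lemma avg_lin N a f h : isL2 f -> isL2 h ->
  avg N (fun t => a * f t + h t) = lin_rvec a (avg N f) (avg N h).
Proof.
move=> f2 h2; apply: eq_from_tnth => i; rewrite !tnth_mktuple.
by rewrite L2inner_linr//; exact: isL2_hcell.
Qed.

Lemma Pavg_lin N a f h : isL2 f -> isL2 h ->
  Pavg N (fun t => a * f t + h t) = (fun t => a * Pavg N f t + Pavg N h t).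
Proof. by move=> f2 h2; rewrite /Pavg avg_lin// stepfun_lin. Qed.

Lemma le_tnth_avg N (i : 'I_N) f : isL2 f -> `|tnth (avg N f) i| <= N%:R * L2norm f.
Proof.
move=> f2; rewrite tnth_mktuple (le_trans (L2_CauchySchwarz (isL2_hcell N i) f2))//.
rewrite ler_wpM2r ?L2norm_ge0//; apply: L2norm_bounded => //.
  by apply: isL2_measurable; exact: isL2_hcell.
by move=> t _; rewrite normrM ger0_norm// ler_piMr// indicE; case: (_ \in _);
  rewrite ?normr0 ?normr1.
Qed.

Lemma Pavg_close N (i : 'I_N) f t e : isL2 f -> cell N i t ->
  (forall s, cell N i s -> `|f t - f s| <= e) -> `|f t - Pavg N f t| <= e.
Proof.
move=> f2 it ft; rewrite /Pavg (stepfunE _ it) tnth_mktuple.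
have h2 := isL2_hcell N i.
have -> : f t - L2inner (hcell N i) f = L2inner (hcell N i) (fun s => f t - f s).
  rewrite L2innerBr//; last exact: isL2_cst; congr (_ - _).
  rewrite /L2inner; under eq_Rintegral do rewrite mulrC.
  rewrite RintegralZl// ?Rintegral_hcell ?mulr1//.
  have := integrable_L2M (isL2_cst 1) h2.
  by apply: eq_integrable => // s _ /=; rewrite mul1r.
have d2 : isL2 (fun s => f t - f s) by apply: isL2B => //; exact: isL2_cst.
rewrite /L2inner; have im := integrable_L2M h2 d2.
apply: (le_trans (le_normr_Rintegral _ _)) => //.
have ih : leb.-integrable (`[0, 1]%classic : set R) (EFin \o hcell N i).
  have := integrable_L2M (isL2_cst 1) h2.
  by apply: eq_integrable => // s _ /=; rewrite mul1r.
have -> : e = \int[leb]_(t in `[0, 1]) (e * hcell N i t).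
  by rewrite RintegralZl// Rintegral_hcell mulr1.
apply: le_Rintegral => //; [exact: integrable_norm|exact: integrable_realZ|].
move=> s _; rewrite normrM /hcell indicE; have [si|] := boolP (s \in _).
  rewrite mulr1 ger0_norm// mulrC ler_wpM2r//; apply: ft.
  by move: si; rewrite inE.
by rewrite mulr0 normr0 mul0r mulr0.
Qed.

Lemma cell_dist N (i : 'I_N) s t : cell N i s -> cell N i t -> `|s - t| <= N%:R^-1.
Proof.
rewrite /cell/= !in_itv/= -!(natr1 i) !mulrDl mul1r => /andP[s1 s2] /andP[t1 t2].
rewrite ler_norml; lra.
Qed.

Lemma exists_natV_le (e : R) : 0 < e ->
  exists2 n0 : nat, (0 < n0)%N & forall n, (n0 <= n)%N -> n%:R^-1 <= e.
Proof.
move=> e0; exists (Num.truncn e^-1).+1 => // n ln.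
have n0 : (0 < n)%N by rewrite (leq_trans _ ln).
rewrite invf_ple ?posrE ?ltr0n//; apply: ltW; apply: (lt_le_trans (truncnS_gt _)).
by rewrite ler_nat.
Qed.

Lemma Pavg_continuous f e : continuous f -> 0 < e ->
  exists2 m0 : nat, (0 < m0)%N & forall m, (m0 <= m)%N ->
    L2norm (fun t => f t - Pavg m f t) <= e.
Proof.
move=> cf e0.
have [d d0 fd] := compact_uniform_continuity (@segment_compact R 0 1) cf e0.
have [m0 m00 md] := @exists_natV_le (d / 2) (divr_gt0 d0 (ltr0n R 2)).
exists m0 => // m lm; have m1 : (0 < m)%N by rewrite (leq_trans _ lm).
have f2 := isL2_continuous cf.
apply: L2norm_bounded; [|exact: ltW|].
  apply: measurable_funB; first exact: isL2_measurable.
  by apply: isL2_measurable; exact: isL2_Pavg.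
move=> t t01; have [i it] := cellP m1 t01.
apply: (Pavg_close f2 it) => s si; apply: fd.
  by move/andP: t01 => [t0 t1]; rewrite /= in_itv/= t0 ltW.
rewrite /ball/=; apply: (le_lt_trans (cell_dist it si)).
by rewrite (le_lt_trans (md _ lm))// ltr_pdivrMr// ltr_pMr// ltr1n.
Qed.

Definition clip (M y : R) : R := Num.max (- M) (Num.min M y).

Lemma clip_le M y : 0 <= M -> `|clip M y| <= M.
Proof.
move=> M0; rewrite ler_norml /clip le_max lexx/= ge_max ge_min lexx/= andbT.
by rewrite (le_trans _ M0)// oppr_le0.
Qed.

Lemma clip_id M y : `|y| <= M -> clip M y = y.
Proof.
rewrite ler_norml /clip => /andP[y1 y2].
by rewrite min_r// max_r.
Qed.

Lemma clip_dist M y z : `|clip M y - clip M z| <= `|y - z|.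
Proof.
rewrite /clip !maxEle !minEle.
have := ler_norm (y - z); have := ler_norm (z - y); rewrite (distrC z).
by case: (boolP (M <= y)); case: (boolP (M <= z)); rewrite -?ltNge => ? ?;
  repeat case: ifPn; rewrite -?ltNge => *; rewrite ler_norml; lra.
Qed.

Lemma continuous_clip M : continuous (clip M).
Proof.
move=> y; apply: (@continuous_max _ _ (fun=> - M) (fun y => Num.min M y)); first exact: cvg_cst.
by apply: (@continuous_min _ _ (fun=> M) id); [exact: cvg_cst|exact: cvg_id].
Qed.

Lemma measurable_clip M f : measurable_fun [set: T] f ->
  measurable_fun [set: T] (fun t => clip M (f t)).
Proof.
move=> mf; apply: measurable_maxr => //.
by apply: measurable_minr.
Qed.

Lemma isL2_clip M f : 0 <= M -> measurable_fun [set: T] f ->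
  isL2 (fun t => clip M (f t)).
Proof.
move=> M0 mf; apply: (@isL2_bounded01 _ _ M); first exact: measurable_clip.
by move=> t _; exact: clip_le.
Qed.

Lemma clip_cvg f e : isL2 f -> 0 < e ->
  exists2 M : R, 0 <= M & L2norm (fun t => f t - clip M (f t)) <= e.
Proof.
move=> f2 e0; have mf := isL2_measurable f2.
have mI : measurable (`[0, 1]%classic : set T) by exact: measurable_itv.
have /(_ _)[] // := @dominated_convergence _ T R leb _ mI
  (fun n t => ((f t - clip n%:R (f t)) ^+ 2)%:E) (fun=> 0%E)
  (EFin \o (fun t => f t ^+ 2)).
- move=> n; apply/measurable_EFinP/measurable_funX/measurable_funTS.
  by apply: measurable_funB => //; exact: measurable_clip.
- apply: aeW => t _; apply: cvg_near_cst.
  exists (Num.truncn `|f t|).+1 => // n /= ln.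
  rewrite clip_id ?subrr ?expr0n//; apply/ltW/(lt_le_trans (truncnS_gt _)).
  by rewrite ler_nat.
- exact: integrable_L2sqr.
- apply: aeW => t n _; rewrite gee0_abs ?lee_fin ?sqr_ge0// -[leRHS]real_normK ?num_real//.
  rewrite -[leLHS]real_normK ?num_real// lerXn2r ?nnegrE//.
  have n0 : 0 <= n%:R :> R by [].
  have := ler_norm (f t); have := ler_norm (- f t); rewrite normrN /clip maxEle minEle.
  by case: (boolP (n%:R <= f t)); rewrite -?ltNge => ?;
    case: ifPn; rewrite -?ltNge => *; rewrite ler_norml; lra.
move=> _ _ cv.
have : (fun n => L2inner (fun t => f t - clip n%:R (f t)) (fun t => f t - clip n%:R (f t)))
    @ \oo --> (0 : R).
  have {}cv : (fun n => (\int[leb]_(x in `[0%R, 1%R])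
      ((f x - clip n%:R (f x)) ^+ 2)%:E)%E) @ \oo --> 0%:E.
    by rewrite integral0 in cv.
  have /fine_cvgP[_ cv'] := cv.
  apply: cvg_trans cv'; apply: near_eq_cvg; apply: nearW => n /=.
  by rewrite /L2inner /Rintegral; congr fine; apply: eq_integral => t _; rewrite expr2.
move=> /cvgrPdist_le/(_ _ (exprn_gt0 2 e0)) [n _ /(_ n (leqnn n))] /=.
rewrite sub0r normrN ger0_norm ?L2inner_ge0// => ne.
exists n%:R => //; rewrite -ler_sqr ?nnegrE ?L2norm_ge0 ?(ltW e0)// L2norm_sqr//.
by apply: isL2B => //; exact: isL2_clip.
Qed.

(** Density of continuous functions in $L^1$ becomes density in $L^2$ after clipping: for two
    functions bounded by [M] the squared distance is at most $2M$ times the $L^1$ distance. *)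
Lemma continuous_dense_L2 f e : isL2 f -> 0 < e ->
  exists2 h : R -> R, continuous h & L2norm (fun t => f t - h t) <= e.
Proof.
move=> f2 e0; have e2 : 0 < e / 2 by exact: divr_gt0.
have [M M0 fM] := clip_cvg f2 e2; have mf := isL2_measurable f2.
have mI : measurable (`[0, 1]%classic : set T) by exact: measurable_itv.
have c2 := isL2_clip M0 mf.
have ic : leb.-integrable (`[0, 1]%classic : set R) (EFin \o (fun t => clip M (f t))).
  have := integrable_L2M (isL2_cst 1) c2.
  by apply: eq_integrable => // t _ /=; rewrite mul1r.
have [| h [ch ih cv]] := approximation_continuous_integrable mI _ ic.
  by rewrite [X in (X < _)%E]lebesgue_measure_itv/= lte_fin ltr01 -EFinB ltry.
(* The $L^1$ accuracy that turns into $L^2$ accuracy [e / 2]; the added 1 keeps the denominator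
   positive when [M] is 0. *)
pose d := (e / 2) ^+ 2 / (2 * M + 1).
have M1 : 0 < 2 * M + 1 by rewrite ltr_wpDl// mulr_ge0.
have d0 : 0 < d by rewrite divr_gt0// exprn_gt0.
have /fine_cvgP[_ /cvgrPdist_le/(_ _ d0)[n _ /(_ n (leqnn n))]] := cv.
rewrite /= sub0r normrN => hd.
have cgh : continuous (fun t => clip M (h n t)).
  by move=> t; apply: (@continuous_comp _ _ _ (h n) (clip M)); [exact: ch|exact: continuous_clip].
exists (fun t => clip M (h n t)) => //.
have g2 := isL2_continuous cgh.
rewrite (le_trans (ler_L2normB f2 g2 c2))// [leRHS]splitr lerD//.
have D2 := isL2B c2 g2.
rewrite -ler_sqr ?nnegrE ?L2norm_ge0 ?(ltW e2)// L2norm_sqr//.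
have iD : leb.-integrable (`[0, 1]%classic : set R)
    (EFin \o (fun t => `|clip M (f t) - h n t|)).
  have := integrable_realD mI ic (integrable_realZ (-1) mI (ih n)).
  move=> /(integrable_norm).
  by apply: eq_integrable => // t _ /=; rewrite mulN1r.
apply: (@le_trans _ _ ((2 * M + 1) * \int[leb]_(t in `[0, 1]) `|clip M (f t) - h n t|)).
  rewrite /L2inner -RintegralZl//; apply: le_Rintegral => //.
  - exact: (integrable_L2M D2 D2).
  - exact: integrable_realZ.
  - move=> t _; rewrite -expr2 -real_normK ?num_real// expr2 ler_pM//.
      rewrite (le_trans (ler_normB _ _))//.
      by have := clip_le (f t) M0; have := clip_le (h n t) M0; lra.
    rewrite (le_trans _ (clip_dist M _ _))// (@clip_id _ (clip M (f t)))//.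
    exact: clip_le.
rewrite mulrC -ler_pdivlMr//; apply: le_trans hd; exact: ler_norm.
Qed.

Lemma Pavg_cvg f e : isL2 f -> 0 < e ->
  exists2 m0 : nat, (0 < m0)%N & forall m, (m0 <= m)%N ->
    L2norm (fun t => f t - Pavg m f t) <= e.
Proof.
move=> f2 e0; have e3 : 0 < e / 3 by exact: divr_gt0.
have [h ch fh] := continuous_dense_L2 f2 e3.
have [m0 m00 hm] := Pavg_continuous ch e3.
exists m0 => // m lm; have h2 := isL2_continuous ch.
rewrite (le_trans (ler_L2normB f2 (isL2_Pavg m f) h2))//.
rewrite (_ : e = e / 3 + (e / 3 + e / 3)); last by field.
rewrite lerD// (le_trans (ler_L2normB h2 (isL2_Pavg m f) (isL2_Pavg m h)))// lerD//.
  exact: hm.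
apply: le_trans fh; rewrite L2normBC//; try exact: isL2_Pavg.
apply: le_trans (L2norm_Pavg m (isL2B f2 h2)).
rewrite le_eqVlt; apply/orP; left; apply/eqP; congr L2norm.
have := Pavg_lin m (-1) h2 f2.
rewrite (_ : (fun t => -1 * h t + f t) = f \- h); last first.
  by apply/funext => t; rewrite /= mulN1r addrC.
by move=> ->; apply/funext => t; rewrite mulN1r addrC.
Qed.

End averages.

(** * Elementary bounds on sine and cosine *)

Section trig_bounds.
Context {R : realType}.
Implicit Types (u x y : R).

Lemma sin_sub_bound x y : x <= y ->
  exists2 c : R, c \in `[x, y] & sin y - sin x = cos c * (y - x).
Proof.
move=> xy; apply: MVT_segment => //.
by apply: continuous_subspaceT => z; exact: continuous_sin.
Qed.

Lemma ler_norm_sin u : `|sin u| <= `|u|.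
Proof.
wlog u0 : u / 0 <= u.
  by move=> H; case: (leP 0 u) => [/H//|/ltW u0]; rewrite -normrN -sinN -(normrN u) H ?oppr_ge0.
have [c _] := sin_sub_bound u0; rewrite sin0 !subr0 => ->.
by rewrite normrM ler_piMl// cos_max.
Qed.

Lemma ler_dist_cos x y : `|cos x - cos y| <= `|x - y|.
Proof.
wlog xy : x y / y <= x.
  move=> H; case: (leP y x) => [/H//|/ltW yx].
  by rewrite distrC (distrC x) H.
have ccos : {within `[y, x], continuous (@cos R)}.
  by apply: continuous_subspaceT => z; exact: continuous_cos.
have [c _ ->] := @MVT_segment _ (@cos R) (fun z => - sin z) y x xy
  (fun z _ => is_derive_cos z) ccos.
by rewrite normrM normrN ler_piMl// sin_max.
Qed.

Lemma cos_ge_half u : `|u| <= 1 -> 2^-1 <= cos u.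
Proof.
move=> u1; have -> : u = (u / 2) *+ 2 by rewrite mulr2n -splitr.
rewrite cos_mulr2n cos2sin2.
have : sin (u / 2) ^+ 2 <= 4^-1.
  rewrite -real_normK ?num_real// (_ : 4^-1 = (2^-1) ^+ 2); last by field.
  rewrite lerXn2r ?nnegrE ?invr_ge0// (le_trans (ler_norm_sin _))//.
  by rewrite normrM normfV (ger0_norm (_ : 0 <= 2))// ler_piMl ?invr_ge0.
by rewrite -(mulr_natr (1 - _)); lra.
Qed.

Lemma norm_sin_ge_half u : `|u| <= 1 -> `|u| <= 2 * `|sin u|.
Proof.
wlog u0 : u / 0 <= u.
  by move=> H; case: (leP 0 u) => [/H//|/ltW u0];
    rewrite -normrN -(normrN (sin u)) -sinN; apply: H; rewrite oppr_ge0.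
move=> u1; have [c /[!in_itv]/= /andP[c0 cu]] := sin_sub_bound u0.
rewrite sin0 !subr0 => ->; rewrite normrM mulrA ler_peMl//.
have c1 : `|c| <= 1 by rewrite ger0_norm// (le_trans cu)// (le_trans (ler_norm _)).
by have := cos_ge_half c1; have := ler_norm (cos c); lra.
Qed.

Lemma cosM x y : cos x * cos y = 2^-1 * cos (x + y) + 2^-1 * cos (x - y).
Proof. by rewrite cosD cosB; field. Qed.

End trig_bounds.

Section prob_real.
Context d (T : measurableType d) (R : realType) (P : probability T R).
Implicit Types (f g h : T -> R) (M e : R).

Lemma prob_integrable f M : measurable_fun setT f -> (forall x, `|f x| <= M) ->
  P.-integrable setT (EFin \o f).
Proof.
move=> mf fM; apply: measurable_bounded_integrable => //.
  by rewrite [X in (X < _)%E]probability_setT ltry.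
by exists M; split; rewrite ?num_real// => x Mx y _; rewrite /= (le_trans (fM _))// ltW.
Qed.

Lemma prob_Rintegral_cst M : \int[P]_x M = M.
Proof. by rewrite Rintegral_cst// [X in fine X]probability_setT mulr1. Qed.

Lemma prob_Rintegral_le f g M : measurable_fun setT f -> measurable_fun setT g ->
  (forall x, `|f x| <= M) -> (forall x, `|g x| <= M) -> (forall x, f x <= g x) ->
  \int[P]_x f x <= \int[P]_x g x.
Proof.
move=> mf mg fM gM fg; apply: le_Rintegral => //; exact: prob_integrable.
Qed.

Lemma prob_Rintegral_dist f g h M : measurable_fun setT f -> measurable_fun setT g ->
  measurable_fun setT h -> (forall x, `|f x| <= M) -> (forall x, `|g x| <= M) ->
  (forall x, `|h x| <= M) -> (forall x, `|f x - g x| <= h x) ->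
  `|\int[P]_x f x - \int[P]_x g x| <= \int[P]_x h x.
Proof.
move=> mf mg mh fM gM hM fgh.
have fi := prob_integrable mf fM; have gi := prob_integrable mg gM.
have fgi : P.-integrable setT (EFin \o (fun x => f x - g x)).
  apply: (@prob_integrable _ (M + M)); first exact: measurable_funB.
  by move=> x; rewrite (le_trans (ler_normB _ _))// lerD.
rewrite -RintegralB//; apply: (le_trans (le_normr_Rintegral _ _)) => //.
apply: le_Rintegral => //; [exact: integrable_norm|exact: prob_integrable hM].
Qed.

End prob_real.

(** * Convergence of integrals on a uniform closure *)

Section uclos_integral.
Context d (T : measurableType d) (R : realType) (atom : set (T -> R)).
Hypothesis atom_le1 : forall f, atom f -> forall x, `|f x| <= 1.
Hypothesis atom_meas : forall f, atom f -> measurable_fun setT f.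

Lemma lspan_measurable f : lspan atom f -> measurable_fun setT f.
Proof.
elim=> {f} [f /atom_meas//| |a f g _ mf _ mg]; first exact: measurable_cst.
by apply: measurable_funD => //; exact: measurable_funM.
Qed.

Lemma uclos_measurable f : uclos atom f -> measurable_fun setT f.
Proof.
move=> uf; have /choice[g Hg] n : exists g, lspan atom g /\
    forall x, `|f x - g x| <= n.+1%:R^-1.
  have n0 : 0 < n.+1%:R^-1 :> R by rewrite invr_gt0.
  by have [g lg fg] := uf _ n0; exists g.
apply: (@measurable_fun_cvg _ _ _ _ g) => [n|x _].
  exact: lspan_measurable (Hg n).1.
apply/cvgrPdist_le => /= e e0; near=> n.
rewrite (le_trans ((Hg n).2 x))//; apply: ltW; near: n.
exact: (near_infty_natSinv_lt (PosNum e0)).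
Unshelve. all: by end_near. Qed.

Variables (P : nat -> probability T R) (P0 : probability T R).
Hypothesis atom_cvg : forall f, atom f ->
  (fun N => \int[P N]_x f x) @ \oo --> \int[P0]_x f x.

Lemma lspan_cvg f : lspan atom f ->
  (fun N => \int[P N]_x f x) @ \oo --> \int[P0]_x f x.
Proof.
elim=> {f} [f /atom_cvg//| |a f g lf cf lg cg].
  rewrite prob_Rintegral_cst; under eq_fun do rewrite prob_Rintegral_cst.
  exact: cvg_cst.
have [Mf _ fM] := lspan_bounded atom_le1 lf.
have [Mg _ gM] := lspan_bounded atom_le1 lg.
have mf := lspan_measurable lf; have mg := lspan_measurable lg.
have E (Q : probability T R) :
    \int[Q]_x (a * f x + g x) = a * \int[Q]_x f x + \int[Q]_x g x.
  have fi := prob_integrable Q mf fM.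
  rewrite RintegralD//; last exact: prob_integrable mg gM.
    by rewrite RintegralZl.
  exact: integrable_realZ.
rewrite E; under eq_fun do rewrite E.
by apply: cvgD => //; apply: cvgMr.
Qed.

Lemma uclos_cvg f : uclos atom f ->
  (fun N => \int[P N]_x f x) @ \oo --> \int[P0]_x f x.
Proof.
move=> uf; have mf := uclos_measurable uf.
have [M M0 fM] := uclos_bounded atom_le1 uf.
apply/cvgrPdist_le => /= e e0; have e3 : 0 < e / 3 by exact: divr_gt0.
have [g lg fg] := uf _ e3; have mg := lspan_measurable lg.
have [Mg Mg0 gM] := lspan_bounded atom_le1 lg.
have close (Q : probability T R) : `|\int[Q]_x f x - \int[Q]_x g x| <= e / 3.
  rewrite -[leRHS](prob_Rintegral_cst Q).
  apply: (@prob_Rintegral_dist _ _ _ _ _ _ _ (M + Mg + e / 3)) => // x.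
  - by have := fM x; lra.
  - by have := gM x; lra.
  - by rewrite gtr0_norm//; lra.
have := lspan_cvg lg => /cvgrPdist_le/(_ _ e3); apply: filterS => N gN.
rewrite (_ : e = e / 3 + (e / 3 + e / 3)); last by field.
rewrite (le_trans (ler_distD (\int[P0]_x g x) _ _))// lerD//.
rewrite (le_trans (ler_distD (\int[P N]_x g x) _ _))// lerD//.
by rewrite distrC.
Qed.

End uclos_integral.

(** * A criterion for weak convergence on L2 *)

Section L2_functionals.
Context {R : realType}.
Implicit Types (x y : L2 R) (F : L2 R -> R) (L B e : R) (m n : nat).

Lemma L2_lipschitz_continuous F L :
  (forall x y, `|F x - F y| <= L * L2dist x y) -> continuous F.
Proof.
move=> FL x; apply/(@cvgrPdist_le _ _ _ _ (nbhs_filter x)) => e e0; apply/nbhs_ballP.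
have L1 : 0 < `|L| + 1 by rewrite ltr_wpDl.
exists (e / (`|L| + 1)); first exact: divr_gt0.
move=> y; rewrite ballEmdist/= => xy.
rewrite (le_trans (FL x y))// (@le_trans _ _ ((`|L| + 1) * L2dist x y))//.
  by rewrite ler_wpM2r ?L2norm_ge0// (le_trans (ler_norm _))// lerDl.
by rewrite mulrC -ler_pdivlMr// ltW.
Qed.

Lemma L2_continuous_measurable F : continuous F -> measurable_fun [set: L2borel R] F.
Proof.
move=> /continuousP cF; apply: (measurability _ (RGenOpens.measurableE R)).
move=> _ [_ [a [b ->] <-]]; rewrite setTI; apply: sub_sigma_algebra.
exact/cF/interval_open.
Qed.

Lemma L2inner_lipschitz (h : R -> R) x y : isL2 h ->
  `|L2inner h x - L2inner h y| <= L2norm h * L2dist x y.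
Proof.
move=> h2; rewrite -L2innerBr//; try exact: L2P.
by apply: L2_CauchySchwarz => //; apply: isL2B; exact: L2P.
Qed.

Lemma L2dist_interp m (z : rvec R m) x :
  L2dist x (interp z) = L2norm (fun t => x t - stepfun z t).
Proof.
have E := L2norm_ae0 (L2P (interp z)) (isL2_stepfun z) (L2_ofE _).
apply/eqP; rewrite eq_le; apply/andP; split.
  rewrite (le_trans (ler_L2normB (L2P x) (L2P _) (isL2_stepfun z)))//.
  by rewrite [X in _ + X]L2normBC ?E ?addr0//; [exact: isL2_stepfun|exact: L2P].
rewrite (le_trans (ler_L2normB (L2P x) (isL2_stepfun z) (L2P (interp z))))//.
by rewrite E addr0.
Qed.

Lemma L2inner_interp m (z : rvec R m) (h : R -> R) : isL2 h ->
  L2inner h (interp z : L2 R) = L2inner h (stepfun z).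
Proof.
move=> h2; apply: L2inner_aer => //; [exact: L2P|exact: isL2_stepfun|].
exact: L2_ofE.
Qed.

Lemma L2norm_interp m (z : rvec R m) : L2norm (interp z : L2 R) = L2norm (stepfun z).
Proof.
apply/eqP; rewrite -(@eqrXn2 _ 2)// ?L2norm_ge0//.
rewrite !L2norm_sqr; [|exact: isL2_stepfun|exact: L2P].
rewrite L2inner_interp; last exact: L2P.
by rewrite L2innerC L2inner_interp//; exact: isL2_stepfun.
Qed.

(** Smallness of this quantity together with a bound on the norm plays the part of tightness: up to
    a small distance the point then lies in a bounded set of a finite-dimensional space. *)
Definition ptail m x : R := L2norm (fun t => x t - Pavg m x t).

(** The constant is 1 for the identity plus 1 for the contraction [Pavg m]. *)
Lemma ptail_lipschitz m x y : `|ptail m x - ptail m y| <= 2 * L2dist x y.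
Proof.
have key x' y' : ptail m x' <= ptail m y' + 2 * L2dist x' y'.
  have x2 := L2P x'; have y2 := L2P y'.
  have xy2 := isL2B x2 y2.
  have P2 f := @isL2_Pavg R m f.
  rewrite /ptail -lerBlDl.
  have := L2norm_le_add (isL2B x2 (P2 x')) (isL2B y2 (P2 y')).
  rewrite -lerBlDr => /le_trans; apply.
  rewrite (_ : (fun t => _) = (fun t => ((x' : R -> R) \- y') t + - Pavg m ((x' : R -> R) \- y') t)).
    rewrite (le_trans (ler_L2normB xy2 (P2 _) (@isL2_0 R)))//.
    rewrite mulr_natl mulr2n lerD//.
      by rewrite le_eqVlt; apply/orP; left; apply/eqP; congr L2norm;
        apply/funext => t; rewrite subr0.
    rewrite L2normBC; [|exact: isL2_0|exact: P2].
    rewrite (_ : (fun t => _) = Pavg m ((x' : R -> R) \- y')).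
      exact: L2norm_Pavg.
    by apply/funext => t; rewrite subr0.
  apply/funext => t; rewrite (_ : (x' : R -> R) \- y' = (fun t => -1 * y' t + x' t)).
    by rewrite Pavg_lin//=; ring.
  by apply/funext => s /=; rewrite mulN1r addrC.
rewrite ler_norml; apply/andP; split.
  by rewrite lerBrDl lerBlDr L2dist_sym; exact: key.
by rewrite lerBlDl; exact: key.
Qed.

Lemma measurable_ptail m : measurable_fun [set: L2borel R] (@ptail m).
Proof.
apply: L2_continuous_measurable; apply: L2_lipschitz_continuous.
exact: ptail_lipschitz.
Qed.

Lemma measurable_L2norm : measurable_fun [set: L2borel R] (fun x : L2 R => L2norm x).
Proof.
apply: L2_continuous_measurable; apply: (@L2_lipschitz_continuous _ 1) => x y.
have key x' y' : L2norm x' <= L2norm y' + 1 * L2dist x' y'.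
  by rewrite mul1r addrC; apply: L2norm_le_add; exact: L2P.
rewrite ler_norml; apply/andP; split.
  by rewrite lerBrDl lerBlDr L2dist_sym; exact: key.
by rewrite lerBlDl; exact: key.
Qed.

Lemma measurable_L2inner (h : R -> R) : isL2 h ->
  measurable_fun [set: L2borel R] (fun x : L2 R => L2inner h x).
Proof.
move=> h2; apply: L2_continuous_measurable.
apply: (@L2_lipschitz_continuous _ (L2norm h)) => x y.
exact: L2inner_lipschitz.
Qed.

Variable mu : probability (L2borel R) R.

(** Dominated convergence with dominating function 1. Truncation makes the integrals finite without
    any moment assumption on [mu]; for nonnegative functions their convergence to 0 is convergence
    in probability. *)
Lemma prob_min_cvg0 (f : nat -> L2 R -> R) :
  (forall n, measurable_fun [set: L2borel R] (f n)) ->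
  (forall n x, 0 <= f n x) ->
  (forall x e, 0 < e -> exists n0, forall n, (n0 <= n)%N -> f n x <= e) ->
  forall e, 0 < e -> exists n0, forall n, (n0 <= n)%N ->
    \int[mu]_x Num.min 1 (f n x) <= e.
Proof.
move=> mf f0 fcv e e0.
have mm n : measurable_fun [set: L2borel R] (fun x => Num.min 1 (f n x)).
  by apply: measurable_minr.
have /(_ _)[] // := @dominated_convergence _ (L2borel R) R mu setT measurableT
  (fun n x => (Num.min 1 (f n x))%:E) (fun=> 0%E) (fun=> 1%E).
- by move=> n; exact/measurable_EFinP.
- apply: aeW => x _; apply/fine_cvgP; split; first exact: nearW.
  apply/cvgrPdist_le => /= d d0; have [n0 fn] := fcv x d d0; exists n0 => // n /= ln.
  rewrite sub0r normrN ger0_norm ?le_min ?ler01 ?f0//.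
  by rewrite ge_min fn ?orbT.
- exact: (finite_measure_integrable_cst mu 1).
- apply: aeW => x n _; rewrite gee0_abs lee_fin ?ge_min ?lexx//.
  by rewrite le_min ler01 f0.
move=> _ _ cv.
have {}cv : (fun n => (\int[mu]_x (Num.min 1 (f n x))%:E)%E) @ \oo --> 0%:E.
  by rewrite integral0 in cv.
have /fine_cvgP[_ /cvgrPdist_le/(_ _ e0)[n0 _ H]] := cv.
exists n0 => n ln; have := H n ln.
by rewrite /= sub0r normrN => /(le_trans (ler_norm _)).
Qed.

Lemma prob_ptail_cvg0 e : 0 < e -> exists2 m0, (0 < m0)%N & forall m, (m0 <= m)%N ->
  \int[mu]_x Num.min 1 (ptail m x) <= e.
Proof.
move=> e0.
have [|||m0 H] := @prob_min_cvg0 (fun m x => ptail m x) _ _ _ _ e0.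
- exact: measurable_ptail.
- by move=> n x; exact: L2norm_ge0.
- by move=> x d d0; have [m0 _ H] := Pavg_cvg (L2P x) d0; exists m0.
by exists m0.+1 => // m lm; apply: H; exact: ltnW.
Qed.

Lemma prob_norm_cvg0 e : 0 < e -> exists2 n0, (0 < n0)%N & forall n, (n0 <= n)%N ->
  \int[mu]_x Num.min 1 (L2norm x / n%:R) <= e.
Proof.
move=> e0.
have [|||m0 H] := @prob_min_cvg0 (fun n x => L2norm x / n%:R) _ _ _ _ e0.
- by move=> n; apply: measurable_funM => //; exact: measurable_L2norm.
- by move=> n x; rewrite divr_ge0// L2norm_ge0.
- move=> x d d0.
  have x1 : 0 < L2norm x + 1 by rewrite ltr_wpDl ?L2norm_ge0.
  have [n0 n00 H] := exists_natV_le (divr_gt0 d0 x1).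
  exists n0 => n ln; have n1 : 0 < n%:R :> R by rewrite ltr0n (leq_trans n00).
  apply: (@le_trans _ _ ((L2norm x + 1) / n%:R)).
    by rewrite ler_wpM2r// ?invr_ge0// lerDl.
  by rewrite mulrC -ler_pdivlMr// H.
by exists m0.+1 => // m lm; apply: H; exact: ltnW.
Qed.

End L2_functionals.

(** * Lipschitz minorants of a bounded function *)

Section inf_convolution.
Context {R : realType}.
Implicit Types (x y : L2 R) (F : L2 R -> R) (e B : R) (n : nat).

(** The Pasch-Hausdorff envelope, for bounded [F] the largest [n]-Lipschitz minorant of [F]. *)
Definition infconv F n x : R := inf [set F y + n%:R * L2dist x y | y in [set: L2 R]].

Variables (F : L2 R -> R) (B : R).
Hypothesis FB : forall x, `|F x| <= B.

Let hi n x : has_inf [set F y + n%:R * L2dist x y | y in [set: L2 R]].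
Proof.
split; first by exists (F x + n%:R * L2dist x x), x.
exists (- B) => _ [y _ <-]; rewrite (@le_trans _ _ (F y))//.
  by have := FB y; rewrite ler_norml => /andP[].
by rewrite lerDl mulr_ge0// L2norm_ge0.
Qed.

Lemma infconv_le n x y : infconv F n x <= F y + n%:R * L2dist x y.
Proof. by apply: ge_inf; [case: (hi n x)|exists y]. Qed.

Lemma infconv_ge n x (c : R) :
  (forall y, c <= F y + n%:R * L2dist x y) -> c <= infconv F n x.
Proof. by move=> H; apply: lb_le_inf; [case: (hi n x)|move=> _ [y _ <-]]. Qed.

Lemma infconv_leF n x : infconv F n x <= F x.
Proof. by rewrite (le_trans (infconv_le n x x))// L2distxx mulr0 addr0. Qed.

Lemma infconv_bounded n x : `|infconv F n x| <= B.
Proof.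
rewrite ler_norml (le_trans (infconv_leF n x)) ?andbT; last first.
  by have := FB x; rewrite ler_norml => /andP[].
apply: infconv_ge => y; rewrite (@le_trans _ _ (F y))//.
  by have := FB y; rewrite ler_norml => /andP[].
by rewrite lerDl mulr_ge0// L2norm_ge0.
Qed.

Lemma infconv_lipschitz n x y : `|infconv F n x - infconv F n y| <= n%:R * L2dist x y.
Proof.
have key x' y' : infconv F n x' - n%:R * L2dist x' y' <= infconv F n y'.
  apply: infconv_ge => z; rewrite lerBlDr (le_trans (infconv_le n x' z))//.
  rewrite -addrA lerD2l -mulrDr ler_wpM2l// addrC.
  exact: L2dist_triangle.
rewrite ler_norml; apply/andP; split.
  by have := key y x; rewrite L2dist_sym; lra.
by have := key x y; lra.
Qed.

(** Competitors within distance [d] of [x] lower the value by at most [e], by continuity at [x].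
    Farther ones pay at least $nd\ge 2B+1$, more than the oscillation of [F]. *)
Lemma infconv_cvg x e : continuous F -> 0 < e ->
  exists n0, forall n, (n0 <= n)%N -> F x - infconv F n x <= e.
Proof.
move=> cF e0; have := cF x => /cvgrPdist_le/(_ _ e0)/nbhs_ballP[d /= d0 xd].
have B0 : 0 <= B by exact: le_trans (FB x).
have B1 : 0 < 2 * B + 1 by lra.
have [n0 n00 H] := exists_natV_le (divr_gt0 d0 B1).
exists n0 => n ln; have n1 : 0 < n%:R :> R by rewrite ltr0n (leq_trans n00).
rewrite lerBlDr addrC -lerBlDr; apply: infconv_ge => y.
have [xy|xy] := ltP (L2dist x y) d.
  have := xd y; rewrite ballEmdist/= => /(_ xy); rewrite ler_norml => /andP[_ h].
  rewrite (@le_trans _ _ (F y))//; first by lra.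
  by rewrite lerDl mulr_ge0// L2norm_ge0.
have : 2 * B + 1 <= n%:R * L2dist x y.
  have := H _ ln; rewrite ler_pdivlMr; last by lra.
  rewrite mulrC ler_pdivrMr// => /le_trans; apply.
  by rewrite mulrC ler_wpM2l.
have := FB x; have := FB y; rewrite !ler_norml => /andP[? ?] /andP[? ?]; lra.
Qed.

End inf_convolution.

Section weak_criterion.
Context {R : realType}.
Implicit Types (x y : L2 R) (F : L2 R -> R) (L B e M : R) (m n N : nat).

(** The phase [th] brings in the sines, and makes products of atoms half sums of two atoms. *)
Definition cos_atom m (f : L2 R -> R) : Prop :=
  exists (a : rvec R m) (th : R), f = (fun x => cos (L2inner (stepfun a) x + th)).

Lemma cos_atom_le1 m f : cos_atom m f -> forall x, `|f x| <= 1.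
Proof. by move=> [a [th ->]] x; exact: cos_max. Qed.

Lemma cos_atom_measurable m f : cos_atom m f -> measurable_fun [set: L2borel R] f.
Proof.
move=> [a [th ->]]; apply: L2_continuous_measurable.
apply: (@L2_lipschitz_continuous _ _ (L2norm (stepfun a))) => x y.
apply: (le_trans (ler_dist_cos _ _)); rewrite opprD addrACA subrr addr0.
by apply: L2inner_lipschitz; exact: isL2_stepfun.
Qed.

Lemma cos_atom1 m : cos_atom m (fun=> 1).
Proof.
exists [tuple 0 | _ < m], 0; apply/funext => x.
rewrite L2innerC L2inner_stepfun; last exact: L2P.
by rewrite big1 ?mulr0 ?addr0 ?cos0// => i _; rewrite tnth_mktuple mul0r.
Qed.

Lemma cos_atomM m f g : cos_atom m f -> cos_atom m g ->
  lspan (cos_atom m) (fun x => f x * g x).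
Proof.
move=> [a [th ->]] [b [th' ->]].
have la : lspan (cos_atom m) (fun x => cos (L2inner (stepfun (lin_rvec 1 a b)) x + (th + th'))).
  by apply: lspan_atom; exists (lin_rvec 1 a b), (th + th').
have lb : lspan (cos_atom m) (fun x => cos (L2inner (stepfun (lin_rvec (-1) b a)) x + (th - th'))).
  by apply: lspan_atom; exists (lin_rvec (-1) b a), (th - th').
have := lspan_lin 2^-1 la (lspanZ 2^-1 lb).
congr (lspan _ _); apply/funext => x; rewrite cosM.
have ? := isL2_stepfun a; have ? := isL2_stepfun b; have ? := L2P x.
by rewrite !stepfun_lin !L2inner_linl//; congr (_ * cos _ + _ * cos _); ring.
Qed.

Lemma hcell_stepfun m (j : 'I_m) (c : R) :
  stepfun ([tuple c * (m%:R * (i == j)%:R) | i < m] : rvec R m) =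
  (fun t => c * hcell m j t).
Proof.
apply/funext => t; rewrite /stepfun (bigD1 j)//= big1 ?addr0.
  by rewrite tnth_mktuple eqxx mulr1 mulrA.
by move=> i ij; rewrite tnth_mktuple (negbTE ij) !mulr0 mul0r.
Qed.

Lemma uclos_abs_sin m (j : 'I_m) (l z : R) :
  uclos (cos_atom m) (fun x => `|sin ((tnth (avg m x) j - z) / l)|).
Proof.
have c1 := @cos_atom_le1 m; have c2 := @cos_atom1 m; have c3 := @cos_atomM m.
apply: (uclos_abs c1 c2 c3).
apply: uclos_lspan; apply: lspan_atom.
(* The step function of this vector is [l^-1] times the normalized indicator of cell [j]; the shift
   by [pi / 2] turns the cosine into a sine. *)
exists [tuple l^-1 * (m%:R * (i == j)%:R) | i < m], (- (z / l) - pi / 2).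
apply/funext => x; rewrite hcell_stepfun L2innerZl; [|exact: isL2_hcell|exact: L2P].
by rewrite tnth_mktuple addrA cosBpihalf; congr sin; ring.
Qed.

(* The finite-grid McShane extension of a Lipschitz function, with the distance
   replaced by the comparable periodic expression [2 l |sin (./l)|], is a
   uniform limit of combinations of the [cos (<h, x> + th)]. *)
Lemma lipschitz_uclos F L B m M e : (0 < m)%N -> 0 <= L -> 0 < M -> 0 < e ->
  (forall x, `|F x| <= B) -> (forall x y, `|F x - F y| <= L * L2dist x y) ->
  exists G, [/\ uclos (cos_atom m) G, forall x, `|G x| <= B &
    forall x, L2norm x <= M -> `|F (interp (avg m x)) - G x| <= e].
Proof.
move=> m0 L0 M0 e0 FB FL.
have c1 := @cos_atom_le1 m; have c2 := @cos_atom1 m; have c3 := @cos_atomM m.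
(* By [le_tnth_avg] the averages of a function of norm at most [M] lie in $[-M',M']$, as do the grid
   values. Their differences are at most [l], the range in which [norm_sin_ge_half] makes [phi]
   dominate the absolute value. *)
pose M' := m%:R * M; have M'0 : 0 < M' by rewrite mulr_gt0// ltr0n.
pose l := 2 * M'; have l0 : 0 < l by rewrite mulr_gt0.
(* Moving to a grid vector within [d] in each coordinate changes the value of [F] by at most $Lmd$,
   and its penalty is at most $2Lmd$ because [phi] is at most twice the absolute value. *)
have D0 : 0 < 3 * L * m%:R + 1 by rewrite ltr_wpDl// !mulr_ge0.
have [n n0 nd] := exists_natV_le (divr_gt0 (divr_gt0 e0 D0) l0).
have n1 : 0 < n%:R :> R by rewrite ltr0n.
pose d := l / n%:R; have d0 : 0 < d by rewrite divr_gt0.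
have de : (3 * L * m%:R) * d <= e.
  apply: (@le_trans _ _ ((3 * L * m%:R + 1) * d)).
    by rewrite ler_wpM2r ?(ltW d0)// lerDl.
  have := nd n (leqnn n); rewrite ler_pdivlMr// ler_pdivlMr// => /(le_trans _); apply.
  by rewrite /d le_eqVlt; apply/orP; left; apply/eqP; ring.
pose z (k : {ffun 'I_m -> 'I_n.+1}) : rvec R m := [tuple (k j)%:R * d - M' | j < m].
have zM k j : `|tnth (z k) j| <= M'.
  rewrite tnth_mktuple.
  have k0 : 0 <= (k j)%:R * d by rewrite mulr_ge0// ltW.
  have k1 : (k j)%:R * d <= l.
    apply: (@le_trans _ _ (n%:R * d)).
      by rewrite ler_wpM2r ?(ltW d0)// ler_nat -ltnS.
    by rewrite /d mulrC divfK// gt_eqF.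
  by rewrite ler_norml; apply/andP; split; rewrite /l in k1; lra.
pose f (y : rvec R m) := F (interp y).
have fL (y y' : rvec R m) : `|f y - f y'| <= L * \sum_(j < m) `|tnth y j - tnth y' j|.
  apply: (le_trans (FL _ _)); rewrite ler_wpM2l//; apply: interp_dist.
    exact: sumr_ge0.
  by move=> i; rewrite (bigD1 i)//= lerDl; exact: sumr_ge0.
pose phi (a : R) := 2 * l * `|sin (a / l)|.
have phi_le a : phi a <= 2 * `|a|.
  rewrite /phi -mulrA ler_wpM2l// (@le_trans _ _ (l * `|a / l|))//.
    by rewrite ler_wpM2l ?(ltW l0)// ler_norm_sin.
  by rewrite normrM normfV (gtr0_norm l0) mulrCA divff ?mulr1// gt_eqF.
have phi_ge a : `|a| <= l -> `|a| <= phi a.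
  move=> al; have al1 : `|a / l| <= 1.
    by rewrite normrM normfV (gtr0_norm l0) ler_pdivrMr// mul1r.
  have := norm_sin_ge_half al1.
  rewrite normrM normfV (gtr0_norm l0) ler_pdivrMr// => /le_trans; apply.
  by rewrite /phi le_eqVlt; apply/orP; left; apply/eqP; ring.
pose T k x := f (z k) - L * \sum_(j < m) phi (tnth (avg m x) j - tnth (z k) j).
pose G0 x := \big[Num.max/- B]_(k <- enum {ffun 'I_m -> 'I_n.+1}) T k x.
have uG0 : uclos (cos_atom m) G0.
  apply: (uclos_bigmax c1 c2 c3) => k.
  apply: (uclosB (uclos_cst c2 _)); apply: (uclosZ c2).
  apply: (uclos_sum c2) => j; apply: (uclosZ c2).
  exact: uclos_abs_sin.
have B0 : 0 <= B by exact: le_trans (FB point).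
exists (fun x => clip B (G0 x)); split.
- apply: (uclos_max c1 c2 c3); first exact: uclos_cst.
  by apply: (uclos_min c1 c2 c3) => //; exact: uclos_cst.
- by move=> x; exact: clip_le.
move=> x xM; rewrite -/(f (avg m x)) -(@clip_id _ B (f _)); last exact: FB.
apply: (le_trans (clip_dist _ _ _)).
have yM j : `|tnth (avg m x) j| <= M'.
  by rewrite (le_trans (le_tnth_avg _ (L2P x)))// ler_wpM2l.
rewrite ger0_norm; last first.
  rewrite subr_ge0; apply: bigmax_le.
    by have := FB (interp (avg m x)); rewrite ler_norml => /andP[].
  move=> k _; rewrite lerBlDr -lerBlDl (le_trans (ler_norm _))//.
  rewrite (le_trans (fL _ _))// ler_wpM2l// ler_sum// => j _.
  rewrite distrC; apply: phi_ge; rewrite (le_trans (ler_normB _ _))//.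
  by rewrite /l mulr_natl mulr2n lerD.
have kP (j : 'I_m) : exists k : 'I_n.+1, `|tnth (avg m x) j - (k%:R * d - M')| <= d.
  have := yM j; rewrite ler_norml => /andP[y1 y2].
  set yy := tnth _ _ in y1 y2 *.
  have yd0 : 0 <= (yy + M') / d by rewrite divr_ge0 ?(ltW d0)//; lra.
  have kn : (Num.truncn ((yy + M') / d) < n.+1)%N.
    rewrite ltnS -(ler_nat R) (@le_trans _ _ ((yy + M') / d)) ?truncn_le//.
    rewrite ler_pdivrMr// /d mulrC divfK ?gt_eqF// /l; lra.
  exists (Ordinal kn) => /=.
  have t1 : (Num.truncn ((yy + M') / d))%:R * d <= yy + M'.
    by rewrite -ler_pdivlMr// truncn_le.
  have t2 : yy + M' < (Num.truncn ((yy + M') / d))%:R * d + d.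
    have := truncnS_gt ((yy + M') / d); rewrite ltr_pdivrMr//.
    by rewrite -[X in _ < X * d -> _]natr1 mulrDl mul1r.
  rewrite ger0_norm; lra.
have /choice[k kd] := kP.
(* One grid vector close to the averages suffices for the lower bound; the upper bound has to hold
   for all terms of the maximum and came from [phi_ge]. *)
pose K : {ffun 'I_m -> 'I_n.+1} := [ffun j => k j].
have KT : T K x <= G0 x by apply: (@le_bigmax_seq _ R _ _ (- B) K xpredT) => //; rewrite mem_enum.
rewrite lerBlDr (le_trans _ (lerD (lexx _) KT))// /T addrCA -lerBlDl.
rewrite (le_trans (ler_norm _))// (le_trans (fL _ _))//.
have S1 : \sum_(j < m) `|tnth (avg m x) j - tnth (z K) j| <= m%:R * d.
  apply: (@le_trans _ _ (\sum_(j < m) d)).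
    apply: ler_sum => j _.
    by rewrite (_ : tnth (z K) j = (k j)%:R * d - M')// tnth_mktuple ffunE.
  by rewrite sumr_const card_ord mulr_natl.
have S2 : \sum_(j < m) phi (tnth (avg m x) j - tnth (z K) j) <= 2 * (m%:R * d).
  apply: (@le_trans _ _ (\sum_(j < m) 2 * `|tnth (avg m x) j - tnth (z K) j|)).
    by apply: ler_sum => j _; exact: phi_le.
  by rewrite -mulr_sumr ler_wpM2l.
rewrite lerBrDr (le_trans _ de)//.
apply: (@le_trans _ _ (L * (m%:R * d) + L * (2 * (m%:R * d)))).
  by rewrite lerD// ler_wpM2l.
by rewrite le_eqVlt; apply/orP; left; apply/eqP; ring.
Qed.

Variables (P : nat -> probability (L2borel R) R) (mu : probability (L2borel R) R).
Hypothesis tail_P : forall e, 0 < e -> exists m0, forall m, (m0 <= m)%N ->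
  exists N0, forall N, (N0 <= N)%N -> \int[P N]_x Num.min 1 (ptail m x) <= e.
Hypothesis norm_P : forall e, 0 < e -> exists n0, forall n, (n0 <= n)%N ->
  exists N0, forall N, (N0 <= N)%N -> \int[P N]_x Num.min 1 (L2norm x / n%:R) <= e.
Hypothesis cos_P : forall m (a : rvec R m) (th : R),
  (fun N => \int[P N]_x cos (L2inner (stepfun a) (x : L2 R) + th)) @ \oo -->
  \int[mu]_x cos (L2inner (stepfun a) (x : L2 R) + th).

Lemma lipschitz_cvg F L B : 0 <= L ->
  (forall x, `|F x| <= B) -> (forall x y, `|F x - F y| <= L * L2dist x y) ->
  (fun N => \int[P N]_x F x) @ \oo --> \int[mu]_x F x.
Proof.
move=> L0 FB FL; have B0 : 0 <= B by exact: le_trans (FB point).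
have mF : measurable_fun [set: L2borel R] F.
  by apply: L2_continuous_measurable; exact: L2_lipschitz_continuous FL.
apply/cvgrPdist_le => /= e e0.
(* Three errors of [e / 9] make up each comparison of [F] with [G]; there are two such comparisons,
   under [mu] and under [P N], besides the convergence for [G]. *)
have e9 : 0 < e / 9 by exact: divr_gt0.
have D1 : 0 < 2 * B + L + 1 by rewrite ltr_wpDl// addr_ge0// mulr_ge0.
have e1 : 0 < e / 9 / (2 * B + L + 1) by exact: divr_gt0.
have [m1 Hm1] := tail_P e1; have [m2 m20 Hm2] := prob_ptail_cvg0 mu e1.
pose m := maxn m1 m2.
have m0 : (0 < m)%N by rewrite (leq_trans m20)// leq_maxr.
have [N1 HN1] := Hm1 m (leq_maxl _ _).
have [n1 Hn1] := norm_P e1; have [n2 n20 Hn2] := prob_norm_cvg0 mu e1.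
pose n := maxn n1 n2.
have n0 : (0 < n)%N by rewrite (leq_trans n20)// leq_maxr.
have n0R : 0 < n%:R :> R by rewrite ltr0n.
have [N2 HN2] := Hn1 n (leq_maxl _ _).
have [G [uG GB FG]] := lipschitz_uclos m0 L0 n0R e9 FB FL.
have c1 := @cos_atom_le1 m.
have mG := @uclos_measurable _ (L2borel R) R _ (@cos_atom_measurable m) G uG.
have cG := @uclos_cvg _ (L2borel R) R _ c1 (@cos_atom_measurable m) P mu _ G uG.
(* [C] covers both costs: [2 * B] where a truncated quantity has reached 1, and the Lipschitz
   constant [L] where [ptail] is still below 1. *)
pose C := 2 * B + L + 1.
pose h x := C * Num.min 1 (ptail m x) + (C * Num.min 1 (L2norm x / n%:R) + e / 9).
have m1' : measurable_fun [set: L2borel R] (fun x => Num.min 1 (ptail m x)).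
  by apply: measurable_minr => //; exact: measurable_ptail.
have m2' : measurable_fun [set: L2borel R] (fun x : L2 R => Num.min 1 (L2norm x / n%:R)).
  apply: measurable_minr => //; apply: measurable_funM => //.
  exact: measurable_L2norm.
have b1 x : 0 <= Num.min 1 (ptail m x) <= 1.
  by rewrite le_min ler01 L2norm_ge0 ge_min lexx.
have b2 x : 0 <= Num.min 1 (L2norm x / n%:R) <= 1.
  by rewrite le_min ler01 divr_ge0 ?L2norm_ge0//= ge_min lexx.
have mh : measurable_fun [set: L2borel R] h.
  by apply: measurable_funD; [|apply: measurable_funD => //]; exact: measurable_funM.
have hM x : `|h x| <= 2 * C + e / 9.
  have /andP[p1 p2] := b1 x; have /andP[q1 q2] := b2 x.
  have p3 : 0 <= C * Num.min 1 (ptail m x) <= C.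
    by rewrite mulr_ge0 ?(ltW D1)//= ler_piMr ?(ltW D1).
  have q3 : 0 <= C * Num.min 1 (L2norm x / n%:R) <= C.
    by rewrite mulr_ge0 ?(ltW D1)//= ler_piMr ?(ltW D1).
  by rewrite ger0_norm /h; move/andP: p3 => [? ?]; move/andP: q3 => [? ?]; lra.
have FGh x : `|F x - G x| <= h x.
  rewrite (le_trans (ler_distD (F (interp (avg m x))) _ _))// lerD//.
    have [pt|pt] := leP 1 (ptail m x).
      rewrite mulr1 (le_trans (ler_normB _ _))// /C.
      by have := FB x; have := FB (interp (avg m x)); lra.
    rewrite (le_trans (FL _ _))// L2dist_interp -/(Pavg m x) -/(ptail m x).
    by rewrite ler_wpM2r ?L2norm_ge0// /C; lra.
  have [xn|xn] := leP (L2norm x) n%:R.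
    rewrite (le_trans (FG x xn))// lerDr mulr_ge0 ?(ltW D1)//.
    by case/andP: (b2 x).
  rewrite min_l; last by rewrite ler_pdivlMr// mul1r ltW.
  rewrite mulr1 (le_trans (ler_normB _ _))// /C.
  by have := FB (interp (avg m x)); have := GB x; lra.
have close (Q : probability (L2borel R) R) :
    \int[Q]_x Num.min 1 (ptail m x) <= e / 9 / (2 * B + L + 1) ->
    \int[Q]_x Num.min 1 (L2norm x / n%:R) <= e / 9 / (2 * B + L + 1) ->
    `|\int[Q]_x F x - \int[Q]_x G x| <= e / 3.
  move=> Q1 Q2; apply: (@le_trans _ _ (\int[Q]_x h x)).
    apply: (@prob_Rintegral_dist _ _ _ _ _ _ _ (2 * C + e / 9)) => // x.
    - by have := FB x; rewrite /C; lra.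
    - by have := GB x; rewrite /C; lra.
  have i1 : Q.-integrable setT (EFin \o (fun x => Num.min 1 (ptail m x))).
    apply: (@prob_integrable _ _ _ _ _ 1) => // x.
    by have /andP[? ?] := b1 x; rewrite ger0_norm.
  have i2 : Q.-integrable setT (EFin \o (fun x : L2 R => Num.min 1 (L2norm x / n%:R))).
    apply: (@prob_integrable _ _ _ _ _ 1) => // x.
    by have /andP[? ?] := b2 x; rewrite ger0_norm.
  have i3 : Q.-integrable setT (EFin \o (fun _ : L2 R => e / 9)).
    exact: finite_measure_integrable_cst.
  rewrite RintegralD//; [|exact: integrable_realZ|]; last first.
    by apply: integrable_realD => //; exact: integrable_realZ.
  rewrite RintegralZl// RintegralD//; last exact: integrable_realZ.
  rewrite RintegralZl// prob_Rintegral_cst.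
  rewrite ler_pdivlMr// mulrC in Q1; rewrite ler_pdivlMr// mulrC in Q2.
  by rewrite /C; lra.
have e3 : 0 < e / 3 by exact: divr_gt0.
have {}cG : (fun N => \int[P N]_x G x) @ \oo --> \int[mu]_x G x.
  by apply: cG => _ [a [th ->]]; exact: cos_P.
move: cG => /cvgrPdist_le/(_ _ e3)[N3 _ HN3].
exists (maxn N1 (maxn N2 N3)) => // N /=; rewrite !geq_max => /and3P[l1 l2 l3].
rewrite (_ : e = e / 3 + (e / 3 + e / 3)); last by field.
rewrite (le_trans (ler_distD (\int[mu]_x G x) _ _))// lerD//.
  by apply: close; [apply: Hm2; exact: leq_maxr|apply: Hn2; exact: leq_maxr].
rewrite (le_trans (ler_distD (\int[P N]_x G x) _ _))// lerD//.
  exact: HN3.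
by rewrite distrC; apply: close; [exact: HN1|exact: HN2].
Qed.

(** A bound from below on the integrals under [P N] suffices, being applied to [F] and to its
    opposite. For such a bound [F] may be replaced by a Lipschitz minorant whose integral under [mu]
    is close to that of [F]. *)
Theorem weak_cvg_of_cos : weak_cvg P mu.
Proof.
suff key F B e : continuous F -> (forall x, `|F x| <= B) -> 0 < e ->
    \forall N \near \oo, \int[mu]_x F x - e <= \int[P N]_x F x.
  move=> F cF [B FB]; apply/cvgrPdist_le => /= e e0.
  have cN : continuous (fun x => - F x) by move=> x; apply: continuous_comp; [exact: cF|exact: opp_continuous].
  have NB x : `|- F x| <= B by rewrite normrN.
  have H1 := key F B e cF FB e0; have H2 := key _ B e cN NB e0.
  have mF := L2_continuous_measurable cF.
  have E (Q : probability (L2borel R) R) : \int[Q]_x (- F x) = - \int[Q]_x F x.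
    rewrite -mulN1r -RintegralZl//; last exact: (prob_integrable Q mF FB).
    by apply: eq_Rintegral => x _; rewrite mulN1r.
  near=> N; rewrite ler_norml; apply/andP; split.
    have : \int[mu]_x (- F x) - e <= \int[P N]_x (- F x) by near: N.
    by rewrite !E; lra.
  have : \int[mu]_x F x - e <= \int[P N]_x F x by near: N.
  by lra.
move=> cF FB e0; have B0 : 0 <= B by exact: le_trans (FB point).
have mF := L2_continuous_measurable cF.
have iB n := @infconv_bounded _ _ _ FB n.
have iL n := @infconv_lipschitz _ _ _ FB n.
have mI n : measurable_fun [set: L2borel R] (infconv F n).
  apply: L2_continuous_measurable.
  exact: L2_lipschitz_continuous (iL n).
have e2 : 0 < e / 2 by exact: divr_gt0.
have [n Hn] : exists n, \int[mu]_x F x - e / 2 <= \int[mu]_x infconv F n x.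
  (* Dividing by [D] keeps the difference between [F] and its minorant below 1, so that the
     truncation in [prob_min_cvg0] has no effect. *)
  pose D := 2 * B + 1; have D0 : 0 < D by rewrite /D; lra.
  have [|||n0 Hn] := @prob_min_cvg0 _ mu (fun n x => (F x - infconv F n x) / D) _ _ _
     _ (divr_gt0 e2 D0).
  - by move=> n; apply: measurable_funM => //; exact: measurable_funB.
  - by move=> n x; rewrite divr_ge0 ?(ltW D0)// subr_ge0 (infconv_leF FB).
  - move=> x d d0; have [n0 H] := infconv_cvg FB x cF (mulr_gt0 d0 D0).
    by exists n0 => n /H; rewrite ler_pdivrMr.
  exists n0; rewrite lerBlDr -lerBlDl.
  have iF := prob_integrable mu mF FB.
  have iI := prob_integrable mu (mI n0) (iB n0).
  rewrite -RintegralB//.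
  have := Hn n0 (leqnn _); rewrite ler_pdivlMr// mulrC -RintegralZl//; last first.
    apply: (@prob_integrable _ _ _ _ _ 1).
      apply: measurable_minr => //; apply: measurable_funM => //.
      exact: measurable_funB.
    move=> x; rewrite ger0_norm ?ge_min ?lexx// le_min ler01 divr_ge0 ?(ltW D0)//.
    by rewrite subr_ge0 (infconv_leF FB).
  move=> /(le_trans _); apply; rewrite le_eqVlt; apply/orP; left; apply/eqP.
  apply: eq_Rintegral => x _.
  rewrite min_r; first by rewrite mulrC divfK// gt_eqF.
  rewrite ler_pdivrMr// mul1r /D; have := FB x; have := iB n0 x.
  by rewrite !ler_norml => /andP[? ?] /andP[? ?]; lra.
have /cvgrPdist_le/(_ _ e2) := lipschitz_cvg (ler0n R n) (iB n) (iL n).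
apply: filterS => N /=; rewrite ler_norml => /andP[_ h].
have : \int[P N]_x infconv F n x <= \int[P N]_x F x.
  by apply: (@prob_Rintegral_le _ _ _ _ _ _ B) => // x; exact: infconv_leF FB n x.
by lra.
Unshelve. all: by end_near. Qed.

End weak_criterion.

(** * Gaussian integrals over vectors *)

Section lebesgue_affine.
Context {R : realType}.
Local Notation leb := (@lebesgue_measure R).
Local Notation T := (measurableTypeR R).
Local Open Scope ereal_scope.

Lemma lebesgue_measure_shift (a : R) (A : set T) : measurable A ->
  leb ((fun x => x + a)%R @^-1` A) = leb A.
Proof.
have ms : measurable_fun [set: T] (fun x : T => x + a : T)%R.
  exact: measurable_funD.
move=> mA; apply/esym.
apply: (@lebesgue_measure_unique _ (pushforward leb (fun x : T => x + a : T)%R)) => //.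
move=> _ [[b c] _ <-] /=; rewrite /pushforward/=.
rewrite [X in _ = leb X](_ : _ = `]b - a, c - a]%classic)%R; last first.
  by apply/seteqP; split=> x /=; rewrite !in_itv/= ltrBlDr lerBrDr.
rewrite !lebesgue_measure_itv/= !lte_fin ltrD2r; case: ifPn => // _.
by rewrite -!EFinB; congr EFin; ring.
Qed.

Lemma ge0_integral_shift (a : R) (f : R -> \bar R) :
  measurable_fun [set: T] f -> (forall x, 0 <= f x) ->
  \int[leb]_x f (x + a)%R = \int[leb]_x f x.
Proof.
move=> mf f0.
have ms : measurable_fun [set: T] (fun x : T => x + a : T)%R.
  exact: measurable_funD.
have := @ge0_integral_pushforward _ _ T T R _ ms leb setT f measurableT mf.
rewrite preimage_setT => /(_ _)/esym; rewrite /comp/= => ->//.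
by apply: eq_measure_integral => // A mA _; exact: lebesgue_measure_shift.
Qed.

Lemma lebesgue_measure_scale (s : R) (A : set T) : (0 < s)%R -> measurable A ->
  s%:E * leb ((fun x => s * x)%R @^-1` A) = leb A.
Proof.
move=> s0.
have ms : measurable_fun [set: T] (fun x : T => s * x : T)%R.
  exact: measurable_funM.
move=> mA; apply/esym.
pose s' := NngNum (ltW s0).
apply: (@lebesgue_measure_unique _ (mscale s' (pushforward leb (fun x : T => s * x : T)%R))) => //.
move=> _ [[b c] _ <-] /=; rewrite /mscale/= /pushforward/=.
rewrite [X in _ = _ * leb X](_ : _ = `]b / s, c / s]%classic)%R; last first.
  by apply/seteqP; split=> x /=; rewrite !in_itv/= ltr_pdivrMr// ler_pdivlMr// ![(_ * s)%R]mulrC.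
rewrite !lebesgue_measure_itv/= !lte_fin ltr_pM2r ?invr_gt0//; case: ifPn => // _.
  by rewrite -!EFinB -EFinM; congr EFin; field; rewrite gt_eqF.
by rewrite mule0.
Qed.

Lemma ge0_integral_scale (s : R) (f : R -> \bar R) : (0 < s)%R ->
  measurable_fun [set: T] f -> (forall x, 0 <= f x) ->
  s%:E * \int[leb]_x f (s * x)%R = \int[leb]_x f x.
Proof.
move=> s0 mf f0.
have ms : measurable_fun [set: T] (fun x : T => s * x : T)%R.
  exact: measurable_funM.
have := @ge0_integral_pushforward _ _ T T R _ ms leb setT f measurableT mf.
rewrite preimage_setT => /(_ _)/esym; rewrite /comp/= => ->//.
pose s' := NngNum (ltW s0).
rewrite -(@ge0_integral_mscale _ T R _ setT measurableT s')//.
by apply: eq_measure_integral => // A mA _; exact: lebesgue_measure_scale.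
Qed.

End lebesgue_affine.

(** * The standard normal density and its second moment *)

Section standard_normal.
Context {R : realType}.
Local Notation leb := (@lebesgue_measure R).
Local Notation T := (measurableTypeR R).

Definition gauss1 (z : R) : R := normal_pdf 0 1 z.

Lemma gauss1E z : gauss1 z = normal_peak 1 * expR (- z ^+ 2 / 2).
Proof. by rewrite /gauss1 normal_pdfE ?oner_neq0// /normal_fun subr0 expr1n. Qed.

Lemma gauss1_ge0 z : 0 <= gauss1 z.
Proof. exact: normal_pdf_ge0. Qed.

Lemma measurable_gauss1 : measurable_fun [set: T] gauss1.
Proof. exact: measurable_normal_pdf. Qed.

Lemma integral_gauss1 : (\int[leb]_z (gauss1 z)%:E = 1)%E.
Proof. exact: integral_normal_pdf. Qed.

Lemma normal_pdf_scale (s z : R) : 0 < s -> s * normal_pdf 0 s (s * z) = gauss1 z.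
Proof.
move=> s0; have s1 : s != 0 by rewrite gt_eqF.
rewrite gauss1E normal_pdfE// /normal_fun subr0 mulrA; congr (_ * expR _); last first.
  by rewrite exprMn -mulr_natr; field.
rewrite /normal_peak expr1n mul1r -mulrnAr sqrtrM ?sqr_ge0// sqrtr_sqr gtr0_norm//.
by rewrite invfM mulrA divff// mul1r.
Qed.

Lemma integral_normal_scale (s : R) (H : R -> \bar R) : 0 < s ->
  measurable_fun [set: T] H -> (forall y, 0 <= H y)%E ->
  (\int[leb]_y (H y * (normal_pdf 0 s y)%:E) =
   \int[leb]_z (H (s * z)%R * (gauss1 z)%:E))%E.
Proof.
move=> s0 mH H0.
have mp : measurable_fun [set: T] (fun y => (normal_pdf 0 s y)%:E).
  by apply/measurable_EFinP; exact: measurable_normal_pdf.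
rewrite -(@ge0_integral_scale _ s)//; last 2 first.
- exact: emeasurable_funM.
- by move=> y; rewrite mule_ge0// lee_fin normal_pdf_ge0.
have ms : measurable_fun [set: T] (fun x : T => s * x : T) by exact: measurable_funM.
rewrite -ge0_integralZl//.
- apply: eq_integral => z _; rewrite -(normal_pdf_scale z s0) EFinM.
  by rewrite muleCA.
- apply: emeasurable_funM; first exact: (measurableT_comp mH).
  exact: (measurableT_comp mp).
- by move=> z _; rewrite mule_ge0// lee_fin normal_pdf_ge0.
- by rewrite lee_fin ltW.
Qed.

Lemma integral_gauss1_scale (r : R) : 0 < r ->
  (\int[leb]_z (normal_peak 1 * expR (- (r * z) ^+ 2 / 2))%:E = (r^-1)%:E)%E.
Proof.
move=> r0; have r1 : r != 0 by rewrite gt_eqF.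
have := @ge0_integral_scale R r (fun z => (gauss1 z)%:E) r0.
rewrite integral_gauss1 => E.
under eq_integral do rewrite -gauss1E.
rewrite -[LHS]mul1e -[1%E](_ : (r^-1 * r)%:E = _)%E; last by rewrite mulVf.
rewrite EFinM -muleA E ?mule1//.
- by apply/measurable_EFinP; exact: measurable_gauss1.
- by move=> z; rewrite lee_fin gauss1_ge0.
Qed.

(* The second moment is squeezed between difference quotients, at [c = 1], of
   the scaling law [int exp (- c z^2 / 2) = c^(-1/2) int exp (- z^2 / 2)],
   because [c |-> exp (- c z^2 / 2)] is convex. *)
Lemma integral_gauss1_sqr : (\int[leb]_z ((z ^+ 2)%:E * (gauss1 z)%:E) = 1)%E.
Proof.
set M := LHS.
have mg : measurable_fun [set: T] (fun z => (gauss1 z)%:E).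
  by apply/measurable_EFinP; exact: measurable_gauss1.
have mz : measurable_fun [set: T] (fun z : T => ((z ^+ 2)%:E * (gauss1 z)%:E)%E).
  by apply: emeasurable_funM => //; apply/measurable_EFinP; exact: measurable_funX.
have z0 (z : R) : (0 <= (z ^+ 2)%:E * (gauss1 z)%:E)%E.
  by rewrite mule_ge0// lee_fin ?sqr_ge0 ?gauss1_ge0.
have me (r : R) : measurable_fun [set: T] (fun z => (normal_peak 1 * expR (- (r * z) ^+ 2 / 2))%:E).
  apply/measurable_EFinP; apply: measurable_funM => //; apply: measurableT_comp => //.
  apply: measurable_funM => //; apply: measurableT_comp => //.
  by apply: measurable_funX; exact: measurable_funM.
have e0 (r z : R) : (0 <= (normal_peak 1 * expR (- (r * z) ^+ 2 / 2))%:E)%E.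
  by rewrite lee_fin mulr_ge0 ?expR_ge0 ?normal_peak_ge0.
have M0 : (0 <= M)%E by exact: integral_ge0.
(* The tangent inequality $1+x\le e^x$ at $x=(1-r^2)z^2/2$. It bounds the second moment from above
   when $r<1$ and from below when $r>1$. *)
have conv (r z : R) : gauss1 z + (1 - r ^+ 2) / 2 * (z ^+ 2 * gauss1 z) <=
    normal_peak 1 * expR (- (r * z) ^+ 2 / 2).
  rewrite gauss1E (_ : - (r * z) ^+ 2 / 2 = - z ^+ 2 / 2 + (1 - r ^+ 2) / 2 * z ^+ 2); last by field.
  rewrite expRD; have := expR_ge1Dx ((1 - r ^+ 2) / 2 * z ^+ 2).
  set E := expR (- _ / 2); set F := expR (_ * _); set p := normal_peak 1 => h.
  have pE : 0 <= p * E by rewrite mulr_ge0 ?normal_peak_ge0 ?expR_ge0.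
  rewrite [leRHS]mulrA (le_trans _ (ler_wpM2l pE h))//.
  by rewrite le_eqVlt; apply/orP; left; apply/eqP; ring.
(* The bound solves $1+\frac{1-r^2}{2}M\le 1/r$ for $M$, after cancelling $1-r$. *)
have up (r : R) : 0 < r < 1 -> (M <= (2 / (r * (r + 1)))%:E)%E.
  move=> /andP[r0 r1]; pose k := (1 - r ^+ 2) / 2.
  have k0 : 0 < k by rewrite /k; nra.
  have : (1 + k%:E * M <= (r^-1)%:E)%E.
    rewrite -(integral_gauss1_scale r0) -integral_gauss1 -ge0_integralZl//; last first.
      by rewrite lee_fin ltW.
    rewrite -ge0_integralD//; last 3 first.
    - by move=> z _; rewrite lee_fin gauss1_ge0.
    - by move=> z _; rewrite mule_ge0// lee_fin ltW.
    - exact: emeasurable_funM.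
    apply: ge0_le_integral => //.
    - move=> z _; apply: adde_ge0; first by rewrite lee_fin gauss1_ge0.
      by apply: mule_ge0 => //; rewrite lee_fin ltW.
    - by apply: emeasurable_funD => //; exact: emeasurable_funM.
    - by move=> z _; rewrite -!EFinM -EFinD lee_fin conv.
  case: M M0 => [M' M'0| |]//.
    rewrite -EFinM -EFinD !lee_fin => h.
    have rr : r * r^-1 = 1 by rewrite divff// gt_eqF.
    rewrite ler_pdivlMr; last by rewrite mulr_gt0// addr_gt0.
    have h2 : r * (1 + k * M') <= 1 by rewrite -[leRHS]rr ler_wpM2l ?(ltW r0).
    have r1' : 0 < 1 - r by lra.
    by rewrite -(ler_pM2r r1'); rewrite /k in h2; nra.
  by move=> _; rewrite muleC gt0_mulye// addey.
have low (r : R) : 1 < r -> ((2 / (r * (r + 1)))%:E <= M)%E.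
  move=> r1; have r0 : 0 < r by lra.
  pose k := (r ^+ 2 - 1) / 2.
  have k0 : 0 < k by rewrite /k; nra.
  have : (1 <= (r^-1)%:E + k%:E * M)%E.
    rewrite -(integral_gauss1_scale r0) -[leLHS]integral_gauss1 -ge0_integralZl//; last first.
      by rewrite lee_fin ltW.
    rewrite -ge0_integralD//; last 2 first.
    - by move=> z _; rewrite mule_ge0// lee_fin ltW.
    - exact: emeasurable_funM.
    apply: ge0_le_integral => //.
    - by move=> z _; rewrite lee_fin gauss1_ge0.
    - by apply: emeasurable_funD => //; exact: emeasurable_funM.
    - move=> z _; rewrite -!EFinM -EFinD lee_fin.
      by have := conv r z; rewrite /k; lra.
  case: M M0 {up} => [M' M'0| |]//; last by move=> *; rewrite leey.
  rewrite -EFinM -EFinD !lee_fin => h.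
  have rr : r * r^-1 = 1 by rewrite divff// gt_eqF.
  rewrite ler_pdivrMr; last by rewrite mulr_gt0// addr_gt0.
  have h2 : r <= 1 + r * (k * M').
    by have := ler_wpM2l (ltW r0) h; rewrite mulr1 mulrDr rr.
  have r1' : 0 < r - 1 by lra.
  by rewrite -(ler_pM2r r1'); rewrite /k in h2; nra.
(* Any [r] below 1 shows that the second moment is finite. *)
have hf : 0 < (2^-1 : R) < 1 by rewrite invr_gt0 ltr0n invf_lt1// ltr1n.
have := up _ hf; case: M M0 up low => [M' M'0 up low _| |]//.
congr EFin; apply/eqP; rewrite eq_le; apply/andP; split; apply/ler_addgt0Pr => e {}e0.
(* As $r$ tends to 1 the bound $2/(r(r+1))$ tends to 1; this [r], and [1 + e / 2] on the other side,
   bring it within [e]. *)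
- pose r := (1 + e / 2)^-1.
  have d0 : 0 < 1 + e / 2 by lra.
  have r01 : 0 < r < 1 by rewrite invr_gt0 d0 invf_lt1//; lra.
  have := up r r01; rewrite lee_fin => /le_trans; apply.
  case/andP: r01 => r0 r1.
  have rd : r * (1 + e / 2) = 1 by rewrite mulVf// gt_eqF.
  rewrite ler_pdivrMr ?mulr_gt0 ?addr_gt0//; nra.
- pose r := 1 + e / 2.
  have r1 : 1 < r by rewrite /r; lra.
  have := low r r1; rewrite lee_fin -lerBlDr => /(le_trans _); apply.
  rewrite ler_pdivlMr ?mulr_gt0 ?addr_gt0//; try lra.
  by rewrite /r; nra.
Qed.

End standard_normal.

Section rvec_lebesgue.
Context {R : realType}.
Local Notation leb := (@lebesgue_measure R).
Local Notation T := (measurableTypeR R).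
Local Open Scope ereal_scope.

Lemma ge0_integral_lebesgue_rvecS n (f : rvec R n.+1 -> \bar R) :
  measurable_fun setT f -> (forall x, 0 <= f x) ->
  \int[lebesgue_rvec n.+1]_x f x =
  \int[leb]_a \int[lebesgue_rvec n]_x f (consv (a, x)).
Proof.
move=> mf f0.
have mc := @measurable_consv R n.
have mfc : measurable_fun setT (f \o @consv R n).
  exact: (measurableT_comp mf mc).
rewrite /= -(fubini_tonelli1 (f \o @consv R n))//; last by move=> z; exact: f0.
have := @ge0_integral_pushforward _ _ _ _ R _ mc
  (leb \x lebesgue_rvec n) setT f measurableT mf.
by rewrite preimage_setT => ->.
Qed.

Lemma measurable_add_rvec n (a : rvec R n) : measurable_fun setT (fun x => add_rvec x a).
Proof.
apply/measurable_fun_tnthP => i.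
rewrite (_ : _ \o _ = (fun x : rvec R n => tnth x i + tnth a i : T)%R); last first.
  by apply/funext => x /=; rewrite tnth_mktuple.
by apply: measurable_funD => //; exact: measurable_tnth.
Qed.

Lemma add_rvec_consv n (a : rvec R n.+1) (r : R) (x : rvec R n) :
  add_rvec (consv (r, x)) a = consv ((r + thead a)%R, add_rvec x [tuple of behead a]).
Proof.
case/tupleP: a => a0 a; apply: eq_from_tnth => i; rewrite tnth_mktuple.
case: (unliftP ord0 i) => [j ->|->].
  rewrite /consv /= !tnthS tnth_mktuple /=; congr (_ + _)%R.
  by congr tnth; apply: val_inj.
by rewrite /consv/= !tnth0 theadE.
Qed.

Lemma ge0_integral_rvec_shift n (a : rvec R n) (f : rvec R n -> \bar R) :
  measurable_fun setT f -> (forall x, 0 <= f x) ->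
  \int[lebesgue_rvec n]_x f (add_rvec x a) = \int[lebesgue_rvec n]_x f x.
Proof.
elim: n a f => [|n IH] a f mf f0.
  by apply: eq_integral => x _; rewrite (tuple0 x) (tuple0 (add_rvec _ _)).
have mfa : measurable_fun setT (fun x => f (add_rvec x a)).
  exact: (measurableT_comp mf (measurable_add_rvec a)).
rewrite (ge0_integral_lebesgue_rvecS mf f0).
rewrite (ge0_integral_lebesgue_rvecS mfa (fun x => f0 _)).
have mfc : measurable_fun setT (f \o @consv R n).
  exact: (measurableT_comp mf (@measurable_consv R n)).
have mr (r : R) : measurable_fun setT (fun x => f (consv (r, x))).
  apply: (measurableT_comp mfc); exact: pair1_measurable.
under eq_integral => r _.
  under eq_integral do rewrite add_rvec_consv.
  rewrite (IH _ (fun x => f (consv ((r + thead a)%R, x))))//.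
  over.
rewrite (@ge0_integral_shift R (thead a) (fun r => \int[lebesgue_rvec n]_x f (consv (r, x))))//.
- apply: (measurable_fun_fubini_tonelli_F (f \o @consv R n)) => //.
  by move=> z; exact: f0.
- by move=> r; exact: integral_ge0.
Qed.

Lemma measurable_rvec_sum n (c : 'I_n -> R) :
  measurable_fun setT (fun x : rvec R n => (\sum_(i < n) tnth x i * c i)%R).
Proof.
apply: measurable_sum => i; apply: measurable_funM => //.
exact: measurable_tnth.
Qed.

Lemma measurable_rvec_sqr n :
  measurable_fun setT (fun x : rvec R n => (\sum_(i < n) tnth x i ^+ 2)%R).
Proof.
apply: measurable_sum => i; apply: measurable_funX; exact: measurable_tnth.
Qed.

Lemma integral_exp_sqr (c : R) : (0 < c)%R ->
  \int[leb]_r (expR (- (c * r ^+ 2)))%:E < +oo.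
Proof.
move=> c0; pose r := Num.sqrt (2 * c).
have r0 : (0 < r)%R by rewrite sqrtr_gt0 mulr_gt0.
have p0 : (0 < normal_peak 1 :> R)%R by rewrite normal_peak_gt0 ?oner_neq0.
have := integral_gauss1_scale r0.
have E z : (- (r * z) ^+ 2 / 2 = - (c * z ^+ 2))%R.
  by rewrite exprMn sqr_sqrtr ?mulr_ge0 ?(ltW c0)//; field.
under eq_integral do rewrite E EFinM.
rewrite ge0_integralZl//; last 2 first.
- apply/measurable_EFinP; apply: measurableT_comp => //; apply: measurableT_comp => //.
  by apply: measurable_funM => //; exact: measurable_funX.
- by rewrite lee_fin ltW.
rewrite -[X in X < _]mul1e -[1](_ : ((normal_peak 1)^-1 * normal_peak 1)%:E = _); last first.
  by rewrite mulVf// gt_eqF.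
by rewrite EFinM -muleA => ->; rewrite -EFinM ltry.
Qed.

Lemma integral_rvec_exp_sqr n (c : R) : (0 < c)%R ->
  \int[lebesgue_rvec n]_x (expR (- (c * \sum_(i < n) tnth x i ^+ 2)))%:E < +oo.
Proof.
move=> c0; elim: n => [|n IH].
  rewrite /= integral_dirac//.
    by rewrite diracT mul1e ltry.
  apply/measurable_EFinP; apply: measurableT_comp => //; apply: measurableT_comp => //.
  by apply: measurable_funM => //; exact: measurable_rvec_sqr.
rewrite ge0_integral_lebesgue_rvecS//; last first.
  apply/measurable_EFinP; apply: measurableT_comp => //; apply: measurableT_comp => //.
  by apply: measurable_funM => //; exact: measurable_rvec_sqr.
under eq_integral => r _.
  under eq_integral => x _.
    rewrite big_ord_recl mulrDr opprD expRD EFinM.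
    under eq_bigr do rewrite /consv tnthS.
    rewrite /consv tnth0 /=.
    over.
  rewrite ge0_integralZl//; last first.
    apply/measurable_EFinP; apply: measurableT_comp => //; apply: measurableT_comp => //.
    by apply: measurable_funM => //; exact: measurable_rvec_sqr.
  over.
rewrite ge0_integralZr//; last 2 first.
- apply/measurable_EFinP; apply: measurableT_comp => //; apply: measurableT_comp => //.
  by apply: measurable_funM => //; exact: measurable_funX.
- by apply: integral_ge0 => x _; rewrite lee_fin expR_ge0.
rewrite lte_mul_pinfty ?integral_exp_sqr//.
- by apply: integral_ge0 => x _; rewrite lee_fin expR_ge0.
- rewrite ge0_fin_numE ?integral_exp_sqr//.
  by apply: integral_ge0 => x _; rewrite lee_fin expR_ge0.
Qed.

End rvec_lebesgue.

(** * Linear functionals and bilinear forms on vectors *)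

Section riesz.
Context {R : realType} (N : nat).
Implicit Types (x y : rvec R N) (l : rvec R N -> R) (B : rvec R N -> rvec R N -> R).

Definition linear_rvec l : Prop :=
  forall (a : R) x y, l (lin_rvec a x y) = a * l x + l y.

Definition unit_rvec (i : 'I_N) : rvec R N := [tuple (j == i)%:R | j < N].

Lemma linear_rvec0 l : linear_rvec l -> l [tuple 0 | _ < N] = 0.
Proof.
move=> ll; have := ll (-1) [tuple 0 | _ < N] [tuple 0 | _ < N].
rewrite (_ : lin_rvec _ _ _ = [tuple 0 | _ < N]); first by rewrite mulN1r addNr.
by apply: eq_from_tnth => i; rewrite !tnth_mktuple mulr0 addr0.
Qed.

(** Induction on a duplicate-free list of coordinates: the vector is built up by restoring one
    coordinate of [x] at a time. *)
Lemma linear_rvecE l x : linear_rvec l ->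
  l x = \sum_(i < N) tnth x i * l (unit_rvec i).
Proof.
move=> ll.
have H (s : seq 'I_N) : uniq s ->
    l [tuple (if i \in s then tnth x i else 0) | i < N] =
    \sum_(i <- s) tnth x i * l (unit_rvec i).
  elim: s => [_|i s IH /= /andP[i_s us]].
    by rewrite big_nil -[RHS](linear_rvec0 ll); congr l.
  rewrite big_cons -IH// -ll; congr l; apply: eq_from_tnth => j.
  rewrite !tnth_mktuple inE; case: eqVneq => [->|ji] /=.
    by rewrite (negbTE i_s) mulr1 addr0.
  by rewrite mulr0 add0r.
rewrite -big_enum/= -H ?enum_uniq//; congr l; apply: eq_from_tnth => i.
by rewrite tnth_mktuple mem_enum.
Qed.

Lemma measurable_linear_rvec l : linear_rvec l -> measurable_fun setT l.
Proof.
move=> ll; rewrite (_ : l = fun x => \sum_(i < N) tnth x i * l (unit_rvec i)).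
  exact: measurable_rvec_sum.
by apply/funext => x; exact: linear_rvecE.
Qed.

Lemma measurable_quadratic_rvec B : (forall y, linear_rvec (B^~ y)) ->
  (forall x, linear_rvec (B x)) -> measurable_fun setT (fun x => B x x).
Proof.
move=> B1 B2; rewrite (_ : (fun x => B x x) =
  (fun x => \sum_(i < N) tnth x i * B (unit_rvec i) x)); last first.
  by apply/funext => x; rewrite (linear_rvecE x (B1 x)).
apply: measurable_sum => i; apply: measurable_funM; first exact: measurable_tnth.
exact: measurable_linear_rvec.
Qed.

(** A vector in the kernel of the Gram matrix has [B v v = 0], hence vanishes; so the matrix is
    invertible and the representing vector solves a linear system. *)
Lemma riesz_rvec B l : (forall y, linear_rvec (B^~ y)) ->
  (forall x, linear_rvec (B x)) ->
  (forall x, B x x = 0 -> forall i, tnth x i = 0) -> linear_rvec l ->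
  exists a, forall x, B a x = l x.
Proof.
move=> B1 B2 B0 ll.
pose M : 'M[R]_N := \matrix_(i, j) B (unit_rvec i) (unit_rvec j).
pose tov (v : 'rV[R]_N) : rvec R N := [tuple v 0 i | i < N].
have BE (v : 'rV[R]_N) j : B (tov v) (unit_rvec j) = (v *m M) 0 j.
  rewrite (linear_rvecE _ (B1 _)) mxE; apply: eq_bigr => i _.
  by rewrite tnth_mktuple mxE.
have uM : M \in unitmx.
  rewrite -row_free_unit -kermx_eq0; apply/rowV0P => v /sub_kermxP vM.
  have : B (tov v) (tov v) = 0.
    rewrite (linear_rvecE _ (B2 _)) big1// => j _.
    by rewrite BE vM mxE mulr0.
  by move=> /B0 v0; apply/rowP => i; have := v0 i; rewrite tnth_mktuple mxE.
pose lv : 'rV[R]_N := \row_j l (unit_rvec j).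
exists (tov (lv *m invmx M)) => x.
rewrite (linear_rvecE _ (B2 _)) (linear_rvecE _ ll); apply: eq_bigr => j _.
by rewrite BE mulmxKV// mxE.
Qed.

End riesz.

Section gaussian_marginal.
Context {R : realType} (N : nat).
Local Notation leb := (@lebesgue_measure R).
Local Notation T := (measurableTypeR R).
Local Notation lrv := (@lebesgue_rvec R N).
Implicit Types (x a : rvec R N).
Local Open Scope ereal_scope.

Variables (q l : rvec R N -> R) (a : rvec R N).
Hypothesis mq : measurable_fun setT q.
Hypothesis ml : measurable_fun setT l.
Hypothesis q_shift : forall x (s : R),
  q (add_rvec x (scale_rvec s a)) = (q x + 2 * s * l x + s ^+ 2 * q a)%R.
Hypothesis l_shift : forall x (s : R),
  l (add_rvec x (scale_rvec s a)) = (l x + s * q a)%R.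
Hypothesis qa0 : (0 < q a)%R.

Let dq x := (expR (- q x / 2))%:E.

Let mdq : measurable_fun setT dq.
Proof.
apply/measurable_EFinP; apply: measurableT_comp => //; apply: measurable_funM => //.
exact: measurableT_comp.
Qed.

(* Multiplying by [exp (- (l x - s)^2 / (2 q a))], integrating over [s], and
   translating [x] by [(s / q a) a] decouples [H (l x)] from the Gaussian
   weight. *)
Lemma ge0_gaussian_marginal (H : R -> \bar R) :
  measurable_fun [set: T] H -> (forall y, 0 <= H y) ->
  \int[lrv]_x (H (l x) * dq x) =
  (\int[lrv]_x dq x) * \int[leb]_y (H y * (normal_pdf 0 (Num.sqrt (q a)) y)%:E).
Proof.
move=> mH H0.
have s20 := qa0; set s2 := q a in s20 *; set sg := Num.sqrt s2.
have sg0 : sg != 0%R by rewrite gt_eqF// sqrtr_gt0.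
have sg2 : (sg ^+ 2 = s2)%R by rewrite sqr_sqrtr// ltW.
have s2n : s2 != 0%R by rewrite gt_eqF.
pose g (s : R) := normal_pdf 0 sg s.
have gE s : g s = (normal_peak sg * expR (- s ^+ 2 / (2 * s2)))%R.
  by rewrite /g normal_pdfE// /normal_fun subr0 sg2 mulr_natl.
have g0 s : (0 <= (g s)%:E) by rewrite lee_fin normal_pdf_ge0.
have mg : measurable_fun [set: T] (fun s => (g s)%:E).
  by apply/measurable_EFinP; exact: measurable_normal_pdf.
have g1 : \int[leb]_s (g s)%:E = 1 by exact: integral_normal_pdf.
have dq0 x : 0 <= dq x by rewrite lee_fin expR_ge0.
have m1 : measurable_fun setT (fun z : rvec R N * T => z.1) by exact: measurable_fst.
have m2 : measurable_fun setT (fun z : rvec R N * T => z.2) by exact: measurable_snd.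
have mlz : measurable_fun setT (fun z : rvec R N * T => l z.1) by exact: measurableT_comp ml m1.
have mHl : measurable_fun setT (fun x => H (l x)) by exact: measurableT_comp mH ml.
transitivity (\int[lrv]_x \int[leb]_s (H (l x) * dq x * (g (s - l x)%R)%:E)).
  apply: eq_integral => x _.
  have mgs : measurable_fun [set: T] (fun s => (g (s - l x)%R)%:E).
    by apply: (measurableT_comp mg); exact: measurable_funD.
  rewrite ge0_integralZl//; last by rewrite mule_ge0.
  by rewrite (@ge0_integral_shift R (- l x)%R (fun s => (g s)%:E))// g1 mule1.
pose f1 (z : rvec R N * T) := H (l z.1) * dq z.1 * (g (z.2 - l z.1)%R)%:E.
have mf1 : measurable_fun setT f1.
  apply: emeasurable_funM; first apply: emeasurable_funM.
  - exact: measurableT_comp mHl m1.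
  - exact: measurableT_comp mdq m1.
  - by apply: (measurableT_comp mg); exact: measurable_funB.
have f10 z : 0 <= f1 z by rewrite !mule_ge0.
rewrite (fubini_tonelli (m1 := lrv) (m2 := leb) f1)//.
transitivity (\int[leb]_s \int[lrv]_x (H (l x + s)%R * (g (l x + s)%R)%:E * dq x)).
  apply: eq_integral => s _.
  have mf1s : measurable_fun setT (fun x => f1 (x, s)).
    exact: (measurableT_comp mf1 (pair2_measurable s)).
  rewrite -[LHS](ge0_integral_rvec_shift (scale_rvec (s / s2) a) mf1s)//.
  apply: eq_integral => x _; rewrite /f1/= l_shift -/s2 divfK//.
  rewrite -!muleA; congr (_ * _); rewrite muleC /dq -!EFinM; congr EFin.
  rewrite !gE q_shift -/s2 -!mulrA; congr (_ * _)%R; rewrite -!expRD; congr expR.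
  (* Completing the square: after the translation the argument of [g] is $-l(x)$, and
     $\frac{q(x)}2+\frac{s\,l(x)}{q(a)}+\frac{s^2}{2q(a)}+\frac{l(x)^2}{2q(a)}=\frac{q(x)}2+\frac{(l(x)+s)^2}{2q(a)}$. *)
  by field.
pose f2 (z : rvec R N * T) := H (l z.1 + z.2)%R * (g (l z.1 + z.2)%R)%:E * dq z.1.
have mf2 : measurable_fun setT f2.
  have mls : measurable_fun setT (fun z : rvec R N * T => (l z.1 + z.2 : T)%R) by exact: measurable_funD.
  apply: emeasurable_funM; first apply: emeasurable_funM.
  - exact: measurableT_comp mH mls.
  - exact: measurableT_comp mg mls.
  - exact: measurableT_comp mdq m1.
have f20 z : 0 <= f2 z by rewrite !mule_ge0.
rewrite -(fubini_tonelli (m1 := lrv) (m2 := leb) f2)// /f2/=.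
have mHg : measurable_fun [set: T] (fun y => H y * (g y)%:E) by exact: emeasurable_funM.
rewrite -ge0_integralZr//; last first.
  by apply: integral_ge0 => y _; rewrite mule_ge0.
apply: eq_integral => x _.
rewrite ge0_integralZr//; last 2 first.
- apply: (measurableT_comp mHg); exact: measurable_funD.
- by move=> s _; rewrite mule_ge0.
rewrite muleC.
have -> : \int[leb]_s (H (l x + s)%R * (g (l x + s)%R)%:E) = \int[leb]_y (H y * (g y)%:E).
  under eq_integral do rewrite addrC.
  by rewrite (@ge0_integral_shift R (l x) (fun y => H y * (g y)%:E))// => y; rewrite mule_ge0.
by [].
Qed.

Lemma ge0_gaussian_marginal1 (H : R -> \bar R) :
  measurable_fun [set: T] H -> (forall y, 0 <= H y) ->
  \int[lrv]_x (H (l x) * dq x) =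
  (\int[lrv]_x dq x) * \int[leb]_z (H (Num.sqrt (q a) * z)%R * (gauss1 z)%:E).
Proof.
move=> mH H0; rewrite (ge0_gaussian_marginal mH H0).
by rewrite (integral_normal_scale _ mH H0)// sqrtr_gt0.
Qed.

End gaussian_marginal.

(** * Discrete and continuous Sobolev energies *)

Section discrete_H1.
Context {R : realType}.
Implicit Types (N m : nat).

Definition AN N (x y : rvec R N) : R :=
  N%:R^-1 * \sum_(i < N) (tnth x i * tnth y i + DN x i * DN y i).

Lemma DN_lin N a (x y : rvec R N) i : DN (lin_rvec a x y) i = a * DN x i + DN y i.
Proof. by rewrite /DN !tnth_mktuple; ring. Qed.

Lemma ANC N (x y : rvec R N) : AN x y = AN y x.
Proof. by congr (_ * _); apply: eq_bigr => i _; ring. Qed.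

Lemma AN_linl N (y : rvec R N) : linear_rvec (fun x => AN x y).
Proof.
move=> a x z; rewrite /AN mulrCA -mulrDr [in RHS]mulr_sumr.
rewrite -[in RHS]big_split/=; congr (_ * _).
by apply: eq_bigr => i _; rewrite DN_lin tnth_mktuple; ring.
Qed.

Lemma AN_linr N (x : rvec R N) : linear_rvec (AN x).
Proof. by move=> a y z; rewrite !(ANC x) AN_linl. Qed.

Lemma AN_sqr N (x : rvec R N) :
  AN x x = L2norm (stepfun x) ^+ 2 + N%:R^-1 * \sum_(i < N) DN x i ^+ 2.
Proof.
by rewrite L2norm_stepfun -mulrDr -big_split.
Qed.

Lemma sum_sqr_ge0 N (F : 'I_N -> R) : 0 <= N%:R^-1 * \sum_(i < N) F i ^+ 2.
Proof. by rewrite mulr_ge0 ?invr_ge0//; apply: sumr_ge0 => i _; rewrite sqr_ge0. Qed.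

Lemma AN_ge0 N (x : rvec R N) : 0 <= AN x x.
Proof. by rewrite AN_sqr addr_ge0 ?sqr_ge0// sum_sqr_ge0. Qed.

Lemma L2norm_stepfun_le N (x : rvec R N) : L2norm (stepfun x) <= Num.sqrt (AN x x).
Proof.
rewrite -(ger0_norm (L2norm_ge0 _)) -sqrtr_sqr ler_wsqrtr// AN_sqr lerDl.
exact: sum_sqr_ge0.
Qed.

Lemma AN_eq0 N (x : rvec R N) : AN x x = 0 -> forall i, tnth x i = 0.
Proof.
move=> x0 i.
have N0 : 0 < N%:R :> R by rewrite ltr0n (leq_trans _ (ltn_ord i)).
have H : \sum_(j < N) tnth x j ^+ 2 <= 0.
  have : N%:R^-1 * \sum_(j < N) tnth x j ^+ 2 <= 0.
    by rewrite -[leRHS]x0 AN_sqr L2norm_stepfun lerDl sum_sqr_ge0.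
  by rewrite mulrC pmulr_lle0 ?invr_gt0.
have : tnth x i ^+ 2 <= 0.
  apply: le_trans H; rewrite (bigD1 i)//= lerDl.
  by apply: sumr_ge0 => j _; rewrite sqr_ge0.
by rewrite real_exprn_even_le0 ?num_real//= => /eqP.
Qed.

Lemma sqr_sum_le (I : Type) (s : seq I) (F : I -> R) :
  (\sum_(i <- s) F i) ^+ 2 <= (size s)%:R * \sum_(i <- s) F i ^+ 2.
Proof.
elim: s => [|i s IH]; first by rewrite !big_nil expr0n mulr0.
rewrite !big_cons/=; set S := \sum_(j <- s) F j in IH *.
set Q := \sum_(j <- s) F j ^+ 2 in IH *.
have [s0|s0] := posnP (size s).
  have S0 : S = 0.
    by apply/eqP; rewrite -sqrf_eq0 eq_le sqr_ge0 andbT (le_trans IH)// s0 mul0r.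
  have Q0 : Q = 0 by rewrite /Q (size0nil s0) big_nil.
  by rewrite S0 Q0 s0 !addr0 mul1r.
rewrite -[X in X * _]natr1; set n : R := (size s)%:R in IH *.
have n0 : 0 < n by rewrite ltr0n.
rewrite -(ler_pM2l n0) -subr_ge0.
(* The first square measures how far the new term is from the mean of the others; the second summand
   is the induction hypothesis. *)
rewrite (_ : _ - _ = (S - n * F i) ^+ 2 + (n + 1) * (n * Q - S ^+ 2)); last by ring.
by rewrite addr_ge0 ?sqr_ge0// mulr_ge0 ?subr_ge0// addr_ge0// ltW.
Qed.

(** Telescoping and Cauchy-Schwarz over the [j - i] steps: the discrete form of the Hoelder
    embedding of H1 with exponent 1/2. The path from [i] to [j] never uses the cyclic difference at
    the last index. *)
Lemma tnth_diff_sqr N (x : rvec R N) (i j : 'I_N) : (i <= j)%N ->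
  (tnth x j - tnth x i) ^+ 2 <= (j - i)%:R / N%:R * (N%:R^-1 * \sum_(k < N) DN x k ^+ 2).
Proof.
move=> ij.
have N0 : 0 < N%:R :> R by rewrite ltr0n (leq_trans _ (ltn_ord i)).
pose X k := nth 0 x k.
have XE (k : 'I_N) : tnth x k = X k by rewrite (tnth_nth 0).
have DE (k : 'I_N) : (k.+1 < N)%N -> DN x k = N%:R * (X k.+1 - X k).
  by move=> kN; rewrite /DN !XE /= modn_small.
rewrite !XE -(telescope_sumr X ij).
apply: (le_trans (sqr_sum_le _ _)); rewrite size_iota -!mulrA ler_wpM2l//.
rewrite mulrA -invfM -expr2 mulrC -ler_pdivrMr ?invr_gt0 ?exprn_gt0// invrK.
rewrite big_nat_cond mulr_suml.
rewrite (eq_bigr (fun k => (N%:R * (X k.+1 - X k)) ^+ 2)); last by move=> k _; ring.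
(* Squared differences extended by 0 to all naturals, so that the sum from [i] to [j] is visibly
   part of the full sum. *)
pose G k := if insub k is Some k' then DN x (k' : 'I_N) ^+ 2 else 0.
have G0 k : 0 <= G k by rewrite /G; case: insub => // k'; rewrite sqr_ge0.
have -> : \sum_(k < N) DN x k ^+ 2 = \sum_(0 <= k < N) G k.
  by rewrite big_mkord; apply: eq_bigr => k _; rewrite /G valK.
rewrite (eq_bigr G); last first.
  move=> k /andP[/andP[ik kj] _].
  have kN : (k < N)%N by rewrite (leq_trans kj)// ltnW.
  rewrite /G insubT DE//=; exact: leq_ltn_trans kj (ltn_ord j).
rewrite -big_nat_cond [leRHS](@big_cat_nat _ _ _ i)//=; last exact: ltnW.
rewrite [X in _ <= _ + X](@big_cat_nat _ _ _ j)//=; last exact: ltnW.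
by rewrite addrCA lerDl addr_ge0// sumr_ge0.
Qed.

Lemma tnth_diff_le N (x : rvec R N) (i j : 'I_N) (d : R) :
  `|i%:R / N%:R - j%:R / N%:R| <= d ->
  (tnth x i - tnth x j) ^+ 2 <= d * AN x x.
Proof.
have N0 : 0 < N%:R :> R by rewrite ltr0n (leq_trans _ (ltn_ord i)).
wlog ij : i j / (i <= j)%N.
  move=> H; have [/H//|/ltnW/H {}H] := leqP i j.
  by rewrite distrC -sqrrN opprB; exact: H.
move=> h; rewrite -sqrrN opprB (le_trans (tnth_diff_sqr x ij))//.
have d0 : 0 <= d by exact: le_trans h.
apply: ler_pM; [by rewrite divr_ge0|exact: sum_sqr_ge0| |].
- rewrite (le_trans _ h)// distrC natrB// mulrBl; exact: ler_norm.
- by rewrite AN_sqr lerDr sqr_ge0.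
Qed.

(** Average $x_i^2\le 2x_j^2+2(x_i-x_j)^2$ over $j$, the differences being controlled by
    [tnth_diff_sqr]. The constant 2 is independent of [N], which makes the later moment bounds free
    of the dimension. *)
Lemma tnth_sqr_le N (x : rvec R N) (i : 'I_N) : tnth x i ^+ 2 <= 2 * AN x x.
Proof.
have N0 : 0 < N%:R :> R by rewrite ltr0n (leq_trans _ (ltn_ord i)).
have D (j : 'I_N) : (tnth x i - tnth x j) ^+ 2 <= N%:R^-1 * \sum_(k < N) DN x k ^+ 2.
  wlog ij : i j / (i <= j)%N.
    move=> H; have [/H//|/ltnW/H {}H] := leqP i j.
    by rewrite -sqrrN opprB; exact: H.
  rewrite -sqrrN opprB (le_trans (tnth_diff_sqr x ij))//.
  rewrite -[leRHS]mul1r ler_wpM2r ?sum_sqr_ge0// ler_pdivrMr// mul1r ler_nat.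
  by rewrite (leq_trans (leq_subr _ _))// ltnW.
set S := N%:R^-1 * \sum_(k < N) DN x k ^+ 2 in D *.
have H (j : 'I_N) : tnth x i ^+ 2 <= 2 * tnth x j ^+ 2 + 2 * S.
  have := D j; have : 0 <= (tnth x i - 2 * tnth x j) ^+ 2 by rewrite sqr_ge0.
  by nra.
have : \sum_(j < N) tnth x i ^+ 2 <= \sum_(j < N) (2 * tnth x j ^+ 2 + 2 * S).
  by apply: ler_sum => j _; exact: H.
set a := tnth x i ^+ 2.
rewrite big_split/= -[X in _ <= X + _ -> _]mulr_sumr !sumr_const !card_ord.
rewrite -[X in X <= _ -> _]mulr_natl -[X in _ <= _ + X -> _]mulr_natl.
rewrite -(ler_pM2l (_ : 0 < N%:R^-1)) ?invr_gt0// mulrA mulVf ?gt_eqF// mul1r.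
move=> /le_trans; apply; rewrite AN_sqr L2norm_stepfun -/S.
by rewrite le_eqVlt; apply/orP; left; apply/eqP; field; rewrite gt_eqF.
Qed.

Lemma sum_norm_le N (F : 'I_N -> R) :
  N%:R^-1 * \sum_(i < N) `|F i| <= Num.sqrt (N%:R^-1 * \sum_(i < N) F i ^+ 2).
Proof.
have [N0|N0] := posnP N.
  by subst N; rewrite !big_ord0 !mulr0 sqrtr0.
have N1 : 0 < N%:R :> R by rewrite ltr0n.
have L0 : 0 <= N%:R^-1 * \sum_(i < N) `|F i|.
  by rewrite mulr_ge0 ?invr_ge0//; exact: sumr_ge0.
rewrite -(ger0_norm L0) -sqrtr_sqr ler_wsqrtr// exprMn.
have := sqr_sum_le (enum 'I_N) (fun i => `|F i|).
rewrite size_enum_ord !big_enum/= => h.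
apply: (le_trans (ler_wpM2l _ h)); first by rewrite sqr_ge0.
rewrite expr2 -mulrA mulKf ?gt_eqF// ler_wpM2l ?invr_ge0//.
by apply: ler_sum => i _; rewrite real_normK ?num_real.
Qed.

Lemma stepfun_Pavg_close N m (x : rvec R N) (t : R) : (0 < m)%N -> (m <= N)%N ->
  0 <= t < 1 ->
  (stepfun x t - Pavg m (stepfun x) t) ^+ 2 <= 2 / m%:R * AN x x.
Proof.
move=> m0 mN t01.
have N0 : (0 < N)%N by exact: leq_trans mN.
have NR : 0 < N%:R :> R by rewrite ltr0n.
have mR : 0 < m%:R :> R by rewrite ltr0n.
have [j jt] := cellP m0 t01; have [i it] := cellP N0 t01.
have A0 : 0 <= 2 / m%:R * AN x x by rewrite mulr_ge0 ?AN_ge0// divr_ge0.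
rewrite -[leRHS]sqr_sqrtr// -real_normK ?num_real// lerXn2r ?nnegrE//.
apply: (Pavg_close (isL2_stepfun x) jt) => s sj.
have s01 := cell01 sj; have [k ks] := cellP N0 s01.
rewrite (stepfunE x it) (stepfunE x ks) -sqrtr_sqr ler_wsqrtr//.
apply: tnth_diff_le.
have st := cell_dist sj jt.
(* The points [s] and [t] are within $1/m$ of each other, and passing to the left ends of their fine
   cells costs at most $1/N\le 1/m$: hence the factor 2. *)
have Nm : N%:R^-1 <= m%:R^-1 :> R by rewrite lef_pV2 ?posrE// ler_nat.
move: it ks; rewrite /cell/= !in_itv/= -!natr1 !mulrDl !mul1r => /andP[i1 i2] /andP[k1 k2].
move: st; rewrite !ler_norml => /andP[s1 s2].
by apply/andP; split; lra.
Qed.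

Lemma L2norm_stepfun_Pavg N m (x : rvec R N) : (0 < m)%N -> (m <= N)%N ->
  L2norm (fun t => stepfun x t - Pavg m (stepfun x) t) <= Num.sqrt (2 / m%:R * AN x x).
Proof.
move=> m0 mN; apply: L2norm_bounded; last 2 first.
- exact: sqrtr_ge0.
- move=> t t01; rewrite -sqrtr_sqr ler_wsqrtr//; exact: stepfun_Pavg_close.
apply: measurable_funB; first exact: measurable_stepfun.
by apply: isL2_measurable; exact: isL2_Pavg.
Qed.

End discrete_H1.

(** * Primitives and integration by parts *)

Section primitive.
Context {R : realType}.
Implicit Types (h f psi phi : R -> R) (s t : R) (N : nat).
Local Notation leb := (@lebesgue_measure R).
Local Notation T := (measurableTypeR R).
Local Notation I01 := (`[0, 1]%classic : set R).

Definition prim h t : R := L2inner (\1_(`[0, t[%classic)) h.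

Lemma isL2_indic (A : set T) : measurable A -> isL2 (\1_A : R -> R).
Proof.
move=> mA; apply: (@isL2_bounded01 _ _ 1); first exact: measurable_indic.
by move=> t _; rewrite indicE; case: (_ \in _); rewrite ?normr0 ?normr1.
Qed.

Lemma isL2_indico s t : isL2 (\1_(`[s, t[%classic) : R -> R).
Proof. by apply: isL2_indic; exact: measurable_itv. Qed.

Lemma integrable_L2 h : isL2 h -> leb.-integrable I01 (EFin \o h).
Proof.
move=> h2; have := integrable_L2M (isL2_cst 1) h2.
by apply: eq_integrable => // t _ /=; rewrite mul1r.
Qed.

Lemma prim0 h : prim h 0 = 0.
Proof.
rewrite /prim /L2inner (@eq_Rintegral _ _ _ _ _ (fun=> 0)).
  by rewrite Rintegral_cst// mul0r.
move=> t _; rewrite indicE (_ : (t \in _) = false) ?mul0r//.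
by apply/negbTE; rewrite notin_setE/= in_itv/= => /andP[/le_lt_trans h1 /h1]; rewrite ltxx.
Qed.

Lemma L2inner_ae01 f h k : isL2 f -> isL2 h -> isL2 k ->
  (forall t, 0 <= t < 1 -> f t = h t) -> L2inner f k = L2inner h k.
Proof.
move=> f2 h2 k2 fh; apply/eqP; rewrite -subr_eq0 -L2innerBl//; apply/eqP.
have := L2_CauchySchwarz (isL2B f2 h2) k2.
have : L2norm (fun t => f t - h t) <= 0.
  apply: L2norm_bounded => //.
    by apply: measurable_funB; exact: isL2_measurable.
  by move=> t /fh ->; rewrite subrr normr0.
move=> n0; have {n0}-> : L2norm (fun t => f t - h t) = 0.
  by apply/eqP; rewrite eq_le n0 L2norm_ge0.
by rewrite mul0r normr_le0 => /eqP.
Qed.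

Lemma prim1 h : isL2 h -> prim h 1 = L2inner (fun=> 1) h.
Proof.
move=> h2; apply: L2inner_ae01 => //; [exact: isL2_indico|exact: isL2_cst|].
by move=> t t01; rewrite indicE mem_set.
Qed.

Lemma primB h s t : isL2 h -> 0 <= s <= t ->
  prim h t - prim h s = L2inner (\1_(`[s, t[%classic)) h.
Proof.
move=> h2 /andP[s0 st]; rewrite /prim -L2innerBl//; try exact: isL2_indico.
congr L2inner; apply/funext => x; rewrite !indicE !mem_setE !in_itv/=.
have [xs|xs] := ltP x s; have [x0|x0] := leP 0 x; rewrite /= ?subr0 ?subrr//.
- by rewrite (lt_le_trans xs st) subrr.
- by move: (lt_le_trans x0 (le_trans s0 xs)); rewrite ltxx.
Qed.

Lemma prim_cell N (i : nat) h : isL2 h -> (i < N)%N ->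
  N%:R * (prim h (i.+1%:R / N%:R) - prim h (i%:R / N%:R)) = L2inner (hcell N i) h.
Proof.
move=> h2 iN; have N0 : 0 < N%:R :> R by rewrite ltr0n (leq_trans _ iN).
rewrite primB//; last first.
  by rewrite divr_ge0//= ler_wpM2r ?invr_ge0// ler_nat.
by rewrite /hcell L2innerZl//; exact: isL2_indic_cell.
Qed.

(** Cauchy-Schwarz against the indicator of $[s,t)$, whose measure is at most [d]. *)
Lemma prim_holder h s t (d : R) : isL2 h -> `|t - s| <= d ->
  `|prim h t - prim h s| <= Num.sqrt d * L2norm h.
Proof.
move=> h2; wlog st : s t / s <= t.
  move=> H; case: (leP s t) => [/H//|/ltW/H {}H].
  by rewrite distrC (distrC (prim h t)).
rewrite ger0_norm ?subr_ge0// => tsd.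
have d0 : 0 <= d by rewrite (le_trans _ tsd)// subr_ge0.
have it := isL2_indico 0 t; have is_ := isL2_indico 0 s.
rewrite /prim -L2innerBl//.
have D2 := isL2B it is_.
apply: (le_trans (L2_CauchySchwarz D2 h2)); rewrite ler_wpM2r ?L2norm_ge0//.
rewrite -(ger0_norm (L2norm_ge0 _)) -sqrtr_sqr ler_wsqrtr// L2norm_sqr//.
apply: (@le_trans _ _ (\int[leb]_(x in I01) \1_(`[s, t[%classic) x)).
  apply: le_Rintegral => //.
  - exact: (integrable_L2M D2 D2).
  - by apply: integrable_L2; exact: isL2_indico.
  - move=> x _ /=; rewrite !indicE !mem_setE !in_itv/=.
    have [x0|x0] := leP 0 x; last by rewrite /= subr0 mul0r.
    have [xs|xs] := ltP x s.
      by rewrite (lt_le_trans xs st) subrr mul0r.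
    by rewrite /= subr0; case: (_ < _); rewrite ?mulr1 ?mulr0.
rewrite /Rintegral integral_indic//=.
apply: le_trans tsd; rewrite -lee_fin fineK; last first.
  rewrite ge0_fin_numE ?measure_ge0// (@le_lt_trans _ _ (leb I01))//.
    by apply: le_measure; rewrite ?inE//=; exact: measurableI.
  by rewrite [X in (X < _)%E]lebesgue_measure_itv/= lte_fin ltr01 -EFinB ltry.
apply: (@le_trans _ _ (leb `[s, t[%classic)).
  by apply: le_measure; rewrite ?inE//=; exact: measurableI.
rewrite [X in (X <= _)%E]lebesgue_measure_itv/= lte_fin; case: ifPn => _.
  by rewrite -EFinB.
by rewrite lee_fin subr_ge0.
Qed.

Lemma prim_continuous h : isL2 h -> continuous (prim h).
Proof.
move=> h2 t; apply/cvgrPdist_le => /= e e0.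
have n1 : 0 < L2norm h + 1 by rewrite ltr_wpDl ?L2norm_ge0.
have d0 : 0 < (e / (L2norm h + 1)) ^+ 2 by rewrite exprn_gt0// divr_gt0.
near=> s; have ts : `|t - s| <= (e / (L2norm h + 1)) ^+ 2.
  by near: s; apply: cvgr_dist_le => //; exact: cvg_id.
apply: (le_trans (prim_holder h2 ts)); rewrite sqrtr_sqr ger0_norm; last first.
  by rewrite divr_ge0// ltW.
apply: (@le_trans _ _ (e / (L2norm h + 1) * (L2norm h + 1))).
  by rewrite ler_wpM2l ?lerDl// divr_ge0// ltW.
by rewrite divfK// gt_eqF.
Unshelve. all: by end_near. Qed.

Lemma isL2_prim h : isL2 h -> isL2 (prim h).
Proof. by move=> h2; apply: isL2_continuous; exact: prim_continuous. Qed.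

Lemma Rintegral_FTC psi phi s : continuous psi ->
  (forall t : R, is_derive t 1 phi (psi t)) -> s <= 1 ->
  \int[leb]_(t in `[s, 1]) psi t = phi 1 - phi s.
Proof.
move=> cpsi dphi; rewrite le_eqVlt => /predU1P[->|s1].
  by rewrite set_itv1 Rintegral_set1 subrr.
have cphi : continuous phi.
  move=> t; apply: differentiable_continuous; apply/derivable1_diffP.
  exact: ex_derive.
rewrite /Rintegral (@continuous_FTC2 _ psi phi)//.
- exact: continuous_subspaceT.
- split.
  + by move=> x _; exact: ex_derive.
  + by apply: cvg_at_right_filter; exact: cphi.
  + by apply: cvg_at_left_filter; exact: cphi.
- by move=> x _; rewrite derive1E; apply: derive_val.
Qed.

(** Integration by parts for [h] that is only square integrable, so that its primitive need not be
    differentiable everywhere. It is Fubini for $\psi(t)h(s)$ on the triangle $s<t$. *)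
Lemma L2inner_prim h psi phi : isL2 h -> continuous psi ->
  (forall t : R, is_derive t 1 phi (psi t)) ->
  L2inner (prim h) psi = phi 1 * L2inner (fun=> 1) h - L2inner h phi.
Proof.
move=> h2 cpsi dphi.
have cphi : continuous phi.
  move=> t; apply: differentiable_continuous; apply/derivable1_diffP.
  exact: ex_derive.
have psi2 := isL2_continuous cpsi; have phi2 := isL2_continuous cphi.
pose p t : R := \1_I01 t * psi t; pose k s : R := \1_I01 s * h s.
(* Evaluated at [t - s] this is the indicator of the triangle. *)
pose c (r : R) : R := \1_(`]0, +oo[%classic) r.
have mI : measurable_fun [set: T] (\1_I01 : T -> R) by exact: measurable_indic.
have mp : measurable_fun [set: T] p.
  by apply: measurable_funM => //; exact: isL2_measurable.
have mk : measurable_fun [set: T] k.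
  by apply: measurable_funM => //; exact: isL2_measurable.
have mc : measurable_fun [set: T] c by exact: measurable_indic.
have pE (g : R -> R) : (fun t => \1_I01 t * g t) = g \_ I01.
  apply/funext => t; rewrite patchE indicE; case: (_ \in _); by rewrite ?mul1r ?mul0r.
have ip : leb.-integrable setT (EFin \o p).
  have := integrable_L2 psi2; rewrite integrable_mkcond//.
  by apply: eq_integrable => // t _; rewrite restrict_EFin /= -pE.
have ik : leb.-integrable setT (EFin \o k).
  have := integrable_L2 h2; rewrite integrable_mkcond//.
  by apply: eq_integrable => // t _; rewrite restrict_EFin /= -pE.
pose G (z : T * T) : R := p z.1 * k z.2 * c (z.1 - z.2).
have mG : measurable_fun setT G.
  have m1 : measurable_fun setT (fun z : T * T => z.1) by exact: measurable_fst.
  have m2 : measurable_fun setT (fun z : T * T => z.2) by exact: measurable_snd.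
  apply: measurable_funM; first apply: measurable_funM.
  - exact: measurableT_comp mp m1.
  - exact: measurableT_comp mk m2.
  - by apply: (measurableT_comp mc); exact: measurable_funB.
have c01 r : 0 <= c r <= 1 by rewrite /c indicE; case: (_ \in _); rewrite ?lexx ?ler01.
have iG : (leb \x leb)%E.-integrable setT (EFin \o G).
  apply/integrable12ltyP; first exact/measurable_EFinP.
  apply: (@le_lt_trans _ _ (\int[leb]_t (`|p t|%:E * \int[leb]_s `|k s|%:E))%E).
    apply: ge0_le_integral => //.
    - by move=> t _; exact: integral_ge0.
    - apply: (measurable_fun_fubini_tonelli_F (fun z => `|(EFin \o G) z|%E)) => //.
      by apply: measurableT_comp => //; exact/measurable_EFinP.
    - apply: emeasurable_funM => //; apply/measurable_EFinP.
      exact: measurableT_comp.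
    move=> t _; rewrite -ge0_integralZl//; last first.
      by apply/measurable_EFinP; exact: measurableT_comp.
    apply: ge0_le_integral => //.
    - apply: measurableT_comp => //; apply: (measurableT_comp (g := fun s => (t, s))).
        exact/measurable_EFinP.
      exact: pair1_measurable.
    - by apply: emeasurable_funM => //; apply/measurable_EFinP; exact: measurableT_comp.
    - move=> s _; rewrite /= -EFinM lee_fin !normrM ler_piMr ?mulr_ge0//.
      by have /andP[? ?] := c01 (t - s); rewrite ger0_norm.
  rewrite ge0_integralZr//; last 2 first.
  - by apply/measurable_EFinP; exact: measurableT_comp.
  - exact: integral_ge0.
  have /integrableP[_ h1] := ip; have /integrableP[_ h3] := ik.
  by rewrite lte_mul_pinfty// ?ge0_fin_numE//; exact: integral_ge0.
have := @Fubini _ _ T T R leb leb (EFin \o G) iG.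
have E1 t : (\int[leb]_s (EFin \o G) (t, s) = (\1_I01 t * (prim h t * psi t))%:E)%E.
  pose g s : R := \1_(`[0, t[%classic) s * h s.
  have ig : leb.-integrable setT (EFin \o (g \_ I01)).
    have := integrable_L2M (isL2_indico 0 t) h2; rewrite integrable_mkcond//.
    by apply: eq_integrable => // s _; rewrite restrict_EFin.
  transitivity (\int[leb]_s ((p t)%:E * ((g \_ I01) s)%:E))%E.
    apply: eq_integral => s _; rewrite /= -EFinM; congr EFin.
    rewrite /G/= -mulrA; congr (_ * _); rewrite -pE /k /g -mulrA [in LHS]indicE [in RHS]indicE.
    case: (boolP (s \in _)); rewrite ?mul0r// inE/= in_itv/= => /andP[s0 s1].
    rewrite !mul1r mulrC; congr (_ * _); rewrite /c !indicE !mem_setE !in_itv/=.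
    by rewrite subr_gt0 andbT s0.
  rewrite integralZl// (_ : (\int[leb]_s ((g \_ I01) s)%:E = (prim h t)%:E)%E).
    by rewrite -EFinM /p -mulrA (mulrC (psi t)).
  rewrite /prim /L2inner Rintegral_mkcond /Rintegral fineK//.
  exact: integrable_fin_num.
have E2 s : (\int[leb]_t (EFin \o G) (t, s) = (\1_I01 s * (h s * (phi 1 - phi s)))%:E)%E.
  have [s01|s01] := boolP (s \in I01); last first.
    rewrite indicE (negbTE s01) mul0r -[RHS](integral0 leb setT).
    apply: eq_integral => t _ /=; congr EFin.
    by rewrite /G /k/= indicE (negbTE s01) mul0r mulr0 mul0r.
  have := s01; rewrite inE/= in_itv/= => /andP[s0 s1].
  have mo : measurable (`]s, 1]%classic : set T) by exact: measurable_itv.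
  have ipsi : leb.-integrable `]s, 1]%classic (EFin \o psi).
    apply: (@integrableS _ _ _ leb I01) => //; last exact: integrable_L2.
    by move=> t /=; rewrite !in_itv/= => /andP[/ltW/(le_trans s0) -> ->].
  have ig : leb.-integrable setT (EFin \o (psi \_ `]s, 1]%classic)).
    have := ipsi; rewrite integrable_mkcond//.
    by apply: eq_integrable => // t _; rewrite restrict_EFin.
  transitivity (\int[leb]_t ((k s)%:E * ((psi \_ `]s, 1]%classic) t)%:E))%E.
    apply: eq_integral => t _; rewrite /= -EFinM; congr EFin.
    rewrite /G/= (mulrC (p t)) -mulrA; congr (_ * _).
    rewrite /p /c patchE !indicE !mem_setE !in_itv/= andbT subr_gt0.
    have [st|st] := ltP s t; last by rewrite mulr0.
    by rewrite (ltW (le_lt_trans s0 st))/=; case: (t <= 1); rewrite ?mul1r ?mulr1 ?mul0r.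
  rewrite integralZl// (_ : (\int[leb]_t ((psi \_ `]s, 1]%classic) t)%:E =
      (phi 1 - phi s)%:E)%E).
    by rewrite -EFinM /k -mulrA.
  rewrite -(Rintegral_FTC cpsi dphi s1) -Rintegral_itv_obnd_cbnd// Rintegral_mkcond.
  by rewrite /Rintegral fineK//; exact: integrable_fin_num.
under eq_integral do rewrite E1; under [in RHS]eq_integral do rewrite E2.
move=> /(congr1 fine) E.
transitivity (\int[leb]_t (\1_I01 t * (prim h t * psi t))).
  by rewrite /L2inner Rintegral_mkcond -(pE (fun t => prim h t * psi t)).
rewrite [LHS]E -/(Rintegral leb setT (fun s => \1_I01 s * (h s * (phi 1 - phi s)))).
rewrite (pE (fun s => h s * (phi 1 - phi s))) -Rintegral_mkcond.
rewrite -/(L2inner h (fun s => phi 1 - phi s)) L2innerBr//; last exact: isL2_cst.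
congr (_ - _); rewrite L2innerC -L2innerZl//; last exact: isL2_cst.
by congr L2inner; apply/funext => t; rewrite mulr1.
Qed.

End primitive.

(** * Completeness of the trigonometric system *)

Section trig_orthogonal.
Context {R : realType}.
Implicit Types (h f psi phi e : R -> R) (s t : R) (N : nat).
Local Notation leb := (@lebesgue_measure R).
Local Notation T := (measurableTypeR R).

(** Integer frequencies make the atoms 1-periodic, and the phase makes their span stable under
    products. *)
Definition trig_atom f : Prop := exists (k : int) (th : R),
  f = (fun t => cos (2 * pi * k%:~R * t + th)).

Lemma trig_atom_le1 f : trig_atom f -> forall t, `|f t| <= 1.
Proof. by move=> [k [th ->]] t; exact: cos_max. Qed.

Lemma trig_atom_continuous f : trig_atom f -> continuous f.
Proof.
move=> [k [th ->]] t; apply: continuous_comp; last exact: continuous_cos.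
by apply: cvgD; [apply: cvgM; [exact: cvg_cst|exact: cvg_id]|exact: cvg_cst].
Qed.

Lemma trig_atom1 : trig_atom (fun=> 1).
Proof. by exists 0, 0; apply/funext => t; rewrite mulr0 mul0r addr0 cos0. Qed.

Lemma trig_atomM f g : trig_atom f -> trig_atom g ->
  lspan trig_atom (fun t => f t * g t).
Proof.
move=> [k [th ->]] [k' [th' ->]].
have l1 : lspan trig_atom (fun t => cos (2 * pi * (k + k')%:~R * t + (th + th'))).
  by apply: lspan_atom; exists (k + k'), (th + th').
have l2 : lspan trig_atom (fun t => cos (2 * pi * (k - k')%:~R * t + (th - th'))).
  by apply: lspan_atom; exists (k - k'), (th - th').
have := lspan_lin 2^-1 l1 (lspanZ 2^-1 l2); congr (lspan _ _).
apply/funext => t; rewrite cosM; congr (_ * cos _ + _ * cos _).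
  by rewrite intrD; ring.
by rewrite intrB; ring.
Qed.

Lemma uclos_trig_isL2 f : uclos trig_atom f -> isL2 f.
Proof.
move=> uf; have [M M0 fM] := uclos_bounded trig_atom_le1 uf.
apply: (@isL2_bounded01 _ _ M) => //.
apply: (@uclos_measurable _ T R trig_atom) => // g /trig_atom_continuous.
exact: continuous_measurable_fun.
Qed.

Variable e : R -> R.
Hypothesis e2 : isL2 e.
Hypothesis e_orth : forall f, trig_atom f -> L2inner e f = 0.

Lemma uclos_trig_orth f : uclos trig_atom f -> L2inner e f = 0.
Proof.
move=> uf; have f2 := uclos_trig_isL2 uf.
have lo g : lspan trig_atom g -> isL2 g /\ L2inner e g = 0.
  elim=> {g} [g ag| |a f1 g _ [f12 f10] _ [g2 g0]].
  - split; last exact: e_orth.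
    by apply: isL2_continuous; exact: trig_atom_continuous.
  - split; first exact: isL2_cst.
    have := @L2innerZr R 0 (fun=> 0) e (isL2_cst 0) e2.
    by under eq_fun do rewrite mulr0; rewrite mul0r.
  - split; first exact: isL2_lin.
    by rewrite L2inner_linr// f10 g0 mulr0 addr0.
apply/eqP; rewrite -normr_le0; apply/ler_addgt0Pr => d d0; rewrite add0r.
have n1 : 0 < L2norm e + 1 by rewrite ltr_wpDl ?L2norm_ge0.
have [g lg fg] := uf _ (divr_gt0 d0 n1).
have [g2 g0] := lo g lg.
rewrite -[L2inner e f]subr0 -g0 -L2innerBr//.
apply: (le_trans (L2_CauchySchwarz e2 (isL2B f2 g2))).
apply: (@le_trans _ _ ((L2norm e + 1) * (d / (L2norm e + 1)))).
  apply: ler_pM; rewrite ?L2norm_ge0 ?lerDl//.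
  apply: L2norm_bounded; last by move=> t _; exact: fg.
    by apply: measurable_funB; exact: isL2_measurable.
  by rewrite divr_ge0// ltW.
by rewrite mulrC divfK// gt_eqF.
Qed.

(** The open arc with centre [c] and radius [r] is where $\cos 2\pi(t-c)$ exceeds $\cos 2\pi r$.
    Steepening the difference by [n] and truncating to [0, 1] tends to the indicator of the arc,
    inside the uniform closure of trigonometric polynomials. *)
Definition arc_bump n (c r t : R) : R :=
  Num.max 0 (Num.min 1 (n%:R * (cos (2 * pi * (t - c)) - cos (2 * pi * r)))).

Lemma uclos_arc_bump n c r : uclos trig_atom (arc_bump n c r).
Proof.
have H1 := trig_atom_le1; have H2 := trig_atom1; have H3 := trig_atomM.
apply: (uclos_max H1 H2 H3); first exact: (uclos_cst H2).
apply: (uclos_min H1 H2 H3); first exact: (uclos_cst H2).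
apply: (uclosZ H2); apply: uclosB; last exact: (uclos_cst H2).
apply: uclos_lspan; apply: lspan_atom; exists 1, (- (2 * pi * c)).
by apply/funext => t; congr cos; rewrite mulr1; ring.
Qed.

Lemma cos_2pi_lt (x r : R) : 0 <= x -> x < r -> r <= 2^-1 ->
  cos (2 * pi * r) < cos (2 * pi * x).
Proof.
move=> x0 xr r2; have p0 := pi_gt0 R.
rewrite ltr_cos ?in_itv/=; first by rewrite ltr_pM2l ?mulr_gt0.
- by apply/andP; split; nra.
- by apply/andP; split; nra.
Qed.

Lemma cos_2pi_le (x r : R) : 0 <= r -> r <= 2^-1 -> r <= x -> x <= 1 - r ->
  cos (2 * pi * x) <= cos (2 * pi * r).
Proof.
move=> r0 r2 rx x1.
have [x2|x2] := leP x 2^-1.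
  have [->//|xr] := eqVneq x r.
  by apply: ltW; apply: cos_2pi_lt => //; rewrite lt_def xr.
have -> : cos (2 * pi * x) = cos (2 * pi * (1 - x)).
  rewrite mulrBr mulr1 (_ : 2 * pi - _ = pi *+ 2 - 2 * pi * x) ?mulr_natl//.
  by rewrite cosB cos2pi sin2pi mul1r mul0r addr0.
have [->//|xr] := eqVneq (1 - x) r.
apply: ltW; apply: cos_2pi_lt => //; last by lra.
by rewrite lt_def xr/=; lra.
Qed.

Lemma arc_bump_cvg (a b t : R) : 0 <= a -> a < b -> b <= 1 -> 0 <= t <= 1 ->
  (fun n => arc_bump n ((a + b) / 2) ((b - a) / 2) t) @ \oo -->
  (\1_(`]a, b[%classic) t : R).
Proof.
move=> a0 ab b1 /andP[t0 t1].
set c := (a + b) / 2; set r := (b - a) / 2.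
have [tab|tab] := boolP (t \in `]a, b[%classic).
  have : a < t < b by move: tab; rewrite inE/= in_itv.
  move=> /andP[ta tb]; rewrite indicE tab.
  have D0 : 0 < cos (2 * pi * (t - c)) - cos (2 * pi * r).
    rewrite subr_gt0 -[X in _ < X]cos_norm normrM (gtr0_norm (_ : 0 < 2 * pi)) ?mulr_gt0 ?pi_gt0//.
    apply: cos_2pi_lt => //; rewrite /r /c; last by lra.
    by rewrite ltr_norml; apply/andP; split; lra.
  apply: cvg_near_cst.
  have [n0 n00 H] := exists_natV_le D0.
  exists n0 => // n /= ln; rewrite /arc_bump min_l ?max_r//.
  have n1 : 0 < n%:R :> R by rewrite ltr0n (leq_trans n00).
  by rewrite mulrC -ler_pdivrMr// div1r; exact: H.
rewrite indicE (negbTE tab); apply: cvg_near_cst; apply: nearW => n.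
rewrite /arc_bump max_l// ge_min; apply/orP; right.
rewrite mulr_ge0_le0// subr_le0.
rewrite -[X in X <= _]cos_norm normrM (gtr0_norm (_ : 0 < 2 * pi)) ?mulr_gt0 ?pi_gt0//.
have tab' : t <= a \/ b <= t.
  have [|ta] := leP t a; first by left.
  have [|tb] := leP b t; first by right.
  by move: tab; rewrite notin_setE/= in_itv/= ta tb.
apply: cos_2pi_le; rewrite /r /c; try lra.
- case: tab' => ?; [rewrite ler0_norm|rewrite ger0_norm]; lra.
- by rewrite ler_norml; apply/andP; split; lra.
Qed.

(** Orthogonality passes from atoms to bumps by uniform approximation and from bumps to the open
    interval by dominated convergence; the cell differs from that interval by its left endpoint.
    Vanishing averages on all cells then force [e] to vanish, by [Pavg_cvg]. *)
Lemma orth_cell N (i : 'I_N) : L2inner (hcell N i) e = 0.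
Proof.
have N0 : 0 < N%:R :> R by rewrite ltr0n (leq_trans _ (ltn_ord i)).
pose a : R := i%:R / N%:R; pose b : R := i.+1%:R / N%:R.
have a0 : 0 <= a by rewrite divr_ge0.
have ab : a < b by rewrite ltr_pM2r ?invr_gt0// ltr_nat.
have b1 : b <= 1 by rewrite ler_pdivrMr// mul1r ler_nat.
have mI : measurable (`[0, 1]%classic : set T) by exact: measurable_itv.
have me := isL2_measurable e2.
have mo : measurable (`]a, b[%classic : set T) by exact: measurable_itv.
have key : L2inner e (\1_(`]a, b[%classic)) = 0.
  pose f n t := e t * arc_bump n ((a + b) / 2) ((b - a) / 2) t.
  have u n := uclos_arc_bump n ((a + b) / 2) ((b - a) / 2).
  have /(_ _)[] // := @dominated_convergence _ T R leb _ mI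
    (fun n t => (f n t)%:E) (fun t => (e t * \1_(`]a, b[%classic) t)%:E)
    (fun t => `|e t|%:E).
  - move=> n; apply/measurable_EFinP/measurable_funTS/measurable_funM => //.
    by apply: isL2_measurable; apply: uclos_trig_isL2.
  - apply/measurable_EFinP/measurable_funTS/measurable_funM => //.
  - apply: aeW => t; rewrite /= in_itv/= => t01; apply/fine_cvgP; split; first exact: nearW.
    apply: cvgMr; exact: arc_bump_cvg.
  - by apply: (integrable_abse (integrable_L2 e2)).
  - apply: aeW => t n _; rewrite /= lee_fin normrM ler_piMr//.
    by rewrite /arc_bump ger0_norm ?le_max ?lexx// ge_max ler01/= ?ge_min ?lexx.
  move=> _ _ cv; rewrite /L2inner /Rintegral.
  have {}cv : (fun n => (\int[leb]_(t in `[0%R, 1%R]) (f n t)%:E)%E) @ \oo -->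
     (\int[leb]_(t in `[0%R, 1%R]) (e t * \1_(`]a, b[%classic) t)%:E)%E by [].
  have E n : (\int[leb]_(t in `[0%R, 1%R]) (f n t)%:E = 0)%E.
    have fn : (\int[leb]_(t in `[0%R, 1%R]) (f n t)%:E)%E \is a fin_num.
      apply: integrable_fin_num => //.
      by apply: (integrable_L2M e2); exact: uclos_trig_isL2.
    by rewrite -(fineK fn); congr EFin; exact: uclos_trig_orth (u n).
  have cv0 : (fun n => (\int[leb]_(t in `[0%R, 1%R]) (f n t)%:E)%E) @ \oo --> 0%E.
    by under eq_fun do rewrite E; exact: cvg_cst.
  by rewrite (cvg_unique _ cv cv0).
rewrite /hcell L2innerZl//; last exact: isL2_indic_cell.
suff -> : L2inner (\1_(cell N i)) e = L2inner (\1_(`]a, b[%classic)) e.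
  by rewrite L2innerC key mulr0.
apply/eqP; rewrite -subr_eq0 -L2innerBl//; [|exact: isL2_indic_cell|exact: isL2_indic].
apply/eqP; rewrite /L2inner /Rintegral.
suff -> : (\int[leb]_(t in `[0%R, 1%R]) ((\1_(cell N i) t - \1_(`]a, b[%classic) t) * e t)%:E = 0)%E by [].
rewrite -(integral0 leb (`[0%R, 1%R]%classic)); apply: ae_eq_integral => //.
  apply/measurable_EFinP/measurable_funTS/measurable_funM => //.
  apply: measurable_funB; first by apply: isL2_measurable; exact: isL2_indic_cell.
  exact: measurable_indic.
exists [set a]; split => //; first exact: lebesgue_measure_set1.
move=> t /= nt; apply: contrapT => ta; apply: nt => _.
rewrite !indicE !mem_setE !in_itv/= le_eqVlt -/a -/b.
by rewrite (_ : (a == t) = false) ?subrr ?mul0r//; apply/eqP => /esym.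
Qed.

Lemma orth_L2norm0 : L2norm e = 0.
Proof.
apply/eqP; rewrite eq_le L2norm_ge0 andbT; apply/ler_addgt0Pr => d d0; rewrite add0r.
have [m m0 H] := Pavg_cvg e2 d0.
apply: le_trans (H m (leqnn m)); rewrite le_eqVlt; apply/orP; left; apply/eqP.
congr L2norm; apply/funext => t.
suff -> : Pavg m e t = 0 by rewrite subr0.
by apply: big1 => i _; rewrite tnth_mktuple orth_cell mul0r.
Qed.

End trig_orthogonal.

(** * Weakly differentiable functions as primitives *)

Section H1_representation.
Context {R : realType}.
Implicit Types (h f df ddf : R -> R) (t : R) (N : nat).
Local Notation leb := (@lebesgue_measure R).
Local Notation T := (measurableTypeR R).

Lemma is_derive_sin_lin (c th t : R) :
  is_derive t 1 (fun t => sin (c * t + th)) (c * cos (c * t + th)).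
Proof.
have d1 : is_derive t 1 (fun t => c * t + th) c.
  by apply: is_derive_eq; rewrite /GRing.scale/=; ring.
have := @is_derive1_comp _ sin (fun t => c * t + th) t _ _ (is_derive_sin _) d1.
by rewrite mulrC.
Qed.

Lemma sinD2piz (k : int) (a : R) : sin (a + 2 * pi * k%:~R) = sin a.
Proof.
have H n (b : R) : sin (b + 2 * pi * n%:R) = sin b.
  have := periodicn (@sinD2pi R) n b.
  by rewrite -[pi *+ 2]mulr_natl -[_ *+ n]mulr_natr.
case: k => n; first exact: H.
rewrite NegzE mulrNz mulrN.
by have := H n.+1 (a - 2 * pi * n.+1%:R); rewrite subrK => ->.
Qed.

(** A du Bois-Reymond argument: both [f] and [prim df] satisfy the same integration by parts formula
    against periodic primitives of the atoms, so their difference minus its mean is orthogonal to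
    every atom. The test function 1 gives the mean of [df]. *)
Lemma H1_rep f df : isH1 f df -> L2inner (fun=> 1) df = 0 /\
  exists c : R, L2norm (fun t => f t - (c + prim df t)) = 0.
Proof.
move=> [f2 df2 wd].
have df0 : L2inner (fun=> 1) df = 0.
  have := wd (fun=> 1) (fun=> erefl) (fun t => derivable_cst _ _ _).
  have -> : derive1 (fun=> 1 : R) = (fun=> 0 : R).
    by apply/funext => t; rewrite derive1E derive_cst.
  move=> /(_ (fun=> cvg_cst _)).
  have -> : L2inner f (fun=> 0) = 0.
    have := @L2innerZr R 0 (fun=> 0) f (isL2_cst 0) f2.
    by under eq_fun do rewrite mulr0; rewrite mul0r.
  by move=> /esym/eqP; rewrite oppr_eq0 L2innerC => /eqP.
split => //.
have p2 := isL2_prim df2; have d2 := isL2B f2 p2.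
(* The mean of the difference, which settles the atoms of frequency 0. *)
pose c := L2inner (fun=> 1) (fun t => f t - prim df t).
exists c; have e2 := isL2B d2 (isL2_cst c).
rewrite (_ : (fun t => _) = (f \- prim df) \- (fun=> c)); last first.
  by apply/funext => t /=; rewrite opprD addrA addrAC.
apply: orth_L2norm0 => // g ag.
have g2 := isL2_continuous (trig_atom_continuous ag).
have [k [th gE]] := ag.
have [k0|k0] := eqVneq k 0.
  have -> : g = (fun t => cos th * 1).
    by rewrite gE k0; apply/funext => t; rewrite mulr0 mul0r add0r mulr1.
  have c1 := @isL2_cst R 1.
  rewrite L2innerZr//= L2innerBl//; last exact: isL2_cst.
  rewrite (L2innerC _ (fun=> 1)) -/c.
  suff -> : L2inner (fun=> c) (fun=> 1) = c by rewrite subrr mulr0.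
  rewrite /L2inner; under eq_Rintegral do rewrite mulr1.
  rewrite Rintegral_cst// [X in fine X]lebesgue_measure_itv/= lte_fin ltr01.
  by rewrite oppr0 adde0 mulr1.
pose w : R := 2 * pi * k%:~R.
have w0 : w != 0 by rewrite !mulf_neq0// ?intr_eq0// gt_eqF// pi_gt0.
(* At a nonzero frequency the atom has a 1-periodic primitive, hence an admissible test function. *)
pose phi t := w^-1 * sin (w * t + th).
have dphi t : is_derive t 1 phi (g t).
  have := is_derive_sin_lin w th t => dsin.
  apply: is_derive_eq; rewrite gE /GRing.scale/= -/w; by field.
have phiE : derive1 phi = g by apply/funext => t; rewrite derive1E; apply: derive_val.
have per : periodic1 phi.
  move=> t; rewrite /phi; congr (_ * _).
  rewrite (_ : w * (t + 1) + th = (w * t + th) + w); last by ring.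
  exact: sinD2piz.
have cg := trig_atom_continuous ag.
have phi2 : isL2 phi.
  apply: isL2_continuous => t; apply: differentiable_continuous.
  by apply/derivable1_diffP; exact: ex_derive.
have E1 : L2inner f g = - L2inner df phi.
  have dd t : derivable phi t 1 by have := dphi t => -[].
  by have := wd phi per dd; rewrite phiE => /(_ cg).
have E2 := L2inner_prim df2 cg dphi; rewrite df0 mulr0 sub0r in E2.
have E3 : L2inner (fun=> c) g = 0.
  rewrite (_ : (fun=> c) = (fun t => c * 1)); last by apply/funext => t; rewrite mulr1.
  rewrite L2innerZl//; last exact: isL2_cst.
  rewrite /L2inner; under eq_Rintegral do rewrite mul1r.
  rewrite (Rintegral_FTC cg dphi ler01).
  by have := per 0; rewrite add0r => ->; rewrite subrr mulr0.
rewrite /= L2innerBl//; last exact: isL2_cst.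
by rewrite E3 subr0 L2innerBl// E1 E2 subrr.
Qed.

End H1_representation.

(** * Sampling twice weakly differentiable functions on the grid *)

Section H2_sampling.
Context {R : realType}.
Implicit Types (f df ddf G : R -> R) (t : R) (N : nat).
Local Notation leb := (@lebesgue_measure R).

Definition sample N G : rvec R N := [tuple G (i%:R / N%:R) | i < N].

Lemma sample_ordS N G (i : 'I_N) : G 0 = G 1 ->
  G (i.+1%:R / N%:R) = tnth (sample N G) (ordS i).
Proof.
move=> G01; rewrite tnth_mktuple /=.
have N0 : (0 < N)%N by rewrite (leq_trans _ (ltn_ord i)).
have [iN|] := ltnP i.+1 N; first by rewrite modn_small.
rewrite leq_eqVlt ltnNge ltn_ord orbF => /eqP <-.
by rewrite modnn mul0r divff ?pnatr_eq0 -?lt0n.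
Qed.

Lemma sum_parts N (z g : 'I_N -> R) :
  \sum_(i < N) z i * (g (ordS i) - g i) = - \sum_(i < N) (z (ordS i) - z i) * g (ordS i).
Proof.
rewrite -sumrN.
have E : \sum_(i < N) z i * g i = \sum_(i < N) z (ordS i) * g (ordS i).
  exact: (reindex_inj (@ordS_inj N)).
transitivity (\sum_(i < N) z i * g (ordS i) - \sum_(i < N) z i * g i).
  by rewrite -sumrB; apply: eq_bigr => i _; rewrite mulrBr.
by rewrite E -sumrB; apply: eq_bigr => i _; rewrite mulrBl opprB.
Qed.

Lemma avg_close N (i : 'I_N) f (a e : R) : isL2 f ->
  (forall s, cell N i s -> `|a - f s| <= e) -> `|a - tnth (avg N f) i| <= e.
Proof.
move=> f2 H; rewrite tnth_mktuple.
have h2 := @isL2_hcell R N i.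
have ih := integrable_L2 h2.
have -> : a - L2inner (hcell N i) f = L2inner (hcell N i) (fun s => a - f s).
  rewrite L2innerBr//; last exact: isL2_cst; congr (_ - _).
  rewrite /L2inner; under eq_Rintegral do rewrite mulrC.
  by rewrite RintegralZl// Rintegral_hcell mulr1.
have d2 : isL2 (fun s => a - f s) by apply: isL2B => //; exact: isL2_cst.
rewrite /L2inner; have im := integrable_L2M h2 d2.
apply: (le_trans (le_normr_Rintegral _ _)) => //.
have -> : e = \int[leb]_(t in `[0, 1]) (e * hcell N i t).
  by rewrite RintegralZl// Rintegral_hcell mulr1.
apply: le_Rintegral => //; [exact: integrable_norm|exact: integrable_realZ|].
move=> s _; rewrite normrM /hcell indicE; have [si|] := boolP (s \in _).
  rewrite mulr1 ger0_norm// mulrC ler_wpM2r//; apply: H.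
  by move: si; rewrite inE.
by rewrite mulr0 normr0 mul0r mulr0.
Qed.

(** The vector samples the continuous representative [F] of [f]. Its difference quotients are
    exactly the cell averages of [df], and the averages of [ddf] are those of the representative [G]
    of [df]. After summation by parts the errors are oscillations of [F] and [G] over one cell, of
    order $N^{-1/2}$ by [prim_holder]; measuring the second one in the energy norm of [z] lets it be
    used as a residual. *)
Lemma H2_sample f df ddf : isH2 f df ddf ->
  exists v : forall N, rvec R N, forall N, (0 < N)%N ->
    L2norm (fun t => stepfun (v N) t - f t) <= Num.sqrt N%:R^-1 * L2norm df /\
    forall z : rvec R N, `|AN (v N) z - L2inner (fun t => f t - ddf t) (stepfun z)|
      <= Num.sqrt N%:R^-1 * (L2norm df + L2norm ddf) * Num.sqrt (AN z z).
Proof.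
move=> [H1f H1df].
have [f2 df2 _] := H1f; have [_ ddf2 _] := H1df.
have [df0 [c fc]] := H1_rep H1f; have [ddf0 [c' dfc']] := H1_rep H1df.
pose F t := c + prim df t; pose G t := c' + prim ddf t.
have F2 : isL2 F by apply: isL2D; [exact: isL2_cst|exact: isL2_prim].
have G2 : isL2 G by apply: isL2D; [exact: isL2_cst|exact: isL2_prim].
have F01 : F 0 = F 1 by rewrite /F prim0 prim1// df0.
have G01 : G 0 = G 1 by rewrite /G prim0 prim1// ddf0.
exists (fun N => sample N F) => N N0.
have NR : 0 < N%:R :> R by rewrite ltr0n.
have Nn : N%:R != 0 :> R by rewrite gt_eqF.
have cd (i : 'I_N) (s : R) : cell N i s -> `|s - i%:R / N%:R| <= N%:R^-1 /\
    `|i.+1%:R / N%:R - s| <= N%:R^-1.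
  rewrite /cell/= in_itv/= -natr1 mulrDl mul1r => /andP[s1 s2].
  by split; rewrite ger0_norm; lra.
have vF : L2norm (fun t => stepfun (sample N F) t - f t) <= Num.sqrt N%:R^-1 * L2norm df.
  have s2 := isL2_stepfun (sample N F).
  rewrite (le_trans (ler_L2normB s2 f2 F2))//.
  rewrite [X in _ + X]L2normBC// fc addr0.
  apply: L2norm_bounded; [|by rewrite mulr_ge0 ?sqrtr_ge0 ?L2norm_ge0|].
    by apply: measurable_funB; exact: isL2_measurable.
  move=> t t01; have [i it] := cellP N0 t01.
  rewrite (stepfunE _ it) tnth_mktuple /F opprD addrACA subrr add0r.
  by apply: prim_holder => //; rewrite distrC; case: (cd i t it).
split => // z.
have z2 := isL2_stepfun z.
have DF (i : 'I_N) : DN (sample N F) i = tnth (avg N G) i.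
  rewrite /DN -sample_ordS// tnth_mktuple /F opprD addrACA subrr add0r.
  rewrite prim_cell// tnth_mktuple; apply: L2inner_aer => //; first exact: isL2_hcell.
  exact: L2norm_eq0.
have avgdd (i : 'I_N) : tnth (avg N ddf) i =
    N%:R * (tnth (sample N G) (ordS i) - tnth (sample N G) i).
  rewrite -sample_ordS// tnth_mktuple tnth_mktuple -prim_cell//.
  by rewrite /G opprD addrACA subrr add0r.
(* Summation by parts pairs the differences of [z] with the values of [G] at right cell ends, hence
   the index [ordS i]. *)
have E : AN (sample N F) z - L2inner (fun t => f t - ddf t) (stepfun z) =
    L2inner (fun t => stepfun (sample N F) t - f t) (stepfun z) +
    N%:R^-1 * \sum_(i < N) DN z i * (tnth (avg N G) i - tnth (sample N G) (ordS i)).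
  rewrite !L2innerBl//; last exact: isL2_stepfun.
  rewrite L2inner_stepfun2 [L2inner ddf _]L2inner_stepfun//.
  rewrite (eq_bigr (fun i => N%:R * (tnth z i *
      (tnth (sample N G) (ordS i) - tnth (sample N G) i)))); last first.
    by move=> i _; rewrite avgdd mulrCA.
  rewrite -mulr_sumr (sum_parts (tnth z) (tnth (sample N G))).
  have E2 : \sum_(i < N) DN z i * (tnth (avg N G) i - tnth (sample N G) (ordS i)) =
      \sum_(i < N) DN (sample N F) i * DN z i -
      N%:R * \sum_(i < N) (tnth z (ordS i) - tnth z i) * tnth (sample N G) (ordS i).
    rewrite mulr_sumr -sumrB; apply: eq_bigr => i _.
    by rewrite DF /DN; ring.
  rewrite E2 /AN big_split/=; ring.
rewrite E (le_trans (ler_normD _ _))//.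
rewrite mulrDr mulrDl lerD//.
  apply: (le_trans (L2_CauchySchwarz (isL2B (isL2_stepfun _) f2) z2)).
  apply: ler_pM; rewrite ?L2norm_ge0//; exact: L2norm_stepfun_le.
set eps := Num.sqrt N%:R^-1 * L2norm ddf.
have eps0 : 0 <= eps by rewrite mulr_ge0 ?sqrtr_ge0 ?L2norm_ge0.
rewrite normrM ger0_norm ?invr_ge0//.
apply: (@le_trans _ _ (N%:R^-1 * \sum_(i < N) `|DN z i| * eps)).
  rewrite ler_wpM2l ?invr_ge0// (le_trans (ler_norm_sum _ _ _))// ler_sum// => i _.
  rewrite normrM ler_wpM2l// distrC; apply: avg_close => // s si.
  rewrite -sample_ordS// /G opprD addrACA subrr add0r.
  by apply: prim_holder => //; case: (cd i s si).
rewrite -mulr_suml mulrA mulrC ler_wpM2l//.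
apply: (le_trans (sum_norm_le _)); rewrite ler_wsqrtr// AN_sqr lerDr.
exact: sqr_ge0.
Qed.

End H2_sampling.

(** * Sampling with the window *)

Section window_sampling.
Context {R : realType}.
Local Notation T := (measurableTypeR R).
Local Notation leb := (@lebesgue_measure R).
Implicit Types (f h w F g : R -> R) (s a e t B : R) (K : (R -> R) -> (R -> R)).

Lemma ge0_integral_affine s a (f : R -> \bar R) : 0 < s ->
  measurable_fun [set: T] f -> (forall x, 0 <= f x)%E ->
  (s%:E * \int[leb]_x f (s * (x - a))%R = \int[leb]_x f x)%E.
Proof.
move=> s0 mf f0; rewrite -(ge0_integral_scale s0 mf f0); congr (_ * _)%E.
rewrite -(@ge0_integral_shift _ (- a) (fun x => f (s * x)))//.
by apply: measurableT_comp => //; exact: measurable_funM.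
Qed.

Lemma Rintegral_affine s a f : 0 < s -> leb.-integrable setT (EFin \o f) ->
  s * \int[leb]_x f (s * (x - a)) = \int[leb]_x f x.
Proof.
move=> s0 fi; have mf : measurable_fun [set: T] (EFin \o f) by case/integrableP: fi.
have fp := integral_funepos_lt_pinfty measurableT fi; have fn := integral_funeneg_lt_pinfty measurableT fi.
have [P0 N0] : (forall x, 0 <= (EFin \o f)^\+ x)%E /\ (forall x, 0 <= (EFin \o f)^\- x)%E.
  by split=> x; [exact: funepos_ge0|exact: funeneg_ge0].
have mp := measurable_funepos mf; have mn := measurable_funeneg mf.
have sp := ge0_integral_affine a s0 mp P0; have sn := ge0_integral_affine a s0 mn N0.
rewrite /Rintegral [in LHS]integralE [in RHS]integralE -sp -sn.
have fin (A : \bar R) : (0 <= A)%E -> (s%:E * A < +oo)%E -> A \is a fin_num.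
  by case: A => [r| |]//= _; rewrite gt0_muley ?lte_fin// ltxx.
have E1 : (\int[leb]_x (EFin \o f)^\+ (s * (x - a))%R)%E =
  (\int[leb]_x (fun x => (f (s * (x - a)))%:E)^\+ x)%E.
  by apply: eq_integral => x _; rewrite !funeposE.
have E2 : (\int[leb]_x (EFin \o f)^\- (s * (x - a))%R)%E =
  (\int[leb]_x (fun x => (f (s * (x - a)))%:E)^\- x)%E.
  by apply: eq_integral => x _; rewrite !funenegE.
rewrite E1 in sp *; rewrite E2 in sn *.
set A := (\int[leb]_x _)%E; set C := (\int[leb]_x _)%E.
have Af : A \is a fin_num.
  by apply: fin; [exact: integral_ge0|rewrite sp].
have Cf : C \is a fin_num.
  by apply: fin; [exact: integral_ge0|rewrite sn].
by rewrite -(fineK Af) -(fineK Cf) /= mulrBr.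
Qed.

Lemma A1_integrable w : A1 w -> leb.-integrable setT (EFin \o w).
Proof.
move=> [w2 [a wa] _].
move: w2; rewrite inE => /andP[]; rewrite !inE/= => mw nw.
have mEw : measurable_fun [set: T] (EFin \o w) by exact/measurable_EFinP.
have [M wM] : exists M : R, {ae leb, forall t, `|w t| <= M}.
  move: nw; rewrite /finite_norm unlock/=.
  case: ifPn => [_ nw|]; last first.
    rewrite -set_itvNyy; rewrite lebesgue_measure_itv/=.
    by rewrite ltey.
  have [M] := ess_sup_inf.ess_supr_bounded nw.
  by exists M.
apply/integrableP; split=> //.
pose b := Num.max a 0; pose M' := Num.max M 0.
apply: (@le_lt_trans _ _ (\int[leb]_x (M' * \1_(`[- b, b]%classic) x)%:E)%E).
  apply: ae_ge0_le_integral => //.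
  - exact: measurableT_comp.
  - move=> x _; rewrite lee_fin mulr_ge0// ?le_max ?lexx ?orbT//.
  - apply/measurable_EFinP; apply: measurable_funM => //.
  - have FF := ae_filter_ringOfSetsType (leb : {measure set T -> \bar R}).
    apply: (@filterS2 _ _ FF _ _ _ _ wa wM) => t wat wMt _; rewrite /= lee_fin indicE.
    have [|] := boolP (t \in _).
      by move=> _; rewrite mulr1 le_max wMt.
    rewrite notin_setE/= in_itv/= => /negP; rewrite -ler_norml -ltNge => bt.
    rewrite wat ?normr0 ?mulr0//.
    by rewrite (le_lt_trans _ bt)// /b le_max lexx.
under eq_integral do rewrite EFinM.
rewrite ge0_integralZl//; last 2 first.
- exact/measurable_EFinP.
- by rewrite lee_fin /M' le_max lexx orbT.
have Lb : (leb (`[(- b)%R, b]%classic : set R) < +oo)%E.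
  by rewrite lebesgue_measure_itv/=; case: ifPn => _; rewrite ?ltry// -EFinD ltry.
rewrite integral_indic// setIT; apply: lte_mul_pinfty => //.
by rewrite lee_fin /M' le_max lexx orbT.
Qed.

Lemma continuous_sum n (F : 'I_n -> R -> R) : (forall j, continuous (F j)) ->
  continuous (fun t => \sum_(j < n) F j t).
Proof.
elim: n F => [|n IH] F cF x.
  by under eq_fun do rewrite big_ord0; exact: cvg_cst.
under eq_fun do rewrite big_ord_recl.
by apply: cvgD; [exact: cF|apply: IH => j; exact: cF].
Qed.

Lemma CS1_bounded F : CS1 F -> exists2 B : R, 0 <= B & forall t, `|F t| <= B.
Proof.
move=> [cF pF].
have pn n t : F (t + n%:R) = F t.
  elim: n => [|n IH]; first by rewrite addr0.
  by rewrite -natr1 addrA pF.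
have pz (n : int) t : F (t + n%:~R) = F t.
  case: n => n; first exact: pn.
  by rewrite NegzE mulrNz -[LHS](pn n.+1) subrK.
have [B FB] : exists B : R, forall t, 0 <= t <= 1 -> `|F t| <= B.
  have cn : {within `[0, 1], continuous (fun t => `|F t|)}.
    apply: continuous_subspaceT => x; apply: (@continuous_comp _ _ _ F Num.norm).
      exact: cF.
    exact: norm_continuous.
  have [c _ Fc] := @EVT_max R _ 0 1 ler01 cn.
  by exists `|F c| => t t01; apply: Fc; rewrite in_itv.
exists B; first by rewrite (le_trans (normr_ge0 (F 0))) ?FB ?lexx ?ler01.
move=> t; rewrite -(pz (- Num.floor t)); apply: FB.
rewrite mulrNz subr_ge0 lerBlDr addrC -intrD1 floor_le/=.
exact/ltW/floorD1_gt.
Qed.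

Section fixed_window.
Variable w : R -> R.
Hypothesis A1w : A1 w.

Let wi := A1_integrable A1w.

Definition wnorm : R := \int[leb]_t `|w t|.

Let wni : leb.-integrable setT (EFin \o (fun y => `|w y|)).
Proof. exact: integrable_norm. Qed.

Lemma wnorm_ge0 : 0 <= wnorm.
Proof. by apply: Rintegral_ge0. Qed.

Lemma integrable_window N s F B : continuous F -> (forall t, `|F t| <= B) ->
  leb.-integrable setT (EFin \o (fun y => w y * F (s + y / N%:R))).
Proof.
move=> cF FB.
have mF : measurable_fun [set: T] (fun y => F (s + y / N%:R)).
  apply: (@measurableT_comp _ _ _ T T T F) => //.
    exact: continuous_measurable_fun.
  by apply: measurable_funD => //; exact: measurable_funM.
apply: (@le_integrable _ T R leb setT measurableT _ (EFin \o (fun y => B * `|w y|))).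
- apply/measurable_EFinP; apply: measurable_funM => //.
  by have /integrableP[/measurable_EFinP] := wi.
- move=> x _ /=; rewrite lee_fin normrM [leRHS]ger0_norm.
    by rewrite mulrC ler_wpM2r.
  by rewrite mulr_ge0// (le_trans _ (FB 0)).
- exact: integrable_realZ.
Qed.

(** Substituting $y=N(t-t_i)$ turns sampling into an average, with a fixed weight of integral 1, of
    values of [F] at distance $|y|/N$ from the grid point. *)
Lemma wsampleE N (i : 'I_N) F B : continuous F -> (forall t, `|F t| <= B) ->
  wsample w F i = \int[leb]_y (w y * F (@grid R N i + y / N%:R)).
Proof.
move=> cF FB; have N0 : 0 < N%:R :> R by rewrite ltr0n (leq_trans _ (ltn_ord i)).
rewrite -(Rintegral_affine (@grid R N i) N0 (integrable_window N (@grid R N i) cF FB)).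
rewrite /wsample; congr (_ * _); apply: eq_Rintegral => x _.
by congr (_ * F _); rewrite mulrAC divff ?gt_eqF// mul1r addrC subrK.
Qed.

Lemma wsample_lin N (i : 'I_N) s F h B B' : continuous F -> continuous h ->
  (forall t, `|F t| <= B) -> (forall t, `|h t| <= B') ->
  wsample w (fun t => s * F t + h t) i = s * wsample w F i + wsample w h i.
Proof.
move=> cF ch FB hB; rewrite (wsampleE i cF FB) (wsampleE i ch hB).
rewrite (@wsampleE _ _ _ (`|s| * B + B')).
- rewrite -RintegralZl//; last exact: integrable_window cF FB.
  rewrite -RintegralD//.
  + by apply: eq_Rintegral => x _; ring.
  + by apply: integrable_realZ => //; exact: integrable_window cF FB.
  + exact: integrable_window ch hB.
- move=> x; apply: cvgD; last exact: ch.
  by apply: cvgM; [exact: cvg_cst|exact: cF].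
- move=> t; rewrite (le_trans (ler_normD _ _))// lerD// normrM.
  by rewrite ler_wpM2l.
Qed.

(** Since [w] has integral 1 the constant [c] can be moved inside the integral, and its compact
    support restricts [y] to a range independent of [N] and [i]. *)
Lemma wsample_close : exists2 a : R, 0 < a & forall N (i : 'I_N) F B c e,
  continuous F -> (forall t, `|F t| <= B) ->
  (forall y, `|y| <= a -> `|F (@grid R N i + y / N%:R) - c| <= e) ->
  `|wsample w F i - c| <= wnorm * e.
Proof.
have [_ [a0 wa] w1] := A1w; exists (Num.max a0 1); first by rewrite lt_max ltr01 orbT.
move=> N i F B c e cF FB Fe; rewrite (wsampleE i cF FB).
have i1 := integrable_window N (@grid R N i) cF FB.
have cc : continuous (fun _ : R => c) by move=> x; exact: cvg_cst.
have i2 := @integrable_window N (@grid R N i) (fun=> c) `|c| cc (fun=> lexx _).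
have mFc : leb.-integrable setT (EFin \o (fun y => w y * (F (@grid R N i + y / N%:R) - c))).
  have := integrableB measurableT i1 i2.
  by apply: eq_integrable => // x _ /=; rewrite -EFinB mulrBr.
have -> : \int[leb]_y (w y * F (@grid R N i + y / N%:R)) - c =
    \int[leb]_y (w y * (F (@grid R N i + y / N%:R) - c)).
  under [RHS]eq_Rintegral do rewrite mulrBr.
  rewrite RintegralB//; congr (_ - _).
  have -> : \int[leb]_y (w y * c) = \int[leb]_y (c * w y).
    by apply: eq_Rintegral => x _; rewrite mulrC.
  by rewrite RintegralZl// w1 mulr1.
apply: (le_trans (le_normr_Rintegral _ _)) => //.
rewrite mulrC -RintegralZl// /Rintegral.
have i3 := integrable_norm mFc.
have i4 := integrable_realZ e measurableT wni.
apply: fine_le; [exact: integrable_fin_num i3|exact: integrable_fin_num i4|].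
have e0 : 0 <= e by rewrite (le_trans _ (Fe 0 _))// normr0 le_max ler01 orbT.
apply: ae_ge0_le_integral => //.
- by case/integrableP: i3.
- by move=> x _; rewrite lee_fin mulr_ge0.
- by case/integrableP: i4.
have FF := ae_filter_ringOfSetsType (leb : {measure set T -> \bar R}).
apply: (@filterS _ _ FF _ _ _ wa) => y wy _; rewrite lee_fin normrM.
have [ya|ay] := leP `|y| a0.
  by rewrite mulrC ler_wpM2r// Fe// le_max ya.
by rewrite wy// normr0 mul0r mulr0.
Qed.

Lemma wsample_bound N (i : 'I_N) F B : continuous F -> (forall t, `|F t| <= B) ->
  `|wsample w F i| <= wnorm * B.
Proof.
move=> cF FB; have [a _ /(_ N i F B 0 B cF FB)] := wsample_close.
by rewrite subr0; apply => y _; rewrite subr0.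
Qed.

Lemma wsample_sum N (i : 'I_N) n (c : 'I_n -> R) (F : 'I_n -> R -> R) (B : 'I_n -> R) :
  (forall j, continuous (F j)) -> (forall j t, `|F j t| <= B j) ->
  wsample w (fun t => \sum_(j < n) c j * F j t) i = \sum_(j < n) c j * wsample w (F j) i.
Proof.
elim: n c F B => [|n IH] c F B cF FB.
  rewrite big_ord0; under eq_fun do rewrite big_ord0.
  apply/eqP; rewrite -normr_le0 -[leRHS](mulr0 wnorm); apply: wsample_bound.
    by move=> x; exact: cvg_cst.
  by move=> t; rewrite normr0.
rewrite big_ord_recl; under eq_fun do rewrite big_ord_recl.
have H (l : 'I_n) t : `|c (lift ord0 l) * F (lift ord0 l) t| <=
    `|c (lift ord0 l)| * B (lift ord0 l) by rewrite normrM ler_wpM2l.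
rewrite (@wsample_lin _ _ _ _ _ (B ord0)
  (\sum_(l < n) `|c (lift ord0 l)| * B (lift ord0 l))).
- by congr (_ + _); apply: (IH _ _ (fun l => B (lift ord0 l))) => *; [exact: cF|exact: FB].
- exact: cF.
- by apply: continuous_sum => l x; apply: cvgM; [exact: cvg_cst|exact: cF].
- exact: FB.
- by move=> t; rewrite (le_trans (ler_norm_sum _ _ _))// ler_sum.
Qed.

Lemma wsample_cvg F B e : continuous F -> (forall t, `|F t| <= B) -> 0 < e ->
  exists N0, forall N, (N0 <= N)%N -> forall (i : 'I_N) t, cell N i t ->
    `|wsample w F i - F t| <= e.
Proof.
move=> cF FB e0; have [a a0 H] := wsample_close.
have w0 := wnorm_ge0.
have e1 : 0 < e / (wnorm + 1) by rewrite divr_gt0// ltr_wpDl.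
have [d d0 Fd] := compact_uniform_continuity (@segment_compact R 0 1) cF e1.
(* The points compared are at most $(1+a)/N$ apart; the 2 in $a+2$ makes this strictly less than
   [d]. *)
have [n0 n00 Hn] := exists_natV_le (divr_gt0 d0 (ltr_wpDl (ltW a0) (ltr0Sn R 1))).
exists n0 => N nN i t it.
apply: (@le_trans _ _ (wnorm * (e / (wnorm + 1)))); last first.
  by rewrite mulrCA ler_piMr ?(ltW e0)// ler_pdivrMr ?ltr_wpDl// mul1r lerDl.
apply: (H N i F B) => // y ya; rewrite distrC; apply: Fd.
  by have := cell01 it => /andP[t0 /ltW t1]; rewrite /= in_itv/= t0.
rewrite /ball/=.
have N0 : 0 < N%:R :> R by rewrite ltr0n (leq_trans _ (ltn_ord i)).
have := Hn _ nN; rewrite ler_pdivlMr ?ltr_wpDl ?(ltW a0)// => aN.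
have yN : `|y / N%:R| <= a / N%:R.
  by rewrite normrM (ger0_norm (_ : 0 <= N%:R^-1)) ?invr_ge0// ler_wpM2r ?invr_ge0.
have tN : `|t - @grid R N i| <= N%:R^-1.
  apply: (cell_dist it); rewrite /cell/= in_itv/= /grid lexx/=.
  by rewrite ltr_pM2r ?invr_gt0// ltr_nat.
rewrite opprD addrA (le_lt_trans (ler_normB _ _))//.
have Ni : 0 < N%:R^-1 :> R by rewrite invr_gt0.
rewrite (le_lt_trans (lerD tN yN))//; lra.
Qed.

End fixed_window.

Section fixed_operator.
Variable K : (R -> R) -> (R -> R).
Hypothesis KC : bounded_L2_C K.

Lemma K_lin a f h : isL2 f -> isL2 h ->
  K (fun t => a * f t + h t) = (fun t => a * K f t + K h t).
Proof. by case: KC => _ + _; apply. Qed.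

Lemma K_continuous f : isL2 f -> continuous (K f).
Proof. by case: KC => + _ _ => /[apply] -[]. Qed.

Lemma K_B f h : isL2 f -> isL2 h -> K (fun t => f t - h t) = (fun t => K f t - K h t).
Proof.
move=> f2 h2; transitivity (K (fun t => (-1) * h t + f t)).
  by congr K; apply/funext => t; rewrite mulN1r addrC.
by rewrite K_lin//; apply/funext => t; rewrite mulN1r addrC.
Qed.

Lemma K_0 : K (fun=> 0) = (fun=> 0).
Proof.
have z2 := @isL2_cst R 0; have := K_B z2 z2.
rewrite (_ : (fun t : R => 0 - 0) = (fun=> 0)); last by apply/funext => t; rewrite subrr.
by move=> ->; apply/funext => t; rewrite subrr.
Qed.

Lemma K_Z a f : isL2 f -> K (fun t => a * f t) = (fun t => a * K f t).
Proof.
move=> f2; have := K_lin a f2 (isL2_cst 0); rewrite K_0.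
rewrite (_ : (fun t => a * f t + 0) = (fun t => a * f t)); last first.
  by apply/funext => t; rewrite addr0.
by move=> ->; apply/funext => t; rewrite addr0.
Qed.

Lemma K_sum n (F : 'I_n -> R -> R) : (forall i, isL2 (F i)) ->
  K (fun t => \sum_(i < n) F i t) = (fun t => \sum_(i < n) K (F i) t).
Proof.
elim: n F => [|n IH] F F2.
  rewrite (_ : (fun t => _) = (fun=> 0)); last by apply/funext => t; rewrite big_ord0.
  by rewrite K_0; apply/funext => t; rewrite big_ord0.
rewrite (_ : (fun t => _) = (fun t => 1 * F ord0 t + \sum_(i < n) F (lift ord0 i) t)).
  rewrite K_lin//; last by apply: isL2_sum.
  by rewrite IH//; apply/funext => t; rewrite big_ord_recl mul1r.
by apply/funext => t; rewrite big_ord_recl mul1r.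
Qed.

Lemma K_bound : exists2 M : R, 0 <= M & forall f, isL2 f -> forall t, `|K f t| <= M * L2norm f.
Proof.
have [_ _ [M HM]] := KC; exists (Num.max M 0); first by rewrite le_max lexx orbT.
by move=> f f2 t; rewrite (le_trans (HM _ f2 t))// ler_wpM2r ?L2norm_ge0// le_max lexx.
Qed.

Lemma K_isL2 f : isL2 f -> isL2 (K f).
Proof. by move=> f2; apply: isL2_continuous; exact: K_continuous. Qed.

Lemma K_stepfun N (x : rvec R N) t :
  K (stepfun x) t = \sum_(i < N) tnth x i * K (\1_(cell N i)) t.
Proof.
rewrite /stepfun K_sum; last by move=> i; apply: isL2Z; exact: isL2_indic_cell.
by apply: eq_bigr => i _; rewrite K_Z//; exact: isL2_indic_cell.
Qed.

(** The part of [f] orthogonal to the averages is controlled by the operator norm alone. The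
    averages involve only the [m] continuous functions [K (\1_(cell m j))], for which a common [N0]
    exists, so the second term is uniform over all [f]. *)
Lemma wsample_K w : A1 w ->
  exists2 C : R, 0 <= C & forall m e, 0 < e ->
  exists N0, forall N, (N0 <= N)%N -> forall f, isL2 f ->
  forall (i : 'I_N) t, cell N i t ->
    `|wsample w (K f) i - K f t|
      <= C * L2norm (fun t => f t - Pavg m f t) + e * L2norm f.
Proof.
move=> A1w; have [M M0 HM] := K_bound; have w0 := wnorm_ge0 w.
exists ((wnorm w + 1) * M); first by rewrite mulr_ge0// addr_ge0.
move=> m e e0.
(* There are [m] terms with coefficients of size at most [m * L2norm f]; the successor keeps the
   denominator positive. *)
have e1 : 0 < e / (m * m).+1%:R by rewrite divr_gt0.
have /choice[n0 Hn] : forall j : 'I_m, exists N0, forall N, (N0 <= N)%N ->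
    forall (i : 'I_N) t, cell N i t ->
    `|wsample w (K (\1_(cell m j))) i - K (\1_(cell m j)) t| <= e / (m * m).+1%:R.
  move=> j; have j2 := @isL2_indic_cell R m j.
  exact: wsample_cvg (K_continuous j2) (HM _ j2) e1.
exists (\max_(j < m) n0 j)%N => N nN f f2 i t it.
have P2 := isL2_Pavg m f.
have d2 : isL2 (fun t => f t - Pavg m f t) by exact: isL2B.
have Kf : K f = (fun t => 1 * K (fun t => f t - Pavg m f t) t + K (Pavg m f) t).
  by rewrite -K_lin//; congr K; apply/funext => s; rewrite mul1r subrK.
have -> : wsample w (K f) i - K f t =
    (wsample w (K (fun t => f t - Pavg m f t)) i - K (fun t => f t - Pavg m f t) t)
    + (wsample w (K (Pavg m f)) i - K (Pavg m f) t).
  rewrite [in LHS]Kf (wsample_lin A1w i 1 (K_continuous d2) (K_continuous P2) (HM _ d2) (HM _ P2)).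
  by ring.
rewrite (le_trans (ler_normD _ _))// lerD//.
  rewrite (le_trans (ler_normB _ _))// -mulrA mulrDl mul1r lerD ?HM//.
  by apply: wsample_bound => //; [exact: K_continuous|exact: HM].
have -> : wsample w (K (Pavg m f)) i - K (Pavg m f) t =
    \sum_(j < m) tnth (avg m f) j *
      (wsample w (K (\1_(cell m j))) i - K (\1_(cell m j)) t).
  under eq_bigr do rewrite mulrBr.
  rewrite sumrB K_stepfun; congr (_ - _).
  rewrite (_ : K (Pavg m f) = (fun t => \sum_(j < m) tnth (avg m f) j * K (\1_(cell m j)) t)).
    have j2 (j : 'I_m) := @isL2_indic_cell R m j.
    exact: (wsample_sum A1w i _ (fun j => K_continuous (j2 j)) (fun j => HM _ (j2 j))).
  by apply/funext => s; exact: K_stepfun.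
rewrite (le_trans (ler_norm_sum _ _ _))//.
apply: (@le_trans _ _ (\sum_(j < m) m%:R * L2norm f * (e / (m * m).+1%:R))).
  apply: ler_sum => j _; rewrite normrM ler_pM//; first exact: le_tnth_avg.
  by apply: Hn => //; rewrite (leq_trans _ nN)// (leq_bigmax j).
rewrite sumr_const card_ord -mulr_natl.
rewrite [leLHS](_ : _ = e * L2norm f * ((m * m)%:R / (m * m).+1%:R)).
  rewrite ler_piMr ?mulr_ge0 ?(ltW e0) ?L2norm_ge0//.
  by rewrite ler_pdivrMr// mul1r ler_nat.
by rewrite natrM; ring.
Qed.

End fixed_operator.
End window_sampling.

(** * Minimizers and Euler-Lagrange equations *)

Section calculus.
Context {R : realType}.
Local Notation T := (measurableTypeR R).
Local Notation leb := (@lebesgue_measure R).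
Implicit Types (f df ddf phi : R -> R) (p h s t e P G L C : R) (F : R * R * R -> R).

Lemma is_derive_continuous f df : (forall x : R, is_derive x 1 f (df x)) -> continuous f.
Proof.
move=> fd t; apply: differentiable_continuous; apply/derivable1_diffP.
exact: (@ex_derive _ _ _ _ _ _ _ (fd t)).
Qed.

Lemma is_derive_line f df p h s : (forall x : R, is_derive x 1 f (df x)) ->
  is_derive s 1 (fun s => f (p + s * h)) (h * df (p + s * h)).
Proof.
move=> fd; have d1 : is_derive s 1 (fun s => p + s * h) h.
  by apply: is_derive_eq; rewrite /GRing.scale/=; ring.
have := @is_derive1_comp _ f (fun s => p + s * h) s _ _ (fd _) d1.
by rewrite mulrC.
Qed.

Lemma MVT_line f df p h : (forall x : R, is_derive x 1 f (df x)) ->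
  exists2 xi, `|xi - p| <= `|h| & f (p + h) - f p = df xi * h.
Proof.
move=> fd; have ld s := is_derive_line p h s fd.
have lc : {within `[0, 1], continuous (fun s => f (p + s * h))}.
  by apply: continuous_subspaceT; exact: is_derive_continuous ld.
have [s] := @MVT_segment R (fun s => f (p + s * h)) _ 0 1 ler01 (fun s _ => ld s) lc.
rewrite in_itv/= => /andP[s0 s1] E; exists (p + s * h).
  by rewrite addrC addKr normrM ger0_norm// ler_piMl.
by move: E; rewrite mul1r mul0r addr0 subr0 mulr1 mulrC.
Qed.

(** Rolle is applied to [f] along the segment minus the quadratic that agrees with it at both ends
    and has the same slope at 0; the mean value theorem for [df] then identifies the remainder. No
    continuity of [ddf] is used. *)
Lemma taylor2 f df ddf p h : (forall x : R, is_derive x 1 f (df x)) ->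
  (forall x : R, is_derive x 1 df (ddf x)) ->
  exists2 xi, `|xi - p| <= `|h| & f (p + h) - f p - df p * h = ddf xi / 2 * h ^+ 2.
Proof.
move=> fd dfd; pose c := f (p + h) - f p - df p * h.
pose g s := f (p + s * h) - (s * (df p * h) + s ^+ 2 * c).
have gd (s : R) : is_derive s 1 g (h * df (p + s * h) - (df p * h + 2 * s * c)).
  have := is_derive_line p h s fd => d1.
  by apply: is_derive_eq; rewrite /GRing.scale/=; ring.
have gc : {within `[0, 1], continuous g}.
  by apply: continuous_subspaceT; exact: is_derive_continuous gd.
have g01 : g 0 = g 1.
  by rewrite /g mul0r addr0 mul0r expr0n mul0r addr0 subr0 !mul1r expr1n mul1r /c; ring.
have [s] := @Rolle R g 0 1 ltr01 (fun s _ => @ex_derive _ _ _ _ _ _ _ (gd s)) gc g01.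
rewrite in_itv/= => /andP[s0 s1] ds.
have E : h * df (p + s * h) - (df p * h + 2 * s * c) = 0.
  by rewrite -(@derive_val _ _ _ _ _ _ _ (gd s)) (@derive_val _ _ _ _ _ _ _ ds).
have [xi xip E2] := MVT_line p (s * h) dfd.
exists xi; first by rewrite (le_trans xip)// normrM gtr0_norm// ler_piMl ?(ltW s1).
rewrite -/c; apply: (@mulfI _ (2 * s)); first by rewrite mulf_neq0 ?gt_eqF.
have E3 : df (p + s * h) = df p + ddf xi * (s * h) by rewrite -E2; ring.
by rewrite -[LHS]add0r -E E3; field.
Qed.

Lemma box_uniform F P G e : continuous F -> 0 < e ->
  exists2 d : R, 0 < d & forall p v t p' v' t' : R,
    `|p| <= P -> `|v| <= G -> 0 <= t <= 1 ->
    `|p - p'| < d -> `|v - v'| < d -> `|t - t'| < d ->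
    `|F (p, v, t) - F (p', v', t')| <= e.
Proof.
move=> cF e0.
have cA : compact ((`[- P, P] `*` `[- G, G]) `*` `[0, 1] : set (R * R * R)).
  by apply: compact_setX; [apply: compact_setX|]; exact: segment_compact.
have [d d0 H] := compact_uniform_continuity cA cF e0.
exists d => // p v t p' v' t' pP vG t01 pd vd td; apply: H.
  by split; [split|]; rewrite /= in_itv/= -?ler_norml.
by split; [split|].
Qed.

Lemma box_bounded F P G : continuous F ->
  exists2 B : R, 0 <= B & forall p v t : R,
    `|p| <= P -> `|v| <= G -> 0 <= t <= 1 -> `|F (p, v, t)| <= B.
Proof.
move=> cF.
have cA : compact ((`[- P, P] `*` `[- G, G]) `*` `[0, 1] : set (R * R * R)).
  by apply: compact_setX; [apply: compact_setX|]; exact: segment_compact.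
have cFA := continuous_compact (continuous_subspaceT cF) cA.
have [M [_ HM]] := compact_bounded cFA.
exists (`|M| + 1); first by rewrite addr_ge0.
move=> p v t pP vG t01; apply: (HM (`|M| + 1)).
  by rewrite (le_lt_trans (ler_norm _))// ltrDl.
exists (p, v, t) => //.
by split; [split|]; rewrite /= in_itv/= -?ler_norml.
Qed.

Lemma continuous_along F (a b : R -> R) : continuous F -> continuous a -> continuous b ->
  continuous (fun t => F (a t, b t, t)).
Proof.
move=> cF ca cb t.
apply: (@continuous_comp _ _ _ (fun t => (a t, b t, t)) F); last exact: cF.
have cab : (a x, b x) @[x --> t] --> (a t, b t).
  exact: (cvg_pair (ca t) (cb t)).
exact: (cvg_pair cab (@cvg_id _ (nbhs t))).
Qed.

(** Extracts the first-order condition at a minimum from a quadratic upper bound, so that nothing is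
    differentiated under the integral sign. *)
Lemma quad_min L C : (forall s, `|s| <= 1 -> 0 <= s * L + C * s ^+ 2) -> L = 0.
Proof.
move=> H; apply/eqP; rewrite -normr_eq0 eq_le normr_ge0 andbT leNgt; apply/negP => L0.
pose D : R := `|C| + `|L|.
have D0 : 0 < D by rewrite ltr_wpDl.
(* With $D=|C|+|L|$ the step stays below 1 in absolute value and the quadratic term stays below half
   of the linear one. *)
pose s : R := - L / (2 * D).
have L2 : `|L| * `|L| = L * L by rewrite -!expr2 real_normK// num_real.
have CD : C <= D by rewrite (le_trans (ler_norm _))// lerDl.
have LD : `|L| <= D by rewrite lerDr.
have s1 : `|s| <= 1.
  rewrite normrM normrN normfV (ger0_norm (_ : 0 <= 2 * D)) ?mulr_ge0 ?(ltW D0)//.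
  by rewrite ler_pdivrMr ?mulr_gt0// mul1r; lra.
have := H s s1; rewrite leNgt => /negP; apply.
have -> : s * L + C * s ^+ 2 = - (L * L) / (2 * D) * (1 - C / (2 * D)).
  by rewrite /s; field; rewrite gt_eqF.
have LL : 0 < L * L by rewrite -L2 mulr_gt0.
have DD : 0 < 2 * D by rewrite mulr_gt0.
rewrite mulNr mulNr oppr_lt0 mulr_gt0 ?(divr_gt0 LL)//.
by rewrite subr_gt0 ltr_pdivrMr ?mulr_gt0// mul1r; lra.
Qed.

Lemma isH1_C1 phi : periodic1 phi -> (forall t, derivable phi t 1) ->
  continuous (derive1 phi) -> isH1 phi (derive1 phi).
Proof.
move=> pphi dphi cphi.
have dd t : is_derive t 1 phi (derive1 phi t) by rewrite derive1E; exact: DeriveDef.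
have cc := is_derive_continuous dd.
split; [exact: isL2_continuous|exact: isL2_continuous|].
move=> psi ppsi dpsi cpsi.
have ddp t : is_derive t 1 psi (derive1 psi t) by rewrite derive1E; exact: DeriveDef.
have ccp := is_derive_continuous ddp.
have cM f1 f2 : continuous f1 -> continuous f2 -> continuous (fun t : R => f1 t * f2 t).
  by move=> c1 c2 t; apply: cvgM; [exact: c1|exact: c2].
apply/eqP; rewrite -subr_eq0 opprK; apply/eqP.
rewrite /L2inner -RintegralD//; first last.
- by apply: integrable_L2; apply: isL2_continuous; exact: cM.
- by apply: integrable_L2; apply: isL2_continuous; exact: cM.
have cd : continuous (fun t => phi t * derive1 psi t + derive1 phi t * psi t).
  by move=> t; apply: cvgD; exact: cM.
have ddd (t : R) : is_derive t 1 (fun t => phi t * psi t)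
    (phi t * derive1 psi t + derive1 phi t * psi t).
  have := dd t; have := ddp t => d1 d2.
  by apply: is_derive_eq; rewrite /GRing.scale/=; ring.
rewrite (Rintegral_FTC cd ddd ler01).
by rewrite -[1]add0r pphi ppsi subrr.
Qed.

Lemma riemann_sum N (c : 'I_N -> R) f e : (0 < N)%N -> isL2 f ->
  (forall (i : 'I_N) t, cell N i t -> `|c i - f t| <= e) ->
  `|N%:R^-1 * \sum_(i < N) c i - \int[leb]_(t in `[0, 1]) f t| <= e.
Proof.
move=> N0 f2 H; pose x : rvec R N := [tuple c i | i < N].
have -> : \sum_(i < N) c i = \sum_(i < N) tnth x i.
  by apply: eq_bigr => i _; rewrite tnth_mktuple.
rewrite -Rintegral_stepfun// -RintegralB//; last 2 first.
- by apply: integrable_L2; exact: isL2_stepfun.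
- exact: integrable_L2.
apply: le_Rintegral01.
  by apply: measurable_funB; [exact: measurable_stepfun|exact: isL2_measurable].
by move=> t /(cellP N0)[i it]; rewrite (stepfunE _ it) tnth_mktuple; exact: H.
Qed.

Lemma A4_continuous (Phi : R -> R -> R -> R) : A4 Phi ->
  continuous (fun x : R * R * R => Phi x.1.1 x.1.2 x.2).
Proof.
move=> [lip _ _ _] x; apply/cvgrPdist_le => e e0.
have [U xU HU] := lip x.
have [M [_ HM]] := HU.
pose k := `|M| + 1.
have k0 : 0 < k by rewrite ltr_wpDl.
have kM : M < k by rewrite (le_lt_trans (ler_norm _))// ltrDl.
have Ux : U x by exact: nbhs_singleton.
near=> y.
have Uy : U y by near: y.
have := HM k kM (x, y) (conj Ux Uy); rewrite /= => h.
apply: (le_trans h); rewrite -ler_pdivlMl//.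
near: y; have := @cvg_id _ (nbhs x) => /cvgrPdist_le; apply.
by rewrite mulr_gt0 ?invr_gt0.
Unshelve. all: by end_near. Qed.

End calculus.

(** * First-order conditions and regularity of minimizers *)

Section minimizers.
Context {R : realType}.
Local Notation T := (measurableTypeR R).
Local Notation leb := (@lebesgue_measure R).
Variables (w g : R -> R) (K Kst : (R -> R) -> (R -> R)) (Phi : R -> R -> R -> R).
Variables (rho h0 c : R).
Hypotheses (rho0 : 0 < rho) (A1w : A1 w) (A2K : A2 K Kst g) (A3P : A3 Phi g h0 c)
  (A4P : A4 Phi).
Implicit Types (f df h dh : R -> R) (p v t s e : R) (N m : nat).
Local Notation d1 := (partial1 1 Phi).
Local Notation d2 := (partial1 2 Phi).

Let KC : bounded_L2_C K. Proof. by case: A2K. Qed.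
Let KstC : bounded_L2_C Kst. Proof. by case: A2K. Qed.
Let gC : CS1 g. Proof. by case: A2K. Qed.

Lemma Phi_derive p v t : is_derive p 1 (fun q => Phi q v t) (d1 p v t).
Proof.
case: A4P => _ /(_ p v t)[D1 _] _ _.
have H : is_derive p 1 (fun q => Phi q v t) (derive1 (fun q => Phi q v t) p).
  by rewrite derive1E; exact: DeriveDef.
exact: H.
Qed.

Lemma d1_derive p v t : is_derive p 1 (fun q => d1 q v t) (d2 p v t).
Proof.
case: A4P => _ /(_ p v t)[_ D2] _ _.
have H : is_derive p 1 (derive1 (fun q => Phi q v t))
    (derive1 (derive1 (fun q => Phi q v t)) p).
  by rewrite [X in is_derive _ _ _ X]derive1E; exact: DeriveDef.
exact: H.
Qed.

Lemma Phi_taylor p v t s : exists2 xi, `|xi - p| <= `|s| &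
  Phi (p + s) v t - Phi p v t - d1 p v t * s = d2 xi v t / 2 * s ^+ 2.
Proof.
exact: (taylor2 p s (fun p => Phi_derive p v t) (fun p => d1_derive p v t)).
Qed.

Lemma Phi_taylor_le p v t s B : (forall xi, `|xi - p| <= `|s| -> `|d2 xi v t| <= B) ->
  Phi (p + s) v t <= Phi p v t + d1 p v t * s + B / 2 * s ^+ 2.
Proof.
move=> HB; have [xi xip E] := Phi_taylor p v t s.
have -> : Phi (p + s) v t = Phi p v t + d1 p v t * s + d2 xi v t / 2 * s ^+ 2.
  by rewrite -E; ring.
rewrite lerD2l ler_wpM2r ?sqr_ge0// ler_wpM2r//.
exact: le_trans (ler_norm _) (HB _ xip).
Qed.

Lemma d2_ge0 p v t : `|v - g t| <= h0 -> 0 <= d2 p v t.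
Proof. by case: A3P => _ _ /(_ p t (v - g t)) + vg => /(_ vg)[_]; rewrite addrC subrK. Qed.

(** Convexity in the first argument holds only for data values within [h0] of [g t], a range that
    contains the sampled data for [N] at least [N1]. *)
Lemma d1_monotone p q v t : `|v - g t| <= h0 -> 0 <= (d1 p v t - d1 q v t) * (p - q).
Proof.
move=> vg; have [xi _] := MVT_line q (p - q) (fun p => d1_derive p v t).
rewrite [q + _]addrC subrK => ->.
by rewrite -mulrA -expr2 mulr_ge0 ?sqr_ge0 ?d2_ge0.
Qed.

Let cd1 : continuous (fun x : R * R * R => d1 x.1.1 x.1.2 x.2).
Proof. by case: A4P. Qed.
Let cd2 : continuous (fun x : R * R * R => d2 x.1.1 x.1.2 x.2).
Proof. by case: A4P. Qed.
Let cPhi := A4_continuous A4P.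

Definition slope f t := d1 (K f t) (g t) t.
(** At the minimizer of [Psi] this is the weight [b] in [Q]. *)
Definition curv f t := d2 (K f t) (g t) t.

Lemma slope_continuous f : isL2 f -> continuous (slope f).
Proof.
by move=> f2; apply: (continuous_along cd1); [exact: K_continuous|case: gC].
Qed.

Lemma curv_continuous f : isL2 f -> continuous (curv f).
Proof.
by move=> f2; apply: (continuous_along cd2); [exact: K_continuous|case: gC].
Qed.

Lemma curv_ge0 f t : 0 <= curv f t.
Proof. by apply: d2_ge0; rewrite subrr normr0; case: A3P => /ltW. Qed.

Lemma Phi_integrable f : isL2 f ->
  leb.-integrable `[0, 1]%classic (EFin \o (fun t => Phi (K f t) (g t) t)).
Proof.
move=> f2; apply: integrable_L2; apply: isL2_continuous.
by apply: (continuous_along cPhi); [exact: K_continuous|case: gC].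
Qed.

Lemma K_bounds : exists2 C : R, 0 <= C & forall f, isL2 f ->
  (forall t, `|K f t| <= C * L2norm f) /\
  forall N (i : 'I_N), `|wsample w (K f) i| <= C * L2norm f.
Proof.
have [M M0 HM] := K_bound KC; have w0 := wnorm_ge0 w.
exists ((wnorm w + 1) * M); first by rewrite mulr_ge0// addr_ge0.
move=> f f2; rewrite -mulrA; have MM := mulr_ge0 M0 (L2norm_ge0 f); split=> [t|N i].
  by rewrite (le_trans (HM _ f2 t))// ler_peMl// lerDr.
rewrite (le_trans (wsample_bound A1w i (K_continuous KC f2) (HM _ f2)))//.
by rewrite ler_wpM2r// lerDl.
Qed.

Lemma isH1_lin a f df h dh : isH1 f df -> isH1 h dh ->
  isH1 (fun t => a * f t + h t) (fun t => a * df t + dh t).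
Proof.
move=> [f2 df2 fd] [h2 dh2 hd]; split; [exact: isL2_lin|exact: isL2_lin|].
move=> phi pp dp cp.
have p2 : isL2 phi.
  apply: isL2_continuous => t; apply: differentiable_continuous.
  by apply/derivable1_diffP; exact: dp.
rewrite !L2inner_linl//; last exact: isL2_continuous.
by rewrite fd// hd//; ring.
Qed.

Lemma energyE f df : isL2 f -> isL2 df ->
  \int[leb]_(t in `[0, 1]) (f t ^+ 2 + df t ^+ 2) = L2inner f f + L2inner df df.
Proof.
move=> f2 df2; by rewrite RintegralD//; exact: integrable_L2sqr.
Qed.

Section Euler_Lagrange.
Variables (ustar dustar : R -> R).
Hypothesis us : Psi_minimizer Phi K g rho ustar dustar.

Let us2 : isL2 ustar. Proof. by case: us => -[]. Qed.
Let dus2 : isL2 dustar. Proof. by case: us => -[]. Qed.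

(** The energy is exactly quadratic along [ustar + s h] and the data term is bounded by its tangent
    plus a quadratic term, so minimality has the form required by [quad_min]. *)
Lemma Euler_Lagrange h dh : isH1 h dh ->
  L2inner (slope ustar) (K h) + rho * (L2inner ustar h + L2inner dustar dh) = 0.
Proof.
move=> hH; have [h2 dh2 _] := hH; have [uH umin] := us.
have [C C0 HC] := K_bounds.
have [G G0 HG] := CS1_bounded gC.
(* For $|s|\le 1$ the intermediate points of the Taylor formula stay in this range, so one bound on
   the second derivative serves all [s]. *)
have [B B0 HB] := box_bounded (C * L2norm ustar + C * L2norm h) G cd2.
pose D := B / 2 * (C * L2norm h) ^+ 2 + rho / 2 * (L2inner h h + L2inner dh dh).
apply: (@quad_min _ _ D) => s s1.
have := umin _ _ (isH1_lin s hH uH); rewrite /Psi (K_lin KC)// -subr_ge0.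
have sl2 : isL2 (slope ustar) by apply: isL2_continuous; exact: slope_continuous.
have Kh2 := K_isL2 KC h2.
have le1 : \int[leb]_(t in `[0, 1]) Phi (s * K h t + K ustar t) (g t) t <=
    \int[leb]_(t in `[0, 1]) Phi (K ustar t) (g t) t + s * L2inner (slope ustar) (K h)
      + B / 2 * (C * L2norm h) ^+ 2 * s ^+ 2.
  have iP := Phi_integrable us2.
  have iS := integrable_L2M sl2 Kh2.
  have mI : measurable (`[0, 1]%classic : set T) by exact: measurable_itv.
  have iSs := integrable_realZ s mI iS.
  have iPS := integrable_realD mI iP iSs.
  have ic := integrable_L2 (@isL2_cst R (B / 2 * (C * L2norm h) ^+ 2 * s ^+ 2)).
  rewrite /L2inner -RintegralZl// -RintegralD//.
  have -> : B / 2 * (C * L2norm h) ^+ 2 * s ^+ 2 =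
      \int[leb]_(t in `[0, 1]) (B / 2 * (C * L2norm h) ^+ 2 * s ^+ 2).
    rewrite Rintegral_cst// [X in fine X]lebesgue_measure_itv/= lte_fin ltr01.
    by rewrite oppr0 adde0 mulr1.
  rewrite -RintegralD//; apply: le_Rintegral => //.
  - have := Phi_integrable (isL2_lin s h2 us2); apply: eq_integrable => // t _ /=.
    by rewrite (K_lin KC).
  - exact: integrable_realD.
  move=> t; rewrite /= in_itv/= => t01.
  have Kht := (HC _ h2).1 t; have Kut := (HC _ us2).1 t.
  have sK : `|s * K h t| <= C * L2norm h by rewrite normrM (le_trans _ Kht)// ler_piMl.
  rewrite [s * K h t + _]addrC; apply: (le_trans (@Phi_taylor_le _ _ _ _ B _)).
    move=> xi xip; apply: (HB xi) => //.
    rewrite -(subrK (K ustar t) xi) (le_trans (ler_normD _ _))// addrC lerD//.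
    exact: le_trans xip sK.
  rewrite -/(slope ustar t) (_ : slope ustar t * (s * K h t) = s * (slope ustar t * K h t));
    last by ring.
  rewrite lerD2l exprMn [s ^+ 2 * _]mulrC mulrA ler_wpM2r ?sqr_ge0//.
  rewrite ler_wpM2l ?divr_ge0//.
  by rewrite -(real_normK (num_real (K h t))) lerXn2r ?nnegrE// mulr_ge0 ?L2norm_ge0.
rewrite !energyE//; try exact: isL2_lin.
rewrite !(L2inner_linl s) ?(L2inner_linr s)//; try exact: isL2_lin.
rewrite (L2innerC h ustar) (L2innerC dh dustar) /D => H.
lra.
Qed.

(** The second derivative dictated by the Euler-Lagrange equation: [rho] times the difference of
    [ustar] and its second derivative is minus [Kst] of the slope. *)
Definition ddustar t := ustar t + rho^-1 * Kst (slope ustar) t.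

Let slope2 : isL2 (slope ustar).
Proof. by apply: isL2_continuous; exact: slope_continuous. Qed.

Let adj h : isL2 h -> L2inner (slope ustar) (K h) = L2inner (Kst (slope ustar)) h.
Proof. by move=> h2; rewrite L2innerC [RHS]L2innerC; case: A2K => _ _ + _; apply. Qed.

(** Regularity comes at once: tested against periodic C1 functions, the Euler-Lagrange equation says
    exactly that [dustar] has weak derivative [ddustar]. *)
Lemma minimizer_H2 : isH2 ustar dustar ddustar.
Proof.
have Ks2 := K_isL2 KstC slope2.
have dd2 : isL2 ddustar by apply: isL2D => //; exact: isL2Z.
case: us => uH _; split=> //; split=> // phi pp dp cp.
have pH := isH1_C1 pp dp cp; have [p2 dp2 _] := pH.
have := Euler_Lagrange pH; rewrite adj// => E.
rewrite /ddustar L2innerDl//; last exact: isL2Z.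
rewrite L2innerZl//.
apply: (@mulfI _ rho); first by rewrite gt_eqF.
rewrite mulrN mulrDr mulVKf ?gt_eqF//; lra.
Qed.

Lemma rho_residual h : isL2 h ->
  rho * L2inner (fun t => ustar t - ddustar t) h = - L2inner (slope ustar) (K h).
Proof.
move=> h2; have Ks2 := K_isL2 KstC slope2.
rewrite adj// (_ : (fun t => _) = (fun t => - rho^-1 * Kst (slope ustar) t)).
  by rewrite L2innerZl// mulrA mulrN divff ?gt_eqF// mulN1r.
by apply/funext => t; rewrite /ddustar; ring.
Qed.

Lemma KN_lin N a (x y : rvec R N) i : KN K w (lin_rvec a x y) i = a * KN K w x i + KN K w y i.
Proof.
have [C _ HC] := K_bounds.
have x2 := isL2_stepfun x; have y2 := isL2_stepfun y.
rewrite /KN stepfun_lin (K_lin KC)//.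
by apply: (wsample_lin A1w); [exact: K_continuous|exact: K_continuous|
  exact: (HC _ x2).1|exact: (HC _ y2).1].
Qed.

Lemma PsiNE N (x : rvec R N) : (0 < N)%N -> PsiN Phi K w g rho x =
  N%:R^-1 * \sum_(i < N) Phi (KN K w x i) (wsample w g i) (grid i) + rho / 2 * AN x x.
Proof.
move=> N0; rewrite /PsiN /AN invfM !mulrA.
by do 2 congr (_ + _); apply: eq_bigr => i _; rewrite !expr2.
Qed.

Lemma grid01 N (i : 'I_N) : 0 <= (grid i : R) <= 1.
Proof.
have N0 : 0 < N%:R :> R by rewrite ltr0n (leq_trans _ (ltn_ord i)).
by rewrite /grid divr_ge0//= ler_pdivrMr// mul1r ler_nat ltnW.
Qed.

Definition dslope N (u : rvec R N) (i : 'I_N) : R :=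
  d1 (KN K w u i) (wsample w g i) (grid i).

Lemma discrete_Euler_Lagrange N (u z : rvec R N) : (0 < N)%N ->
  PsiN_minimizer Phi K w g rho u ->
  N%:R^-1 * \sum_(i < N) dslope u i * KN K w z i + rho * AN u z = 0.
Proof.
move=> N0 umin.
(* A sum of absolute values bounds each of its terms; the size of the bound does not matter, since
   only the linear term survives [quad_min]. *)
pose P : R := \sum_(i < N) (`|KN K w u i| + `|KN K w z i|).
pose G : R := \sum_(i < N) `|wsample w g i|.
have [B B0 HB] := box_bounded P G cd2.
pose D := N%:R^-1 * \sum_(i < N) (B / 2 * KN K w z i ^+ 2) + rho / 2 * AN z z.
apply: (@quad_min _ _ D) => s s1.
have := umin (lin_rvec s z u); rewrite !PsiNE// AN_linl !AN_linr (ANC z u).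
have le1 : \sum_(i < N) Phi (KN K w (lin_rvec s z u) i) (wsample w g i) (grid i) <=
  \sum_(i < N) Phi (KN K w u i) (wsample w g i) (grid i) +
    s * \sum_(i < N) dslope u i * KN K w z i +
    s ^+ 2 * \sum_(i < N) (B / 2 * KN K w z i ^+ 2).
  rewrite !mulr_sumr -!big_split/=; apply: ler_sum => i _.
  rewrite KN_lin [s * _ + KN _ _ _ _]addrC; apply: (le_trans (@Phi_taylor_le _ _ _ _ B _)).
    move=> xi xip; apply: (HB xi (wsample w g i) (grid i)); last exact: grid01.
    - rewrite -(subrK (KN K w u i) xi) (le_trans (ler_normD _ _))// addrC.
      rewrite (@le_trans _ _ (`|KN K w u i| + `|KN K w z i|))//.
        by rewrite lerD2l (le_trans xip)// normrM ler_piMl.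
      rewrite /P (bigD1 i)//= lerDl; apply: sumr_ge0 => j _.
      by rewrite addr_ge0.
    - by rewrite /G (bigD1 i)//= lerDl; apply: sumr_ge0.
  by rewrite -/(dslope u i) le_eqVlt; apply/orP; left; apply/eqP; ring.
have iN : 0 <= N%:R^-1 :> R by rewrite invr_ge0.
have := ler_wpM2l iN le1; rewrite !mulrDr /D => H1 H2.
lra.
Qed.

End Euler_Lagrange.
End minimizers.

(** * Convergence of discrete minimizers and of the potentials *)

Section minimizer_cvg.
Context {R : realType}.
Local Notation T := (measurableTypeR R).
Local Notation leb := (@lebesgue_measure R).
Variables (w g : R -> R) (K Kst : (R -> R) -> (R -> R)) (Phi : R -> R -> R -> R).
Variables (rho h0 c : R).
Hypotheses (rho0 : 0 < rho) (A1w : A1 w) (A2K : A2 K Kst g) (A3P : A3 Phi g h0 c)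
  (A4P : A4 Phi).
Implicit Types (f df h dh : R -> R) (p v t s e M : R) (N m : nat).
Local Notation d1 := (partial1 1 Phi).
Local Notation d2 := (partial1 2 Phi).

Let KC : bounded_L2_C K. Proof. by case: A2K. Qed.
Let gC : CS1 g. Proof. by case: A2K. Qed.
Let cd1 : continuous (fun x : R * R * R => d1 x.1.1 x.1.2 x.2).
Proof. by case: A4P. Qed.
Let cd2 : continuous (fun x : R * R * R => d2 x.1.1 x.1.2 x.2).
Proof. by case: A4P. Qed.

Lemma sqrtV_small (D e : R) : 0 < e -> exists m0, forall m, (m0 <= m)%N ->
  D * Num.sqrt (m%:R^-1) <= e.
Proof.
move=> e0; have D1 : 0 < `|D| + 1 by rewrite ltr_wpDl.
have k0 : 0 < (e / (`|D| + 1)) ^+ 2 by rewrite exprn_gt0 ?divr_gt0.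
have [m0 m00 H] := exists_natV_le k0; exists m0 => m mm.
have sk : Num.sqrt (m%:R^-1) <= e / (`|D| + 1).
  rewrite -[leRHS]ger0_norm ?divr_ge0 ?(ltW e0) ?(ltW D1)// -sqrtr_sqr.
  by rewrite ler_wsqrtr// H.
apply: (@le_trans _ _ ((`|D| + 1) * (e / (`|D| + 1)))).
  apply: (@le_trans _ _ ((`|D| + 1) * Num.sqrt (m%:R^-1))).
    by rewrite ler_wpM2r ?sqrtr_ge0// (le_trans (ler_norm D))// lerDl.
  by rewrite ler_wpM2l ?(ltW D1).
by rewrite mulrCA divff ?gt_eqF// mulr1.
Qed.

Lemma grid_cell N (i : 'I_N) : cell N i (grid i : R).
Proof.
have N0 : 0 < N%:R :> R by rewrite ltr0n (leq_trans _ (ltn_ord i)).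
by rewrite /cell/= in_itv/= /grid lexx/= ltr_pM2r ?invr_gt0// ltr_nat.
Qed.

Lemma data_cvg (P : R) (F : R * R * R -> R) (e : R) : continuous F -> 0 < e ->
  exists2 d : R, 0 < d & exists N0, forall N, (N0 <= N)%N ->
  forall (i : 'I_N) t p q, cell N i t -> `|p| <= P -> `|p - q| < d ->
    `|F (p, g t, t) - F (q, wsample w g i, grid i)| <= e.
Proof.
move=> cF e0; have [G0 _ HG] := CS1_bounded gC.
have [d' d0 Hd] := box_uniform P G0 cF e0.
exists d' => //.
have d2 : 0 < d' / 2 by rewrite divr_gt0.
have [N2 H2] := wsample_cvg A1w gC.1 HG d2.
have [N3 _ H3] := exists_natV_le d2.
have dd : d' / 2 < d' by rewrite ltr_pdivrMr// ltr_pMr// ltr1n.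
exists (maxn N2 N3) => N; rewrite geq_max => /andP[n2 n3] i t p q it pP pq.
have /andP[t0 /ltW t1] := cell01 it.
apply: Hd => //; first by rewrite t0 t1.
  by rewrite distrC (le_lt_trans (H2 N n2 i t it)).
by rewrite (le_lt_trans (cell_dist it (grid_cell i)))// (le_lt_trans (H3 N n3)).
Qed.

Lemma KN_cvg (v : forall N, rvec R N) f : isL2 f ->
  (forall e, 0 < e -> exists N0, forall N, (N0 <= N)%N ->
    L2norm (fun t => stepfun (v N) t - f t) <= e) ->
  forall e, 0 < e -> exists N0, forall N, (N0 <= N)%N ->
  forall (i : 'I_N) t, cell N i t -> `|KN K w (v N) i - K f t| <= e.
Proof.
move=> f2 vf e e0; have [C C0 HC] := K_bounds A1w A2K.
have C1 : 0 < C + 1 by rewrite ltr_wpDl.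
have e1 : 0 < e / 2 / (C + 1) by rewrite !divr_gt0.
have e2 : 0 < e / 2 by rewrite divr_gt0.
have [N2 H2] := vf _ e1.
have [N3 H3] := wsample_cvg A1w (K_continuous KC f2) (HC _ f2).1 e2.
exists (maxn N2 N3) => N; rewrite geq_max => /andP[n2 n3] i t it.
have v2 := isL2_stepfun (v N).
have d2 : isL2 (fun t => stepfun (v N) t - f t) by exact: isL2B.
have E : KN K w (v N) i = wsample w (K (fun t => stepfun (v N) t - f t)) i + wsample w (K f) i.
  rewrite -[X in X + _]mul1r.
  rewrite -(wsample_lin A1w i 1 (K_continuous KC d2) (K_continuous KC f2) (HC _ d2).1 (HC _ f2).1).
  rewrite -(K_lin KC)//; congr wsample; congr K; apply/funext => s.
  by rewrite mul1r subrK.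
rewrite E -addrA (le_trans (ler_normD _ _))// [leRHS]splitr lerD ?H3//.
rewrite (le_trans ((HC _ d2).2 _ _))//.
apply: (@le_trans _ _ ((C + 1) * (e / 2 / (C + 1)))); last first.
  by rewrite mulrCA divff ?gt_eqF// mulr1.
by rewrite ler_pM ?L2norm_ge0 ?H2// lerDl.
Qed.

Variables (u : forall N, rvec R N) (ustar dustar : R -> R) (N1 : nat).
Hypotheses (N10 : (0 < N1)%N)
  (gN : forall N, (N1 <= N)%N -> forall i : 'I_N, `|wsample w g i - g (grid i)| <= h0)
  (umin : forall N, (N1 <= N)%N -> PsiN_minimizer Phi K w g rho (u N))
  (us : Psi_minimizer Phi K g rho ustar dustar).

Let us2 : isL2 ustar. Proof. by case: us => -[]. Qed.
Let al := slope g K Phi ustar.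

(** Consistency: sampled values of [ustar] nearly solve the discrete Euler-Lagrange equation. The
    residual is measured relative to the energy norm of the test vector, so that it can be absorbed
    by the coercive term in [minimizer_cvg]. *)
Lemma sampled_residual (v : forall N, rvec R N) :
  (forall N, (0 < N)%N ->
    L2norm (fun t => stepfun (v N) t - ustar t) <= Num.sqrt N%:R^-1 * L2norm dustar /\
    forall z : rvec R N, `|AN (v N) z - L2inner
       (fun t => ustar t - ddustar g K Kst Phi rho ustar t) (stepfun z)|
      <= Num.sqrt N%:R^-1 * (L2norm dustar + L2norm (ddustar g K Kst Phi rho ustar))
         * Num.sqrt (AN z z)) ->
  forall e, 0 < e -> exists N0, forall N, (N0 <= N)%N -> forall z : rvec R N,
    `|N%:R^-1 * \sum_(i < N) dslope w g K Phi (v N) i * KN K w z i + rho * AN (v N) z|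
      <= e * Num.sqrt (AN z z).
Proof.
move=> Hv e e0; have [C C0 HC] := K_bounds A1w A2K.
have vcvg e' : 0 < e' -> exists N0, forall N, (N0 <= N)%N ->
    L2norm (fun t => stepfun (v N) t - ustar t) <= e'.
  move=> e'0; have [N2 H2] := sqrtV_small (L2norm dustar) e'0.
  exists (maxn 1 N2) => N; rewrite geq_max => /andP[N0 n2].
  by rewrite (le_trans (Hv N N0).1)// mulrC H2.
have [A A0 HA] : exists2 A : R, 0 <= A & forall t, 0 <= t <= 1 -> `|al t| <= A.
  have [G _ HG] := CS1_bounded gC.
  have [A A0 HA] := box_bounded (C * L2norm ustar) G cd1.
  exists A => // t t01; apply: (HA (K ustar t) (g t) t) => //.
  exact: (HC _ us2).1.
have [C1 C10 HC1] := wsample_K KC A1w.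
(* The four shares go to the error in the slope, the window error on the tail of [z], the window
   error on its averages, and the residual of the discrete energy. *)
have e4 : 0 < e / 4 by rewrite divr_gt0.
have CC : 0 < C + 1 by rewrite ltr_wpDl.
have AA : 0 < A + 1 by rewrite ltr_wpDl.
have [d d0 [N2 H2]] := data_cvg (C * L2norm ustar) cd1 (divr_gt0 e4 CC).
have d20 : 0 < d / 2 by rewrite divr_gt0.
have dd : d / 2 < d by rewrite ltr_pdivrMr// ltr_pMr// ltr1n.
have [N3 H3] := KN_cvg us2 vcvg d20.
(* Chooses [m] so that the tail of [z], at most $\sqrt{2/m}$ times its energy norm, costs one
   share. *)
have [m0 Hm] := sqrtV_small (A * C1 * Num.sqrt 2) e4.
pose m := maxn 1 m0.
have m1 : (0 < m)%N by rewrite /m leq_max.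
have [N4 H4] := HC1 m _ (divr_gt0 e4 AA).
pose D := rho * (L2norm dustar + L2norm (ddustar g K Kst Phi rho ustar)).
have [N5 H5] := sqrtV_small D e4.
exists (maxn N2 (maxn N3 (maxn N4 (maxn N5 m)))) => N.
rewrite !geq_max => /and5P[n2 n3 n4 n5 mm] z.
have mN : (m <= N)%N by rewrite /m geq_max mm.
have N0 : (0 < N)%N by exact: leq_trans m1 mN.
have z2 := isL2_stepfun z; have zS := L2norm_stepfun_le z.
set S := Num.sqrt (AN z z) in zS *.
have S0 : 0 <= S by exact: sqrtr_ge0.
pose be := K (stepfun z).
have mm0 : (m0 <= m)%N by rewrite /m leq_max leqnn orbT.
have zP : A * (C1 * L2norm (fun t => stepfun z t - Pavg m (stepfun z) t)) <= e / 4 * S.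
  rewrite mulrA; apply: (@le_trans _ _ (A * C1 * (Num.sqrt 2 * Num.sqrt (m%:R^-1) * S))).
    rewrite ler_wpM2l ?mulr_ge0// (le_trans (L2norm_stepfun_Pavg z m1 mN))//.
    by rewrite sqrtrM ?divr_ge0// sqrtrM.
  by rewrite !mulrA ler_wpM2r// Hm.
have riem : `|N%:R^-1 * \sum_(i < N) dslope w g K Phi (v N) i * KN K w z i
    - L2inner al be| <= e / 4 * S + (e / 4 * S + e / 4 * S).
  apply: riemann_sum => //.
    apply: isL2_continuous => t; apply: cvgM.
      exact: (slope_continuous A2K A4P us2).
    exact: (K_continuous KC z2).
  move=> i t it; set a := dslope _ _ _ _ _ i; set b := KN _ _ _ i.
  have -> : a * b - al t * be t = (a - al t) * b + al t * (b - be t) by ring.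
  have /andP[t0 /ltW t1] := cell01 it.
  have bS : `|b| <= C * S.
    by rewrite (le_trans ((HC _ z2).2 N i))// ler_wpM2l.
  have aal : `|a - al t| <= e / 4 / (C + 1).
    rewrite distrC; apply: (H2 N n2 i t (K ustar t) (KN K w (v N) i) it).
      exact: (HC _ us2).1.
    by rewrite distrC (le_lt_trans (H3 N n3 i t it)).
  rewrite (le_trans (ler_normD _ _))// [`|(a - _) * b|]normrM [`|al t * _|]normrM lerD//.
    apply: (@le_trans _ _ (e / 4 / (C + 1) * ((C + 1) * S))).
      by apply: ler_pM => //; rewrite (le_trans bS)// ler_wpM2r// lerDl.
    by rewrite mulrA divfK ?gt_eqF.
  apply: (@le_trans _ _ (A * (C1 * L2norm (fun t => stepfun z t - Pavg m (stepfun z) t)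
      + e / 4 / (A + 1) * L2norm (stepfun z)))).
    by apply: ler_pM => //; [apply: HA; rewrite t0 t1|exact: H4].
  rewrite mulrDr lerD//.
  apply: (@le_trans _ _ ((A + 1) * (e / 4 / (A + 1) * S))); last first.
    by rewrite mulrA [(A + 1) * _]mulrC divfK ?gt_eqF.
  apply: ler_pM; rewrite ?lerDl//; last by rewrite ler_wpM2l// !divr_ge0 ?(ltW e0) ?(ltW AA).
  by rewrite mulr_ge0 ?L2norm_ge0// !divr_ge0 ?(ltW e0) ?(ltW AA).
have res : `|rho * AN (v N) z + L2inner al be| <= e / 4 * S.
  have E := rho_residual rho0 A2K A4P us z2.
  have -> : rho * AN (v N) z + L2inner al be = rho * (AN (v N) z -
      L2inner (fun t => ustar t - ddustar g K Kst Phi rho ustar t) (stepfun z)).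
    by rewrite mulrBr E opprK.
  rewrite normrM gtr0_norm//.
  apply: (le_trans (ler_wpM2l (ltW rho0) ((Hv N N0).2 z))).
  rewrite -/S mulrA ler_wpM2r// mulrCA mulrC; exact: H5.
have -> : N%:R^-1 * (\sum_(i < N) dslope w g K Phi (v N) i * KN K w z i) + rho * AN (v N) z =
  (N%:R^-1 * (\sum_(i < N) dslope w g K Phi (v N) i * KN K w z i) - L2inner al be)
  + (rho * AN (v N) z + L2inner al be) by ring.
rewrite (le_trans (ler_normD _ _))// (le_trans (lerD riem res))//; lra.
Qed.

Lemma minimizer_cvg e : 0 < e -> exists N0, forall N, (N0 <= N)%N ->
  L2norm (fun t => stepfun (u N) t - ustar t) <= e.
Proof.
move=> e0.
have aux (X Y a b : R) : Y + rho * b = 0 -> 0 <= X - Y -> rho * a - rho * b <= X + rho * a.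
  by lra.
have [v Hv] := H2_sample (minimizer_H2 rho0 A1w A2K A4P us).
have e2 : 0 < e / 2 by rewrite divr_gt0.
(* With this tolerance, dividing by [rho] and by the energy norm of the difference leaves
   [e / 2]. *)
have [N2 H2] := sampled_residual Hv (mulr_gt0 rho0 e2).
have [N3 H3] := sqrtV_small (L2norm dustar) e2.
exists (maxn N1 (maxn N2 N3)) => N; rewrite !geq_max => /and3P[n1 n2 n3].
have N0 : (0 < N)%N by exact: leq_trans N10 n1.
(* The difference of the sampled minimizer and the discrete one is the test vector for both
   equations; the data terms then differ by a nonnegative amount by monotonicity, and only its
   energy remains. *)
pose z := lin_rvec (-1) (u N) (v N).
have EL := discrete_Euler_Lagrange A1w A2K A4P z N0 (umin n1).
have HN := H2 N n2 z.
have Azz : AN z z = AN (v N) z - AN (u N) z.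
  by rewrite {1}/z AN_linl; ring.
have KNz i : KN K w z i = KN K w (v N) i - KN K w (u N) i.
  by rewrite /z (KN_lin A1w A2K); ring.
have mono : 0 <= N%:R^-1 * \sum_(i < N) dslope w g K Phi (v N) i * KN K w z i -
    N%:R^-1 * \sum_(i < N) dslope w g K Phi (u N) i * KN K w z i.
  rewrite -mulrBr -sumrB mulr_ge0 ?invr_ge0//; apply: sumr_ge0 => i _.
  by rewrite -mulrBl KNz; apply: (d1_monotone A3P A4P); exact: gN.
have zS := L2norm_stepfun_le z.
have AS : AN z z = Num.sqrt (AN z z) ^+ 2 by rewrite sqr_sqrtr// AN_ge0.
set S := Num.sqrt (AN z z) in zS AS HN.
have S0 : 0 <= S by exact: sqrtr_ge0.
have leS : rho * S ^+ 2 <= rho * (e / 2) * S.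
  rewrite -AS Azz mulrBr (le_trans _ HN)// (le_trans _ (ler_norm _))//.
  exact: aux EL mono.
have Se : S <= e / 2.
  have [S00|Sp] := eqVneq S 0; first by rewrite S00 ltW.
  have S1 : 0 < S by rewrite lt_def Sp.
  by move: leS; rewrite -mulrA ler_pM2l// expr2 ler_pM2r.
have u2 := isL2_stepfun (u N); have v2 := isL2_stepfun (v N).
rewrite (le_trans (ler_L2normB u2 us2 v2))// [leRHS]splitr lerD//.
  rewrite L2normBC//; apply: le_trans Se; apply: le_trans zS.
  by rewrite /z stepfun_lin le_eqVlt; apply/orP; left; apply/eqP; congr L2norm;
     apply/funext => t; rewrite mulN1r addrC.
by rewrite (le_trans (Hv N N0).1)// mulrC H3.
Qed.

Lemma add_rvecE N (x y : rvec R N) : add_rvec x y = lin_rvec 1 y x.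
Proof. by apply: eq_from_tnth => i; rewrite !tnth_mktuple mul1r addrC. Qed.

(* [linear_rvec] is stated for [lin_rvec], so homogeneity is read off [(a - 1) x + x]. *)
Lemma scale_rvecE N a (x : rvec R N) : scale_rvec a x = lin_rvec (a - 1) x x.
Proof. by apply: eq_from_tnth => i; rewrite !tnth_mktuple mulrBl mul1r subrK. Qed.

Lemma linear_scale N (l : rvec R N -> R) a x : linear_rvec l -> l (scale_rvec a x) = a * l x.
Proof. by move=> ll; rewrite scale_rvecE ll mulrBl mul1r subrK. Qed.

Lemma AN_scale N a (x : rvec R N) : AN (scale_rvec a x) (scale_rvec a x) = a ^+ 2 * AN x x.
Proof.
rewrite (linear_scale a x (AN_linl (scale_rvec a x))) (linear_scale a x (AN_linr x)).
by rewrite mulrA.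
Qed.

Variable tau : nat -> R.
Hypotheses (tau0 : forall N, 0 < tau N) (tauoo : tau @ \oo --> +oo).

Definition scaled N (x : rvec R N) := scale_rvec (Num.sqrt (tau N)) x.

(* The density of [mud N] is proportional to [exp (- VN x)] times the Gaussian
   density [exp (- rho AN (scaled x) (scaled x) / 2)]; [WN] is the limit of [VN]. *)
Definition VN N (x : rvec R N) : R :=
  tau N * (PsiN Phi K w g rho (add_rvec (u N) x) - PsiN Phi K w g rho (u N))
  - rho / 2 * AN (scaled x) (scaled x).

Definition WN N (x : rvec R N) : R :=
  2^-1 * \int[leb]_(t in `[0, 1]) (curv g K Phi ustar t * K (stepfun x) t ^+ 2).

(** The linear terms cancel by the discrete Euler-Lagrange equation, the energy is subtracted
    exactly, and [tau N] turns the squares of [x] into squares of [scaled x]. Undoing the scaling in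
    the displacement gives the factor $1/\sqrt{\tau_N}$, which drives the intermediate points to the
    minimizer. *)
Lemma VNE N (x : rvec R N) : (N1 <= N)%N ->
  exists2 xi : 'I_N -> R,
    (forall i, `|xi i - KN K w (u N) i| <= `|KN K w (scaled x) i| / Num.sqrt (tau N)) &
    VN x = N%:R^-1 * \sum_(i < N)
      (d2 (xi i) (wsample w g i) (grid i) / 2 * KN K w (scaled x) i ^+ 2).
Proof.
move=> n1; have N0 : (0 < N)%N by exact: leq_trans N10 n1.
have st0 : 0 < Num.sqrt (tau N) by rewrite sqrtr_gt0.
have KX i : KN K w (scaled x) i = Num.sqrt (tau N) * KN K w x i.
  rewrite /scaled; apply: (linear_scale _ _ (fun a y z => KN_lin A1w A2K a y z i)).
have /choice[xi Hxi] : forall i : 'I_N, exists xi : R,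
    `|xi - KN K w (u N) i| <= `|KN K w x i| /\
    Phi (KN K w (u N) i + KN K w x i) (wsample w g i) (grid i)
    - Phi (KN K w (u N) i) (wsample w g i) (grid i)
    - dslope w g K Phi (u N) i * KN K w x i =
    d2 xi (wsample w g i) (grid i) / 2 * KN K w x i ^+ 2.
  move=> i; have [y y1 y2] := Phi_taylor A4P (KN K w (u N) i) (wsample w g i) (grid i) (KN K w x i).
  by exists y.
exists xi => [i|].
  rewrite KX normrM gtr0_norm// mulrC mulrA mulVf ?gt_eqF// mul1r.
  by case: (Hxi i).
have EL := discrete_Euler_Lagrange A1w A2K A4P x N0 (umin n1).
rewrite /VN !PsiNE// add_rvecE AN_linl !AN_linr (ANC x (u N)) /scaled AN_scale.
rewrite sqr_sqrtr ?(ltW (tau0 N))//.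
under eq_bigr do rewrite (KN_lin A1w A2K) mul1r addrC.
have -> : \sum_(i < N) (d2 (xi i) (wsample w g i) (grid i) / 2 *
    KN K w (scale_rvec (Num.sqrt (tau N)) x) i ^+ 2) =
  tau N * (\sum_(i < N) Phi (KN K w (u N) i + KN K w x i) (wsample w g i) (grid i)
    - \sum_(i < N) Phi (KN K w (u N) i) (wsample w g i) (grid i)
    - \sum_(i < N) dslope w g K Phi (u N) i * KN K w x i).
  rewrite -!sumrB mulr_sumr; apply: eq_bigr => i _; case: (Hxi i) => _ ->.
  rewrite -/(scaled x) KX exprMn sqr_sqrtr ?(ltW (tau0 N))//; ring.
have aux (n t r A B D p q s : R) : n * D + r * p = 0 ->
  t * (n * A + r / 2 * (1 * (1 * q + p) + (1 * p + s)) - (n * B + r / 2 * s)) - r / 2 * (t * q)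
   = n * (t * (A - B - D)).
  move=> E; have -> : n * (t * (A - B - D)) = t * (n * A - n * B - n * D) by ring.
  have -> : n * D = - (r * p) by apply/eqP; rewrite -addr_eq0 E.
  by field.
exact: aux EL.
Qed.

Lemma VN_ge0 N (x : rvec R N) : (N1 <= N)%N -> 0 <= VN x.
Proof.
move=> n1; have [xi _ ->] := VNE x n1.
rewrite mulr_ge0 ?invr_ge0//; apply: sumr_ge0 => i _.
by rewrite mulr_ge0 ?sqr_ge0// divr_ge0//; apply: (d2_ge0 A3P); exact: gN.
Qed.

Lemma WN_ge0 N (x : rvec R N) : 0 <= WN x.
Proof.
rewrite mulr_ge0 ?invr_ge0//; apply: Rintegral_ge0 => t _.
by rewrite mulr_ge0 ?sqr_ge0//; exact: (curv_ge0 K A3P).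
Qed.

(** The threshold [d] is fixed before [m]: [gap_small] chooses [m] in terms of [d], so that tails
    exceeding [d] carry little mass, and only then lets [N] grow. *)
Lemma VN_close M e : 0 <= M -> 0 < e -> exists2 d : R, 0 < d &
  forall m, exists N0, forall N, (N0 <= N)%N -> forall x : rvec R N,
    L2norm (stepfun (scaled x)) <= M ->
    L2norm (fun t => stepfun (scaled x) t - Pavg m (stepfun (scaled x)) t) <= d ->
    `|VN x - WN (scaled x)| <= e.
Proof.
move=> M0 e0; have [C C0 HC] := K_bounds A1w A2K.
have [C1 C10 HC1] := wsample_K KC A1w.
have [B B0 HB] : exists2 B : R, 0 <= B &
    forall t, 0 <= t <= 1 -> `|curv g K Phi ustar t| <= B.
  have [G _ HG] := CS1_bounded gC.
  have [A A0 HA] := box_bounded (C * L2norm ustar) G cd2.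
  exists A => // t t01; apply: (HA (K ustar t) (g t) t) => //.
  exact: (HC _ us2).1.
pose Cx := C * M.
have Cx0 : 0 <= Cx by rewrite mulr_ge0.
have e3 : 0 < e / 3 by rewrite divr_gt0.
(* The factors in front of the tail, of the window error and of the error in the curvature, each
   enlarged by 1 to be positive; each error receives [e / 3]. *)
have D1 : 0 < B * Cx * C1 + 1 by rewrite ltr_wpDl// !mulr_ge0.
have D2 : 0 < B * Cx * M + 1 by rewrite ltr_wpDl// !mulr_ge0.
have D3 : 0 < Cx ^+ 2 + 1 by rewrite ltr_wpDl// sqr_ge0.
have small (a b : R) : 0 <= a -> 0 < b -> a * (b / (a + 1)) <= b.
  move=> a0 b0; rewrite mulrCA ler_piMr ?(ltW b0)// ler_pdivrMr ?ltr_wpDl//.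
  by rewrite mul1r lerDl.
exists (e / 3 / (B * Cx * C1 + 1)); first by rewrite divr_gt0.
move=> m.
have [d d0 [N2 H2]] := data_cvg (C * L2norm ustar) cd2 (divr_gt0 e3 D3).
have d20 : 0 < d / 2 by rewrite divr_gt0.
have [N3 H3] := KN_cvg us2 minimizer_cvg d20.
have [N4 H4] := HC1 m _ (divr_gt0 e3 D2).
(* This bounds the displacement of the intermediate points in [VNE], whose numerator is at most
   [Cx]. *)
have [N5 H5] : exists N5, forall N, (N5 <= N)%N -> Cx / Num.sqrt (tau N) < d / 2.
  have /cvgryPgt/(_ ((Cx / (d / 2)) ^+ 2))[N5 _ H5] := tauoo.
  exists N5 => N n5; have st0 : 0 < Num.sqrt (tau N) by rewrite sqrtr_gt0.
  rewrite ltr_pdivrMr// mulrC -ltr_pdivrMr//.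
  have q0 : 0 <= Cx / (d / 2) by rewrite divr_ge0 ?(ltW d20).
  rewrite -(ger0_norm q0) -sqrtr_sqr ltr_sqrt//.
  exact: H5.
exists (maxn N1 (maxn N2 (maxn N3 (maxn N4 N5)))) => N.
rewrite !geq_max => /and5P[n1 n2 n3 n4 n5] x xM xd.
have N0 : (0 < N)%N by exact: leq_trans N10 n1.
have [xi Hxi ->] := VNE x n1.
have st0 : 0 < Num.sqrt (tau N) by rewrite sqrtr_gt0.
have x2 := isL2_stepfun (scaled x).
have cu : continuous (curv g K Phi ustar) by exact: (curv_continuous A2K A4P us2).
have cK := K_continuous KC x2.
have cc : continuous (fun t => curv g K Phi ustar t * K (stepfun (scaled x)) t ^+ 2).
  move=> t; apply: cvgM; first exact: cu.
  by apply: (@cvgM _ _ _ _ (K (stepfun (scaled x))) (K (stepfun (scaled x)))); exact: cK.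
rewrite /WN -RintegralZl//; last exact/integrable_L2/isL2_continuous.
apply: riemann_sum => //; first by apply/isL2Z/isL2_continuous.
move=> i t it; have /andP[t0 /ltW t1] := cell01 it.
set k := d2 _ _ _; set b := curv _ _ _ _ t; set y := KN _ _ _ i; set z := K _ t.
have yC : `|y| <= Cx by rewrite (le_trans ((HC _ x2).2 N i))// ler_wpM2l.
have zC : `|z| <= Cx by rewrite (le_trans ((HC _ x2).1 t))// ler_wpM2l.
have bB : `|b| <= B by apply: HB; rewrite t0 t1.
have kb : `|k - b| <= e / 3 / (Cx ^+ 2 + 1).
  rewrite distrC; apply: (H2 N n2 i t (K ustar t) (xi i) it); first exact: (HC _ us2).1.
  rewrite -[K ustar t](subrK (KN K w (u N) i)) -addrA (le_lt_trans (ler_normD _ _))//.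
  rewrite [ltRHS]splitr ler_ltD//; first by rewrite distrC H3.
  rewrite distrC (le_lt_trans (Hxi i))// (le_lt_trans _ (H5 N n5))//.
  by rewrite ler_wpM2r ?invr_ge0 ?(ltW st0).
have yz : `|y - z| <= C1 * (e / 3 / (B * Cx * C1 + 1)) + e / 3 / (B * Cx * M + 1) * M.
  rewrite (le_trans (H4 N n4 _ x2 i t it))// lerD ?ler_wpM2l//.
  by rewrite !divr_ge0 ?(ltW e0) ?(ltW D2).
have -> : k / 2 * y ^+ 2 - 2^-1 * (b * z ^+ 2) =
    2^-1 * ((k - b) * y ^+ 2) + b * ((y - z) * (2^-1 * (y + z))) by field.
have yz2 : `|2^-1 * (y + z)| <= Cx.
  rewrite normrM ger0_norm ?invr_ge0// mulrC ler_pdivrMr//.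
  rewrite (le_trans (ler_normD _ _))//.
  by rewrite mulrDr !mulr1 lerD.
have y2 : `|y ^+ 2| <= Cx ^+ 2 by rewrite normrX lerXn2r ?nnegrE.
have T1 : `|2^-1 * ((k - b) * y ^+ 2)| <= e / 3.
  rewrite normrM ger0_norm ?invr_ge0// normrM.
  apply: (@le_trans _ _ (Cx ^+ 2 * (e / 3 / (Cx ^+ 2 + 1)))); last first.
    by apply: small => //; rewrite sqr_ge0.
  rewrite -[leRHS]mul1r ler_pM ?invr_ge0 ?mulr_ge0 ?invf_le1 ?ler1n//.
  by rewrite mulrC ler_pM.
have T2 : `|b * ((y - z) * (2^-1 * (y + z)))| <= e / 3 + e / 3.
  rewrite !normrM -normrM.
  apply: (@le_trans _ _ (B * ((C1 * (e / 3 / (B * Cx * C1 + 1)) +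
      e / 3 / (B * Cx * M + 1) * M) * Cx))).
    by rewrite ler_pM ?mulr_ge0// ler_pM.
  rewrite mulrDl mulrDr lerD//.
    rewrite [leLHS](_ : _ = B * Cx * C1 * (e / 3 / (B * Cx * C1 + 1))); last by ring.
    by apply: small => //; rewrite !mulr_ge0.
  rewrite [leLHS](_ : _ = B * Cx * M * (e / 3 / (B * Cx * M + 1))); last by ring.
  by apply: small => //; rewrite !mulr_ge0.
rewrite (le_trans (ler_normD _ _))// (le_trans (lerD T1 T2))//.
by rewrite [leRHS](_ : _ = e / 3 + (e / 3 + e / 3)); [|field].
Qed.

Lemma WN_bound : exists2 C : R, 0 <= C & forall N (x : rvec R N),
  WN x <= C * L2norm (stepfun x) ^+ 2.
Proof.
have [C C0 HC] := K_bounds A1w A2K.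
have [B B0 HB] : exists2 B : R, 0 <= B &
    forall t, 0 <= t <= 1 -> `|curv g K Phi ustar t| <= B.
  have [G _ HG] := CS1_bounded gC.
  have [A A0 HA] := box_bounded (C * L2norm ustar) G cd2.
  exists A => // t t01; apply: (HA (K ustar t) (g t) t) => //.
  exact: (HC _ us2).1.
exists (B * C ^+ 2); first by rewrite mulr_ge0 ?sqr_ge0.
move=> N x; have x2 := isL2_stepfun x.
have cu : continuous (curv g K Phi ustar) by exact: (curv_continuous A2K A4P us2).
have cK := K_continuous KC x2.
have cc : continuous (fun t => curv g K Phi ustar t * K (stepfun x) t ^+ 2).
  move=> t; apply: cvgM; first exact: cu.
  by apply: (@cvgM _ _ _ _ (K (stepfun x)) (K (stepfun x))); exact: cK.
rewrite /WN; apply: (@le_trans _ _ (1 * (B * C ^+ 2 * L2norm (stepfun x) ^+ 2))); last by rewrite mul1r.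
have le1 : `|\int[leb]_(t in `[0, 1]) (curv g K Phi ustar t * K (stepfun x) t ^+ 2)|
    <= B * C ^+ 2 * L2norm (stepfun x) ^+ 2.
  apply: le_Rintegral01; first exact: continuous_measurable_fun.
  move=> t /andP[t0 /ltW t1]; rewrite normrM -mulrA ler_pM//; first by apply: HB; rewrite t0 t1.
  by rewrite normrX -exprMn lerXn2r ?nnegrE ?mulr_ge0 ?L2norm_ge0// (HC _ x2).1.
rewrite ler_pM ?invr_ge0 ?invf_le1 ?ler1n//; last exact: le_trans (ler_norm _) le1.
apply: Rintegral_ge0 => t _.
by rewrite mulr_ge0 ?sqr_ge0//; exact: (curv_ge0 K A3P).
Qed.

End minimizer_cvg.

(** * Galerkin approximation of the covariance *)

Section galerkin.
Context {R : realType}.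
Local Notation T := (measurableTypeR R).
Local Notation leb := (@lebesgue_measure R).
Variables (K Kst : (R -> R) -> (R -> R)) (b : R -> R) (rho : R).
Hypotheses (rho0 : 0 < rho) (KC : bounded_L2_C K) (KstC : bounded_L2_C Kst)
  (adj : L2_adjoint K Kst) (cb : continuous b) (b0 : forall t, 0 <= b t).
Implicit Types (f h : R -> R) (e t : R) (N : nat).

(** The quadratic form of [Q] on step functions, with the exact operator [K] and only the derivative
    discretized. It is the form of the Gaussian obtained from the energy Gaussian with weight
    [expR (- WN x)]. *)
Definition qN N (x y : rvec R N) : R :=
  L2inner (fun t => b t * K (stepfun x) t) (K (stepfun y)) + rho * AN x y.

Let bK2 f : isL2 f -> isL2 (fun t => b t * K f t).
Proof.
move=> f2; apply: isL2_continuous => t.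
by apply: cvgM; [exact: cb|exact: (K_continuous KC f2)].
Qed.

Lemma qNC N (x y : rvec R N) : qN x y = qN y x.
Proof.
by rewrite /qN (ANC x); congr (_ + _); apply: eq_Rintegral => t _; ring.
Qed.

Lemma qN_linr N (x : rvec R N) : linear_rvec (qN x).
Proof.
move=> a y z; rewrite /qN stepfun_lin (K_lin KC); try exact: isL2_stepfun.
rewrite L2inner_linr ?AN_linr; first by ring.
- exact/(K_isL2 KC)/isL2_stepfun.
- exact/(K_isL2 KC)/isL2_stepfun.
- exact/bK2/isL2_stepfun.
Qed.

Lemma qN_linl N (y : rvec R N) : linear_rvec (fun x => qN x y).
Proof. by move=> a x z; rewrite !(qNC _ y) qN_linr. Qed.

Lemma qN_ge N (x : rvec R N) : rho * AN x x <= qN x x.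
Proof.
rewrite /qN lerDr; apply: Rintegral_ge0 => t _.
by rewrite -mulrA mulr_ge0// -expr2 sqr_ge0.
Qed.

Lemma qN_eq0 N (x : rvec R N) : qN x x = 0 -> forall i, tnth x i = 0.
Proof.
move=> q0; apply: AN_eq0; apply/eqP; rewrite eq_le AN_ge0 andbT.
by rewrite -(pmulr_rle0 _ rho0) -q0 qN_ge.
Qed.

Lemma linear_L2inner_stepfun N h : isL2 h ->
  linear_rvec (fun x : rvec R N => L2inner h (stepfun x)).
Proof.
by move=> h2 a x y; rewrite stepfun_lin L2inner_linr//; exact: isL2_stepfun.
Qed.

(** The Galerkin solution is compared with the samples [v N] of [f]: these solve the discrete
    equation up to a residual of order $N^{-1/2}$, and coercivity by [rho * AN] turns the residual
    into a bound on the difference. *)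
Lemma galerkin h f : isL2 h -> Qrel K Kst b rho f h ->
  exists2 y : forall N, rvec R N,
    (forall N (z : rvec R N), qN (y N) z = L2inner h (stepfun z)) &
    forall e, 0 < e -> exists N0, forall N, (N0 <= N)%N ->
      `|qN (y N) (y N) - L2inner f h| <= e.
Proof.
move=> h2 [df [ddf [fH hE]]].
have [[f2 df2 _] [_ ddf2 _]] := fH.
have ex N : exists y : rvec R N,
    forall z, qN y z = L2inner h (stepfun z).
  apply: (@riesz_rvec R N (@qN N)) => //.
  - exact: qN_linl.
  - exact: qN_linr.
  - exact: qN_eq0.
  - exact: linear_L2inner_stepfun.
pose y0 N := sval (cid (ex N)).
have Hy0 N : forall z, qN (y0 N) z = L2inner h (stepfun z) := svalP (cid (ex N)).
exists y0 => // e e0.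
have [C C0 HC] := K_bound KC.
have [B B0 HB] : exists2 B : R, 0 <= B & forall t, 0 <= t <= 1 -> `|b t| <= B.
  have cn : {within `[0, 1], continuous (fun t => `|b t|)}.
    apply: continuous_subspaceT => x; apply: (@continuous_comp _ _ _ b Num.norm).
      exact: cb.
    exact: norm_continuous.
  have [c _ Hc] := @EVT_max R _ 0 1 ler01 cn.
  by exists `|b c| => // t t01; apply: Hc; rewrite in_itv.
have [v Hv] := H2_sample fH.
pose D := B * C ^+ 2 * L2norm df + rho * (L2norm df + L2norm ddf).
(* The weak form of [Q f = h], with the adjoint moved onto the test function. *)
have hS N (z : rvec R N) : L2inner h (stepfun z) =
    L2inner (fun t => b t * K f t) (K (stepfun z))
    + rho * L2inner (fun t => f t - ddf t) (stepfun z).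
  have z2 := isL2_stepfun z.
  have k2 : isL2 (Kst (fun s => b s * K f s)) by apply: (K_isL2 KstC); exact: bK2.
  have r2 : isL2 (fun t => - ddf t + f t).
    have := isL2B f2 ddf2; rewrite (_ : _ \- _ = (fun t => - ddf t + f t))//.
    by apply/funext => t; rewrite addrC.
  rewrite L2innerC (@L2inner_aer _ h (fun t => Kst (fun s => b s * K f s) t
      + rho * (- ddf t + f t)))//; last by apply: isL2D => //; exact: isL2Z.
  rewrite L2innerDr//; last exact: isL2Z.
  rewrite L2innerZr// -adj//; last exact: bK2.
  rewrite L2innerC; congr (_ + _ * _); rewrite L2innerC; congr L2inner.
  by apply/funext => t; rewrite addrC.
have res N (z : rvec R N) : (0 < N)%N ->
    `|qN (v N) z - L2inner h (stepfun z)| <=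
      Num.sqrt N%:R^-1 * D * Num.sqrt (AN z z).
  move=> N0; have [v1 v2] := Hv N N0.
  have z2 := isL2_stepfun z; have s2 := isL2_stepfun (v N).
  have d2 : isL2 (fun t => stepfun (v N) t - f t) by exact: isL2B.
  have Kz2 := K_isL2 KC z2.
  have zS := L2norm_stepfun_le z.
  rewrite hS /qN.
  have -> : L2inner (fun t => b t * K (stepfun (v N)) t) (K (stepfun z)) + rho * AN (v N) z -
    (L2inner (fun t => b t * K f t) (K (stepfun z)) +
     rho * L2inner (fun t => f t - ddf t) (stepfun z)) =
    L2inner (fun t => b t * K (fun t => stepfun (v N) t - f t) t) (K (stepfun z)) +
    rho * (AN (v N) z - L2inner (fun t => f t - ddf t) (stepfun z)).
    rewrite (K_B KC)// (_ : (fun t => b t * (_ - _)) = (fun t =>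
        b t * K (stepfun (v N)) t - b t * K f t)); last first.
      by apply/funext => t; rewrite mulrBr.
    by rewrite (L2innerBl (bK2 s2) (bK2 f2) Kz2); ring.
  apply: (le_trans (ler_normD _ _)); rewrite /D [X in _ <= X * _]mulrDr [leRHS]mulrDl; apply: lerD.
    apply: le_Rintegral01.
      apply: measurable_funM; last exact: isL2_measurable.
      by apply: isL2_measurable; exact: bK2.
    move=> t /andP[t0 /ltW t1]; rewrite !normrM.
    apply: (@le_trans _ _ (B * (C * (Num.sqrt N%:R^-1 * L2norm df)) *
        (C * Num.sqrt (AN z z)))); last first.
      by rewrite le_eqVlt; apply/orP; left; apply/eqP; ring.
    apply: ler_pM; rewrite ?mulr_ge0//.
      apply: ler_pM => //; first by apply: HB; rewrite t0 t1.
      by rewrite (le_trans (HC _ d2 t))// ler_wpM2l.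
    by rewrite (le_trans (HC _ z2 t))// ler_wpM2l.
  rewrite normrM gtr0_norm// (le_trans (ler_wpM2l (ltW rho0) (v2 z)))//.
  by rewrite le_eqVlt; apply/orP; left; apply/eqP; ring.
have h1 : 0 < L2norm h + 1 by rewrite ltr_wpDl ?L2norm_ge0.
have e1 : 0 < e / (L2norm h + 1) by rewrite divr_gt0.
have [N2 H2] := sqrtV_small (L2norm df + D / rho) e1.
exists (maxn 1 N2) => N; rewrite geq_max => /andP[N0 n2].
(* The error itself as test vector: its form value is the residual of [v N], because [y0 N]
   satisfies the equation exactly. *)
pose z := lin_rvec (-1) (y0 N) (v N).
have qz : qN z z = qN (v N) z - L2inner h (stepfun z).
  by rewrite -Hy0 {1}/z qN_linl; ring.
have AS : AN z z = Num.sqrt (AN z z) ^+ 2 by rewrite sqr_sqrtr// AN_ge0.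
have zS := L2norm_stepfun_le z.
have qle := qN_ge z; have resz := res N z N0.
have [v1 _] := Hv N N0.
set S := Num.sqrt (AN z z) in AS zS resz.
have S0 : 0 <= S by exact: sqrtr_ge0.
have leS : rho * S ^+ 2 <= Num.sqrt N%:R^-1 * D * S.
  by rewrite -AS (le_trans qle)// qz (le_trans (ler_norm _)).
have D0 : 0 <= D by rewrite !(addr_ge0, mulr_ge0) ?sqr_ge0 ?L2norm_ge0 ?(ltW rho0).
have SD : S <= Num.sqrt N%:R^-1 * (D / rho).
  have [S00|Sp] := eqVneq S 0.
    by rewrite S00 mulr_ge0 ?sqrtr_ge0// divr_ge0// ltW.
  have S1 : 0 < S by rewrite lt_def Sp.
  move: leS; rewrite expr2 mulrA ler_pM2r// mulrA => leS.
  by rewrite ler_pdivlMr// mulrC.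
have y2 := isL2_stepfun (y0 N); have v2 := isL2_stepfun (v N).
have yf : L2norm (fun t => stepfun (y0 N) t - f t) <= e / (L2norm h + 1).
  rewrite (le_trans (ler_L2normB y2 f2 v2))// (le_trans _ (H2 N n2))//.
  rewrite mulrC mulrDr addrC lerD//.
  rewrite L2normBC//; apply: le_trans SD; apply: le_trans zS.
  by rewrite /z stepfun_lin le_eqVlt; apply/orP; left; apply/eqP; congr L2norm;
     apply/funext => t; rewrite mulN1r addrC.
rewrite Hy0 (L2innerC f) -L2innerBr//.
rewrite (le_trans (L2_CauchySchwarz h2 (isL2B y2 f2)))//.
apply: (@le_trans _ _ ((L2norm h + 1) * (e / (L2norm h + 1)))); last first.
  by rewrite mulrCA divff ?gt_eqF// mulr1.
by rewrite ler_pM ?L2norm_ge0// lerDl.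
Qed.

End galerkin.

(** * Moments under the energy Gaussian *)

Section tilted_measure.
Context d (T : measurableType d) (R : realType).
Variables (la : {measure set T -> \bar R}) (e0 : T -> R).
Hypotheses (me0 : measurable_fun setT e0) (e00 : forall x, 0 <= e0 x)
  (ie0 : la.-integrable setT (EFin \o e0)).
Implicit Types (F G V : T -> R) (B : R).

(* Not normalized: the total mass of [e0] need not be 1. *)
Definition mean F : R := \int[la]_x (F x * e0 x).

Lemma mean_integrable F B : measurable_fun setT F -> (forall x, `|F x| <= B) ->
  la.-integrable setT (EFin \o (fun x => F x * e0 x)).
Proof.
move=> mF FB.
apply: (@le_integrable _ T R la setT measurableT _ (EFin \o (fun x => B * e0 x))).
- by apply/measurable_EFinP; exact: measurable_funM.
- move=> x _ /=; rewrite lee_fin !normrM ler_wpM2r//.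
  by rewrite (le_trans (FB x))// ler_norm.
- exact: integrable_realZ.
Qed.

Lemma mean_le F G : la.-integrable setT (EFin \o (fun x => F x * e0 x)) ->
  la.-integrable setT (EFin \o (fun x => G x * e0 x)) ->
  (forall x, F x <= G x) -> mean F <= mean G.
Proof.
by move=> iF iG FG; apply: le_Rintegral => // x _; rewrite ler_wpM2r.
Qed.

Lemma mean_dist F G H : la.-integrable setT (EFin \o (fun x => F x * e0 x)) ->
  la.-integrable setT (EFin \o (fun x => G x * e0 x)) ->
  la.-integrable setT (EFin \o (fun x => H x * e0 x)) ->
  (forall x, `|F x - G x| <= H x) -> `|mean F - mean G| <= mean H.
Proof.
move=> iF iG iH FG; rewrite /mean -RintegralB//.
have E : (fun x => F x * e0 x - G x * e0 x) = (fun x => (F x - G x) * e0 x).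
  by apply/funext => x; rewrite mulrBl.
rewrite [X in Rintegral _ _ X]E.
have iFG : la.-integrable setT (EFin \o (fun x => (F x - G x) * e0 x)).
  by rewrite -E; have := integrableB measurableT iF iG; apply: eq_integrable.
apply: (le_trans (le_normr_Rintegral _ _)) => //.
apply: le_Rintegral => //; first exact: integrable_norm.
by move=> x _; rewrite normrM (ger0_norm (e00 x)) ler_wpM2r.
Qed.

Lemma mean_ge0 F : (forall x, 0 <= F x) -> 0 <= mean F.
Proof. by move=> F0; apply: Rintegral_ge0 => x _; rewrite mulr_ge0. Qed.

Lemma exp_integrable V F B : measurable_fun setT V -> (forall x, 0 <= V x) ->
  measurable_fun setT F -> (forall x, `|F x| <= B) ->
  la.-integrable setT (EFin \o (fun x => F x * expR (- V x) * e0 x)).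
Proof.
move=> mV V0 mF FB; apply: (@mean_integrable _ B).
  apply: measurable_funM => //; apply: measurableT_comp => //.
  exact: measurableT_comp.
move=> x; rewrite normrM (ger0_norm (expR_ge0 _)) (le_trans _ (FB x))//.
by rewrite ler_piMr// expR_le1 oppr_le0.
Qed.

(** The unknown constant [z] is eliminated by the total mass 1 of [P]. Expectations become ratios of
    unnormalized means, written as a product, and the denominator is seen to be positive. *)
Lemma tilted_mean (P : probability T R) (z k : R) V F B : 0 < k ->
  measurable_fun setT V -> (forall x, 0 <= V x) ->
  (forall A, measurable A ->
    P A = (z%:E * \int[la]_(x in A) (k * (expR (- V x) * e0 x))%:E)%E) ->
  measurable_fun setT F -> (forall x, 0 <= F x <= B) ->
  0 < mean (fun x => expR (- V x)) /\
  \int[P]_x F x * mean (fun x => expR (- V x)) = mean (fun x => F x * expR (- V x)).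
Proof.
move=> k0 mV V0 PE mF FB.
pose p x := z * (k * (expR (- V x) * e0 x)).
have mk : measurable_fun setT (fun x => k * (expR (- V x) * e0 x)).
  apply: measurable_funM => //; apply: measurable_funM => //.
  by apply: measurableT_comp => //; exact: measurableT_comp.
have k00 x : 0 <= k * (expR (- V x) * e0 x).
  by rewrite mulr_ge0 ?(ltW k0)// mulr_ge0// expR_ge0.
(* A negative factor would make the total mass nonpositive. *)
have z0 : 0 <= z.
  have := PE setT measurableT; rewrite probability_setT => E.
  rewrite leNgt; apply/negP => zn.
  have : ((1 : R)%:E <= 0)%E.
    rewrite E mule_le0_ge0 ?lee_fin ?(ltW zn)//.
    by apply: integral_ge0 => x _; rewrite lee_fin.
  by rewrite lee_fin ler10.
have mp : measurable_fun setT p by exact: measurable_funM.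
have p0 x : 0 <= p x by rewrite mulr_ge0.
have PE' A : measurable A -> P A = (\int[la]_(x in A) (p x)%:E)%E.
  move=> mA; rewrite PE// -ge0_integralZl//.
  - by apply/measurable_EFinP; exact: measurable_funTS.
  - by move=> x _; rewrite lee_fin.
have main G C : measurable_fun setT G -> (forall x, 0 <= G x <= C) ->
    \int[P]_x G x = z * k * mean (fun x => G x * expR (- V x)).
  move=> mG GC; rewrite /Rintegral.
  rewrite (@ge0_integral_density _ _ _ la P p)//; last 2 first.
  - exact/measurable_EFinP.
  - by move=> x; rewrite lee_fin; case/andP: (GC x).
  rewrite /mean /Rintegral.
  under eq_integral => x _.
    rewrite -EFinM (_ : G x * p x = z * k * (G x * expR (- V x) * e0 x)); last by rewrite /p; ring.
    rewrite EFinM; over.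
  have iG := @exp_integrable V G C mV V0 mG _.
  rewrite integralZl//; last first.
    by apply: iG => x; rewrite ger0_norm; case/andP: (GC x).
  rewrite fineM//; apply: integrable_fin_num => //.
  by apply: iG => x; rewrite ger0_norm; case/andP: (GC x).
have E1 := main (fun=> 1) 1 (measurable_cst _).
have E1' : 1 = z * k * mean (fun x => expR (- V x)).
  rewrite -[LHS](prob_Rintegral_cst P) E1; last by move=> x; rewrite ler01 lexx.
  by congr (_ * _); apply: eq_Rintegral => x _; rewrite mul1r.
split.
  rewrite lt_neqAle mean_ge0 ?andbT; last by move=> x; exact: expR_ge0.
  apply/eqP => E0; move: E1'; rewrite -E0 mulr0 => /eqP.
  by rewrite oner_eq0.
by rewrite (main F B)// mulrAC -E1' mul1r.
Qed.

End tilted_measure.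

Section scaled_form.
Context {R : realType} (N : nat).
Local Notation leb := (@lebesgue_measure R).
Local Notation T := (measurableTypeR R).
Local Notation lrv := (@lebesgue_rvec R N).
Variables (B : rvec R N -> rvec R N -> R) (s : R).
Hypotheses (Bl : forall y, linear_rvec (B^~ y)) (Br : forall x, linear_rvec (B x))
  (BC : forall x y, B x y = B y x) (s0 : 0 < s).
Implicit Types (x y a : rvec R N) (l : rvec R N -> R).

Let sc x := scale_rvec s x.

Lemma lin_sqr t a y : B (lin_rvec t a y) (lin_rvec t a y) =
  B y y + 2 * t * B a y + t ^+ 2 * B a a.
Proof. by rewrite Bl !Br (BC y a); ring. Qed.

Lemma measurable_form : measurable_fun setT (fun x => B (sc x) (sc x)).
Proof.
apply: (measurableT_comp (measurable_quadratic_rvec Bl Br)).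
exact: measurable_scale_rvec.
Qed.

Lemma scaled_marginal l a (H : R -> \bar R) : linear_rvec l ->
  (forall x, B a x = l x) -> 0 < B a a ->
  measurable_fun [set: T] H -> (forall y : R, 0 <= H y)%E ->
  (\int[lrv]_x (H (l (sc x)) * (expR (- B (sc x) (sc x) / 2))%:E) =
   (\int[lrv]_x (expR (- B (sc x) (sc x) / 2))%:E) *
   \int[leb]_z (H (Num.sqrt (B a a) * z)%R * (gauss1 z)%:E))%E.
Proof.
move=> ll la a0 mH H0.
have sn : s != 0 by rewrite gt_eqF.
(* The form is evaluated at scaled vectors, so the translation direction is [a] divided by [s]. *)
have Ea : sc (scale_rvec s^-1 a) = a.
  by apply: eq_from_tnth => i; rewrite !tnth_mktuple mulrA divff// mul1r.
have Es x t : sc (add_rvec x (scale_rvec t (scale_rvec s^-1 a))) = lin_rvec t a (sc x).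
  apply: eq_from_tnth => i; rewrite !tnth_mktuple mulrDr addrC; congr (_ + _).
  by rewrite mulrCA [s * _]mulrA divff// mul1r.
rewrite (@ge0_gaussian_marginal1 R N (fun x => B (sc x) (sc x))
  (fun x => l (sc x)) (scale_rvec s^-1 a)) ?Ea//.
- exact: measurable_form.
- apply: (measurableT_comp (measurable_linear_rvec ll)); exact: measurable_scale_rvec.
- by move=> x t; rewrite Es lin_sqr la.
- by move=> x t; rewrite Es ll -(la a) addrC.
Qed.

End scaled_form.

Section energy_moments.
Context {R : realType} (N : nat) (rho s : R).
Hypotheses (rho0 : 0 < rho) (s0 : 0 < s) .
Local Notation leb := (@lebesgue_measure R).
Local Notation T := (measurableTypeR R).
Local Notation lrv := (@lebesgue_rvec R N).
Implicit Types (x y a : rvec R N) (l : rvec R N -> R).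

Let sc x := scale_rvec s x.

Definition edens x : R := expR (- (rho * AN (sc x) (sc x)) / 2).

Let B x y := rho * AN x y.
Let Bl y : linear_rvec (B^~ y).
Proof. by move=> a x z; rewrite /B AN_linl; ring. Qed.
Let Br x : linear_rvec (B x).
Proof. by move=> a y z; rewrite /B AN_linr; ring. Qed.
Let BC x y : B x y = B y x. Proof. by rewrite /B ANC. Qed.

Lemma measurable_edens : measurable_fun setT edens.
Proof.
apply: measurableT_comp => //; apply: measurable_funM => //; apply: measurableT_comp => //.
exact: (measurable_form s Bl Br).
Qed.

Lemma edens_gt0 x : 0 < edens x. Proof. exact: expR_gt0. Qed.

Lemma integrable_edens : lrv.-integrable setT (EFin \o edens).
Proof.
apply/integrableP; split; first by apply/measurable_EFinP; exact: measurable_edens.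
(* The sum of squares is at most [N] times the energy; [N + 1] is used to keep the denominator
   positive for [N = 0]. *)
pose c : R := rho * s ^+ 2 / (2 * (N%:R + 1)).
have N1 : 0 < N%:R + 1 :> R by rewrite ltr_wpDl.
have c0 : 0 < c by rewrite divr_gt0 ?mulr_gt0 ?exprn_gt0.
apply: le_lt_trans (integral_rvec_exp_sqr N c0).
apply: ge0_le_integral => //.
- by apply: measurableT_comp => //; apply/measurable_EFinP; exact: measurable_edens.
- apply/measurable_EFinP; apply: measurableT_comp => //; apply: measurableT_comp => //.
  by apply: measurable_funM => //; exact: measurable_rvec_sqr.
move=> x _; rewrite /= lee_fin ger0_norm ?expR_ge0// ler_expR mulNr lerN2.
have AE : AN (sc x) (sc x) = s ^+ 2 * AN x x by exact: AN_scale.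
have le1 : \sum_(i < N) tnth x i ^+ 2 <= N%:R * AN x x.
  have [N0|N0] := posnP N.
    rewrite big1 => [|i _]; first by rewrite mulr_ge0 ?AN_ge0.
    by have := ltn_ord i; rewrite {2}N0.
  rewrite /AN mulrA divff ?mul1r ?pnatr_eq0 -?lt0n//.
  by apply: ler_sum => i _; rewrite -!expr2 lerDl sqr_ge0.
rewrite AE /c.
apply: (@le_trans _ _ (rho * s ^+ 2 / (2 * (N%:R + 1)) * ((N%:R + 1) * AN x x))).
  rewrite ler_wpM2l ?(ltW c0)// (le_trans le1)// ler_wpM2r ?AN_ge0// lerDl ler01//.
by rewrite le_eqVlt; apply/orP; left; apply/eqP; field; rewrite gt_eqF.
Qed.

Definition Z0 : R := \int[lrv]_x edens x.

Let Z0E : (\int[lrv]_x (edens x)%:E = Z0%:E)%E.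
Proof. by rewrite /Z0 /Rintegral fineK//; exact: (integrable_fin_num _ integrable_edens). Qed.

(** The variance of [l] is [B a a] for its Riesz representative [a]. Its square is $l(a)^2\le
    c\,A_N(a,a)=(c/\rho)B(a,a)$, which gives the bound $c/\rho$ in any dimension. A zero
    representative is treated apart, as the marginal formula needs positive variance. *)
Lemma moment1 l (c : R) : linear_rvec l -> 0 <= c ->
  (forall x, l x ^+ 2 <= c * AN x x) ->
  (\int[lrv]_x ((l (sc x) ^+ 2)%:E * (edens x)%:E) <= (c / rho * Z0)%:E)%E.
Proof.
move=> ll c0 lc.
have Z00 : 0 <= Z0 by apply: Rintegral_ge0 => x _; exact: ltW (edens_gt0 x).
have [a Ha] : exists a, forall x, B a x = l x.
  apply: riesz_rvec => // x; rewrite /B => /eqP; rewrite mulf_eq0 gt_eqF//= => /eqP.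
  exact: AN_eq0.
have Baa : 0 <= B a a by rewrite /B mulr_ge0 ?AN_ge0 ?(ltW rho0).
have Bc : B a a <= c / rho.
  have [->|Bn] := eqVneq (B a a) 0; first by rewrite divr_ge0 ?(ltW rho0).
  have Bp : 0 < B a a by rewrite lt_def Bn.
  rewrite -(ler_pM2r Bp) -expr2 {1}Ha (le_trans (lc a))//.
  by rewrite /B [leRHS]mulrA divfK ?gt_eqF.
have [B0|Bn] := eqVneq (B a a) 0.
  have a0 : forall i, tnth a i = 0.
    by apply: AN_eq0; apply/eqP; move/eqP: B0; rewrite mulf_eq0 gt_eqF.
  have l0 x : l x = 0.
    rewrite -Ha /B /AN big1 ?mulr0// => i _.
    by rewrite /DN !a0 subrr mulr0 !mul0r addr0.
  under eq_integral do rewrite l0 expr0n mul0e.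
  by rewrite integral0 lee_fin mulr_ge0 ?divr_ge0 ?(ltW rho0).
have Bp : 0 < B a a by rewrite lt_def Bn.
rewrite (@scaled_marginal R N B s Bl Br BC s0 l a (fun y : R => (y ^+ 2)%:E) ll Ha Bp);
  last 2 first.
- by apply/measurable_EFinP; exact: measurable_funX.
- by move=> y; rewrite lee_fin sqr_ge0.
rewrite [X in (X * _ <= _)%E]Z0E.
have -> : (\int[leb]_z (((Num.sqrt (B a a) * z) ^+ 2)%:E * (gauss1 z)%:E) = (B a a)%:E)%E.
  under eq_integral do rewrite exprMn sqr_sqrtr// EFinM -muleA.
  rewrite ge0_integralZl//; last 2 first.
  - by apply: emeasurable_funM; apply/measurable_EFinP;
      [exact: measurable_funX|exact: measurable_gauss1].
  - by move=> z _; rewrite mule_ge0// lee_fin ?sqr_ge0 ?gauss1_ge0.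
  by rewrite integral_gauss1_sqr mule1.
by rewrite -EFinM lee_fin mulrC ler_wpM2r.
Qed.

(** For fixed [t] the value [G x t] is a linear functional with the same constant [c], so [moment1]
    applies for each [t] and Tonelli integrates the result over an interval of length 1; no trace of
    a covariance is computed. *)
Lemma moment2 (G : rvec R N -> R -> R) (c : R) : 0 <= c ->
  (forall t : R, linear_rvec (G^~ t)) -> (forall x, isL2 (G x)) ->
  (forall x (t : R), 0 <= t < 1 -> G x t ^+ 2 <= c * AN x x) ->
  lrv.-integrable setT (EFin \o (fun x => L2norm (G (sc x)) ^+ 2 * edens x)) /\
  mean lrv edens (fun x => L2norm (G (sc x)) ^+ 2) <= c / rho * Z0.
Proof.
move=> c0 Gl G2 Gc.
have mI : measurable (`[0, 1[%classic : set T) by exact: measurable_itv.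
have Gsum x (t : R) : G (sc x) t = \sum_(i < N) tnth (sc x) i * G (unit_rvec i) t.
  by rewrite (linear_rvecE _ (Gl t)).
pose f (z : rvec R N * T) : \bar R :=
  (\1_(`[0, 1[%classic : set T) z.2 * (G (sc z.1) z.2 ^+ 2 * edens z.1))%:E.
have m1 : measurable_fun setT (fun z : rvec R N * T => z.1) by exact: measurable_fst.
have m2 : measurable_fun setT (fun z : rvec R N * T => z.2) by exact: measurable_snd.
have mi : measurable_fun [set: T] (\1_(`[0, 1[%classic : set T) : T -> R).
  exact: measurable_indic.
have ms (i : 'I_N) : measurable_fun setT (fun x : rvec R N => tnth (sc x) i).
  apply: (measurableT_comp (measurable_tnth i)); exact: measurable_scale_rvec.
have mG (x : rvec R N) : measurable_fun [set: T] (G x) by exact: isL2_measurable.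
have mf : measurable_fun setT f.
  apply/measurable_EFinP; apply: measurable_funM.
    exact: measurableT_comp mi m2.
  apply: measurable_funM.
    apply: measurable_funX.
    rewrite (_ : (fun z => _) = (fun z : rvec R N * T =>
      \sum_(i < N) tnth (sc z.1) i * G (unit_rvec i) z.2)); last by apply/funext => z.
    apply: measurable_sum => i; apply: measurable_funM.
      exact: measurableT_comp (ms i) m1.
    exact: measurableT_comp (mG _) m2.
  exact: measurableT_comp measurable_edens m1.
have f0 z : (0 <= f z)%E.
  by rewrite lee_fin mulr_ge0// mulr_ge0 ?sqr_ge0// ltW// edens_gt0.
have Z00 : 0 <= Z0 by apply: Rintegral_ge0 => x _; exact: ltW (edens_gt0 x).
have cZ : 0 <= c / rho * Z0 by rewrite mulr_ge0// divr_ge0 ?(ltW rho0).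
have FE x : (\int[leb]_t f (x, t) = (L2norm (G (sc x)) ^+ 2 * edens x)%:E)%E.
  have g2 := G2 (sc x).
  have ii : leb.-integrable `[0, 1[%classic (EFin \o (fun t => G (sc x) t ^+ 2)).
    apply: (integrableS _ mI _ (integrable_L2sqr g2)) => //.
    by move=> t; rewrite /= !in_itv/= => /andP[-> /ltW].
  have ig : leb.-integrable setT (EFin \o (fun t => \1_(`[0, 1[%classic : set T) t *
      G (sc x) t ^+ 2)).
    have := (integrable_mkcond (EFin \o (fun t : T => G (sc x) t ^+ 2)) mI).1 ii.
    apply: eq_integrable => // t _; rewrite /= patchE indicE.
    by case: ifPn => _; rewrite ?mul1r ?mul0r.
  have -> : L2norm (G (sc x)) ^+ 2 =
      \int[leb]_t (\1_(`[0, 1[%classic : set T) t * G (sc x) t ^+ 2).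
    rewrite L2norm_sqr// /L2inner -Rintegral_itv_bndo_bndc//.
    rewrite Rintegral_mkcond; apply: eq_Rintegral => t _; rewrite patchE indicE.
    by case: ifPn => _; rewrite ?mul1r ?mul0r.
  rewrite mulrC EFinM /Rintegral fineK; last exact: integrable_fin_num ig.
  rewrite -integralZl//; apply: eq_integral => t _.
  by rewrite /f -EFinM; congr EFin; ring.
have le1 : (\int[lrv]_x (L2norm (G (sc x)) ^+ 2 * edens x)%:E <= (c / rho * Z0)%:E)%E.
  under eq_integral do rewrite -FE.
  rewrite (fubini_tonelli (m1 := lrv) (m2 := leb) f)//.
  apply: (@le_trans _ _ (\int[leb]_t ((c / rho * Z0)%:E * (\1_(`[0%R, 1%R[%classic : set T) t)%:E))%E).
    apply: ge0_le_integral => //.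
    - by move=> t _; apply: integral_ge0.
    - exact: (measurable_fun_fubini_tonelli_G f).
    - by apply: emeasurable_funM => //; apply/measurable_EFinP; exact: measurable_indic.
    move=> t _; rewrite indicE; have [tI|tI] := boolP (t \in _).
      rewrite mule1; apply: le_trans (moment1 (Gl t) c0 _).
        apply: ge0_le_integral => //.
        - exact: measurableT_comp mf (pair2_measurable _).
        - apply: emeasurable_funM; apply/measurable_EFinP; last exact: measurable_edens.
          apply: measurable_funX; apply: (measurableT_comp (measurable_linear_rvec (Gl t))).
          exact: measurable_scale_rvec.
        - by move=> x _; rewrite /f/= indicE tI mul1r EFinM.
      by move=> x; apply: Gc; move: tI; rewrite inE/= in_itv.
    rewrite mule0 integral0_eq// => x _.
    by rewrite /f/= indicE (negbTE tI) mul0r.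
  rewrite ge0_integralZl//; last by apply/measurable_EFinP; exact: measurable_indic.
  rewrite integral_indic// setIT.
  rewrite [X in (_ * X <= _)%E]lebesgue_measure_itv/= lte_fin ltr01 oppr0 adde0.
  by rewrite mule1.
have mF : measurable_fun setT (EFin \o (fun x => L2norm (G (sc x)) ^+ 2 * edens x)).
  rewrite (_ : EFin \o _ = fubini_F leb f); last by apply/funext => x; rewrite /fubini_F FE.
  exact: (measurable_fun_fubini_tonelli_F f).
have n0 x : 0 <= L2norm (G (sc x)) ^+ 2 * edens x.
  by rewrite mulr_ge0 ?sqr_ge0// ltW// edens_gt0.
have iF : lrv.-integrable setT (EFin \o (fun x => L2norm (G (sc x)) ^+ 2 * edens x)).
  apply/integrableP; split=> //; under eq_integral do rewrite gee0_abs ?lee_fin//.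
  by rewrite (le_lt_trans le1)// ltry.
split=> //; rewrite /mean /Rintegral -lee_fin fineK//.
exact: integrable_fin_num iF.
Qed.

End energy_moments.

(** * Cosine integrals of Gaussian measures *)

Section gaussian_cosine.
Context {R : realType}.
Local Notation leb := (@lebesgue_measure R).
Local Notation T := (measurableTypeR R).
Implicit Types (s th y : R) (h : R -> R).

(* The constant 1 keeps the integrand nonnegative. *)
Definition gcos s th : R := \int[leb]_z ((1 + cos (s * z + th)) * gauss1 z).

Let cos1 (y : R) : 0 <= 1 + cos y <= 2.
Proof. by have := cos_geN1 y; have := cos_le1 y; lra. Qed.

Lemma measurable_cos1 s th : measurable_fun [set: T] (fun z => 1 + cos (s * z + th)).
Proof.
apply: measurable_funD => //; apply: (@measurableT_comp _ _ _ T T T cos).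
  by apply: continuous_measurable_fun; exact: continuous_cos.
by apply: measurable_funD => //; exact: measurable_funM.
Qed.

Let ig : leb.-integrable setT (EFin \o @gauss1 R).
Proof.
apply/integrableP; split; first by apply/measurable_EFinP; exact: measurable_gauss1.
under eq_integral do rewrite gee0_abs ?lee_fin ?gauss1_ge0//.
by rewrite integral_gauss1 ltry.
Qed.

Let igz : leb.-integrable setT (EFin \o (fun z => z ^+ 2 * @gauss1 R z)).
Proof.
apply/integrableP; split.
  apply/measurable_EFinP; apply: measurable_funM; last exact: measurable_gauss1.
  exact: measurable_funX.
rewrite (_ : integral _ _ _ = 1%E) ?ltry// -[RHS](@integral_gauss1_sqr R).
by apply: eq_integral => z _; rewrite /= ger0_norm ?EFinM// mulr_ge0 ?gauss1_ge0 ?sqr_ge0.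
Qed.

Lemma gcos_integrable s th :
  leb.-integrable setT (EFin \o (fun z => (1 + cos (s * z + th)) * gauss1 z)).
Proof.
have c2 z : `|1 + cos (s * z + th)| <= 2.
  by have /andP[c0 c2] := cos1 (s * z + th); rewrite ger0_norm.
exact: (@mean_integrable _ T R leb (@gauss1 R) (@measurable_gauss1 R) ig
  (fun z => 1 + cos (s * z + th)) 2 (measurable_cos1 s th) c2).
Qed.

(** The cosines differ by at most $|s-s'||z|\le|s-s'|(1+z^2)$, and the constant 2 is the integral of
    $1+z^2$ under the standard normal law. *)
Lemma gcos_dist s s' th : `|gcos s th - gcos s' th| <= `|s - s'| * 2.
Proof.
have iH : leb.-integrable setT (EFin \o (fun z : R => `|s - s'| * (1 + z ^+ 2) * gauss1 z)).
  have := integrable_realZ `|s - s'| measurableT (integrable_realD measurableT ig igz).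
  by apply: eq_integrable => // z _ /=; congr EFin; ring.
have := @mean_dist _ T R leb (@gauss1 R) (@gauss1_ge0 R) _ _ _ (gcos_integrable s th) (gcos_integrable s' th) iH.
have -> : @mean _ T R leb (@gauss1 R) (fun z : R => `|s - s'| * (1 + z ^+ 2)) = `|s - s'| * 2.
  rewrite /mean; under eq_Rintegral do rewrite -mulrA mulrDl mul1r.
  rewrite RintegralZl//; last exact: integrable_realD.
  rewrite RintegralD//; congr (_ * _); rewrite /Rintegral.
  rewrite integral_gauss1 (_ : (\int[leb]_z (z ^+ 2 * gauss1 z)%:E)%E = 1%E)//.
  by under eq_integral do rewrite EFinM; exact: integral_gauss1_sqr.
apply => z.
rewrite opprD addrACA subrr add0r (le_trans (ler_dist_cos _ _))//.
rewrite opprD addrACA subrr addr0 -mulrBl normrM ler_wpM2l//.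
have : 0 <= (`|z| - 2^-1) ^+ 2 by rewrite sqr_ge0.
rewrite sqrrB real_normK ?num_real//.
by rewrite -(real_normK (num_real z)) expr2; nra.
Qed.

Section gaussian_measure.
Variables (mu : probability (L2borel R) R) (C : (R -> R) -> (R -> R)).
Hypothesis muC : centered_gaussian mu C.

(** Writing the marginal as the law of [s * z] with [z] standard normal treats the Dirac mass at 0
    and the nondegenerate case alike. *)
Lemma gaussian_marginal_law h : isL2 h -> exists2 s : R, 0 <= s &
  forall H : R -> \bar R, measurable_fun [set: T] H -> (forall y, 0 <= H y)%E ->
  (\int[mu]_x H (L2inner h (x : L2 R)) = \int[leb]_z (H (s * z)%R * (gauss1 z)%:E))%E.
Proof.
move=> h2; have [s s0 Hs] := muC.1 h h2; exists s => // H mH H0.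
pose Yf (x : L2borel R) : T := L2inner h (x : L2 R).
have mY : measurable_fun setT Yf by exact: measurable_L2inner.
pose Y : {mfun L2borel R >-> T} := HB.pack Yf (isMeasurableFun.Build _ _ _ _ Yf mY).
have -> : (\int[mu]_x H (L2inner h (x : L2 R)) = \int[distribution mu Y]_y H y)%E.
  by rewrite ge0_integral_distribution.
have [se|sn] := eqVneq s 0.
  rewrite (@eq_measure_integral _ _ _ _ (\d_(0 : T))); last first.
    by move=> A mA _; have := Hs A mA; rewrite /centered_normal se eqxx.
  rewrite integral_dirac// diracT mul1e se.
  under eq_integral do rewrite mul0r.
  rewrite ge0_integralZl//; last 2 first.
  - by apply/measurable_EFinP; exact: measurable_gauss1.
  - by move=> z _; rewrite lee_fin gauss1_ge0.
  by rewrite integral_gauss1 mule1.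
have sp : 0 < s by rewrite lt_def sn.
rewrite -(integral_normal_scale sp mH H0).
apply: (@ge0_integral_density _ _ _ leb (distribution mu Y) (normal_pdf 0 s)) => //.
- exact: measurable_normal_pdf.
- by move=> x; exact: normal_pdf_ge0.
- by move=> A mA; have := Hs A mA; rewrite /centered_normal (negbTE sn).
Qed.

Lemma gaussian_cos h th : isL2 h ->
  0 <= L2inner (C h) h /\
  1 + \int[mu]_x cos (L2inner h (x : L2 R) + th) = gcos (Num.sqrt (L2inner (C h) h)) th.
Proof.
move=> h2; have [s s0 Hs] := gaussian_marginal_law h2.
have CE : L2inner (C h) h = s ^+ 2.
  rewrite muC.2// /Rintegral.
  have := Hs (fun y => (y * y)%:E); rewrite /= => ->.
  - under eq_integral do rewrite -expr2 exprMn EFinM -muleA.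
    rewrite ge0_integralZl//; last 3 first.
    + by apply: emeasurable_funM; apply/measurable_EFinP;
        [exact: measurable_funX|exact: measurable_gauss1].
    + by move=> z _; rewrite mule_ge0// lee_fin ?sqr_ge0 ?gauss1_ge0.
    + by rewrite lee_fin sqr_ge0.
    by rewrite integral_gauss1_sqr mule1.
  - by apply/measurable_EFinP; exact: measurable_funM.
  - by move=> y; rewrite lee_fin -expr2 sqr_ge0.
split; first by rewrite CE sqr_ge0.
rewrite CE sqrtr_sqr ger0_norm//.
have mc : measurable_fun setT (fun x : L2borel R => cos (L2inner h (x : L2 R) + th)).
  have mcos : measurable_fun [set: T] (@cos R).
    by apply: continuous_measurable_fun; exact: continuous_cos.
  have ml : measurable_fun setT (fun x : L2borel R => L2inner h (x : L2 R) + th).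
    by apply: measurable_funD => //; exact: measurable_L2inner.
  exact: (measurableT_comp mcos ml).
have ic := prob_integrable mu mc (fun x => cos_max _).
have i1 := prob_integrable mu (measurable_cst (1 : R)) (fun=> lexx `|1|).
rewrite -[X in X + _](prob_Rintegral_cst mu) -RintegralD//.
rewrite /gcos /Rintegral; congr fine.
have := Hs (fun y => (1 + cos (y + th))%:E); rewrite /= => ->.
- by apply: eq_integral => z _; rewrite EFinM.
- apply/measurable_EFinP; have := measurable_cos1 1 th.
  by apply: eq_measurable_fun => z _; rewrite mul1r.
- by move=> y; rewrite lee_fin; case/andP: (cos1 (y + th)).
Qed.

End gaussian_measure.

Lemma ler_dist_sqrt (a b : R) : 0 <= a -> 0 <= b ->
  `|Num.sqrt a - Num.sqrt b| <= Num.sqrt `|a - b|.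
Proof.
wlog ab : a b / a <= b.
  move=> H a0 b0; have [/H->//|/ltW/H] := leP a b.
  by rewrite distrC (distrC b); apply.
move=> a0 b0; rewrite distrC (distrC a) !ger0_norm ?subr_ge0 ?ler_wsqrtr//.
rewrite lerBlDr -ler_sqr ?nnegrE ?addr_ge0 ?sqrtr_ge0// sqrrD !sqr_sqrtr ?subr_ge0//.
have := mulr_ge0 (sqrtr_ge0 (b - a)) (sqrtr_ge0 a); lra.
Qed.

End gaussian_cosine.

(** * The rescaled posterior *)

Section posterior.
Context {R : realType}.
Local Notation T := (measurableTypeR R).
Local Notation leb := (@lebesgue_measure R).
Variables (w g : R -> R) (K Kst : (R -> R) -> (R -> R)) (Phi : R -> R -> R -> R).
Variables (rho h0 c : R) (N1 : nat) (u : forall N : nat, rvec R N).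
Variables (ustar dustar : R -> R) (tau : nat -> R).
Variable mud : forall N : nat, probability (rvec R N) R.
Hypotheses (rho0 : 0 < rho) (A1w : A1 w) (A2K : A2 K Kst g) (A3P : A3 Phi g h0 c)
  (A4P : A4 Phi) (N10 : (0 < N1)%N)
  (gN : forall N, (N1 <= N)%N -> forall i : 'I_N, `|wsample w g i - g (grid i)| <= h0)
  (umin : forall N, (N1 <= N)%N -> PsiN_minimizer Phi K w g rho (u N))
  (us : Psi_minimizer Phi K g rho ustar dustar)
  (tau0 : forall N, 0 < tau N) (tauoo : tau @ \oo --> +oo)
  (mudE : forall N, (N1 <= N)%N -> density_propto (mud N)
    (fun eta => expR (- (tau N * PsiN Phi K w g rho (add_rvec (u N) eta))))).
Implicit Types (N m n : nat) (e : R).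

Let s N : R := Num.sqrt (tau N).
Let s0 N : 0 < s N. Proof. by rewrite sqrtr_gt0. Qed.
Let KC : bounded_L2_C K. Proof. by case: A2K. Qed.
Let us2 : isL2 ustar. Proof. by case: us => -[]. Qed.
Let b := curv g K Phi ustar.
Let cb : continuous b. Proof. exact: (curv_continuous A2K A4P us2). Qed.
Let b0 t : 0 <= b t. Proof. exact: (curv_ge0 K A3P). Qed.

Local Notation sc x := (scaled tau x).
Local Notation V := (VN w g K Phi rho u tau).
Local Notation W x := (WN g K Phi ustar (sc x)).
Local Notation e0 N := (@edens R N rho (s N)).
Local Notation lrv N := (@lebesgue_rvec R N).
Local Notation mn N F := (mean (lrv N) (e0 N) F).
Local Notation Z N := (@Z0 R N rho (s N)).
Local Notation law N := (distribution
  (distribution (mud N) (@scale_rvec R N (Num.sqrt (tau N)))) (@interp R N)).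

Let me0 N : measurable_fun setT (e0 N). Proof. exact: measurable_edens. Qed.
Let e00 N x : 0 <= e0 N x. Proof. exact: ltW (edens_gt0 _ _ _). Qed.
Let ie0 N : (lrv N).-integrable setT (EFin \o e0 N).
Proof. exact: integrable_edens. Qed.

Let Z1 N : mn N (fun=> 1) = Z N.
Proof. by apply: eq_Rintegral => x _; rewrite mul1r. Qed.

Lemma WN_qN N (x : rvec R N) :
  WN g K Phi ustar x + rho / 2 * AN x x = qN K b rho x x / 2.
Proof.
rewrite /WN /qN /L2inner mulrDl; congr (_ + _); last by ring.
by rewrite mulrC; congr (_ * _); apply: eq_Rintegral => t _; rewrite expr2 mulrA.
Qed.

Lemma measurable_WN N : measurable_fun setT (fun x : rvec R N => W x).
Proof.
have -> : (fun x : rvec R N => W x) =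
    (fun x => qN K b rho (sc x) (sc x) / 2 - rho * AN (sc x) (sc x) / 2).
  by apply/funext => x; rewrite -WN_qN; ring.
apply: measurable_funB; apply: measurable_funM => //.
  have H := @measurable_form R N (@qN R K b rho N) (s N)
    (fun y => qN_linl rho KC cb y) (fun y => qN_linr rho KC cb y).
  exact: H.
have Bl y : linear_rvec (fun x : rvec R N => rho * AN x y).
  by move=> a x z; rewrite AN_linl; ring.
have Br y : linear_rvec (fun x : rvec R N => rho * AN y x).
  by move=> a x z; rewrite AN_linr; ring.
exact: (measurable_form (s N) Bl Br).
Qed.

Lemma measurable_VN N : (0 < N)%N -> measurable_fun setT (@V N).
Proof.
move=> N0; apply: measurable_funB; last first.
  apply: measurable_funM => //.
  exact: (measurable_form (s N) (@AN_linl R N) (@AN_linr R N)).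
apply: measurable_funM => //; apply: measurable_funB => //.
under eq_fun do rewrite PsiNE// add_rvecE.
apply: measurable_funD.
  apply: measurable_funM => //; apply: measurable_sum => i.
  have cP : continuous (fun p => Phi p (wsample w g i) (grid i)).
    by apply: is_derive_continuous => p; exact: Phi_derive.
  have mP := continuous_measurable_fun cP.
  have mK : measurable_fun setT (fun x : rvec R N => KN K w (lin_rvec 1 x (u N)) i : T).
    under eq_fun do rewrite (KN_lin A1w A2K).
    apply: measurable_funD => //; apply: measurable_funM => //.
    exact: (measurable_linear_rvec (fun a y z => KN_lin A1w A2K a y z i)).
  exact: (measurableT_comp mP mK).
apply: measurable_funM => //.
under eq_fun do rewrite AN_linl !AN_linr.
apply: measurable_funD; last apply: measurable_funD => //.
  apply: measurable_funM => //; apply: measurable_funD.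
    apply: measurable_funM => //.
    exact: (measurable_quadratic_rvec (@AN_linl R N) (@AN_linr R N)).
  exact: (measurable_linear_rvec (AN_linl (u N))).
apply: measurable_funM => //; exact: (measurable_linear_rvec (AN_linr (u N))).
Qed.

Let V0 N (x : rvec R N) : (N1 <= N)%N -> 0 <= V x.
Proof. exact: (VN_ge0 A1w A2K A3P A4P N10 gN umin tau0). Qed.
Let W0 N (x : rvec R N) : 0 <= W x.
Proof. exact: (WN_ge0 K A3P). Qed.
Let Npos N : (N1 <= N)%N -> (0 < N)%N. Proof. exact: leq_trans. Qed.

Lemma law_Rintegral N (f : L2borel R -> R) B : measurable_fun setT f ->
  (forall x, `|f x| <= B) -> \int[law N]_x f x = \int[mud N]_x f (interp (sc x)).
Proof.
move=> mf fB.
have mfi : measurable_fun setT (fun x : rvec R N => f (interp x)).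
  exact: (measurableT_comp mf (@measurable_interp R N)).
have mEf : measurable_fun setT (EFin \o f) by exact/measurable_EFinP.
have mEfi : measurable_fun setT (EFin \o (fun x : rvec R N => f (interp x))).
  exact/measurable_EFinP.
rewrite /Rintegral; congr fine.
rewrite integral_distribution//; last first.
  exact: (prob_integrable _ mfi (fun x => fB _)).
rewrite (integral_distribution (X := @scale_rvec R N (Num.sqrt (tau N))) mEfi)//.
have mfs : measurable_fun setT (fun x : rvec R N => f (interp (sc x))).
  exact: (measurableT_comp mfi (@measurable_scale_rvec R N (Num.sqrt (tau N)))).
exact: (prob_integrable _ mfs (fun x => fB _)).
Qed.

Lemma law_mean N (f : L2borel R -> R) B : (N1 <= N)%N -> measurable_fun setT f ->
  (forall x, 0 <= f x <= B) ->
  0 < mn N (fun x => expR (- V x)) /\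
  \int[law N]_x f x * mn N (fun x => expR (- V x)) =
    mn N (fun x => f (interp (sc x)) * expR (- V x)).
Proof.
move=> n1 mf fB; have [z Hz] := mudE n1.
have mfi : measurable_fun setT (fun x : rvec R N => f (interp x)).
  exact: (measurableT_comp mf (@measurable_interp R N)).
have mfs : measurable_fun setT (fun x : rvec R N => f (interp (sc x))).
  exact: (measurableT_comp mfi (@measurable_scale_rvec R N (Num.sqrt (tau N)))).
rewrite (@law_Rintegral N f B)//; last first.
  by move=> x; have /andP[f0 f1] := fB x; rewrite ger0_norm.
(* Adding and subtracting the minimum of [PsiN] splits the density into a constant, [expR (- V x)]
   and the energy density. *)
have HE (A : set (rvec R N)) : measurable A -> mud N A = (z%:E * \int[lrv N]_(x in A)
    (expR (- (tau N * PsiN Phi K w g rho (u N))) * (expR (- V x) * e0 N x))%:E)%E.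
  move=> mA; rewrite Hz//; congr (_ * _)%E; apply: eq_integral => x _; congr EFin.
  rewrite -!expRD; congr expR; rewrite /VN -/(s N) -/(scaled tau x).
  by field.
have H := (@tilted_mean _ _ R (lrv N) (e0 N) (@me0 N) (@e00 N) (ie0 N) (mud N) z
  (expR (- (tau N * PsiN Phi K w g rho (u N)))) (@V N) (fun x => f (interp (sc x))) B
  (expR_gt0 _) (measurable_VN (Npos n1)) (fun x => V0 x n1) HE mfs (fun x => fB _)).
exact H.
Qed.

Lemma norm_moment N : (N1 <= N)%N ->
  (lrv N).-integrable setT (EFin \o (fun x => L2norm (stepfun (sc x)) ^+ 2 * e0 N x)) /\
  mn N (fun x => L2norm (stepfun (sc x)) ^+ 2) <= 2 / rho * Z N.
Proof.
move=> n1; apply: (moment2 rho0 (s0 N) (G := @stepfun R N) (c := 2)) => //.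
- by move=> t a x y; rewrite stepfun_lin.
- exact: isL2_stepfun.
- by move=> x t /(cellP (Npos n1))[i it]; rewrite (stepfunE _ it) tnth_sqr_le.
Qed.

Lemma tail_moment N m : (N1 <= N)%N -> (0 < m)%N -> (m <= N)%N ->
  (lrv N).-integrable setT (EFin \o (fun x =>
    L2norm (fun t => stepfun (sc x) t - Pavg m (stepfun (sc x)) t) ^+ 2 * e0 N x)) /\
  mn N (fun x => L2norm (fun t => stepfun (sc x) t - Pavg m (stepfun (sc x)) t) ^+ 2)
    <= 2 / m%:R / rho * Z N.
Proof.
move=> n1 m0 mN.
apply: (moment2 rho0 (s0 N) (G := fun x t => stepfun x t - Pavg m (stepfun x) t)
  (c := 2 / m%:R)).
- by rewrite divr_ge0.
- move=> t a x y; rewrite stepfun_lin Pavg_lin; [by ring|exact: isL2_stepfun|exact: isL2_stepfun].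
- by move=> x; apply: isL2B; [exact: isL2_stepfun|exact: isL2_Pavg].
- by move=> x t; exact: stepfun_Pavg_close.
Qed.

Let iexpV N (F : rvec R N -> R) (B : R) : (N1 <= N)%N -> measurable_fun setT F ->
  (forall x, `|F x| <= B) ->
  (lrv N).-integrable setT (EFin \o (fun x => F x * expR (- V x) * e0 N x)).
Proof.
move=> n1 mF FB.
have H := @exp_integrable _ _ R (lrv N) (e0 N) (@me0 N) (ie0 N) (@V N) F B
  (measurable_VN (Npos n1)) (fun x => V0 x n1) mF FB.
exact H.
Qed.

Let iexpW N (F : rvec R N -> R) (B : R) : measurable_fun setT F ->
  (forall x, `|F x| <= B) ->
  (lrv N).-integrable setT (EFin \o (fun x => F x * expR (- W x) * e0 N x)).
Proof.
move=> mF FB.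
have H := @exp_integrable _ _ R (lrv N) (e0 N) (@me0 N) (ie0 N) _ F B
  (@measurable_WN N) (@W0 N) mF FB.
exact H.
Qed.

Let iexpV1 N : (N1 <= N)%N ->
  (lrv N).-integrable setT (EFin \o (fun x => expR (- V x) * e0 N x)).
Proof.
move=> n1; have := @iexpV N (fun=> 1) `|1| n1 (measurable_cst _) (fun=> lexx _).
by apply: eq_integrable => // x _; rewrite /= mul1r.
Qed.

Let iexpW1 N : (lrv N).-integrable setT (EFin \o (fun x => expR (- W x) * e0 N x)).
Proof.
have := @iexpW N (fun=> 1) `|1| (measurable_cst _) (fun=> lexx _).
by apply: eq_integrable => // x _; rewrite /= mul1r.
Qed.

Let i1e0 N : (lrv N).-integrable setT (EFin \o (fun x => 1 * e0 N x)).
Proof. by have := ie0 N; apply: eq_integrable => // x _; rewrite /= mul1r. Qed.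

Lemma Z_gt0 N : (N1 <= N)%N -> 0 < Z N.
Proof.
move=> n1.
(* [law_mean] is applied to the zero function, for the sake of its first conclusion. *)
have z00 (x : L2borel R) : 0 <= (0 : R) <= 0 by rewrite lexx.
have [B0 _] := law_mean n1 (measurable_cst (0 : R)) z00.
apply: (lt_le_trans B0); rewrite -Z1; apply: (mean_le (@e00 N)) => //.
  exact: iexpV1.
by move=> x; rewrite expR_le1 oppr_le0 V0.
Qed.

Lemma expR_dist (p q : R) : 0 <= p -> 0 <= q -> `|expR (- p) - expR (- q)| <= `|p - q|.
Proof.
wlog pq : p q / p <= q.
  move=> H p0 q0; have [/H->//|/ltW/H] := leP p q.
  by rewrite distrC (distrC p); apply.
move=> p0 q0; rewrite [leRHS]distrC !ger0_norm ?subr_ge0 ?ler_expR ?lerN2//.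
have -> : expR (- q) = expR (- p) * expR (p - q) by rewrite -expRD; congr expR; ring.
have := expR_ge1Dx (p - q); have : expR (- p) <= 1 by rewrite expR_le1 oppr_le0.
have := expR_gt0 (- p); nra.
Qed.

(** Converts second moments into bounds on truncated first moments, as [weak_cvg_of_cos] asks for
    them. *)
Lemma min_sqr_le (d y : R) : 0 < d -> 0 <= y -> Num.min 1 y <= d + y ^+ 2 / d.
Proof.
move=> d0 y0; rewrite ge_min; apply/orP; right.
have [yd|dy] := leP y d; first by rewrite (le_trans yd)// lerDl divr_ge0 ?sqr_ge0 ?(ltW d0).
rewrite (le_trans _ (_ : y ^+ 2 / d <= _))//; last by rewrite lerDr (ltW d0).
by rewrite ler_pdivlMr// expr2 ler_wpM2l// ltW.
Qed.

Lemma mean_affine N (p q : R) (F : rvec R N -> R) :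
  (lrv N).-integrable setT (EFin \o (fun x => F x * e0 N x)) ->
  (lrv N).-integrable setT (EFin \o (fun x => (p + q * F x) * e0 N x)) /\
  mn N (fun x => p + q * F x) = p * Z N + q * mn N F.
Proof.
move=> iF; have i1 := integrable_realZ p measurableT (ie0 N).
have i2 := integrable_realZ q measurableT iF.
split.
  have := integrable_realD measurableT i1 i2.
  by apply: eq_integrable => // x _ /=; congr EFin; ring.
rewrite /mean -[p * _]RintegralZl// -[q * _]RintegralZl// -RintegralD//.
by apply: eq_Rintegral => x _; ring.
Qed.

Let normX N (x : rvec R N) := L2norm (stepfun (sc x)).
Let tailX m N (x : rvec R N) :=
  L2norm (fun t => stepfun (sc x) t - Pavg m (stepfun (sc x)) t).

(** The $L^1$ distance between the unnormalized densities of the posterior and of its Gaussian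
    replacement. *)
Definition gap N : R := mn N (fun x => `|expR (- V x) - expR (- W x)|).

Let mexpV N : (0 < N)%N -> measurable_fun setT (fun x : rvec R N => expR (- V x)).
Proof.
move=> N0; apply: measurableT_comp => //; apply: measurableT_comp => //.
exact: measurable_VN.
Qed.

Let mexpW N : measurable_fun setT (fun x : rvec R N => expR (- W x)).
Proof.
apply: measurableT_comp => //; apply: measurableT_comp => //.
exact: measurable_WN.
Qed.

Let exp01 (p : R) : 0 <= p -> 0 <= expR (- p) <= 1.
Proof. by move=> p0; rewrite expR_ge0 expR_le1 oppr_le0. Qed.

Let gap_le1 N (x : rvec R N) : (N1 <= N)%N -> `|expR (- V x) - expR (- W x)| <= 1.
Proof.
move=> n1; have := exp01 (V0 x n1); have := exp01 (W0 x).
by rewrite ler_norml => /andP[? ?] /andP[? ?]; lra.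
Qed.

Let igap N (F : rvec R N -> R) (B : R) : (N1 <= N)%N -> measurable_fun setT F ->
  (forall x, `|F x| <= B) ->
  (lrv N).-integrable setT
    (EFin \o (fun x => F x * `|expR (- V x) - expR (- W x)| * e0 N x)).
Proof.
move=> n1 mF FB.
have mG : measurable_fun setT (fun x : rvec R N => F x * `|expR (- V x) - expR (- W x)|).
  apply: measurable_funM => //; apply: measurableT_comp => //; apply: measurable_funB.
    exact: mexpV (Npos n1).
  exact: mexpW.
have GB x : `|F x * `|expR (- V x) - expR (- W x)| | <= B.
  by rewrite normrM normr_id (le_trans _ (FB x))// ler_piMr// gap_le1.
have H := @mean_integrable _ _ R (lrv N) (e0 N) (@me0 N) (ie0 N) _ B mG GB.
exact H.
Qed.

Lemma gap_small e : 0 < e -> exists N0, forall N, (N0 <= N)%N ->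
  (N1 <= N)%N /\ gap N <= e * Z N.
Proof.
move=> ep; have e3 : 0 < e / 3 by rewrite divr_gt0.
(* By Chebyshev and [norm_moment], norms above [M] carry at most the fraction [e / 3] of the
   Gaussian mass. *)
pose M := Num.sqrt (2 / rho / (e / 3)).
have MM : 0 < 2 / rho / (e / 3) by rewrite !divr_gt0.
have M0 : 0 < M by rewrite sqrtr_gt0.
have M2 : M ^+ 2 = 2 / rho / (e / 3) by rewrite sqr_sqrtr// ltW.
have [d d0 Hd] := VN_close rho0 A1w A2K A3P A4P N10 gN umin us tau0 tauoo (ltW M0) e3.
(* Once $1/m$ is below this, the tail moment $2/(m\rho)$ divided by $d^2$ is at most [e / 3]. *)
have k0 : 0 < e / 3 * (rho * d ^+ 2) / 2.
  by rewrite divr_gt0// mulr_gt0// mulr_gt0// exprn_gt0.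
have [m m0 Hm] := exists_natV_le k0.
have [N2 H2] := Hd m.
exists (maxn N1 (maxn N2 m)) => N; rewrite !geq_max => /and3P[n1 n2 mN]; split=> //.
have [in1 ln1] := norm_moment n1.
have [it1 lt1] := tail_moment n1 m0 mN.
have Zp := Z_gt0 n1.
have [ia Ea] := mean_affine (e / 3) (M ^- 2) in1.
have [ib Eb] := mean_affine 0 (d ^- 2) it1.
(* Dominates the difference of the two weights everywhere: [VN_close] gives [e / 3] where norm and
   tail are small, and elsewhere one of the Chebyshev terms is at least 1, which bounds the
   difference. *)
pose Q x := (e / 3 + M ^- 2 * @normX N x ^+ 2) + (0 + d ^- 2 * @tailX m N x ^+ 2).
have iQ : (lrv N).-integrable setT (EFin \o (fun x => Q x * e0 N x)).
  have := integrable_realD measurableT ia ib.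
  by apply: eq_integrable => // x _ /=; congr EFin; rewrite /Q -mulrDl.
have EQ : mn N Q = e / 3 * Z N + M ^- 2 * mn N (fun x => normX x ^+ 2)
    + (0 * Z N + d ^- 2 * mn N (fun x => tailX m x ^+ 2)).
  rewrite -Ea -Eb /mean -RintegralD//.
  by apply: eq_Rintegral => x _; rewrite /Q -mulrDl.
have ig : (lrv N).-integrable setT
    (EFin \o (fun x => `|expR (- V x) - expR (- W x)| * e0 N x)).
  have := @igap N (fun=> 1) `|1| n1 (measurable_cst _) (fun=> lexx _).
  by apply: eq_integrable => // x _; rewrite /= mul1r.
have le1 : gap N <= mn N Q.
  apply: (mean_le (@e00 N) ig iQ) => x.
  have nM : 0 <= M ^- 2 * @normX N x ^+ 2 by rewrite mulr_ge0 ?invr_ge0 ?sqr_ge0.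
  have nd : 0 <= d ^- 2 * @tailX m N x ^+ 2 by rewrite mulr_ge0 ?invr_ge0 ?sqr_ge0.
  have [xM|Mx] := leP (@normX N x) M; last first.
    have big : 1 <= M ^- 2 * @normX N x ^+ 2.
      rewrite mulrC ler_pdivlMr ?exprn_gt0// mul1r lerXn2r ?nnegrE ?(ltW M0) ?(ltW Mx)//.
      exact: L2norm_ge0.
    by rewrite /Q (le_trans (gap_le1 x n1))//; lra.
  have [xd|dx] := leP (@tailX m N x) d; last first.
    have big : 1 <= d ^- 2 * @tailX m N x ^+ 2.
      rewrite mulrC ler_pdivlMr ?exprn_gt0// mul1r lerXn2r ?nnegrE ?(ltW d0) ?(ltW dx)//.
      exact: L2norm_ge0.
    by rewrite /Q (le_trans (gap_le1 x n1))//; lra.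
  have := expR_dist (V0 x n1) (W0 x); have := H2 N n2 x xM xd.
  by rewrite /Q; lra.
have t1 : M ^- 2 * mn N (fun x => normX x ^+ 2) <= e / 3 * Z N.
  apply: (@le_trans _ _ (M ^- 2 * (2 / rho * Z N))).
    by rewrite ler_wpM2l ?invr_ge0 ?sqr_ge0.
  by rewrite M2 le_eqVlt; apply/orP; left; apply/eqP; field; rewrite !gt_eqF.
have t2 : d ^- 2 * mn N (fun x => tailX m x ^+ 2) <= e / 3 * Z N.
  apply: (@le_trans _ _ (d ^- 2 * (2 / m%:R / rho * Z N))).
    by rewrite ler_wpM2l ?invr_ge0 ?sqr_ge0.
  rewrite !mulrA ler_wpM2r ?(ltW Zp)//.
  have := Hm m (leqnn m); move: (m%:R^-1) => v Hv.
  rewrite [leLHS](_ : _ = v * (2 / (rho * d ^+ 2))); last by field; rewrite !gt_eqF.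
  apply: (le_trans (ler_wpM2r _ Hv)).
    by rewrite divr_ge0// mulr_ge0 ?sqr_ge0// ltW.
  by rewrite le_eqVlt; apply/orP; left; apply/eqP; field; rewrite !gt_eqF.
rewrite (le_trans le1)// EQ; lra.
Qed.

(** Where the squared norm is at most [M] the weight is at least [k], and elsewhere $k-(k/M)y^2$ is
    negative; so this function lies below the weight everywhere and its mean needs only the second
    moment. *)
Lemma expW_low : exists2 beta : R, 0 < beta &
  forall N, (N1 <= N)%N -> beta * Z N <= mn N (fun x => expR (- W x)).
Proof.
have [C C0 HC] := WN_bound A1w A2K A3P A4P us.
(* Twice the second moment bound, so that half of [k] survives. *)
pose M := 4 / rho.
have M0 : 0 < M by rewrite divr_gt0.
pose k := expR (- (C * M)).
have k0 : 0 < k by exact: expR_gt0.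
exists (k / 2) => [|N n1]; first by rewrite divr_gt0.
have [in1 ln1] := norm_moment n1.
have Zp := Z_gt0 n1.
have [ia Ea] := mean_affine k (- (k / M)) in1.
apply: (@le_trans _ _ (mn N (fun x => k + - (k / M) * L2norm (stepfun (sc x)) ^+ 2))).
  rewrite Ea -lerBlDl.
  have le1 : k / M * mn N (fun x => L2norm (stepfun (sc x)) ^+ 2) <= k / M * (2 / rho * Z N).
    by rewrite ler_wpM2l// divr_ge0 ?(ltW M0) ?(ltW k0).
  have E : k / M * (2 / rho * Z N) = k / 2 * Z N.
    by rewrite /M; field; rewrite gt_eqF.
  by rewrite E in le1; lra.
apply: (mean_le (@e00 N) ia (iexpW1 N)) => x.
set y := L2norm _.
have y0 : 0 <= y ^+ 2 by rewrite sqr_ge0.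
have [yM|My] := leP (y ^+ 2) M; last first.
  apply: (@le_trans _ _ 0); last exact: expR_ge0.
  have : k <= k / M * y ^+ 2.
    by rewrite mulrAC ler_pdivlMr// ler_wpM2l ?(ltW k0)// ltW.
  by lra.
apply: (@le_trans _ _ k).
  by rewrite gerDl mulNr oppr_le0 mulr_ge0// divr_ge0 ?(ltW M0) ?(ltW k0).
rewrite ler_expR lerN2 (le_trans (HC N (sc x)))//.
by rewrite ler_wpM2l.
Qed.

(** The bound for [W] survives with half its constant once the gap is at most the other half. It
    transfers the Gaussian moment bounds to the posterior. *)
Lemma expV_low : exists2 beta : R, 0 < beta & exists N0, forall N, (N0 <= N)%N ->
  (N1 <= N)%N /\ beta * Z N <= mn N (fun x => expR (- V x)).
Proof.
have [be be0 Hb] := expW_low.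
have b2 : 0 < be / 2 by rewrite divr_gt0.
have [N2 H2] := gap_small b2.
exists (be / 2) => //; exists N2 => N n2; have [n1 gN2] := H2 N n2; split=> //.
have ig : (lrv N).-integrable setT
    (EFin \o (fun x => `|expR (- V x) - expR (- W x)| * e0 N x)).
  have := @igap N (fun=> 1) `|1| n1 (measurable_cst _) (fun=> lexx _).
  by apply: eq_integrable => // x _; rewrite /= mul1r.
have := mean_dist (@e00 N) (iexpV1 n1) (iexpW1 N) ig (fun x => lexx _).
rewrite -/(gap N) ler_distl => /andP[lo _].
have := Hb N n1; lra.
Qed.

Lemma tail_law e : 0 < e -> exists m0, forall m, (m0 <= m)%N ->
  exists N0, forall N, (N0 <= N)%N -> \int[law N]_x Num.min 1 (ptail m x) <= e.
Proof.
move=> ep; have [be be0 [N2 H2]] := expV_low.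
(* Both terms of [min_sqr_le] contribute at most [d * Z N], together [e * be * Z N], which the lower
   bound on the posterior mass turns into [e]. *)
pose d := e * be / 2.
have d0 : 0 < d by rewrite divr_gt0// mulr_gt0.
have k0 : 0 < rho * d ^+ 2 / 2 by rewrite divr_gt0// mulr_gt0// exprn_gt0.
have [m0 m00 Hm] := exists_natV_le k0.
exists m0 => m mm; have m1 : (0 < m)%N by exact: leq_trans mm.
exists (maxn N2 m) => N; rewrite geq_max => /andP[n2 mN].
have [n1 Bb] := H2 N n2.
have mf : measurable_fun setT (fun x : L2borel R => Num.min 1 (ptail m (x : L2 R))).
  by apply: measurable_minr => //; exact: measurable_ptail.
have f01 (x : L2borel R) : 0 <= Num.min 1 (ptail m (x : L2 R)) <= 1.
  by rewrite le_min ler01 L2norm_ge0 ge_min lexx.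
have [B0 E] := law_mean n1 mf f01.
have Zp := Z_gt0 n1.
have [it1 lt1] := tail_moment n1 m1 mN.
have [ia Ea] := mean_affine d d^-1 it1.
have mfi : measurable_fun setT (fun x : rvec R N => Num.min 1 (ptail m (interp (sc x) : L2 R))).
  have mi := measurableT_comp mf (@measurable_interp R N).
  exact: (measurableT_comp mi (@measurable_scale_rvec R N (Num.sqrt (tau N)))).
have fn x : `|Num.min 1 (ptail m (interp (@scaled R tau N x) : L2 R))| <= 1.
  by have /andP[f0 f1] := f01 (interp (sc x)); rewrite ger0_norm.
have le1 := mean_le (@e00 N) (iexpV n1 mfi fn) ia.
rewrite -(ler_pM2r B0) E (le_trans (le1 _))//.
  move=> x; have /andP[f0 _] := f01 (interp (sc x)).
  apply: (@le_trans _ _ (Num.min 1 (ptail m (interp (sc x) : L2 R)))).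
    by rewrite ler_piMr//; case/andP: (exp01 (V0 x n1)).
  (* The class [interp] agrees with its step function almost everywhere, so both have the same
     averages. *)
  have pt : ptail m (interp (sc x) : L2 R) <= tailX m x.
    have s2 := isL2_stepfun (sc x).
    have i2 := L2P (interp (sc x) : L2 R).
    have P2 := isL2_Pavg m (stepfun (sc x)).
    have -> : ptail m (interp (sc x) : L2 R) =
        L2norm (fun t => (interp (sc x) : L2 R) t - Pavg m (stepfun (sc x)) t).
      rewrite /ptail; congr L2norm; apply/funext => t; congr (_ - stepfun _ _).
      by apply: eq_from_tnth => i; rewrite !tnth_mktuple L2inner_interp//; exact: isL2_hcell.
    rewrite (le_trans (ler_L2normB i2 P2 s2))// (L2norm_ae0 i2 s2 (L2_ofE _)).
    by rewrite add0r.
  have := min_sqr_le d0 (L2norm_ge0 (fun t => stepfun (sc x) t - Pavg m (stepfun (sc x)) t)).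
  rewrite [_ / d]mulrC; apply: le_trans.
  by rewrite le_min !ge_min lexx/= pt orbT.
rewrite Ea.
have t2 : d^-1 * mn N (fun x => tailX m x ^+ 2) <= d * Z N.
  apply: (@le_trans _ _ (d^-1 * (2 / m%:R / rho * Z N))).
    by rewrite ler_wpM2l ?invr_ge0 ?(ltW d0).
  rewrite !mulrA ler_wpM2r ?(ltW Zp)//.
  have := Hm m mm; move: (m%:R^-1) => v Hv.
  rewrite [leLHS](_ : _ = v * (2 / (rho * d))); last by field; rewrite !gt_eqF.
  apply: (le_trans (ler_wpM2r _ Hv)).
    by rewrite divr_ge0// mulr_ge0 ?(ltW d0)// ltW.
  by rewrite le_eqVlt; apply/orP; left; apply/eqP; field; rewrite !gt_eqF.
apply: (le_trans (lerD (lexx _) t2)).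
apply: (@le_trans _ _ (e * (be * Z N))); last by rewrite ler_wpM2l// ltW.
by rewrite /d le_eqVlt; apply/orP; left; apply/eqP; field.
Qed.

Lemma norm_law e : 0 < e -> exists n0, forall n, (n0 <= n)%N ->
  exists N0, forall N, (N0 <= N)%N ->
    \int[law N]_x Num.min 1 (L2norm (x : L2 R) / n%:R) <= e.
Proof.
move=> ep; have [be be0 [N2 H2]] := expV_low.
pose d := e * be / 2.
have d0 : 0 < d by rewrite divr_gt0// mulr_gt0.
have k0 : 0 < rho * d ^+ 2 / 2 by rewrite divr_gt0// mulr_gt0// exprn_gt0.
have [n0 n00 Hn] := exists_natV_le k0.
exists n0 => n nn; have n1' : (0 < n)%N by exact: leq_trans nn.
exists N2 => N n2; have [n1 Bb] := H2 N n2.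
have mf : measurable_fun setT (fun x : L2borel R => Num.min 1 (L2norm (x : L2 R) / n%:R)).
  by apply: measurable_minr => //; apply: measurable_funM => //; exact: measurable_L2norm.
have f01 (x : L2borel R) : 0 <= Num.min 1 (L2norm (x : L2 R) / n%:R) <= 1.
  by rewrite le_min ler01 divr_ge0 ?L2norm_ge0// ge_min lexx.
have [B0 E] := law_mean n1 mf f01.
have Zp := Z_gt0 n1.
have [it1 lt1] := norm_moment n1.
have [ia Ea] := mean_affine d (n%:R ^- 2 / d) it1.
have mfi : measurable_fun setT (fun x : rvec R N =>
    Num.min 1 (L2norm (interp (sc x) : L2 R) / n%:R)).
  have mi := measurableT_comp mf (@measurable_interp R N).
  exact: (measurableT_comp mi (@measurable_scale_rvec R N (Num.sqrt (tau N)))).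
have fn x : `|Num.min 1 (L2norm (interp (@scaled R tau N x) : L2 R) / n%:R)| <= 1.
  by have /andP[f0 f1] := f01 (interp (sc x)); rewrite ger0_norm.
have le1 := mean_le (@e00 N) (iexpV n1 mfi fn) ia.
rewrite -(ler_pM2r B0) E (le_trans (le1 _))//.
  move=> x; have /andP[f0 _] := f01 (interp (sc x)).
  apply: (@le_trans _ _ (Num.min 1 (L2norm (interp (sc x) : L2 R) / n%:R))).
    by rewrite ler_piMr//; case/andP: (exp01 (V0 x n1)).
  rewrite L2norm_interp.
  have q0 : 0 <= L2norm (stepfun (sc x)) / n%:R by rewrite divr_ge0 ?L2norm_ge0.
  apply: (le_trans (min_sqr_le d0 q0)).
  rewrite lerD2l expr_div_n le_eqVlt; apply/orP; left; apply/eqP; ring.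
rewrite Ea.
have t2 : n%:R ^- 2 / d * mn N (fun x => normX x ^+ 2) <= d * Z N.
  apply: (@le_trans _ _ (n%:R ^- 2 / d * (2 / rho * Z N))).
    by rewrite ler_wpM2l// divr_ge0 ?(ltW d0)// invr_ge0 sqr_ge0.
  rewrite !mulrA ler_wpM2r ?(ltW Zp)//.
  have Hv := Hn n nn.
  have v1 : n%:R ^- 2 <= n%:R^-1 :> R.
    rewrite expr2 invfM ler_piMr ?invr_ge0// invf_le1 ?ltr0n// ler1n.
    by [].
  move: (n%:R ^- 2) (n%:R^-1) Hv v1 => v' v Hv v1.
  rewrite [leLHS](_ : _ = v' * (2 / (rho * d))); last by field; rewrite !gt_eqF.
  apply: (le_trans (ler_wpM2r _ (le_trans v1 Hv))).
    by rewrite divr_ge0// mulr_ge0 ?(ltW d0)// ltW.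
  by rewrite le_eqVlt; apply/orP; left; apply/eqP; field; rewrite !gt_eqF.
apply: (le_trans (lerD (lexx _) t2)).
apply: (@le_trans _ _ (e * (be * Z N))); last by rewrite ler_wpM2l// ltW.
by rewrite /d le_eqVlt; apply/orP; left; apply/eqP; field.
Qed.

Let cos1 (y : R) : 0 <= 1 + cos y <= 2.
Proof. by have := cos_geN1 y; have := cos_le1 y; lra. Qed.

(** With weight [expR (- W x)] the energy Gaussian becomes the Gaussian with form [qN]. The Galerkin
    solution is the Riesz representative of the pairing with [h] in this form, so its form value is
    the variance. *)
Lemma linearized_gcos N (h : R -> R) (th : R) (y : rvec R N) : isL2 h ->
  (forall z, qN K b rho y z = L2inner h (stepfun z)) ->
  mn N (fun x => (1 + cos (L2inner h (stepfun (sc x)) + th)) * expR (- W x)) =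
  mn N (fun x => expR (- W x)) * gcos (Num.sqrt (qN K b rho y y)) th.
Proof.
move=> h2 Hy.
have q0 : 0 <= qN K b rho y y.
  by apply: le_trans (qN_ge K rho b0 y); rewrite mulr_ge0 ?AN_ge0 ?(ltW rho0).
have dE (x : rvec R N) : expR (- W x) * e0 N x = expR (- qN K b rho (sc x) (sc x) / 2).
  rewrite -expRD; congr expR; rewrite [RHS]mulNr -WN_qN -/(s N) -/(scaled tau x).
  by field.
pose H (z : R) : \bar R := (1 + cos (z + th))%:E.
have mH : measurable_fun [set: T] H.
  apply/measurable_EFinP; have := @measurable_cos1 R 1 th.
  by apply: eq_measurable_fun => z _; rewrite mul1r.
have H0 z : (0 <= H z)%E by rewrite lee_fin; case/andP: (cos1 (z + th)).
have iW := iexpW1 N.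
have ig := gcos_integrable (Num.sqrt (qN K b rho y y)) th.
have main : (\int[lrv N]_x (H (L2inner h (stepfun (sc x))) *
    (expR (- qN K b rho (sc x) (sc x) / 2))%:E) =
    (\int[lrv N]_x (expR (- qN K b rho (sc x) (sc x) / 2))%:E) *
    \int[leb]_z (H (Num.sqrt (qN K b rho y y) * z)%R * (gauss1 z)%:E))%E.
  (* Zero variance forces [y = 0], and then the pairing with [h] vanishes identically. *)
  have [qe|qn] := eqVneq (qN K b rho y y) 0.
    have y0 := qN_eq0 rho0 b0 qe.
    have l0 (x : rvec R N) : L2inner h (stepfun x) = 0.
      rewrite -Hy qNC (_ : y = lin_rvec (-1) y y).
        by rewrite (qN_linr rho KC cb); ring.
      by apply: eq_from_tnth => i; rewrite tnth_mktuple !y0; ring.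
    under eq_integral do rewrite l0.
    rewrite ge0_integralZl//; last first.
      apply/measurable_EFinP.
      have := iexpW1 N => /integrableP[/measurable_EFinP + _].
      by apply: eq_measurable_fun => x _; rewrite dE.
    rewrite muleC; congr (_ * _)%E.
    under eq_integral do rewrite qe sqrtr0 mul0r.
    rewrite ge0_integralZl//; last 2 first.
    - by apply/measurable_EFinP; exact: measurable_gauss1.
    - by move=> z _; rewrite lee_fin gauss1_ge0.
    by rewrite integral_gauss1 mule1.
  apply: (@scaled_marginal R N (@qN R K b rho N) (s N)
    (fun y => qN_linl rho KC cb y) (fun y => qN_linr rho KC cb y)
    (fun x y => qNC K b rho x y) (s0 N) (fun x => L2inner h (stepfun x)) y H) => //.
  - exact: linear_L2inner_stepfun.
  - by rewrite lt_def qn.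
rewrite /mean /Rintegral /gcos /Rintegral -fineM; last 2 first.
- exact: integrable_fin_num iW.
- exact: integrable_fin_num ig.
congr fine; rewrite [X in _ = (X * _)%E](_ : _ =
  (\int[lrv N]_x (expR (- qN K b rho (sc x) (sc x) / 2))%:E)%E); last first.
  by apply: eq_integral => x _; rewrite dE.
rewrite [X in _ = (_ * X)%E](_ : _ =
  (\int[leb]_z (H (Num.sqrt (qN K b rho y y) * z)%R * (gauss1 z)%:E))%E); last first.
  by apply: eq_integral => x _; rewrite -EFinM.
rewrite -main; apply: eq_integral => x _.
by rewrite -mulrA dE EFinM.
Qed.

(** Both sides are kept multiplied by the Gaussian mass, which avoids quotients. Of the factor 4,
    two come from the numerators, as the integrand is at most 2, and two from the normalizing
    masses, multiplied by an expectation of at most 2. *)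
Lemma law_gcos N (h : R -> R) (th : R) (y : rvec R N) : (N1 <= N)%N -> isL2 h ->
  (forall z, qN K b rho y z = L2inner h (stepfun z)) ->
  `|1 + \int[law N]_x cos (L2inner h (x : L2 R) + th)
    - gcos (Num.sqrt (qN K b rho y y)) th| * mn N (fun x => expR (- W x))
  <= 4 * gap N.
Proof.
move=> n1 h2 Hy.
have mcos : measurable_fun [set: T] (@cos R).
  by apply: continuous_measurable_fun; exact: continuous_cos.
have ml : measurable_fun setT (fun x : L2borel R => L2inner h (x : L2 R) + th).
  by apply: measurable_funD => //; exact: measurable_L2inner.
have mc : measurable_fun setT (fun x : L2borel R => cos (L2inner h (x : L2 R) + th)).
  exact: (measurableT_comp mcos ml).
pose f (x : L2borel R) := 1 + cos (L2inner h (x : L2 R) + th).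
have mf : measurable_fun setT f by exact: measurable_funD.
have f02 x : 0 <= f x <= 2 by exact: cos1.
have fn x : `|f x| <= 2 by have /andP[f0 f2] := f02 x; rewrite ger0_norm.
have -> : 1 + \int[law N]_x cos (L2inner h (x : L2 R) + th) = \int[law N]_x f x.
  have ic := prob_integrable (law N) mc (fun x => cos_max _).
  have i1 := prob_integrable (law N) (measurable_cst (1 : R)) (fun=> lexx `|1|).
  by rewrite -[X in X + _](prob_Rintegral_cst (law N)) -RintegralD.
have [B0 E] := law_mean n1 mf f02.
have E2 : \int[law N]_x f x <= 2.
  rewrite -(prob_Rintegral_cst (law N) 2).
  by apply: (@prob_Rintegral_le _ _ _ (law N) f (fun=> 2) 2) => // x; [rewrite ger0_norm|case/andP: (f02 x)].
have E20 : 0 <= \int[law N]_x f x by apply: Rintegral_ge0 => x _; case/andP: (f02 x).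
have A' := linearized_gcos th h2 Hy.
set F := \int[law N]_x f x in E E2 E20 *.
set G := gcos _ _ in A' *.
set BW := mn N (fun x => expR (- W x)) in A' *.
set BV := mn N (fun x => expR (- V x)) in B0 E *.
have fE (x : rvec R N) : f (interp (sc x)) = 1 + cos (L2inner h (stepfun (sc x)) + th).
  by rewrite /f L2inner_interp.
have mfi : measurable_fun setT (fun x : rvec R N => f (interp (sc x))).
  have mi := measurableT_comp mf (@measurable_interp R N).
  exact: (measurableT_comp mi (@measurable_scale_rvec R N (Num.sqrt (tau N)))).
have fin x : `|f (interp (@scaled R tau N x))| <= 2 by exact: fn.
have dA : `|mn N (fun x => f (interp (sc x)) * expR (- V x)) -
    mn N (fun x => f (interp (sc x)) * expR (- W x))| <= 2 * gap N.
  have ig : (lrv N).-integrable setT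
      (EFin \o (fun x => 2 * `|expR (- V x) - expR (- W x)| * e0 N x)).
    have := @igap N (fun=> 2) `|2| n1 (measurable_cst _) (fun=> lexx _).
    by apply: eq_integrable.
  have := mean_dist (@e00 N) (iexpV n1 mfi fin) (iexpW mfi fin) ig.
  have -> : mn N (fun x => 2 * `|expR (- V x) - expR (- W x)|) = 2 * gap N.
    rewrite /gap /mean -RintegralZl//.
      by apply: eq_Rintegral => x _; rewrite mulrA.
    have := @igap N (fun=> 1) `|1| n1 (measurable_cst _) (fun=> lexx _).
    by apply: eq_integrable => // x _; rewrite /= mul1r.
  by apply=> x; rewrite -mulrBr normrM ler_wpM2r.
have dB : `|BV - BW| <= gap N.
  have ig : (lrv N).-integrable setT
      (EFin \o (fun x => `|expR (- V x) - expR (- W x)| * e0 N x)).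
    have := @igap N (fun=> 1) `|1| n1 (measurable_cst _) (fun=> lexx _).
    by apply: eq_integrable => // x _; rewrite /= mul1r.
  exact: (mean_dist (@e00 N) (iexpV1 n1) (iexpW1 N) ig (fun x => lexx _)).
have A2 : mn N (fun x => f (interp (sc x)) * expR (- W x)) = BW * G.
  by rewrite -A'; apply: eq_Rintegral => x _; rewrite fE.
have BW0 : 0 <= BW by apply: Rintegral_ge0 => x _; rewrite mulr_ge0 ?expR_ge0.
rewrite -E A2 in dA.
rewrite -{1}(ger0_norm BW0) -normrM.
have -> : (F - G) * BW = (F * BV - BW * G) - F * (BV - BW) by ring.
rewrite (le_trans (ler_normB _ _))// normrM (ger0_norm E20).
have FB : F * `|BV - BW| <= 2 * gap N by rewrite ler_pM.
rewrite (le_trans (lerD dA FB))// -mulrDl le_eqVlt; apply/orP; left; apply/eqP.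
by congr (_ * _); rewrite -natrD.
Qed.

End posterior.

(** The final arithmetic: [J] and [I] are the cosine integrals under the limit and under the law,
    [G0] and [G] the values of [gcos] at the limit and at the Galerkin deviation, [B] the linearized
    mass, [D] the gap, and [be] the lower bound of [B] relative to [Z]. *)
Lemma ratio_estimate (R : realFieldType) (J I G0 G B D be Z e : R) :
  1 + J = G0 -> `|G0 - G| <= e / 2 -> `|1 + I - G| * B <= 4 * D ->
  D <= e * be / 8 * Z -> be * Z <= B -> 0 < be -> 0 < Z -> `|J - I| <= e.
Proof.
move=> E s1 L DZ BZ be0 Z0.
have s2 : `|1 + I - G| <= e / 2.
  rewrite -(ler_pM2r (mulr_gt0 be0 Z0)).
  apply: (@le_trans _ _ (4 * (e * be / 8 * Z))).
    by rewrite (le_trans (ler_wpM2l _ BZ))// (le_trans L)// ler_wpM2l.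
  by rewrite le_eqVlt; apply/orP; left; apply/eqP; field.
have -> : J - I = (G0 - G) - (1 + I - G) by rewrite -E; ring.
by rewrite (le_trans (ler_normB _ _))// [leRHS]splitr lerD.
Qed.

Theorem lemma5p8 (R : realType)
    (w g : R -> R) (K Kst : (R -> R) -> (R -> R)) (Phi : R -> R -> R -> R)
    (rho h0 c : R) (N1 : nat)
    (u : forall N : nat, rvec R N) (ustar dustar : R -> R)
    (tau : nat -> R)
    (mud : forall N : nat, probability (rvec R N) R)
    (Qinv : (R -> R) -> (R -> R)) (mu : probability (L2borel R) R) :
  0 < rho ->
  (forall p v : R, periodic1 (Phi p v)) ->
  A1 w -> A2 K Kst g -> A3 Phi g h0 c -> A4 Phi ->
  (0 < N1)%N ->
  (forall N, (N1 <= N)%N -> forall i : 'I_N,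
    `|wsample w g i - g (grid i)| <= h0) ->
  (forall N, (N1 <= N)%N -> PsiN_minimizer Phi K w g rho (u N)) ->
  Psi_minimizer Phi K g rho ustar dustar ->
  A5 Phi K w g N1 u ->
  (partition_of_unity w \/ compact_L2_C Kst) ->
  (forall N, 0 < tau N) -> tau @ \oo --> +oo ->
  (forall N, (N1 <= N)%N -> density_propto (mud N)
    (fun eta => expR (- (tau N * PsiN Phi K w g rho (add_rvec (u N) eta))))) ->
  (fun N => N%:R ^+ 2 / tau N) @ \oo --> 0 ->
  (fun N => ln (tau N) / N%:R) @ \oo --> 0 ->
  inverse_op
    (Qrel K Kst (fun t => partial1 2 Phi (K ustar t) (g t) t) rho) Qinv ->
  centered_gaussian mu Qinv ->
  weak_cvg (fun N =>
    distribution
      (distribution (mud N) (@scale_rvec R N (Num.sqrt (tau N))))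
      (@interp R N)) mu.
Proof.
move=> rho0 _ A1w A2K A3P A4P N10 gN umin us _ _ tau0 tauoo mudE _ _ [Qi _] muG.
have us2 : isL2 ustar by case: us => -[].
have [KC KstC adj _] := A2K.
have cb := curv_continuous A2K A4P us2.
have b0 t : 0 <= curv g K Phi ustar t by exact: (curv_ge0 K A3P).
apply: weak_cvg_of_cos.
- exact: (tail_law rho0 A1w A2K A3P A4P N10 gN umin us tau0 tauoo mudE).
- exact: (norm_law rho0 A1w A2K A3P A4P N10 gN umin us tau0 tauoo mudE).
move=> m a th; have h2 := isL2_stepfun a; set h := stepfun a in h2 *.
(* The inverse operator enters only here, supplying the solution of [Q f = h] that the Galerkin
   vectors approach. *)
have [y Hy Hc] := galerkin rho0 KC KstC adj cb b0 h2 (Qi h h2).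
have [c0 E] := gaussian_cos muG th h2.
have [be be0 Hbe] := expW_low rho0 A1w A2K A3P A4P N10 gN umin us tau0 mudE.
apply/cvgrPdist_le => e e0.
have e4 : 0 < e / 4 by rewrite divr_gt0.
(* Variances enter through square roots, whence the square; the Lipschitz constant 2 of [gcos] turns
   [e / 4] into [e / 2]. *)
have [N2 H2] := Hc _ (exprn_gt0 2 e4).
(* Four times the gap, divided by a mass of at least [be * Z], is then at most [e / 2]. *)
have e8 : 0 < e * be / 8 by rewrite divr_gt0// mulr_gt0.
have [N3 H3] := gap_small rho0 A1w A2K A3P A4P N10 gN umin us tau0 tauoo mudE e8.
exists (maxn N2 N3) => // N; rewrite /= geq_max => /andP[n2 n3].
have [n1 gapN] := H3 N n3.
have Zp := Z_gt0 rho0 A1w A2K A3P A4P N10 gN umin tau0 mudE n1.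
have L := law_gcos rho0 A1w A2K A3P A4P N10 gN umin us tau0 mudE th n1 h2 (Hy N).
have BW := Hbe N n1.
have s1 : `|gcos (Num.sqrt (L2inner (Qinv h) h)) th -
    gcos (Num.sqrt (qN K (curv g K Phi ustar) rho (y N) (y N))) th| <= e / 2.
  apply: (le_trans (gcos_dist _ _ _)).
  have q0 : 0 <= qN K (curv g K Phi ustar) rho (y N) (y N).
    by apply: le_trans (qN_ge K rho b0 (y N)); rewrite mulr_ge0 ?AN_ge0 ?(ltW rho0).
  have d1 : `|Num.sqrt (L2inner (Qinv h) h) -
      Num.sqrt (qN K (curv g K Phi ustar) rho (y N) (y N))| <= e / 4.
    apply: (le_trans (ler_dist_sqrt c0 q0)).
    have -> : e / 4 = Num.sqrt ((e / 4) ^+ 2) by rewrite sqrtr_sqr ger0_norm ?(ltW e4).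
    by rewrite ler_wsqrtr// distrC H2.
  by rewrite (le_trans (ler_wpM2r _ d1))//; lra.
exact: (ratio_estimate E s1 L gapN BW be0 Zp).
Qed.
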